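(* Let $\alpha,\beta\in\mathbb{C}$ and let $f_4(x)$ be the elliptic function of level $4$ with parameters $\alpha,\beta$. Then \[ f_4(x)=\frac{1}{32}\,\frac{\alpha\,(4\wp(x)+3\alpha^2-\beta)(2\wp(x)-\alpha^2+\beta)(4\wp(x)-7\alpha^2+5\beta)}{\wp(x)^4+c_1\wp(x)^3+c_2\wp(x)^2+c_3\wp(x)+c_4} -\frac1{32}\,\frac{\wp'(x)\,(4\wp(x)+3\alpha^2-\beta)^2}{\wp(x)^4+c_1\wp(x)^3+c_2\wp(x)^2+c_3\wp(x)+c_4}, \] where \[ c_1=\alpha^2-\beta,\qquad c_2=\tfrac{51}{8}\alpha^4-\tfrac{21}{4}\alpha^2\beta+\tfrac38\beta^2,\qquad c_3=-\tfrac1{16}(\alpha^2-\beta)(47\alpha^4-34\alpha^2\beta-\beta^2), \] \[ c_4=\tfrac{545}{256}\alpha^8-\tfrac{295}{64}\alpha^6\beta+\tfrac{435}{128}\alpha^4\beta^2-\tfrac{55}{64}\alpha^2\beta^3+\tfrac1{256}\beta^4, \] and $\wp(x)=\wp(x;\widetilde g_2,\widetilde g_3)$ is the Weierstrass function with invariants \[ \widetilde g_2=-\tfrac14(13\alpha^4-6\alpha^2\beta-3\beta^2),\qquad \widetilde g_3=\tfrac18(\alpha^2-\beta)(17\alpha^4-14\alpha^2\beta+\beta^2). \] In the non-degenerate case $\Delta=256\alpha^2(5\alpha^2-3\beta)(4\alpha^2-3\beta)^4\neq0$, when $f_4$ is written as $f_4(x)=\frac{\sigma(x)\sigma(z)}{\sigma(z-x)}\exp(\alpha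 x-\zeta(z)x)$ with $z=\tfrac12\omega_1$ and $\sigma,\zeta$ the Weierstrass functions of the lattice $\langle2\omega_1,2\omega_2\rangle$, this $\wp(x)$ is the Weierstrass function with period lattice $\langle2\omega_1,8\omega_2\rangle$.
   Context: Here $\langle a,b\rangle$ denotes the lattice $\mathbb{Z}a+\mathbb{Z}b\subset\mathbb{C}$. For arbitrary $(g_2,g_3)\in\mathbb{C}^2$, $\wp(x;g_2,g_3)$ denotes the solution of $\wp'^2=4\wp^3-g_2\wp-g_3$ with $\wp(x)=x^{-2}+O(x)$ at $x=0$ (so the case $g_2^3-27g_3^2=0$ is allowed). The function $f_{Kr}$. Let $\wp,\zeta,\sigma$ be the Weierstrass functions of a lattice with invariants $g_2,g_3$, let $z$ be a point not in the lattice, $\alpha\in\mathbb{C}$, and \[ f_{Kr}(x)=\frac{\sigma(x)\sigma(z)}{\sigma(z-x)}\exp(\alpha x-\zeta(z)x). \] The Taylor coefficients of $f_{Kr}$ at $x=0$ are polynomials with rational coefficients in $\alpha$, $\beta=\wp(z)$, $\gamma=\wp'(z)$, $\lambda=g_2$ (and $g_3=4\beta^3-\lambda\beta-\gamma^2$); these polynomials define $f_{Kr}$ for all $(\alpha,\beta,\gamma,\lambda)\in\mathbb{C}^4$, including degenerate values with $\Delta=g_2^3-27g_3^2=0$: \[ f_{Kr}(x)=x+\alpha x^2+(\alpha^2+\beta)\tfrac{x^3}{2}+(\alpha^3+3\alpha\beta-\gamma)\tfrac{x^4}{3!}+(5\alpha^4+30\alpha^2\beta+45\beta^2-20\alpha\gamma-3\lambda)\tfrac{x^5}{5!}+\cdots.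 \] The elliptic function of level $4$ with parameters $\alpha,\beta$, denoted $f_4(x)$, is $f_{Kr}(x)$ with \[ \gamma=4\alpha(4\alpha^2-3\beta),\qquad \lambda=4(32\alpha^4-24\alpha^2\beta+3\beta^2). \] For these parameters $g_2^3-27g_3^2=256\alpha^2(5\alpha^2-3\beta)(4\alpha^2-3\beta)^4$, and when this is nonzero the generators $2\omega_1,2\omega_2$ of the period lattice of $\wp(x;g_2,g_3)$ are chosen so that $f_4$ has the form above with $z=\frac12\omega_1$. *)

(* Defs.v *)
From HB Require Import structures.
From mathcomp Require Import all_boot all_order all_algebra.
From mathcomp Require Import all_classical all_reals all_analysis.
From mathcomp Require Import complex.
(* the notations of mpoly clash with those of MathComp-Analysis *)
From mathcomp Require Import -(notations) mpoly.

Set Implicit Arguments.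
Unset Strict Implicit.
Unset Printing Implicit Defensive.

Import Order.TTheory GRing.Theory Num.Theory.
Import numFieldNormedType.Exports.

Local Open Scope classical_set_scope.
Local Open Scope ring_scope.

(* R[i] seen as an abstract numClosedFieldType, so that the topology, the norm
   and the (complex) derivative that MathComp-Analysis puts on every
   numFieldType are found by inference. *)
Definition Cx (R : realType) : numClosedFieldType := R[i].

Definition cexp (R : realType) (x : Cx R) : Cx R :=
  limn (series (fun n => x ^+ n / n`!%:R)).

Section Lattice.
Variables (R : realType) (w1 w2 : Cx R).

Definition lattice_basis : Prop :=
  forall a b : R, (a%:C)%C * w1 + (b%:C)%C * w2 = 0 :> Cx R -> a = 0 /\ b = 0.

Definition lattice_pt (m : int * int) : Cx R := m.1%:~R * w1 + m.2%:~R * w2.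

Definition in_lattice : set (Cx R) := range lattice_pt.

(* [-N, N] x [-N, N] *)
Definition box (N : nat) : seq (int * int) :=
  [seq (i%:Z - N%:Z, j%:Z - N%:Z) | i <- iota 0 (2 * N).+1,
                                    j <- iota 0 (2 * N).+1].

(* Sums and products over the nonzero lattice points. Those used below are
   absolutely convergent, so the exhaustion by boxes is immaterial. *)
Definition lattice_sum (F : Cx R -> Cx R) : Cx R :=
  limn (fun N => \sum_(m <- box N | m != (0, 0)) F (lattice_pt m)).

Definition lattice_prod (F : Cx R -> Cx R) : Cx R :=
  limn (fun N => \prod_(m <- box N | m != (0, 0)) F (lattice_pt m)).

Definition lattice_g2 : Cx R := 60 * lattice_sum (fun w => w ^- 4).

Definition lattice_sigma (x : Cx R) : Cx R :=
  x * lattice_prod (fun w => (1 - x / w) * cexp (x / w + (x / w) ^+ 2 / 2)).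

Definition lattice_zeta (x : Cx R) : Cx R :=
  x^-1 + lattice_sum (fun w => (x - w)^-1 + w^-1 + x / w ^+ 2).

Definition lattice_wp (x : Cx R) : Cx R :=
  x ^- 2 + lattice_sum (fun w => (x - w) ^- 2 - w ^- 2).

Definition lattice_fKr (z alpha x : Cx R) : Cx R :=
  lattice_sigma x * lattice_sigma z / lattice_sigma (z - x)
  * cexp (alpha * x - lattice_zeta z * x).

End Lattice.

(* wp(x; g2, g3) for arbitrary g2, g3, degenerate values included: the germ at 0
   of the solution of the differential equation with wp(x) = x^-2 + O(x). *)
Definition is_wp (R : realType) (g2 g3 : Cx R) (p : Cx R -> Cx R) : Prop :=
  [/\ \forall x \near (0 : Cx R)^', derivable p x 1,
      \forall x \near (0 : Cx R)^',
        derive1 p x ^+ 2 = 4 * p x ^+ 3 - g2 * p x - g3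
    & (fun x => p x - x ^- 2) =O_ ((0 : Cx R)^') id].

(* Only the germ at 0 of this function is determined: it has to be used near 0. *)
Definition wp (R : realType) (g2 g3 : Cx R) : Cx R -> Cx R :=
  xget (fun=> 0) (is_wp g2 g3).

Definition is_wp_lattice (R : realType) (g2 g3 w1 w2 : Cx R) : Prop :=
  lattice_basis w1 w2 /\
  \forall x \near (0 : Cx R)^', wp g2 g3 x = lattice_wp w1 w2 x.

(* Value of a rational polynomial in the variables alpha, beta, gamma, lambda. *)
Definition eval_Kr (R : realType) (p : mpoly 4 rat)
    (alpha beta gamma lambda : Cx R) : Cx R :=
  meval (tnth [tuple alpha; beta; gamma; lambda])
    (map_mpoly ratr p).

Definition is_Kr_coef (R : realType) (n : nat) (p : mpoly 4 rat) : Prop :=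
  forall w1 w2 z alpha : Cx R, lattice_basis w1 w2 -> ~ in_lattice w1 w2 z ->
    derive1n n (lattice_fKr w1 w2 z alpha) 0 / n`!%:R
    = eval_Kr p alpha (lattice_wp w1 w2 z) (derive1 (lattice_wp w1 w2) z)
        (lattice_g2 w1 w2).

(* There is exactly one such polynomial for each n. *)
Definition Kr_coef (R : realType) (n : nat) : mpoly 4 rat :=
  xget (0 : mpoly 4 rat) (is_Kr_coef R n).

Definition fKr (R : realType) (alpha beta gamma lambda x : Cx R) : Cx R :=
  limn (series (fun n =>
    eval_Kr (Kr_coef R n) alpha beta gamma lambda * x ^+ n)).

Section Level4.
Variables (R : realType) (alpha beta : Cx R).

Definition gamma4 : Cx R := 4 * alpha * (4 * alpha ^+ 2 - 3 * beta).

Definition lambda4 : Cx R :=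
  4 * (32 * alpha ^+ 4 - 24 * alpha ^+ 2 * beta + 3 * beta ^+ 2).

Definition g3_4 : Cx R := 4 * beta ^+ 3 - lambda4 * beta - gamma4 ^+ 2.

Definition f4 : Cx R -> Cx R := fKr alpha beta gamma4 lambda4.

End Level4.

(* Main.v *)
(** Two kinds of germs at [0] are determined by a differential equation of the first order:
    [p = x^-2 + O(x)] by [p'^2 = 4 p^3 - g2 p - g3], and [f = x + o(x)] by
    [2 f' (p - beta) = f (2 alpha (p - beta) - p' - gamma)].
    For a lattice, [f_Kr] satisfies the second equation with [beta = wp(z)], [gamma = wp'(z)],
    because its logarithmic derivative is [alpha + zeta(x) + zeta(z - x) - zeta(z)], which is
    given by the addition formula; all identities between elliptic functions come from
    Liouville's theorem. So the Taylor coefficients obey a recursion with polynomial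
    coefficients. The polynomials are unique since [wp] is surjective and the lattices
    [<1, n i>], [n >= 2], have pairwise distinct invariants [g3^2 / g2^3]: the sums of
    [w^-2k] over such a lattice tend to [2] as [k] grows, and those over its points off
    the real axis are dominated by [n i] and [- n i].

    With these uniqueness statements the formula for [f4] amounts to rational identities in
    [wp(x; g2t, g3t)]. For the lattice, uniqueness gives [beta = wp(z)] and [gamma = wp'(z)]
    with [z = w1 / 2], and the addition formula at [w1 = 2 z] gives
    [wp(w1) = 4 alpha^2 - 2 beta]. The lattice [<w1 / 2, 2 w2>] is the union of the four
    cosets of [<2 w1, 2 w2>] by multiples of [z], hence its Eisenstein sums are obtained
    from the second and fourth derivatives of [wp] at these multiples, and it is
    homothetic to [<2 w1, 8 w2>]. *)
Require Import Defs.
From HB Require Import structures.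
From mathcomp Require Import all_boot all_order all_algebra.
From mathcomp Require Import all_classical all_reals all_analysis.
From mathcomp Require Import complex.
(* The notations of mpoly clash with those of MathComp-Analysis. *)
From mathcomp Require Import -(notations) mpoly.
From mathcomp Require Import ring lra zify.

Set Implicit Arguments.
Unset Strict Implicit.
Unset Printing Implicit Defensive.

Import Order.TTheory GRing.Theory Num.Theory.
Import numFieldNormedType.Exports.

Local Open Scope classical_set_scope.
Local Open Scope ring_scope.

(** * Modulus and complex derivative *)

Section Modulus.
Variable R : realType.
Local Notation C := (Cx R).
Implicit Types (x y z : C) (r : R).

(** Liouville's theorem is proved without contour integrals: a doubly periodic [F] maps the torus to
    the plane with total signed area 0, while a complex derivative multiplies areas by the square of
    its modulus, so it vanishes. Each use exhibits explicit expansions at the singular points, with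
    lattice sums as remainders. Degenerate parameters have no lattice, so the formula for [f4]
    cannot rest on elliptic functions; the differential equations hold for all parameters. The
    equation for [p] fixes [p'] only up to sign and is singular at the pole, which makes its
    uniqueness the delicate one. In the non-degenerate case the rational identities describe an
    isogeny of degree four: [<2 w1, 8 w2>] has index four in [<2 w1, 2 w2>]. With [Y = wp - e],
    where [e] is the value of wp at [4 w2], translation by [4 w2] is [Y -> d^2 / Y], and its fixed
    value [Y = - d] is taken at [2 w2] and [- 2 w2]; up to a constant, [p] is the sum of the four
    translates of wp. *)

Definition rc r : C := (r%:C)%C.
Definition re z : R := complex.Re z.
Definition im z : R := complex.Im z.
(** [|z|] is an element of [Cx R], which is only partially ordered; a modulus in the ordered field
    [R] makes estimates accessible to [lra] and [nra]. *)
Definition nm z : R := Num.sqrt (re z ^+ 2 + im z ^+ 2).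

Lemma normE z : `|z| = rc (nm z).
Proof. exact: normc_def. Qed.

Lemma rcD r s : rc (r + s) = rc r + rc s. Proof. exact: rmorphD. Qed.
Lemma rcB r s : rc (r - s) = rc r - rc s. Proof. exact: rmorphB. Qed.
Lemma rcN r : rc (- r) = - rc r. Proof. exact: rmorphN. Qed.
Lemma rcM r s : rc (r * s) = rc r * rc s. Proof. exact: rmorphM. Qed.
Lemma rcV r : rc r^-1 = (rc r)^-1. Proof. exact: fmorphV. Qed.
Lemma rcX r n : rc (r ^+ n) = rc r ^+ n. Proof. exact: rmorphXn. Qed.
Lemma rc0 : rc 0 = 0. Proof. exact: rmorph0. Qed.
Lemma rc1 : rc 1 = 1. Proof. exact: rmorph1. Qed.
Lemma rc_nat n : rc n%:R = n%:R. Proof. exact: rmorph_nat. Qed.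
Lemma rc_inj : injective rc. Proof. exact: complexI. Qed.
Lemma rc_le r s : (rc r <= rc s) = (r <= s). Proof. exact: lecR. Qed.
Lemma rc_lt r s : (rc r < rc s) = (r < s). Proof. exact: ltcR. Qed.
Lemma rc_eq0 r : (rc r == 0) = (r == 0).
Proof. by rewrite -rc0 (inj_eq rc_inj). Qed.

Lemma nm_ge0 z : 0 <= nm z. Proof. exact: sqrtr_ge0. Qed.
Lemma nm0 : nm 0 = 0.
Proof. by apply: rc_inj; rewrite -normE normr0 rc0. Qed.
Lemma nm1 : nm 1 = 1.
Proof. by apply: rc_inj; rewrite -normE normr1 rc1. Qed.
Lemma nm_eq0 z : (nm z == 0) = (z == 0).
Proof. by rewrite -rc_eq0 -normE normr_eq0. Qed.
Lemma nm_gt0 z : (0 < nm z) = (z != 0).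
Proof. by rewrite lt_def nm_eq0 nm_ge0 andbT. Qed.
Lemma nmM x y : nm (x * y) = nm x * nm y.
Proof. by apply: rc_inj; rewrite rcM -!normE normrM. Qed.
Lemma nmN x : nm (- x) = nm x.
Proof. by apply: rc_inj; rewrite -!normE normrN. Qed.
Lemma nmBC x y : nm (x - y) = nm (y - x).
Proof. by rewrite -nmN opprB. Qed.
Lemma nmV x : nm x^-1 = (nm x)^-1.
Proof. by apply: rc_inj; rewrite rcV -!normE normfV. Qed.
Lemma nmX x n : nm (x ^+ n) = nm x ^+ n.
Proof. by apply: rc_inj; rewrite rcX -!normE normrX. Qed.
Lemma nmD x y : nm (x + y) <= nm x + nm y.
Proof. by rewrite -rc_le rcD -!normE ler_normD. Qed.
Lemma nmB x y : nm (x - y) <= nm x + nm y.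
Proof. by rewrite -(nmN y) nmD. Qed.
Lemma nm_subD x y : nm x - nm y <= nm (x + y).
Proof. by have := nmD (x + y) (- y); rewrite addrK nmN; lra. Qed.
Lemma nm_subB x y : nm x - nm y <= nm (x - y).
Proof. by rewrite -(nmN y) nm_subD. Qed.
Lemma nm_rc r : nm (rc r) = `|r|.
Proof. by rewrite /nm /re /im /= expr0n addr0 sqrtr_sqr. Qed.
Lemma nm_nat n : nm n%:R = n%:R.
Proof. by rewrite -rc_nat nm_rc ger0_norm. Qed.
Lemma nm_sum I (s : seq I) (F : I -> C) :
  nm (\sum_(i <- s) F i) <= \sum_(i <- s) nm (F i).
Proof.
elim: s => [|a s IH]; first by rewrite !big_nil nm0.
by rewrite !big_cons; apply: le_trans (nmD _ _) _; rewrite lerD2l.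
Qed.

Lemma re_le_nm z : `|re z| <= nm z.
Proof.
rewrite -(sqrtr_sqr (re z)) /nm ler_wsqrtr// lerDl; exact: sqr_ge0.
Qed.
Lemma im_le_nm z : `|im z| <= nm z.
Proof.
rewrite -(sqrtr_sqr (im z)) /nm ler_wsqrtr// lerDr; exact: sqr_ge0.
Qed.
Lemma reD x y : re (x + y) = re x + re y. Proof. by case: x; case: y. Qed.
Lemma imD x y : im (x + y) = im x + im y. Proof. by case: x; case: y. Qed.
Lemma reN x : re (- x) = - re x. Proof. by case: x. Qed.
Lemma imN x : im (- x) = - im x. Proof. by case: x. Qed.
Lemma reM x y : re (x * y) = re x * re y - im x * im y.
Proof. by case: x; case: y. Qed.
Lemma imM x y : im (x * y) = re x * im y + im x * re y.
Proof. by case: x => a b; case: y => c d; rewrite /= addrC; congr (_ + _); rewrite mulrC. Qed.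
Lemma re_rc r : re (rc r) = r. Proof. by []. Qed.
Lemma im_rc r : im (rc r) = 0. Proof. by []. Qed.
Lemma cplx_eq x y : re x = re y -> im x = im y -> x = y.
Proof. by case: x => a b; case: y => c d /= -> ->. Qed.
Definition cj z : C := Complex (re z) (- im z).
Lemma cjM x y : cj (x * y) = cj x * cj y.
Proof.
by apply: cplx_eq; rewrite /cj ?reM ?imM /re /im /= -/(re _) -/(im _) ?reM ?imM
  ?mulrNN// mulrN mulNr opprD.
Qed.
Lemma cjD x y : cj (x + y) = cj x + cj y.
Proof. by case: x y => a b [c d]; rewrite /cj /=; congr Complex; rewrite opprD. Qed.
Lemma mul_cj x : cj x * x = rc (nm x ^+ 2).
Proof.
apply: cplx_eq.
  rewrite reM /cj /re /im /= /nm sqr_sqrtr ?addr_ge0 ?sqr_ge0//.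
  by rewrite mulNr opprK.
by rewrite imM /cj /re /im /= mulNr mulrC subrr.
Qed.
Lemma nm_cj x : nm (cj x) = nm x.
Proof. by rewrite /nm /cj /re /im /= sqrrN. Qed.

Lemma near_nmP x (P : C -> Prop) :
  (\forall y \near x, P y) <-> exists2 d : R, 0 < d & forall y, nm (y - x) < d -> P y.
Proof.
split=> [/nbhs_normP[e e0 eP]|[d d0 dP]].
  have er : e \is Num.real by rewrite gtr0_real.
  have eE : e = rc (re e) by rewrite /rc /re; apply/esym/RRe_real.
  exists (re e) => [|y yx]; first by rewrite -rc_lt rc0 -eE.
  by apply: eP; rewrite /ball_/= eE distrC normE rc_lt.
apply/nbhs_normP; exists (rc d) => /=; first by rewrite -rc0 rc_lt.
by move=> y /=; rewrite distrC normE rc_lt; exact: dP.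
Qed.

Lemma dnear_nmP x (P : C -> Prop) :
  (\forall y \near x^', P y) <->
  exists2 d : R, 0 < d & forall y, y != x -> nm (y - x) < d -> P y.
Proof.
rewrite near_withinE; split=> [/near_nmP[d d0 H]|[d d0 H]].
  by exists d => // y yx ?; apply: H.
by apply/near_nmP; exists d => // y yd yx; exact: H.
Qed.

Lemma cvgn_nmP (u : nat -> C) (l : C) :
  (u n @[n --> \oo] --> l) <->
  (forall e, 0 < e -> exists N, forall n, (N <= n)%N -> nm (u n - l) < e).
Proof.
split=> [/cvgrPdist_lt H e e0|H].
  have /H[N _ HN] : 0 < rc e by rewrite -rc0 rc_lt.
  by exists N => n Nn; rewrite -rc_lt -normE distrC; exact: HN.
apply/cvgrPdist_lt => e e0.
have er : e \is Num.real by rewrite gtr0_real.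
have eE : e = rc (re e) by rewrite /rc /re; apply/esym/RRe_real.
have /H[N HN] : 0 < re e by rewrite -rc_lt rc0 -eE.
by exists N => // n /= Nn; rewrite distrC eE normE rc_lt; exact: HN.
Qed.

Lemma limn_nm (u : nat -> C) (l : C) :
  (forall e, 0 < e -> exists N, forall n, (N <= n)%N -> nm (u n - l) < e) ->
  limn u = l.
Proof. by move/cvgn_nmP/cvg_lim => -> //; exact: norm_hausdorff. Qed.

Lemma le_eps (a b : R) : (forall e, 0 < e -> a <= b + e) -> a <= b.
Proof. by move=> H; apply/ler_addgt0Pr. Qed.

Lemma nm_eq0_eps z : (forall e, 0 < e -> nm z <= e) -> z = 0.
Proof.
move=> H; apply/eqP; rewrite -nm_eq0 eq_le nm_ge0 andbT.
by apply: le_eps => e /H; rewrite add0r.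
Qed.

End Modulus.

Section ComplexDerivative.
Variable R : realType.
Local Notation C := (Cx R).
Implicit Types (f g : C -> C) (x y v w h : C).

(** The multiplied-out form of the difference quotient: it remains meaningful at [h = 0] and
    provides the linear remainder bound that later estimates use directly. *)
Definition cder f x v := forall e : R, 0 < e -> exists2 d : R, 0 < d &
  forall h, nm h < d -> nm (f (x + h) - f x - v * h) <= e * nm h.

Lemma cderP f x v : cder f x v <-> is_derive x 1 f v.
Proof.
split=> [H|].
  have Hc : (fun h => h^-1 *: ((f \o shift x) (h *: (1 : C)) - f x)) @ 0^' --> v.
    apply/cvgrPdist_le => e e0.
    have er : e \is Num.real by rewrite gtr0_real.
    have eE : e = rc (re e) by rewrite /rc /re; apply/esym/RRe_real.
    have /H[d d0 Hd] : 0 < re e by rewrite -rc_lt rc0 -eE.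
    apply/dnear_nmP; exists d => // h h0; rewrite subr0 => hd.
    have := Hd h hd; rewrite eE normE rc_le => {}Hd /=.
    have -> : v - h^-1 *: (f (h *: 1 + x) - f x) =
              - (h^-1 * (f (x + h) - f x - v * h)).
      by rewrite /GRing.scale /= mulr1 (addrC h x); field.
    by rewrite nmN nmM nmV mulrC ler_pdivrMr// nm_gt0.
  by apply: DeriveDef; [apply/cvg_ex; exists v|apply: cvg_lim Hc; exact: norm_hausdorff].
case=> /cvg_ex[l Hl] <-; have -> : 'D_1 f x = l.
  by apply: cvg_lim Hl; exact: norm_hausdorff.
move=> e e0.
move/cvgrPdist_le : Hl => /(_ (rc e)); rewrite -rc0 rc_lt => /(_ e0).
move=> /dnear_nmP[d d0 Hd]; exists d => // h hd.
have [->|h0] := eqVneq h 0.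
  by rewrite nm0 mulr0 addr0 subrr sub0r mulr0 oppr0 nm0.
have := Hd h h0; rewrite subr0 => /(_ hd); rewrite normE rc_le /=.
have -> : l - h^-1 *: (f (h *: 1 + x) - f x) =
              - (h^-1 * (f (x + h) - f x - l * h)).
  by rewrite /GRing.scale /= mulr1 (addrC h x); field.
by rewrite nmN nmM nmV mulrC ler_pdivrMr// nm_gt0.
Qed.

Lemma cder_derive1 f x v : cder f x v -> derive1 f x = v.
Proof. by rewrite derive1E => /cderP[_ ->]. Qed.

Lemma derivable_cder f x : derivable f x 1 -> cder f x (derive1 f x).
Proof. by move=> Hf; apply/cderP; rewrite derive1E; apply: DeriveDef. Qed.

Lemma cder_derivable f x v : cder f x v -> derivable f x 1.
Proof. by move/cderP => []. Qed.

Lemma cder_unique f x v w : cder f x v -> cder f x w -> v = w.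
Proof. by move=> /cder_derive1 <- /cder_derive1 <-. Qed.

Lemma cder_eqv f x v w : cder f x v -> v = w -> cder f x w.
Proof. by move=> + <-. Qed.

Lemma cder_ext f g x v (d : R) : 0 < d ->
  (forall y, nm (y - x) < d -> f y = g y) -> cder f x v -> cder g x v.
Proof.
move=> d0 fg Hf e /Hf[d' d'0 Hd']; exists (Num.min d d'); first by rewrite lt_min d0.
move=> h; rewrite lt_min => /andP[hd hd'].
by rewrite -!fg ?subrr ?nm0// ?(addrC x) ?addrK// (addrC h); exact: Hd'.
Qed.

Lemma eq_cder f g x v : f =1 g -> cder f x v -> cder g x v.
Proof. by move=> fg; apply: (cder_ext ltr01) => y _. Qed.

Lemma cder_cst (c : C) x : cder (fun=> c) x 0.
Proof. by move=> e e0; exists 1 => // h _; rewrite subrr mul0r subr0 nm0 mulr_ge0 ?nm_ge0 ?ltW. Qed.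

Lemma cder_id x : cder id x 1.
Proof.
by move=> e e0; exists 1 => // h _; rewrite mul1r (addrC x) addrK subrr nm0 mulr_ge0 ?nm_ge0 ?ltW.
Qed.

Lemma cderD f g x v w : cder f x v -> cder g x w -> cder (fun y => f y + g y) x (v + w).
Proof. by move=> /cderP ? /cderP ?; apply/cderP; exact: is_deriveD. Qed.

Lemma cderN f x v : cder f x v -> cder (fun y => - f y) x (- v).
Proof. by move=> /cderP ?; apply/cderP; exact: is_deriveN. Qed.

Lemma cderB f g x v w : cder f x v -> cder g x w -> cder (fun y => f y - g y) x (v - w).
Proof. by move=> ? /cderN; exact: cderD. Qed.

Lemma cderM f g x v w : cder f x v -> cder g x w ->
  cder (fun y => f y * g y) x (f x * w + v * g x).
Proof.
move=> /cderP Hf /cderP Hg; apply/cderP.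
have : is_derive x 1 (f * g) (f x *: w + g x *: v) by exact: is_deriveM.
by rewrite /GRing.scale /= (mulrC (g x)).
Qed.

Lemma cderZ c f x v : cder f x v -> cder (fun y => c * f y) x (c * v).
Proof. by move=> /(cderM (cder_cst c x)); rewrite mul0r addr0. Qed.

Lemma cderX f n x v : cder f x v -> cder (fun y => f y ^+ n) x (n%:R * f x ^+ n.-1 * v).
Proof.
move=> Hf; elim: n => [|n IH].
  by rewrite mul0r mul0r; apply: eq_cder (cder_cst 1 x) => y; rewrite expr0.
apply: (@eq_cder (fun y => f y * f y ^+ n)) => [y|]; first by rewrite exprS.
apply: cder_eqv (cderM Hf IH) _; case: n {IH} => [|n]; first by rewrite /= expr0; ring.
by rewrite /= -[in RHS]natr1 exprS; ring.
Qed.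

Lemma cder_bound f x v : cder f x v -> exists2 d : R, 0 < d &
  forall h, nm h < d -> nm (f (x + h) - f x) <= (nm v + 1) * nm h.
Proof.
move=> /(_ 1 ltr01)[d d0 Hd]; exists d => // h /Hd.
rewrite mul1r mulrDl mul1r -nmM => Hh.
have := nmD (f (x + h) - f x - v * h) (v * h); rewrite subrK; lra.
Qed.

Lemma cder_cont f x v : cder f x v -> forall e : R, 0 < e ->
  exists2 d : R, 0 < d & forall y, nm (y - x) < d -> nm (f y - f x) < e.
Proof.
move=> /cder_bound[d d0 Hd] e e0.
have v1 : 0 < nm v + 1 by have := nm_ge0 v; lra.
exists (Num.min d (e / (nm v + 1))); first by rewrite lt_min d0 divr_gt0.
move=> y; rewrite lt_min ltr_pdivlMr// => /andP[yd ye].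
have := Hd _ yd; rewrite (addrC x) subrK => H; apply: le_lt_trans H _.
by rewrite mulrC.
Qed.

Lemma cder_comp f g x v w : cder f x v -> cder g (f x) w ->
  cder (fun y => g (f y)) x (w * v).
Proof.
move=> Hf Hg e e0.
have v1 : 0 < nm v + 1 by have := nm_ge0 v; lra.
have w1 : 0 < nm w + 1 by have := nm_ge0 w; lra.
have [d1 d10 H1] := cder_bound Hf.
have [d2 d20 H2] := Hg (e / 2 / (nm v + 1)) ltac:(rewrite !divr_gt0//).
have [d3 d30 H3] := Hf (e / 2 / (nm w + 1)) ltac:(rewrite !divr_gt0//).
exists (Num.min (Num.min d1 d3) (d2 / (nm v + 1))).
  by rewrite !lt_min d10 d30 divr_gt0.
move=> h; rewrite !lt_min => /andP[/andP[h1 h3]]; rewrite ltr_pdivlMr// => h2.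
have {}H1 := H1 _ h1; have {}H3 := H3 _ h3.
set k := f (x + h) - f x in H1 H3.
have kE : f (x + h) = f x + k by rewrite /k (addrC (f x)) subrK.
have {}H2 := H2 k ltac:(apply: le_lt_trans H1 _; rewrite mulrC//).
rewrite kE.
have -> : g (f x + k) - g (f x) - w * v * h =
  (g (f x + k) - g (f x) - w * k) + w * (k - v * h) by ring.
apply: le_trans (nmD _ _) _; rewrite nmM.
have E1 : e / 2 / (nm v + 1) * nm k <= e / 2 * nm h.
  apply: (@le_trans _ _ (e / 2 / (nm v + 1) * ((nm v + 1) * nm h))).
    by rewrite ler_wpM2l// !divr_ge0// ltW.
  by rewrite le_eqVlt; apply/orP; left; apply/eqP; field; rewrite lt0r_neq0.
have E2 : nm w * nm (k - v * h) <= e / 2 * nm h.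
  apply: (@le_trans _ _ ((nm w + 1) * (e / 2 / (nm w + 1) * nm h))).
    by rewrite ler_pM ?nm_ge0// lerDl.
  by rewrite le_eqVlt; apply/orP; left; apply/eqP; field; rewrite lt0r_neq0.
lra.
Qed.

Lemma cderV f x v : f x != 0 -> cder f x v ->
  cder (fun y => (f y)^-1) x (- v / f x ^+ 2).
Proof.
move=> fx0 /cderP[Hf Df]; apply/cderP; apply: DeriveDef; first exact: derivableV.
by rewrite deriveV// Df /GRing.scale /=; field.
Qed.

Lemma cder_shift f x a v : cder f (x + a) v -> cder (fun y => f (y + a)) x v.
Proof. by move=> Hf e /Hf[d d0 Hd]; exists d => // h /Hd; rewrite (addrAC x h a). Qed.

Lemma cder_opp f x a v : cder f (a - x) v -> cder (fun y => f (a - y)) x (- v).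
Proof.
move=> Hf; have /(cder_comp (g := f)) : cder (fun y => a - y) x (0 - 1).
  by apply: cderB; [exact: cder_cst|exact: cder_id].
by move/(_ _ Hf); rewrite sub0r mulrN1.
Qed.

Lemma cder_sum I (s : seq I) (F : I -> C -> C) (G : I -> C) x :
  (forall i, cder (F i) x (G i)) ->
  cder (fun y => \sum_(i <- s) F i y) x (\sum_(i <- s) G i).
Proof.
move=> H; elim: s => [|i s IH].
  by rewrite big_nil; apply: eq_cder (cder_cst 0 x) => y; rewrite big_nil.
rewrite big_cons; apply: (@eq_cder (fun y => F i y + \sum_(j <- s) F j y)).
  by move=> y; rewrite big_cons.
exact: cderD.
Qed.

(** Reduces complex derivatives to real ones: along a line, the component of [f] selected by [c] is
    a real function, to which the real mean value theorem applies. *)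
Lemma is_derive_re_line f (c a h g : C) (t : R) : cder f (a + rc t * h) g ->
  is_derive t 1 (fun t : R => re (c * f (a + rc t * h))) (re (c * (g * h))).
Proof.
move=> H; set phi := fun t : R => _.
have Hc : (fun k => k^-1 *: ((phi \o shift t) (k *: (1 : R)) - phi t)) @ 0^' --> re (c * (g * h)).
  apply/cvgrPdist_le => e e0.
  set B := nm c * nm h + 1.
  have B0 : 0 < B by have := nm_ge0 c; have := nm_ge0 h; rewrite /B; nra.
  have [d d0 Hd] := H (e / B) (divr_gt0 e0 B0).
  near=> k.
  have k0 : k != 0 by near: k; exact: nbhs_dnbhs_neq.
  rewrite /= [k%:A]mulr1 /phi /=.
  have kd : nm (rc k * h) < d.
    rewrite nmM nm_rc; have : `|k| < d / (nm h + 1).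
      near: k; apply: dnbhs0_lt; rewrite divr_gt0//; have := nm_ge0 h; lra.
    rewrite ltr_pdivlMr; last by have := nm_ge0 h; lra.
    by move=> Hk; apply: le_lt_trans Hk; rewrite ler_wpM2l// lerDl.
  have := Hd _ kd; move=> Hq.
  have -> : re (c * (g * h)) - k^-1 *: (re (c * f (a + rc (k + t) * h)) - re (c * f (a + rc t * h)))
   = - re (c * (rc k)^-1 * (f (a + rc t * h + rc k * h) - f (a + rc t * h) - g * (rc k * h))).
    have -> : a + rc t * h + rc k * h = a + rc (k + t) * h by rewrite rcD; ring.
    rewrite -reN /GRing.scale /= -reN -reD -[k^-1]re_rc.
    have reZ (x : C) : re (rc k^-1) * re x = re (rc k^-1 * x).
      by rewrite reM im_rc mul0r subr0.
    rewrite reZ -reN -reD rcV; congr re; field.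
    by rewrite rc_eq0.
  rewrite normrN; apply: le_trans (re_le_nm _) _.
  rewrite !nmM nmV nm_rc.
  rewrite nmM nm_rc in Hq.
  have k0' : 0 < `|k| by rewrite normr_gt0.
  have : nm c / `|k| * nm (f (a + rc t * h + rc k * h) - f (a + rc t * h) - g * (rc k * h))
    <= nm c / `|k| * (e / B * (`|k| * nm h)).
    by rewrite ler_wpM2l// divr_ge0// nm_ge0.
  move/le_trans; apply.
  have -> : nm c / `|k| * (e / B * (`|k| * nm h)) = e * (nm c * nm h) / B.
    by field; rewrite (lt0r_neq0 B0) (lt0r_neq0 k0').
  rewrite ler_pdivrMr// ler_wpM2l ?(ltW e0)// /B; lra.
by apply: DeriveDef; [apply/cvg_ex; eexists; exact: Hc|apply: cvg_lim Hc; exact: norm_hausdorff].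
Unshelve. all: by end_near. Qed.

Lemma re_segment_mvt f (g : C -> C) (c a h : C) :
  (forall t : R, 0 <= t <= 1 -> cder f (a + rc t * h) (g (a + rc t * h))) ->
  exists2 t : R, 0 < t < 1 &
    re (c * (f (a + h) - f a)) = re (c * (g (a + rc t * h) * h)).
Proof.
move=> H.
pose phi (t : R) := re (c * f (a + rc t * h)).
have dphi (t : R) : 0 <= t <= 1 -> is_derive t 1 phi (re (c * (g (a + rc t * h) * h))).
  by move=> /H; exact: is_derive_re_line.
have cphi : {within `[0, 1], continuous phi}.
  apply: derivable_within_continuous => t; rewrite in_itv /= => t01.
  by have [] := dphi _ t01.
have [t] := MVT ltr01 (fun t t01 => dphi t ltac:(move: t01; rewrite in_itv /= => /andP[/ltW-> /ltW->]//)) cphi.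
rewrite in_itv /= => t01; rewrite subr0 mulr1 => Ht; exists t => //.
by rewrite -Ht /phi rc0 rc1 mul1r mul0r addr0 -reN -reD mulrBr.
Qed.

Lemma mean_value_bound f (g : C -> C) (M : R) (a h : C) :
  (forall t : R, 0 <= t <= 1 -> cder f (a + rc t * h) (g (a + rc t * h))) ->
  (forall t : R, 0 <= t <= 1 -> nm (g (a + rc t * h)) <= M) ->
  nm (f (a + h) - f a) <= M * nm h.
Proof.
move=> H HM; set D := f (a + h) - f a.
(* The choice [c = cj D] turns the left side of the mean value equality into the squared modulus of
   the increment [D]. *)
have [t t01] := re_segment_mvt (cj D) H.
rewrite -/D mul_cj re_rc => E.
have [D0|D0] := eqVneq (nm D) 0.
  rewrite D0 mulr_ge0 ?nm_ge0//; apply: le_trans (nm_ge0 _) (HM 0 _).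
  by rewrite lexx ler01.
have Dp : 0 < nm D by rewrite lt_def D0 nm_ge0.
rewrite -(ler_pM2l Dp) -expr2 E.
apply: le_trans (ler_norm _) _; apply: le_trans (re_le_nm _) _.
rewrite !nmM nm_cj ler_pM2l// ler_wpM2r ?nm_ge0// HM//.
by case/andP: t01 => /ltW-> /ltW->.
Qed.

Lemma cder_ball_bound f (g : C -> C) (M r : R) (c x y : C) :
  (forall z, nm (z - c) < r -> cder f z (g z)) ->
  (forall z, nm (z - c) < r -> nm (g z) <= M) ->
  nm (x - c) < r -> nm (y - c) < r -> nm (f y - f x) <= M * nm (y - x).
Proof.
move=> H HM xr yr.
have tr (t : R) : 0 <= t <= 1 -> nm (x + rc t * (y - x) - c) < r.
  case/andP=> t0 t1.
  have -> : x + rc t * (y - x) - c = rc (1 - t) * (x - c) + rc t * (y - c).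
    by rewrite rcB rc1; ring.
  apply: le_lt_trans (nmD _ _) _; rewrite !nmM !nm_rc !ger0_norm ?subr_ge0//.
  have [->|t0'] := eqVneq t 0; first by rewrite mul0r addr0 subr0 mul1r.
  have tp : 0 < t by rewrite lt_def t0'.
  by nra.
have := @mean_value_bound f g M x (y - x) (fun t t01 => H _ (tr t t01)) (fun t t01 => HM _ (tr t t01)).
by rewrite (addrC x) subrK.
Qed.

Lemma cder0_cst f (r : R) (c x y : C) : (forall z, nm (z - c) < r -> cder f z 0) ->
  nm (x - c) < r -> nm (y - c) < r -> f x = f y.
Proof.
move=> H xr yr; apply/eqP; rewrite -subr_eq0 -nm_eq0 eq_le nm_ge0 andbT.
have := @cder_ball_bound f (fun=> 0) 0 r c y x H _ yr xr; rewrite mul0r; apply.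
by move=> z _; rewrite nm0.
Qed.

End ComplexDerivative.

(** * Unconditional sums *)

Section UnconditionalSums.
Variables (R : realType) (I : eqType).
Local Notation C := (Cx R).
Implicit Types (b : I -> R) (F G : I -> C) (s : seq I).

Definition bsummable b := (forall i, 0 <= b i) /\
  exists M : R, forall s, uniq s -> \sum_(i <- s) b i <= M.

(** Limit along finite duplicate-free lists ordered by inclusion. No enumeration enters, so
    translating or negating the index set is a mere reindexing. *)
Definition hassum F (S : C) := forall e : R, 0 < e -> exists2 s0, uniq s0 &
  forall s, uniq s -> {subset s0 <= s} -> nm (\sum_(i <- s) F i - S) < e.

Lemma uniq_subset_perm s0 s : uniq s0 -> uniq s -> {subset s0 <= s} ->
  perm_eq s (s0 ++ [seq i <- s | i \notin s0]).
Proof.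
move=> us0 us sub; apply: uniq_perm => //.
  rewrite cat_uniq us0 filter_uniq// andbT /=.
  by apply/hasPn => i; rewrite mem_filter => /andP[].
move=> i; rewrite mem_cat mem_filter; case: (boolP (i \in s0)) => //= /sub ->//.
Qed.

Lemma big_uniq_subset (V : nmodType) s0 s (F : I -> V) : uniq s0 -> uniq s -> {subset s0 <= s} ->
  \sum_(i <- s) F i = \sum_(i <- s0) F i + \sum_(i <- [seq i <- s | i \notin s0]) F i.
Proof. by move=> us0 us sub; rewrite (perm_big _ (uniq_subset_perm us0 us sub)) big_cat. Qed.

Lemma bsum_tail b (e : R) : bsummable b -> 0 < e -> exists2 s0, uniq s0 &
  forall s, uniq s -> (forall i, i \in s -> i \notin s0) -> \sum_(i <- s) b i <= e.
Proof.
move=> [b0 [M HM]] e0.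
pose E := [set x | exists2 s, uniq s & x = \sum_(i <- s) b i].
have hE : has_sup E.
  split; first by exists 0, [::] => //; rewrite big_nil.
  by exists M => _ [s us ->]; exact: HM.
have [_ [s0 us0 ->] Hs0] := sup_adherent e0 hE.
exists s0 => // s us dis.
have : \sum_(i <- s0 ++ s) b i <= sup E.
  apply: ub_le_sup; first by case: hE.
  exists (s0 ++ s) => //; rewrite cat_uniq us0 us andbT /=.
  by apply/hasPn => i /dis.
by rewrite big_cat /=; lra.
Qed.

Lemma hassum_unique F S T : hassum F S -> hassum F T -> S = T.
Proof.
move=> HS HT; apply/eqP; rewrite -subr_eq0; apply/eqP/nm_eq0_eps => e e0.
have e20 : 0 < e / 2 by lra.
have [s1 us1 H1] := HS _ e20; have [s2 us2 H2] := HT _ e20.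
pose s := undup (s1 ++ s2).
have us : uniq s by exact: undup_uniq.
have {}H1 := H1 s us ltac:(by move=> i; rewrite mem_undup mem_cat => ->).
have {}H2 := H2 s us ltac:(by move=> i; rewrite mem_undup mem_cat => ->; rewrite orbT).
have -> : S - T = (\sum_(i <- s) F i - T) - (\sum_(i <- s) F i - S) by ring.
by apply: le_trans (nmB _ _) _; lra.
Qed.

Lemma eq_hassum F G S : F =1 G -> hassum F S -> hassum G S.
Proof.
move=> FG H e /H[s0 us0 Hs]; exists s0 => // s us sub.
by rewrite -(eq_bigr _ (fun i _ => FG i)); exact: Hs.
Qed.

Lemma hassumD F G S T : hassum F S -> hassum G T -> hassum (fun i => F i + G i) (S + T).
Proof.
move=> HS HT e e0; have e20 : 0 < e / 2 by lra.
have [s1 us1 H1] := HS _ e20; have [s2 us2 H2] := HT _ e20.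
exists (undup (s1 ++ s2)); first exact: undup_uniq.
move=> s us sub; rewrite big_split /=.
have {}H1 := H1 s us ltac:(by move=> i i1; apply: sub; rewrite mem_undup mem_cat i1).
have {}H2 := H2 s us ltac:(by move=> i i1; apply: sub; rewrite mem_undup mem_cat i1 orbT).
rewrite opprD addrACA; apply: le_lt_trans (nmD _ _) _; lra.
Qed.

Lemma hassumZ c F S : hassum F S -> hassum (fun i => c * F i) (c * S).
Proof.
move=> H e e0; have c1 : 0 < nm c + 1 by have := nm_ge0 c; lra.
have [s0 us0 Hs] := H _ (divr_gt0 e0 c1); exists s0 => // s us sub.
rewrite -mulr_sumr -mulrBr nmM.
have := Hs s us sub; rewrite ltr_pdivlMr// => {}Hs.
by apply: le_lt_trans Hs; rewrite mulrC ler_wpM2l ?nm_ge0// lerDl.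
Qed.

Lemma hassumN F S : hassum F S -> hassum (fun i => - F i) (- S).
Proof. by move=> /(hassumZ (-1)); rewrite mulN1r; apply: eq_hassum => i; rewrite mulN1r. Qed.

Lemma hassumB F G S T : hassum F S -> hassum G T -> hassum (fun i => F i - G i) (S - T).
Proof. by move=> ? /hassumN; exact: hassumD. Qed.

Lemma hassum_delta i0 (a : C) : hassum (fun i => if i == i0 then a else 0) a.
Proof.
move=> e e0; exists [:: i0] => // s us sub.
rewrite (bigD1_seq i0) ?us ?sub ?mem_head//= eqxx big1 ?addr0 ?subrr ?nm0// => i.
by move/negbTE => ->.
Qed.

Lemma hassum_finite F (B : seq I) : uniq B ->
  hassum (fun i => if i \in B then F i else 0) (\sum_(i <- B) F i).
Proof.
move=> uB e e0; exists B => // s us sub.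
rewrite (big_uniq_subset _ uB us sub) [X in _ + X - _]big1_seq ?addr0.
  rewrite -sumrB big1_seq ?nm0// => i /= iB; by rewrite iB subrr.
by move=> i /=; rewrite mem_filter => /andP[/negbTE ->].
Qed.

Lemma hassum_nonneg b : bsummable b -> exists S : R, hassum (fun i => rc (b i)) (rc S).
Proof.
move=> [b0 [M HM]].
pose E := [set x | exists2 s, uniq s & x = \sum_(i <- s) b i].
have hE : has_sup E.
  split; first by exists 0, [::] => //; rewrite big_nil.
  by exists M => _ [s us ->]; exact: HM.
exists (sup E) => e e0.
have [_ [s0 us0 ->] Hs0] := sup_adherent e0 hE.
exists s0 => // s us sub.
have -> : \sum_(i <- s) rc (b i) = rc (\sum_(i <- s) b i).
  by elim: (s) => [|j t IH]; rewrite ?big_nil ?rc0// !big_cons rcD IH.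
rewrite -rcB nm_rc.
have : \sum_(i <- s) b i <= sup E by apply: ub_le_sup; [case: hE|exists s].
have : \sum_(i <- s0) b i <= \sum_(i <- s) b i.
  by rewrite (big_uniq_subset _ us0 us sub) lerDl sumr_ge0.
by move=> ? ?; rewrite ler0_norm; lra.
Qed.

Lemma bsummable_dom b (b' : I -> R) (A : seq I) (c : R) : bsummable b -> (forall i, 0 <= b' i) ->
  (forall i, i \notin A -> b' i <= c * b i) -> bsummable b'.
Proof.
move=> [b0 [M HM]] b'0 H; split=> //.
exists (\sum_(i <- undup A) b' i + `|c| * M) => s us.
pose s1 := [seq i <- s | i \in A]; pose s2 := [seq i <- s | i \notin A].
have -> : \sum_(i <- s) b' i = \sum_(i <- s1) b' i + \sum_(i <- s2) b' i.
  by rewrite !big_filter [LHS](bigID (mem A)).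
apply: lerD.
  rewrite (big_uniq_subset _ (s0 := s1) (s := undup A)) ?filter_uniq ?undup_uniq//.
    by rewrite lerDl sumr_ge0.
  by move=> i; rewrite mem_filter mem_undup => /andP[].
apply: (@le_trans _ _ (\sum_(i <- s2) `|c| * b i)).
  rewrite !big_filter; apply: ler_sum => i iA; apply: le_trans (H i iA) _.
  by rewrite ler_wpM2r// ler_norm.
by rewrite -mulr_sumr ler_wpM2l// HM// filter_uniq.
Qed.

Lemma hassum_dom1 b F : bsummable b -> (forall i, nm (F i) <= b i) -> exists S, hassum F S.
Proof.
move=> bb H.
have part (p : C -> R) : (forall z, `|p z| <= nm z) -> exists S : C, hassum (fun i => rc (p (F i))) S.
  move=> pn.
  have pb i : `|p (F i)| <= b i by apply: le_trans (pn _) (H i).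
  have [S1 H1] := hassum_nonneg bb.
  (* Adding [b] makes the real component nonnegative, so that a supremum gives its sum; [b] is
     subtracted again afterwards. *)
  have : bsummable (fun i => p (F i) + b i).
    apply: (bsummable_dom (A := [::]) (c := 2) bb) => i; have := pb i; rewrite ler_norml; lra.
  move=> /hassum_nonneg[S2 H2]; exists (rc S2 - rc S1).
  by apply: eq_hassum (hassumB H2 H1) => i; rewrite rcD addrK.
have [S1 H1] := part (@re R) (@re_le_nm R).
have [S2 H2] := part (@im R) (@im_le_nm R).
exists (S1 + Complex 0 1 * S2); apply: eq_hassum (hassumD H1 (hassumZ _ H2)) => i.
by apply: cplx_eq; rewrite ?reD ?imD ?reM ?imM /=; ring.
Qed.

Lemma hassum_dom b F (A : seq I) (c : R) : bsummable b ->
  (forall i, i \notin A -> nm (F i) <= c * b i) -> exists S, hassum F S.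
Proof.
move=> bb H; have : bsummable (fun i => nm (F i)).
  by apply: bsummable_dom bb _ H => i; exact: nm_ge0.
by move=> bF; apply: hassum_dom1 bF _.
Qed.

Lemma hassum_finite_change F G S (A : seq I) : hassum G S ->
  (forall i, i \notin A -> F i = G i) -> exists S', hassum F S'.
Proof.
move=> HG FG.
have [| |D HD] := @hassum_dom (fun=> 0) (fun i => F i - G i) A 0.
- by split=> //; exists 0 => s _; rewrite big1.
- by move=> i /FG ->; rewrite subrr nm0 mulr0.
by exists (S + D); apply: eq_hassum (hassumD HG HD) => i; rewrite addrC subrK.
Qed.

Lemma hassum_tail F S s0 (M : R) : hassum F S -> uniq s0 ->
  (forall s, uniq s -> (forall i, i \in s -> i \notin s0) -> nm (\sum_(i <- s) F i) <= M) ->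
  nm (S - \sum_(i <- s0) F i) <= M.
Proof.
move=> H us0 HM; apply: le_eps => e /H[s1 us1 Hs].
pose s := undup (s0 ++ s1).
have us : uniq s by exact: undup_uniq.
have sub0 : {subset s0 <= s} by move=> i; rewrite mem_undup mem_cat => ->.
have {}Hs := Hs s us ltac:(by move=> i; rewrite mem_undup mem_cat => ->; rewrite orbT).
rewrite (big_uniq_subset _ us0 us sub0) in Hs.
have {}HM := HM [seq i <- s | i \notin s0] ltac:(exact: filter_uniq)
  ltac:(by move=> i; rewrite mem_filter => /andP[]).
set a := \sum_(i <- s0) F i in Hs *; set t := \sum_(i <- _) F i in Hs HM.
have -> : S - a = t - (a + t - S) by ring.
by apply: le_trans (nmB _ _) _; lra.
Qed.

Lemma hassum_limn F S (s : nat -> seq I) : hassum F S -> (forall n, uniq (s n)) ->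
  (forall i, exists N, forall n, (N <= n)%N -> i \in s n) ->
  limn (fun n => \sum_(i <- s n) F i) = S.
Proof.
move=> H us ex; apply: limn_nm => e /H[s0 us0 Hs].
have [N HN] : exists N, forall n, (N <= n)%N -> {subset s0 <= s n}.
  elim: s0 {us0 Hs} => [|i t [N IH]]; first by exists 0.
  have [M HM] := ex i; exists (maxn M N) => n; rewrite geq_max => /andP[Mn Nn] j.
  by rewrite in_cons => /predU1P[->|/(IH n Nn)//]; exact: HM.
by exists N => n Nn; apply: Hs => //; exact: HN.
Qed.

(** Termwise differentiation: beyond a finite list the mean value bound controls each remainder by a
    multiple of [nm h * b i], hence their sum by a small tail of [b], and the finite part is
    differentiated directly. [A] absorbs the finitely many terms for which the majorant is not
    valid. *)
Theorem cder_hassum b (A : seq I) (c r : R) (F G : I -> C -> C) (f : C -> C) (x g : C) :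
  bsummable b -> 0 < r ->
  (forall i y, nm (y - x) < r -> cder (F i) y (G i y)) ->
  (forall i, i \notin A -> forall y, nm (y - x) < r -> nm (G i y) <= c * b i) ->
  (forall y, nm (y - x) < r -> hassum (F^~ y) (f y)) -> hassum (G^~ x) g ->
  cder f x g.
Proof.
move=> bb r0 HF HG Hf Hg e e0.
have c0 : 0 <= `|c| by []. have c1 : 0 < 3 * (`|c| + 1) by lra.
have [s0 us0 Hs0] := bsum_tail bb (divr_gt0 e0 c1).
pose s1 := undup (s0 ++ A); have us1 : uniq s1 by exact: undup_uniq.
have [d d0 Hd] : exists2 d : R, 0 < d & forall h, nm h < d ->
    nm (\sum_(i <- s1) F i (x + h) - \sum_(i <- s1) F i x - (\sum_(i <- s1) G i x) * h)
    <= e / 3 * nm h.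
  have H : cder (fun y => \sum_(i <- s1) F i y) x (\sum_(i <- s1) G i x).
    by apply: cder_sum => i; apply: HF; rewrite subrr nm0.
  by have e30 : 0 < e / 3 by [lra]; have [d d0 Hd] := H _ e30; exists d.
exists (Num.min d r); first by rewrite lt_min d0.
move=> h; rewrite lt_min => /andP[hd hr].
have xhr : nm (x + h - x) < r by rewrite (addrC x) addrK.
pose H i := F i (x + h) - F i x - h * G i x.
have HS : hassum H (f (x + h) - f x - h * g).
  by apply: hassumB (hassumZ _ Hg); apply: hassumB; apply: Hf => //; rewrite subrr nm0.
have tl : nm ((f (x + h) - f x - h * g) - \sum_(i <- s1) H i) <= 2 * (e / 3) * nm h.
  apply: hassum_tail HS us1 _ => s us dis.
  apply: le_trans (nm_sum _ _) _.
  have Hi i : i \in s -> nm (H i) <= (2 * `|c| * nm h) * b i.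
    move=> /dis; rewrite mem_undup mem_cat negb_or => /andP[_ iA].
    have cb : forall y, nm (y - x) < r -> nm (G i y) <= `|c| * b i.
      move=> y yr; apply: le_trans (HG i iA y yr) _; rewrite ler_wpM2r ?ler_norm//.
      by case: bb.
    have := @cder_ball_bound _ (F i) (G i) (`|c| * b i) r x x (x + h) (HF i) cb.
    rewrite subrr nm0 (addrC x) addrK (addrC h) => /(_ r0 hr) H1.
    have H2 : nm (h * G i x) <= nm h * (`|c| * b i).
      by rewrite nmM ler_wpM2l ?nm_ge0// cb// subrr nm0.
    by apply: le_trans (nmB _ _) _; lra.
  apply: (@le_trans _ _ (\sum_(i <- s) (2 * `|c| * nm h) * b i)).
    by rewrite !big_seq; apply: ler_sum.
  rewrite -mulr_sumr.
  have : \sum_(i <- s) b i <= e / (3 * (`|c| + 1)).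
    by apply: Hs0 => // i /dis; rewrite mem_undup mem_cat negb_or => /andP[].
  rewrite ler_pdivlMr// => Hb.
  have bs0 : 0 <= \sum_(i <- s) b i by apply: sumr_ge0 => i _; case: bb.
  have hh := nm_ge0 h.
  have : `|c| * \sum_(i <- s) b i <= e / 3 by nra.
  by move=> Hcb; nra.
have {}Hd := Hd h hd.
have E : \sum_(i <- s1) H i = \sum_(i <- s1) F i (x + h) - \sum_(i <- s1) F i x -
    (\sum_(i <- s1) G i x) * h.
  by rewrite mulr_suml -!sumrB; apply: eq_bigr => i _; rewrite /H (mulrC h).
rewrite (mulrC g) -[X in nm X](subrK (\sum_(i <- s1) H i)).
apply: le_trans (nmD _ _) _; rewrite {2}E; lra.
Qed.

End UnconditionalSums.

Lemma hassum_reindex (R : realType) (I J : eqType) (f : I -> J) (g : J -> I) (F : J -> Cx R) S :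
  cancel f g -> cancel g f -> hassum F S -> hassum (fun i => F (f i)) S.
Proof.
move=> fK gK H e /H[s0 us0 Hs]; exists (map g s0).
  by rewrite map_inj_uniq//; exact: can_inj gK.
move=> s us sub; have := Hs (map f s); rewrite big_map; apply.
  by rewrite map_inj_uniq//; exact: can_inj fK.
move=> j js; apply/mapP; exists (g j); last by rewrite gK.
by apply/sub/map_f.
Qed.

(** * Liouville's theorem for elliptic functions *)

Section LatticeGeometry.
Variables (R : realType) (w1 w2 : Cx R).
Local Notation C := (Cx R).
Hypothesis wB : lattice_basis w1 w2.

(** The signed area of the period parallelogram, which is the determinant in Cramer's rule for the
    coordinates of a point. *)
Definition covol : R := im (cj w1 * w2).

Lemma covol_neq0 : covol != 0.
Proof.
apply/eqP => D0.
have E : rc (re (cj w1 * w2)) * w1 + rc (- nm w1 ^+ 2) * w2 = 0.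
  rewrite rcN -mul_cj.
  have -> : rc (re (cj w1 * w2)) = cj w1 * w2.
    by apply: cplx_eq; rewrite ?re_rc ?im_rc// -[RHS]/covol D0.
  ring.
have [_ /eqP] := wB E; rewrite oppr_eq0 sqrf_eq0 nm_eq0 => /eqP w10.
have [|/eqP] := wB (a := 1) (b := 0); last by rewrite oner_eq0.
by rewrite w10 -/(rc 0) mulr0 rc0 mul0r addr0.
Qed.

Lemma covolE (a b : R) (x : C) : x = rc a * w1 + rc b * w2 ->
  im (cj w1 * x) = b * covol /\ im (cj w2 * x) = - (a * covol).
Proof.
move=> ->; rewrite /covol; case: w1 => p q; case: w2 => r s.
by rewrite /cj /im /re /=; split; ring.
Qed.

Lemma basis_coords (x : C) : exists a b : R, x = rc a * w1 + rc b * w2.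
Proof.
exists (- im (cj w2 * x) / covol), (im (cj w1 * x) / covol).
have := covol_neq0; rewrite /covol; case: w1 => p q; case: w2 => r s; case: x => u v.
rewrite /cj /im /re /= => D0.
apply: cplx_eq; rewrite /re /im /rc /=; field; move: D0; congr (_ != 0); ring.
Qed.

Lemma coords_bound (a b : R) :
  `|a| * `|covol| <= (nm w1 + nm w2) * nm (rc a * w1 + rc b * w2) /\
  `|b| * `|covol| <= (nm w1 + nm w2) * nm (rc a * w1 + rc b * w2).
Proof.
have [Eb Ea] := covolE (erefl (rc a * w1 + rc b * w2)).
set x := rc a * w1 + _ in Ea Eb *.
rewrite -!normrM -Eb -[X in `|X|]opprK -Ea normrN.
have := nm_ge0 x; have := nm_ge0 w1; have := nm_ge0 w2 => p1 p2 p3.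
by split; apply: le_trans (im_le_nm _) _; rewrite nmM nm_cj; nra.
Qed.

Lemma floor_coords (x : C) : exists m n : int, exists a b : R,
  [/\ x = rc a * w1 + rc b * w2 + (m%:~R * w1 + n%:~R * w2), 0 <= a <= 1 & 0 <= b <= 1].
Proof.
have [a [b ->]] := basis_coords x.
exists (Num.floor a), (Num.floor b), (a - (Num.floor a)%:~R), (b - (Num.floor b)%:~R).
have rcz (n : int) : rc n%:~R = n%:~R :> C by exact: rmorph_int.
split; first by rewrite !rcB !rcz; ring.
  by have := floor_itv a; lra.
by have := floor_itv b; lra.
Qed.

(** Compactness of the unit square of coordinates. The radius is an argument of [P], so that locally
    valid radii yield a single one for the whole period parallelogram. *)
Lemma fundamental_covering (P : R -> C -> Prop) :
  (forall x, exists2 d : R, 0 < d & forall y, nm (y - x) < d -> forall e, 0 < e < d -> P e y) ->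
  exists2 d : R, 0 < d &
    forall a b : R, 0 <= a <= 1 -> 0 <= b <= 1 -> P d (rc a * w1 + rc b * w2).
Proof.
move=> H.
have cK : compact (`[0%R, 1%R]%classic `*` `[0%R, 1%R]%classic : set (R * R)).
  by apply: compact_setX; exact: segment_compact.
have /compact_near_coveringP := cK.
move=> /(_ R 0^'+ (fun e p => P e (rc p.1 * w1 + rc p.2 * w2)) _) /=.
have W1 : 0 < nm w1 + nm w2 + 1 by have := nm_ge0 w1; have := nm_ge0 w2; lra.
have step : forall p : R * R, (`[0%R, 1%R]%classic `*` `[0%R, 1%R]%classic) p ->
   \forall p' \near p & e \near 0^'+, P e (rc p'.1 * w1 + rc p'.2 * w2).
  move=> [a b] _; have [d d0 Hd] := H (rc a * w1 + rc b * w2).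
  exists (ball (a, b) (d / (nm w1 + nm w2 + 1)), [set e | 0 < e < d]) => /=.
    split; first exact: nbhsx_ballx (divr_gt0 _ _).
    by near=> e; apply/andP; split; near: e; [exact: nbhs_right_gt|exact: nbhs_right_lt].
  move=> [[a' b'] e] /= [[ba bb] e0d]; apply: Hd => //.
  move: ba bb; rewrite -!ball_normE /= => ba bb.
  have -> : rc a' * w1 + rc b' * w2 - (rc a * w1 + rc b * w2) =
    rc (a' - a) * w1 + rc (b' - b) * w2 by rewrite !rcB; ring.
  apply: le_lt_trans (nmD _ _) _; rewrite !nmM !nm_rc.
  rewrite ltr_pdivlMr// in ba; rewrite ltr_pdivlMr// in bb.
  rewrite distrC in ba; rewrite distrC in bb.
  have := normr_ge0 (a' - a); have := normr_ge0 (b' - b).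
  have := nm_ge0 w1; have := nm_ge0 w2.
  move: ba bb; set A := `|a' - a|; set B := `|b' - b| => ba bb p1 p2 p3 p4.
  have [AB|AB] := leP A B; nra.
move=> /(_ step); rewrite near_withinE => /nbhs_ballP[d /= d0 Hd].
exists (d / 2); first lra.
move=> a b a01 b01.
have d2 : 0 < d / 2 by lra.
have := Hd (d / 2); rewrite -ball_normE /= sub0r normrN gtr0_norm//.
by move=> /(_ ltac:(lra) d2 (a, b)) /=; apply; split; rewrite /= in_itv.
Unshelve. all: by end_near. Qed.

End LatticeGeometry.

Lemma periodic_int (T : Type) (R : realType) (G : Cx R -> T) w : (forall x, G (x + w) = G x) ->
  forall (m : int) x, G (x + m%:~R * w) = G x.
Proof.
move=> H; have Hn (n : nat) x : G (x + n%:R * w) = G x.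
  elim: n x => [|n IH] x; first by rewrite mul0r addr0.
  by rewrite -[RHS]IH -[RHS]H -natr1; congr G; ring.
case=> n x; first by rewrite -[_%:~R]/(n%:R) Hn.
rewrite -[LHS](Hn n.+1); congr G.
by rewrite NegzE mulrNz -pmulrn; ring.
Qed.

Section EllipticLiouville.
Variables (R : realType) (w1 w2 : Cx R) (F F1 : Cx R -> Cx R).
Local Notation C := (Cx R).
Hypothesis wB : lattice_basis w1 w2.
Hypothesis dF : forall x, cder F x (F1 x).
Hypothesis cF1 : forall x (e : R), 0 < e -> exists2 d : R, 0 < d &
  forall y, nm (y - x) < d -> nm (F1 y - F1 x) < e.
Hypothesis per1 : forall x, F (x + w1) = F x.
Hypothesis per2 : forall x, F (x + w2) = F x.

Lemma elliptic_derivative_periodic w : (forall x, F (x + w) = F x) ->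
  forall x, F1 (x + w) = F1 x.
Proof.
move=> H x; apply: (@cder_unique _ F x) (dF x).
by apply: eq_cder (cder_shift (dF (x + w))) => y; rewrite H.
Qed.

Lemma elliptic_derivative_translate (m n : int) x : F1 (x + (m%:~R * w1 + n%:~R * w2)) = F1 x.
Proof.
rewrite addrA (periodic_int (elliptic_derivative_periodic per2)).
by rewrite (periodic_int (elliptic_derivative_periodic per1)).
Qed.

Lemma elliptic_derivative_ucont (e : R) : 0 < e -> exists2 d : R, 0 < d &
  forall x y, nm (y - x) < d -> nm (F1 y - F1 x) < e.
Proof.
move=> e0.
have [|d d0 Hd] := @fundamental_covering R w1 w2
  (fun d x => forall y, nm (y - x) < d -> nm (F1 y - F1 x) < e).
  move=> x; have e20 : 0 < e / 2 by lra.
  have [d d0 Hd] := cF1 x e20.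
  exists (d / 2) => [|y yx d' /andP[d'0 d'd] z zy]; first lra.
  have zx : nm (z - x) < d.
    have -> : z - x = (z - y) + (y - x) by ring.
    by apply: le_lt_trans (nmD _ _) _; lra.
  have -> : F1 z - F1 y = (F1 z - F1 x) - (F1 y - F1 x) by ring.
  apply: le_lt_trans (nmB _ _) _.
  have := Hd _ zx; have := Hd y ltac:(lra); lra.
exists d => // x y yx.
have [m [n [a [b [xE a01 b01]]]]] := floor_coords wB x.
have := Hd a b a01 b01 (y - (m%:~R * w1 + n%:~R * w2)).
have yE : y - (m%:~R * w1 + n%:~R * w2) - (rc a * w1 + rc b * w2) = y - x.
  by rewrite xE; ring.
rewrite yE => /(_ yx).
rewrite -(elliptic_derivative_translate m n (y - _)) subrK.
by rewrite -(elliptic_derivative_translate m n (rc a * w1 + _)) -xE.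
Qed.

Lemma elliptic_derivative_bounded : exists2 M : R, 0 < M & forall x, nm (F1 x) <= M.
Proof.
(* The radius also plays the inverse of the bound: shrinking it weakens the inequality, as the
   covering argument requires. *)
have [|d d0 Hd] := @fundamental_covering R w1 w2 (fun d x => nm (F1 x) <= d^-1).
  move=> x; have [d d0 Hd] := cF1 x (@ltr01 R).
  have n1 : 0 < nm (F1 x) + 1 by have := nm_ge0 (F1 x); lra.
  exists (Num.min d (nm (F1 x) + 1)^-1); first by rewrite lt_min d0 invr_gt0.
  move=> y; rewrite lt_min => /andP[yx _] e; rewrite lt_min => /andP[e0 /andP[_ el]].
  have := Hd y yx => H1.
  apply: (@le_trans _ _ (nm (F1 x) + 1)).
    by have := nm_subB (F1 y) (F1 x); lra.
  by rewrite -[leLHS]invrK lef_pV2 ?posrE ?invr_gt0// ltW.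
exists d^-1; first by rewrite invr_gt0.
move=> x; have [m [n [a [b [-> a01 b01]]]]] := floor_coords wB x.
by rewrite elliptic_derivative_translate Hd.
Qed.

Section Grid.
Variables (a h1 h2 : C) (n : nat).
Hypotheses (hw1 : n%:R * h1 = w1) (hw2 : n%:R * h2 = w2).
Let P (i j : nat) := F (a + i%:R * h1 + j%:R * h2).

(* Twice the signed area of the image of a cell of the grid. *)
Let area i j := im (cj (P i.+1 j.+1 - P i j) * (P i j.+1 - P i.+1 j)).

(* The areas cancel along the edges of the cells, as the grid lies on a torus. *)
Lemma grid_area0 : \sum_(0 <= i < n) \sum_(0 <= j < n) area i j = 0.
Proof.
have Pn1 j : P n j = P 0 j.
  by rewrite /P hw1 mul0r addr0 -(per1 (a + _)); congr F; ring.
have Pn2 i : P i n = P i 0.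
  by rewrite /P hw2 mul0r addr0 per2.
pose u i j := im (cj (P i.+1 j) * P i j); pose v i j := im (cj (P i j.+1) * P i j).
have E i j : area i j = (u i j.+1 - u i j) - (v i.+1 j - v i j).
  rewrite /area /u /v; move: (P i j) (P i.+1 j) (P i j.+1) (P i.+1 j.+1).
  by case=> ? ? [? ?] [? ?] [? ?]; rewrite /cj /im /re /=; ring.
have -> : \sum_(0 <= i < n) \sum_(0 <= j < n) area i j =
  \sum_(0 <= i < n) \sum_(0 <= j < n) (u i j.+1 - u i j) -
  \sum_(0 <= j < n) \sum_(0 <= i < n) (v i.+1 j - v i j).
  rewrite [X in _ - X]exchange_big -sumrB; apply: eq_bigr => i _.
  by rewrite -sumrB; apply: eq_bigr => j _.
rewrite !big1 ?subr0// => i _; rewrite telescope_sumr//.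
  by rewrite /v !Pn1 subrr.
by rewrite /u !Pn2 subrr.
Qed.

(** Twice the signed area of a quadrilateral is given by its two diagonals. To first order these are
    [F1 x * (h1 + h2)] and [F1 x * (h2 - h1)], whence the factor [nm (F1 x) ^+ 2]; each diagonal has
    an error of at most [e * h]. *)
Lemma grid_area_estimate (e M h : R) i j (x := a + i%:R * h1 + j%:R * h2) :
  nm (F1 x) <= M -> nm h1 + nm h2 <= h -> 0 <= e ->
  (forall k, nm k <= h -> nm (F (x + k) - F x - F1 x * k) <= e * nm k) ->
  `|area i j - 2 * nm (F1 x) ^+ 2 * im (cj h1 * h2)| <= e * (2 * M + e) * h ^+ 2.
Proof.
move=> HM Hh e0 H.
have n1 := nm_ge0 h1; have n2 := nm_ge0 h2.
have H1 := H h1 ltac:(lra); have H2 := H h2 ltac:(lra).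
have H12 := H (h1 + h2) ltac:(apply: le_trans (nmD _ _) _; lra).
set e1 := F (x + h1) - _ - _ in H1; set e2 := F (x + h2) - _ - _ in H2.
set e12 := F (x + (h1 + h2)) - _ - _ in H12.
have -> : area i j = im (cj (F1 x * (h1 + h2) + e12) * (F1 x * (h2 - h1) + (e2 - e1))).
  congr (im (cj _ * _)).
    have -> : P i.+1 j.+1 = F (x + (h1 + h2)).
      by congr F; rewrite /x -(natr1 i) -(natr1 j); ring.
    by rewrite /e12 /P -/x; ring.
  have -> : P i j.+1 = F (x + h2) by congr F; rewrite /x -natr1; ring.
  have -> : P i.+1 j = F (x + h1) by congr F; rewrite /x -natr1; ring.
  by rewrite /e1 /e2; ring.
have -> : 2 * nm (F1 x) ^+ 2 * im (cj h1 * h2) =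
    im (cj (F1 x * (h1 + h2)) * (F1 x * (h2 - h1))).
  rewrite [in RHS]cjM [in RHS]mulrACA mul_cj [in RHS]imM re_rc im_rc mul0r addr0.
  by move: (h1) (h2) => [? ?] [? ?]; rewrite /cj /im /re /=; ring.
set X := F1 x * (h1 + h2); set Y := F1 x * (h2 - h1).
have -> : im (cj (X + e12) * (Y + (e2 - e1))) - im (cj X * Y) =
  im (cj X * (e2 - e1) + cj e12 * (Y + (e2 - e1))).
  by rewrite cjD -imN -imD; congr im; ring.
apply: le_trans (im_le_nm _) _; apply: le_trans (nmD _ _) _.
rewrite !nmM !nm_cj.
have X1 : nm X <= M * h.
  rewrite /X nmM ler_pM ?nm_ge0//; apply: le_trans (nmD _ _) _; lra.
have Y1 : nm Y <= M * h.
  rewrite /Y nmM ler_pM ?nm_ge0//; apply: le_trans (nmB _ _) _; lra.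
have E12 : nm e12 <= e * h.
  apply: le_trans H12 _; rewrite ler_wpM2l//; apply: le_trans (nmD _ _) _; lra.
have E1 : nm (e2 - e1) <= e * h.
  apply: le_trans (nmB _ _) _; nra.
have Z1 : nm (Y + (e2 - e1)) <= M * h + e * h by apply: le_trans (nmD _ _) _; lra.
have M0 : 0 <= M := le_trans (nm_ge0 _) HM.
have h0 : 0 <= h by lra.
have : nm X * nm (e2 - e1) <= (M * h) * (e * h) by rewrite ler_pM ?nm_ge0.
have : nm e12 * nm (Y + (e2 - e1)) <= (e * h) * (M * h + e * h) by rewrite ler_pM ?nm_ge0.
lra.
Qed.

End Grid.

(** The signed areas of the image cells sum to 0, yet up to a small error each is [nm (F1 x) ^+ 2]
    times the signed area of the cell. A nonzero [F1 z] would keep this sum away from 0 by an amount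
    that does not depend on the mesh. *)
Theorem elliptic_liouville x y : F x = F y.
Proof.
suff F10 z : F1 z = 0.
  apply: (@cder0_cst _ F (nm (y - x) + 1) x).
  - by move=> z _; rewrite -(F10 z).
  - by rewrite subrr nm0; have := nm_ge0 (y - x); lra.
  - by lra.
apply/eqP; rewrite -nm_eq0; apply/negPn/negP => m0'.
set m := nm (F1 z) in m0'.
have m0 : 0 < m by rewrite lt_def m0' nm_ge0.
have [M M0 HM] := elliptic_derivative_bounded.
pose D := im (cj w1 * w2); have D0 : 0 < `|D| by rewrite normr_gt0 (covol_neq0 wB).
pose W := nm w1 + nm w2 + 1.
have W0 : 0 < W by rewrite /W; have := nm_ge0 w1; have := nm_ge0 w2; lra.
have m20 : 0 < m / 2 by lra.
have [d1 d10 Hd1] := cF1 z m20.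
(* A parallelogram at [z] with sides [w1 / q] and [w2 / q] stays in the ball of radius [d1], where
   the modulus of [F1] is at least [m / 2]. *)
have [q Hq] : exists q : nat, W / d1 < q%:R.
  by exists (Num.bound (W / d1)); apply: archi_boundP; rewrite divr_ge0 ?ltW.
have q0 : 0 < q%:R :> R by apply: le_lt_trans Hq; rewrite divr_ge0 ?ltW.
(* Chosen so that comparing the lower and upper estimates of [S] leaves exactly
   [m ^+ 2 <= e * B]. *)
pose B := q%:R ^+ 2 * 2 * ((2 * M + 1) * W ^+ 2) / `|D|.
have B0 : 0 < B by rewrite /B divr_gt0// !mulr_gt0 ?exprn_gt0//; lra.
pose e := Num.min 1 (m ^+ 2 / (2 * B)).
have e0 : 0 < e by rewrite lt_min ltr01 divr_gt0 ?exprn_gt0//; lra.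
have e1 : e <= 1 by rewrite ge_min lexx.
have eB : e * B < m ^+ 2.
  have : e <= m ^+ 2 / (2 * B) by rewrite ge_min lexx orbT.
  rewrite ler_pdivlMr; last lra.
  have : 0 < m ^+ 2 by rewrite exprn_gt0.
  lra.
have [d d0 Hd] := elliptic_derivative_ucont e0.
have [k0 Hk0] : exists k0 : nat, W / d < k0%:R.
  by exists (Num.bound (W / d)); apply: archi_boundP; rewrite divr_ge0 ?ltW.
pose k := k0.+1; have k00 : 0 < k%:R :> R by rewrite ltr0n.
(* The mesh [W / n] is below the radius [d] of uniform continuity, and the corner with sides
   [w1 / q] and [w2 / q] consists of [k * k] cells. *)
pose n := (q * k)%N.
have q1 : 1 <= q%:R :> R by rewrite ler1n lt0n; apply/eqP => q'; move: q0; rewrite q' ltxx.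
have nE : n%:R = q%:R * k%:R :> R by rewrite natrM.
have n0 : 0 < n%:R :> R by rewrite nE mulr_gt0.
have nW : W / n%:R < d.
  rewrite ltr_pdivrMr// mulrC -ltr_pdivrMr//; apply: lt_trans Hk0 _.
  by rewrite nE /k -natr1; have : 0 <= k0%:R :> R by []; nra.
have nC : n%:R != 0 :> C by rewrite -rc_nat rc_eq0 lt0r_neq0.
pose h1 := w1 / n%:R; pose h2 := w2 / n%:R.
have hw1 : n%:R * h1 = w1 by rewrite /h1 mulrC divfK.
have hw2 : n%:R * h2 = w2 by rewrite /h2 mulrC divfK.
have nh1 : nm h1 = nm w1 / n%:R by rewrite /h1 nmM nmV nm_nat.
have nh2 : nm h2 = nm w2 / n%:R by rewrite /h2 nmM nmV nm_nat.
have hW : nm h1 + nm h2 <= W / n%:R.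
  by rewrite nh1 nh2 -mulrDl ler_wpM2r ?invr_ge0 ?ltW// /W; lra.
have Dh : im (cj h1 * h2) = D / n%:R ^+ 2.
  have nC2 : n%:R = rc n%:R :> C by rewrite rc_nat.
  have -> : D = im (cj (n%:R * h1) * (n%:R * h2)) by rewrite hw1 hw2.
  rewrite nC2; have : n%:R != 0 :> R by rewrite lt0r_neq0.
  by move: (h1) (h2) => [? ?] [? ?] ?; rewrite /cj /im /re /rc /=; field.
have Tay (t : C) l : nm l <= W / n%:R -> nm (F (t + l) - F t - F1 t * l) <= e * nm l.
  move=> lW.
  have Hder s : 0 <= s <= 1 -> cder (fun v => F v - F1 t * v) (t + rc s * l) (F1 (t + rc s * l) - F1 t).
    move=> _; apply: cderB (dF _) _; apply: cder_eqv (cderZ (F1 t) (cder_id _)) _.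
    by rewrite mulr1.
  have Hb s : 0 <= s <= 1 -> nm (F1 (t + rc s * l) - F1 t) <= e.
    move=> /andP[s0 s1]; apply/ltW/Hd; rewrite (addrC t) addrK nmM nm_rc ger0_norm//.
    by apply: le_lt_trans nW; apply: le_trans lW; rewrite -[leRHS]mul1r ler_wpM2r ?nm_ge0.
  have := mean_value_bound (g := fun v => F1 v - F1 t) Hder Hb.
  by rewrite (_ : F (t + l) - F1 t * (t + l) - (F t - F1 t * t) = F (t + l) - F t - F1 t * l)//; ring.
pose xx (i j : nat) := z + i%:R * h1 + j%:R * h2.
have dsum (c : R) (p : nat) : \sum_(0 <= i < p) \sum_(0 <= j < p) c = c * p%:R * p%:R.
  by rewrite !sumr_const_nat subn0 -(mulr_natr (c *+ p)) -(mulr_natr c).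
pose S := \sum_(0 <= i < n) \sum_(0 <= j < n) nm (F1 (xx i j)) ^+ 2.
have upper : S * `|D| <= n%:R ^+ 2 * (e * ((2 * M + 1) * W ^+ 2)) / 2.
  pose area i j := im (cj (F (xx i.+1 j.+1) - F (xx i j)) * (F (xx i j.+1) - F (xx i.+1 j))).
  have A0 : \sum_(0 <= i < n) \sum_(0 <= j < n) area i j = 0 := grid_area0 z hw1 hw2.
  pose c := e * (2 * M + e) * (W / n%:R) ^+ 2.
  have Hc i j : `|area i j - 2 * nm (F1 (xx i j)) ^+ 2 * (D / n%:R ^+ 2)| <= c.
    by rewrite -Dh; apply: grid_area_estimate => //; [exact: ltW|move=> l; exact: Tay].
  have : `|\sum_(0 <= i < n) \sum_(0 <= j < n) (area i j - 2 * nm (F1 (xx i j)) ^+ 2 * (D / n%:R ^+ 2))|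
      <= \sum_(0 <= i < n) \sum_(0 <= j < n) c.
    apply: le_trans (ler_norm_sum _ _ _) _; apply: ler_sum => i _.
    by apply: le_trans (ler_norm_sum _ _ _) _; apply: ler_sum => j _.
  have -> : \sum_(0 <= i < n) \sum_(0 <= j < n) (area i j - 2 * nm (F1 (xx i j)) ^+ 2 * (D / n%:R ^+ 2))
     = - (2 * (D / n%:R ^+ 2) * S).
    rewrite (eq_bigr (fun i => \sum_(0 <= j < n) area i j - 2 * (D / n%:R ^+ 2) * \sum_(0 <= j < n) nm (F1 (xx i j)) ^+ 2)).
      by rewrite sumrB A0 sub0r -mulr_sumr.
    by move=> i _; rewrite mulr_sumr -sumrB; apply: eq_bigr => j _; ring.
  rewrite (dsum c n) normrN normrM normrM.
  have S0 : 0 <= S by apply: sumr_ge0 => i _; apply: sumr_ge0 => j _; exact: sqr_ge0.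
  rewrite (ger0_norm S0) normrM normfV normrX (ger0_norm (ltW n0)) normr_nat.
  have -> : c * n%:R * n%:R = e * (2 * M + e) * W ^+ 2.
    by rewrite /c; field; exact: lt0r_neq0.
  have n2 : 0 < n%:R ^+ 2 :> R by rewrite exprn_gt0.
  have -> : 2 * (`|D| / n%:R ^+ 2) * S = (2 * `|D| * S) / n%:R ^+ 2 by ring.
  rewrite ler_pdivrMr// => H1.
  have : e * (2 * M + e) * W ^+ 2 <= e * ((2 * M + 1) * W ^+ 2).
    by rewrite -mulrA ler_wpM2l ?(ltW e0)// ler_wpM2r ?sqr_ge0//; lra.
  by rewrite -(ler_pM2r n2) => H2; rewrite ler_pdivlMr//; lra.
have lower : k%:R ^+ 2 * (m / 2) ^+ 2 <= S.
  have kn : (k <= n)%N.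
    by rewrite /n leq_pmull// lt0n; apply/eqP => q'; move: q0; rewrite q' ltxx.
  have pt i j : (i < k)%N -> (j < k)%N -> (m / 2) ^+ 2 <= nm (F1 (xx i j)) ^+ 2.
    move=> ik jk; apply: lerXn2r; rewrite ?nnegrE ?nm_ge0 ?ltW//.
    have : nm (xx i j - z) < d1.
      have -> : xx i j - z = i%:R * h1 + j%:R * h2 by rewrite /xx; ring.
      apply: le_lt_trans (nmD _ _) _; rewrite (nmM _ h1) (nmM _ h2) !nm_nat nh1 nh2.
      have ik' : i%:R <= k%:R :> R by rewrite ler_nat ltnW.
      have jk' : j%:R <= k%:R :> R by rewrite ler_nat ltnW.
      apply: (@le_lt_trans _ _ (k%:R * (nm w1 / n%:R) + k%:R * (nm w2 / n%:R))).
        by apply: lerD; rewrite ler_wpM2r// divr_ge0 ?nm_ge0.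
      have -> : k%:R * (nm w1 / n%:R) + k%:R * (nm w2 / n%:R) = (nm w1 + nm w2) / q%:R.
        by rewrite nE; field; rewrite !lt0r_neq0.
      rewrite ltr_pdivrMr// mulrC; move: Hq; rewrite ltr_pdivrMr// => h.
      by apply: lt_trans h; rewrite /W; lra.
    by move=> /Hd1; have := nm_subB (F1 z) (F1 (xx i j)); rewrite nmBC -/m; lra.
  have sq i j : 0 <= nm (F1 (xx i j)) ^+ 2 by exact: sqr_ge0.
  rewrite /S (big_cat_nat _ kn)//= -[leLHS]addr0; apply: lerD; last first.
    by apply: sumr_ge0 => i _; apply: sumr_ge0.
  apply: (@le_trans _ _ (\sum_(0 <= i < k) \sum_(0 <= j < k) (m / 2) ^+ 2)).
    by rewrite dsum le_eqVlt; apply/orP; left; apply/eqP; ring.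
  apply: ler_sum_nat => i /andP[_ ik].
  rewrite (big_cat_nat _ kn)//= -[leLHS]addr0; apply: lerD; last by apply: sumr_ge0.
  by apply: ler_sum_nat => j /andP[_ jk]; exact: pt.
have : k%:R ^+ 2 * (m / 2) ^+ 2 * `|D| <= n%:R ^+ 2 * (e * ((2 * M + 1) * W ^+ 2)) / 2.
  by apply: le_trans upper; rewrite ler_pM2r.
have -> : n%:R ^+ 2 * (e * ((2 * M + 1) * W ^+ 2)) / 2 = k%:R ^+ 2 * (e * B) / 4 * `|D|.
  by rewrite nE /B; field; exact: lt0r_neq0.
rewrite ler_pM2r// -mulrA ler_pM2l ?exprn_gt0//.
rewrite expr_div_n; lra.
Qed.

End EllipticLiouville.

(** * Twice differentiable functions and Liouville's theorem under a local condition *)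

Section TwiceDifferentiable.
Variable R : realType.
Local Notation C := (Cx R).
Implicit Types (U : set C) (f g : C -> C).

(** The second derivative guarantees the continuity of the first that Liouville's theorem assumes,
    and the class is closed under algebraic operations by explicit formulas. *)
Definition smooth2 U f := exists f1 f2 : C -> C,
  forall y, U y -> cder f y (f1 y) /\ cder f1 y (f2 y).

Lemma smooth2_cst U (c : C) : smooth2 U (fun=> c).
Proof. by exists (fun=> 0), (fun=> 0) => y _; split; exact: cder_cst. Qed.

Lemma smooth2_id U : smooth2 U (fun x => x).
Proof. by exists (fun=> 1), (fun=> 0) => y _; split; [exact: cder_id|exact: cder_cst]. Qed.

Lemma smooth2D U f g : smooth2 U f -> smooth2 U g -> smooth2 U (fun x => f x + g x).
Proof.
move=> [f1 [f2 Hf]] [g1 [g2 Hg]]; exists (fun x => f1 x + g1 x), (fun x => f2 x + g2 x).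
by move=> y Uy; have [? ?] := Hf y Uy; have [? ?] := Hg y Uy; split; exact: cderD.
Qed.

Lemma smooth2M U f g : smooth2 U f -> smooth2 U g -> smooth2 U (fun x => f x * g x).
Proof.
move=> [f1 [f2 Hf]] [g1 [g2 Hg]].
exists (fun x => f x * g1 x + f1 x * g x).
exists (fun x => (f x * g2 x + f1 x * g1 x) + (f1 x * g1 x + f2 x * g x)).
move=> y Uy; have [? ?] := Hf y Uy; have [? ?] := Hg y Uy.
by split; [exact: cderM|apply: cderD; exact: cderM].
Qed.

Lemma smooth2N U f : smooth2 U f -> smooth2 U (fun x => - f x).
Proof.
move=> [f1 [f2 Hf]]; exists (fun x => - f1 x), (fun x => - f2 x).
by move=> y /Hf[? ?]; split; exact: cderN.
Qed.

Lemma smooth2X U f n : smooth2 U f -> smooth2 U (fun x => f x ^+ n).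
Proof.
move=> Hf; elim: n => [|n IH]; first by exact: (smooth2_cst U 1).
have [f1 [f2 H]] := smooth2M Hf IH; exists f1, f2 => y /H[H1 H2]; split=> //.
by apply: eq_cder H1 => x; rewrite exprS.
Qed.

Lemma smooth2V U f : smooth2 U f -> (forall y, U y -> f y != 0) ->
  smooth2 U (fun x => (f x)^-1).
Proof.
move=> [f1 [f2 Hf]] f0.
exists (fun x => - f1 x * (f x ^+ 2)^-1).
exists (fun x => (- f1 x) * (- (2%:R * f x ^+ 1 * f1 x) / (f x ^+ 2) ^+ 2) + (- f2 x) * (f x ^+ 2)^-1).
move=> y Uy; have [H1 H2] := Hf y Uy; split; first exact: cderV (f0 y Uy) H1.
apply: cderM (cderN H2) _.
by apply: (@cderV _ (fun x => f x ^+ 2)); rewrite ?sqrf_eq0 ?f0//; exact: (cderX 2).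
Qed.

Lemma smooth2_sub U V f : V `<=` U -> smooth2 U f -> smooth2 V f.
Proof. by move=> VU [f1 [f2 H]]; exists f1, f2 => y /VU; exact: H. Qed.

Lemma smooth2_opp U f a : smooth2 U f -> smooth2 [set x | U (a - x)] (fun x => f (a - x)).
Proof.
move=> [f1 [f2 H]]; exists (fun x => - f1 (a - x)), (fun x => - - f2 (a - x)) => y /= /H[H1 H2].
by split; [exact: cder_opp|apply: cderN; exact: cder_opp].
Qed.

Lemma smooth2_shift U f a : smooth2 U f -> smooth2 [set x | U (x + a)] (fun x => f (x + a)).
Proof.
move=> [f1 [f2 H]]; exists (fun x => f1 (x + a)), (fun x => f2 (x + a)) => y /= /H[H1 H2].
by split; exact: cder_shift.
Qed.

Definition cball (x : C) (r : R) : set C := [set y | nm (y - x) < r].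

Lemma cball_sub x y (r : R) : nm (y - x) < r ->
  exists2 d : R, 0 < d & cball y d `<=` cball x r.
Proof.
move=> yx; exists (r - nm (y - x)); first lra.
move=> z /= zy; rewrite /cball /=; have -> : z - x = (z - y) + (y - x) by ring.
by apply: le_lt_trans (nmD _ _) _; rewrite /cball /= in zy; lra.
Qed.

Lemma smooth2_ext x (r : R) f g : (forall y, cball x r y -> f y = g y) ->
  smooth2 (cball x r) f -> smooth2 (cball x r) g.
Proof.
move=> fg [f1 [f2 H]]; exists f1, f2 => y yr; have [H1 H2] := H y yr; split=> //.
have [d d0 Hd] := cball_sub yr.
by apply: (cder_ext d0) H1 => z zy; apply: fg; exact: Hd.
Qed.

Theorem elliptic_liouville2 (w1 w2 : C) (F : C -> C) : lattice_basis w1 w2 ->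
  (forall x, F (x + w1) = F x) -> (forall x, F (x + w2) = F x) ->
  (forall x, exists2 r : R, 0 < r & smooth2 (cball x r) F) ->
  forall x y, F x = F y.
Proof.
move=> wB p1 p2 loc.
have dF x : cder F x (derive1 F x).
  have [r r0 [f1 [f2 H]]] := loc x.
  have [H1 _] := H x ltac:(by rewrite /cball /= subrr nm0).
  by rewrite (cder_derive1 H1).
apply: (elliptic_liouville (F1 := derive1 F) wB) => // x e e0.
have [r r0 [f1 [f2 H]]] := loc x.
have xx : cball x r x by rewrite /cball /= subrr nm0.
have [H1 H2] := H x xx.
have [d d0 Hd] := cder_cont H2 e0.
exists (Num.min d r); first by rewrite lt_min d0.
move=> y; rewrite lt_min => /andP[yd yr].
by rewrite (cder_derive1 H1) (cder_derive1 (H y yr).1); exact: Hd.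
Qed.

End TwiceDifferentiable.

(** * Sums over lattices *)

Section ReciprocalSums.
Variables (R : realType) (I : eqType).
Local Notation C := (Cx R).
Implicit Types (a : I -> C) (x : C).

Definition csum (F : I -> C) : C := xget 0 (hassum F).

Lemma csumE F S : hassum F S -> csum F = S.
Proof. by move=> H; apply: xget_unique => // T HT; exact: hassum_unique HT H. Qed.

Lemma csumP F S : hassum F S -> hassum F (csum F).
Proof. by move=> H; rewrite (csumE H). Qed.

(** The properties of a lattice on which the sums rest. They also hold for the points [z - L m],
    whose sums give Taylor expansions at [z]. *)
Definition admissible a := bsummable (fun i => nm (a i) ^- 3) /\
  forall r : R, exists A : seq I, forall i, i \notin A -> r <= nm (a i).

(* Terms with [a i = 0] vanish as soon as [0 < n], since [0^-1 = 0]. *)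
Definition Tterm a n k x i := (a i) ^- n * (a i - x) ^- k.
Definition T a n k x := csum (Tterm a n k x).

Lemma Tterm_bound a n k x y i : (3 <= n + k)%N ->
  2 * (nm x + 1) <= nm (a i) -> nm (y - x) < 1 ->
  nm (Tterm a n k y i) <= 2 ^+ k * nm (a i) ^- 3.
Proof.
move=> nk ax yx; rewrite /Tterm nmM !nmV !nmX.
set A := nm (a i) in ax *; have n0 := nm_ge0 x.
have y1 : nm y <= nm x + 1.
  by rewrite -(subrK x y); apply: le_trans (nmD _ _) _; lra.
have A0 : 1 <= A by lra.
have B0 : A / 2 <= nm (a i - y) by have := nm_subB (a i) y; rewrite -/A; lra.
have A20 : 0 < A / 2 by lra.
apply: (@le_trans _ _ (A ^- n * (2 ^+ k * A ^- k))).
  rewrite ler_wpM2l ?invr_ge0 ?exprn_ge0//; first lra.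
  have -> : 2 ^+ k * A ^- k = (A / 2) ^- k by rewrite expr_div_n invf_div.
  rewrite lef_pV2 ?posrE ?exprn_gt0//; last lra.
  by rewrite lerXn2r ?nnegrE; lra.
rewrite mulrCA ler_wpM2l ?exprn_ge0// -invfM -exprD lef_pV2 ?posrE ?exprn_gt0; try lra.
by rewrite ler_weXn2l.
Qed.

Lemma Tterm_hassum a n k x : admissible a -> (3 <= n + k)%N -> exists S, hassum (Tterm a n k x) S.
Proof.
move=> [bs fin] nk; have [A HA] := fin (2 * (nm x + 1)).
apply: (hassum_dom (A := A) (c := 2 ^+ k) bs) => i /HA Hi.
by apply: (Tterm_bound nk Hi); rewrite subrr nm0.
Qed.

Lemma T_hassum a n k x : admissible a -> (3 <= n + k)%N -> hassum (Tterm a n k x) (T a n k x).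
Proof. by move=> Ha nk; have [S HS] := Tterm_hassum x Ha nk; exact: csumP HS. Qed.

(** The second alternative covers the lattice point 0: its term vanishes identically when [0 < n],
    so that the sums are differentiable at 0, where the Laurent expansions need them. *)
Definition avoids a n x := forall i, a i != x \/ (a i = 0 /\ (0 < n)%N).

Lemma avoids_ball a n x : admissible a -> avoids a n x ->
  exists2 r : R, 0 < r & forall y, nm (y - x) < r -> avoids a n y.
Proof.
move=> [_ fin] Hx; have [A HA] := fin (nm x + 1).
have [r r0 Hr] : exists2 r : R, 0 < r & forall i, i \in A ->
    forall y, nm (y - x) < r -> a i != y \/ (a i = 0 /\ (0 < n)%N).
  elim: A {HA} => [|i A [r r0 Hr]]; first by exists 1.
  have [aix|ai0] := Hx i; last first.
    by exists r => // j; rewrite in_cons => /predU1P[-> y _|/Hr//]; right.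
  have n0 : 0 < nm (a i - x) by rewrite nm_gt0 subr_eq0.
  exists (Num.min r (nm (a i - x))); first by rewrite lt_min r0.
  move=> j; rewrite in_cons => /predU1P[->|jA] y; rewrite lt_min => /andP[yr yi]; last exact: Hr.
  by left; apply/eqP => E; move: yi; rewrite E ltxx.
exists (Num.min r 1); first by rewrite lt_min r0 ltr01.
move=> y; rewrite lt_min => /andP[yr y1] i.
have [/Hr|/HA Hi] := boolP (i \in A); first by apply.
left; apply/eqP => E; move: Hi; rewrite E => Hi.
have := nm_subB y x; lra.
Qed.

Lemma Tterm_cder a n k y i : a i != y \/ (a i = 0 /\ (0 < n)%N) ->
  cder (fun y => Tterm a n k y i) y (k%:R * Tterm a n k.+1 y i).
Proof.
case=> [aiy|[ai0 n0]]; last first.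
  apply: (@eq_cder _ (fun=> 0)) => [z|].
    by rewrite /Tterm ai0 expr0n eqn0Ngt n0 invr0 mul0r.
  apply: cder_eqv (cder_cst 0 y) _.
  by rewrite /Tterm ai0 expr0n eqn0Ngt n0 invr0 mul0r mulr0.
have d0 : a i - y != 0 by rewrite subr_eq0.
have H1 : cder (fun z => a i - z) y (-1).
  by apply: cder_eqv (cderB (cder_cst (a i) y) (cder_id y)) _; rewrite sub0r.
have H2 := cderX k H1.
have H3 := @cderV _ (fun z => (a i - z) ^+ k) y _ (expf_neq0 k d0) H2.
apply: cder_eqv (cderZ ((a i) ^- n) H3) _.
rewrite /Tterm; case: k {H2 H3} => [|k]; first by rewrite !mul0r oppr0 mul0r mulr0.
rewrite -[k.+1.-1]/k !exprS expr0; have := expf_neq0 k d0.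
move: ((a i) ^- n) ((a i - y) ^+ k) => u v v0.
by field; rewrite d0 v0.
Qed.

Lemma T_cder a n k x : admissible a -> (3 <= n + k)%N -> avoids a n x ->
  cder (T a n k) x (k%:R * T a n k.+1 x).
Proof.
move=> Ha nk Hx; have [r r0 Hr] := avoids_ball Ha Hx.
have [bs fin] := Ha.
have [A HA] := fin (2 * (nm x + 1)).
have nk1 : (3 <= n + k.+1)%N by rewrite addnS ltnW// ltnS.
apply: (@cder_hassum _ _ _ A (k%:R * 2 ^+ k.+1) (Num.min r 1) (fun i y => Tterm a n k y i)
   (fun i y => k%:R * Tterm a n k.+1 y i) _ _ _ bs).
- by rewrite lt_min r0 ltr01.
- move=> i y; rewrite lt_min => /andP[/Hr yr _]; exact: Tterm_cder.
- move=> i /HA Hi y; rewrite lt_min => /andP[_ y1].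
  by rewrite nmM nm_nat -mulrA ler_wpM2l// (Tterm_bound nk1 Hi).
- by move=> y _; exact: T_hassum.
- exact/hassumZ/T_hassum.
Qed.

Lemma T_smooth2 a n k (U : set C) : admissible a -> (3 <= n + k)%N ->
  (forall x, U x -> avoids a n x) -> smooth2 U (T a n k).
Proof.
move=> Ha nk HU; exists (fun x => k%:R * T a n k.+1 x), (fun x => k%:R * (k.+1%:R * T a n k.+2 x)).
move=> y /HU Hy; split; first exact: T_cder.
by apply: cderZ; apply: T_cder => //; rewrite addnS ltnW// ltnS.
Qed.

(** Termwise this is [(a - x) + x = a] divided by powers. Iterated, it splits off Taylor
    coefficients at 0 with an exact remainder, because [T a n 0 x] does not depend on [x]. *)
Lemma T_recr a n k x : admissible a -> (3 <= n + k.+1)%N -> (0 < n)%N -> avoids a n x ->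
  T a n k.+1 x = T a n.+1 k x + x * T a n.+1 k.+1 x.
Proof.
move=> Ha nk n0 Hx; apply: csumE.
have nk' : (3 <= n.+1 + k)%N by rewrite addSnnS.
have nk'' : (3 <= n.+1 + k.+1)%N by rewrite addSn ltnW.
have := hassumD (T_hassum x Ha nk') (hassumZ x (T_hassum x Ha nk'')).
apply: eq_hassum => i; rewrite /Tterm.
have [->|ai0] := eqVneq (a i) 0.
  by rewrite !expr0n /= eqn0Ngt n0 invr0 !(mul0r, mulr0) addr0.
case: (Hx i) => [aix|[/eqP]]; last by rewrite (negbTE ai0).
have d0 : a i - x != 0 by rewrite subr_eq0.
rewrite !exprS; have := expf_neq0 n ai0; have := expf_neq0 k d0.
by move: (a i ^+ n) ((a i - x) ^+ k) => u v u0 v0; field; rewrite u0 v0 d0 ai0.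
Qed.

Lemma T_k0 a n x : T a n 0 x = T a n 0 0.
Proof. by congr csum; apply/funext => i; rewrite /Tterm !expr0. Qed.

Lemma T_x0 a n k : T a n k 0 = T a (n + k) 0 0.
Proof.
by congr csum; apply/funext => i; rewrite /Tterm subr0 expr0 invr1 mulr1 exprD invfM.
Qed.

Lemma admissible_shift a x : admissible a -> admissible (fun i => x - a i).
Proof.
move=> [bs fin]; split.
  have [A HA] := fin (2 * nm x + 1).
  apply: (bsummable_dom (A := A) (c := 8) bs) => i; first by rewrite invr_ge0 exprn_ge0 ?nm_ge0.
  move=> /HA Hi; have n0 := nm_ge0 x.
  have H : nm (a i) / 2 <= nm (x - a i) by rewrite nmBC; have := nm_subB (a i) x; lra.
  have p : 0 < nm (a i) / 2 by lra.
  have -> : 8 * nm (a i) ^- 3 = (nm (a i) / 2) ^- 3.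
    by rewrite expr_div_n invf_div; congr (_ / _); rewrite !exprS expr0; ring.
  rewrite lef_pV2 ?posrE ?exprn_gt0//; last lra.
  by rewrite lerXn2r ?nnegrE; lra.
move=> r; have [A HA] := fin (r + nm x); exists A => i /HA Hi.
by rewrite nmBC; have := nm_subB (a i) x; lra.
Qed.

End ReciprocalSums.

(** * Summability of the inverse cubes of lattice points *)

Section LatticeSummability.
Variable R : realType.
Local Notation C := (Cx R).

Lemma ler_sum_subset (J : eqType) (s t : seq J) (b : J -> R) : uniq s -> uniq t ->
  {subset s <= t} -> (forall i, 0 <= b i) -> \sum_(i <- s) b i <= \sum_(i <- t) b i.
Proof.
move=> us ut st b0; rewrite (big_uniq_subset b us ut st) lerDl.
exact: sumr_ge0.
Qed.

(** The power [(1 + |a|)^(-3/2)]: up to a constant, the product of two of them, one for each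
    coordinate, dominates the inverse cube of a lattice point, and the exponent [3/2] still exceeds
    1. *)
Definition powm32 (a : int) : R := ((1 + `|a|%N%:R) * Num.sqrt (1 + `|a|%N%:R))^-1.

Lemma powm32_ge0 a : 0 <= powm32 a.
Proof. by rewrite invr_ge0 mulr_ge0 ?sqrtr_ge0// addr_ge0. Qed.

(** With [x] and [y] the square roots of [N + 1] and [N + 2], the right side grows by
    [2 / x - 2 / y], which is at least the new term because [(y - x) * (y + x) = 1]. *)
Lemma sum_powm32_nat (N : nat) :
  \sum_(0 <= i < N.+1) powm32 (Posz i) <= 3 - 2 / Num.sqrt N.+1%:R.
Proof.
elim: N => [|N IH].
  by rewrite big_nat1 /powm32 absz0 addr0 sqrtr1 mulr1 invr1; lra.
rewrite big_nat_recr//=.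
have := IH; rewrite /powm32 /= [1 + _]addrC natr1.
have n0 : 0 < N.+1%:R :> R by rewrite ltr0n.
have n1 : 0 < N.+2%:R :> R by rewrite ltr0n.
set x := Num.sqrt N.+1%:R; set y := Num.sqrt N.+2%:R.
have x0 : 0 < x by rewrite sqrtr_gt0.
have y0 : 0 < y by rewrite sqrtr_gt0.
have x2 : x ^+ 2 = N.+1%:R by rewrite sqr_sqrtr// ltW.
have y2 : y ^+ 2 = N.+2%:R by rewrite sqr_sqrtr// ltW.
have yx2 : y ^+ 2 = x ^+ 2 + 1 by rewrite x2 y2 natr1.
have xy : x <= y by rewrite ler_wsqrtr// ler_nat.
rewrite -y2 => {}IH.
have : (y ^+ 2 * y)^-1 <= 2 / x - 2 / y.
  have -> : 2 / x - 2 / y = 2 * (y - x) / (x * y) by field; rewrite !lt0r_neq0.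
  rewrite ler_pdivlMr ?mulr_gt0// mulrC ler_pdivrMr ?mulr_gt0 ?exprn_gt0//.
  have : (y - x) * (y + x) = 1 by rewrite -subr_sqr yx2; ring.
  move=> E; have : 1 <= 2 * (y - x) * y by nra.
  move=> H; have : x * y <= y * y by nra.
  by nra.
lra.
Qed.

Lemma bsummable_powm32 : bsummable powm32.
Proof.
split; first exact: powm32_ge0.
exists 6 => s us.
have [N HN] : exists N : nat, forall a, a \in s -> (`|a| <= N)%N.
  elim: s {us} => [|a s [N IH]]; first by exists 0.
  exists (maxn `|a| N) => c; rewrite in_cons => /predU1P[->|/IH]; first exact: leq_maxl.
  by move/leq_trans; apply; exact: leq_maxr.
pose P := [seq Posz i | i <- iota 0 N.+1]; pose Q := [seq - Posz i | i <- iota 0 N.+1].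
pose t := undup (P ++ Q).
apply: (@le_trans _ _ (\sum_(a <- t) powm32 a)).
  apply: ler_sum_subset => //; [exact: undup_uniq| |exact: powm32_ge0].
  move=> a /HN aN; rewrite mem_undup mem_cat; apply/orP.
  have [a0|a0] := leP 0 a; [left|right]; apply/mapP.
    by exists `|a|%N; rewrite ?mem_iota ?ltnS// gez0_abs.
  by exists `|a|%N; rewrite ?mem_iota ?ltnS// ltz0_abs// opprK.
apply: (@le_trans _ _ (\sum_(a <- P ++ Q) powm32 a)).
  rewrite /t; elim: (P ++ Q) => [|a l IH]; first by rewrite !big_nil.
  rewrite /=; case: ifP => _; rewrite big_cons; last by rewrite big_cons lerD2l.
  by apply: le_trans IH _; rewrite lerDr powm32_ge0.
have H := sum_powm32_nat N.
have i0 : 0 <= 2 / Num.sqrt N.+1%:R :> R by rewrite divr_ge0 ?sqrtr_ge0.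
rewrite big_cat /= !big_map; move: H; rewrite /index_iota subn0 => H.
have -> : \sum_(i <- iota 0 N.+1) powm32 (- Posz i) = \sum_(i <- iota 0 N.+1) powm32 (Posz i).
  by apply: eq_bigr => i _; rewrite /powm32 abszN.
lra.
Qed.

Lemma bsummable_prod (J K : eqType) (b : J -> R) (c : K -> R) : bsummable b -> bsummable c ->
  bsummable (fun m : J * K => b m.1 * c m.2).
Proof.
move=> [b0 [M HM]] [c0 [N HN]]; split; first by move=> m; rewrite mulr_ge0.
exists (M * N) => s us.
pose A := undup (map fst s); pose B := undup (map snd s).
apply: (@le_trans _ _ (\sum_(m <- [seq (a, e) | a <- A, e <- B]) b m.1 * c m.2)).
  apply: ler_sum_subset => //.
  - by apply: allpairs_uniq; rewrite ?undup_uniq// => -[? ?] [? ?].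
  - move=> [a e] m; apply/allpairsP; exists (a, e); rewrite !mem_undup; split=> //.
      by apply/mapP; exists (a, e).
    by apply/mapP; exists (a, e).
  - by move=> m; rewrite mulr_ge0.
rewrite big_allpairs /=.
rewrite (eq_bigr (fun a => b a * \sum_(e <- B) c e)) => [|a _]; last by rewrite mulr_sumr.
rewrite -mulr_suml; apply: ler_pM; rewrite ?sumr_ge0//; first exact/HM/undup_uniq.
exact/HN/undup_uniq.
Qed.

End LatticeSummability.

Lemma mem_box (N : nat) (m : int * int) : (m \in box N) = ((`|m.1| <= N) && (`|m.2| <= N))%N.
Proof.
case: m => a b /=; apply/allpairsP/andP => [[[i j] /= []]|[aN bN]].
  by rewrite !(mem_iota 0 (2 * N).+1) => iN jN [-> ->]; split; lia.
by exists (absz (a + Posz N), absz (b + Posz N)); rewrite !(mem_iota 0 (2 * N).+1) /=; split; try lia; congr pair; lia.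
Qed.

Lemma box_uniq N : uniq (box N).
Proof.
apply: allpairs_uniq; rewrite ?iota_uniq// => -[i j] [i' j'] _ _ /= [] H1 H2.
by congr pair; lia.
Qed.

Section LatticePoints.
Variables (R : realType) (w1 w2 : Cx R).
Local Notation C := (Cx R).
Local Notation L := (lattice_pt w1 w2).

Lemma lattice_ptD m n : L (m + n) = L m + L n.
Proof. by rewrite /lattice_pt /= !rmorphD /=; ring. Qed.
Lemma lattice_ptN m : L (- m) = - L m.
Proof. by rewrite /lattice_pt /= !rmorphN /=; ring. Qed.
Lemma lattice_pt0 : L 0 = 0.
Proof. by rewrite /lattice_pt /= !mul0r addr0. Qed.

(** The unconditional sum runs over all points, the origin included with whatever value the
    convention [0^-1 = 0] assigns to [F 0]; this value is subtracted. *)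
Lemma lattice_sumE (F : C -> C) S : hassum (fun m => F (L m)) S ->
  lattice_sum w1 w2 F = S - F 0.
Proof.
move=> H; have H0 : hassum (fun m => if m != (0, 0) then F (L m) else 0) (S - F 0).
  apply: eq_hassum (hassumB H (hassum_delta (0 : int * int) (F 0))) => m.
  by case: eqVneq => [->|_]; rewrite ?lattice_pt0 ?subrr// subr0.
rewrite /lattice_sum; under eq_fun do rewrite big_mkcond.
apply: hassum_limn H0 _ _; first exact: box_uniq.
move=> m; exists (maxn `|m.1| `|m.2|) => N HN; rewrite mem_box.
by apply/andP; split; apply: leq_trans HN; rewrite ?leq_maxl ?leq_maxr.
Qed.

Hypothesis wB : lattice_basis w1 w2.

Let W := nm w1 + nm w2 + 1.
Let D := covol w1 w2.

Lemma lattice_pt_lower (m : int * int) :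
  (maxn `|m.1| `|m.2|)%:R * `|D| <= W * nm (L m).
Proof.
have [H1 H2] := coords_bound w1 w2 (m.1%:~R) (m.2%:~R).
have rcz (n : int) : rc n%:~R = n%:~R :> C by exact: rmorph_int.
rewrite !rcz -/(L m) -!intr_norm -!natr_absz -/D in H1 H2.
have n0 := nm_ge0 (L m).
have WW : (nm w1 + nm w2) * nm (L m) <= W * nm (L m) by rewrite /W; nra.
rewrite /maxn; case: ifP => _.
  exact: le_trans WW.
exact: le_trans WW.
Qed.

Let D0 : 0 < `|D|. Proof. by rewrite normr_gt0 covol_neq0. Qed.
Let W0 : 0 < W. Proof. by rewrite /W; have := nm_ge0 w1; have := nm_ge0 w2; lra. Qed.

Lemma lattice_pt_eq0 m : (L m == 0) = (m == 0).
Proof.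
apply/eqP/eqP => [E|->]; last exact: lattice_pt0.
have := lattice_pt_lower m; rewrite E nm0 mulr0 pmulr_lle0// lern0.
by rewrite -leqn0 geq_max !leqn0 !absz_eq0 => /andP[/eqP ? /eqP ?]; rewrite (surjective_pairing m); congr pair.
Qed.

(** For nonzero [m], the modulus of [L m] is at least a constant times the larger coordinate [M],
    while [1 + |m.1|] and [1 + |m.2|] are at most [2 * M], so that the inverse of the product of the
    two [powm32] is at most [8 * M ^+ 3]. *)
Lemma lattice_admissible : admissible L.
Proof.
split; last first.
  move=> r; have [N HN] : exists N : nat, r * W / `|D| < N%:R.
    exists (Num.bound `|r * W / `|D| |); apply: le_lt_trans (ler_norm _) _.
    exact: archi_boundP.
  exists (box N) => m; rewrite mem_box negb_and -!ltnNge => H.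
  have NM : (N <= maxn `|m.1| `|m.2|)%N.
    by case/orP: H => /ltnW H; apply: leq_trans H _; rewrite ?leq_maxl ?leq_maxr.
  have H1 := lattice_pt_lower m.
  have : N%:R * `|D| <= W * nm (L m).
    by apply: le_trans H1; rewrite ler_wpM2r// ler_nat.
  move: HN; rewrite ltr_pdivrMr// => H2 H3.
  by rewrite -(ler_pM2l W0) mulrC; lra.
have bb := bsummable_prod (bsummable_powm32 R) (bsummable_powm32 R).
apply: (bsummable_dom (A := [:: 0]) (c := 8 * (W / `|D|) ^+ 3) bb) => m.
  by rewrite invr_ge0 exprn_ge0 ?nm_ge0.
rewrite inE => m0.
have := lattice_pt_lower m; set M := maxn _ _ => HM.
have M1 : (1 <= M)%N.
  rewrite lt0n /M; apply: contra m0; rewrite -leqn0 geq_max !leqn0 !absz_eq0.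
  by case: (m) => a b /= /andP[/eqP -> /eqP ->].
have M1R : 1 <= M%:R :> R by rewrite ler1n.
have M0 : 0 < M%:R :> R by lra.
have p1 : `|m.1|%N%:R <= M%:R :> R by rewrite ler_nat leq_maxl.
have p2 : `|m.2|%N%:R <= M%:R :> R by rewrite ler_nat leq_maxr.
rewrite /powm32 -invfM.
set p := 1 + _; set q := 1 + _.
have pM : p <= 2 * M%:R by rewrite /p; lra.
have qM : q <= 2 * M%:R by rewrite /q; lra.
have pp : 0 < p by rewrite /p; have : 0 <= `|m.1|%N%:R :> R by []; lra.
have qq : 0 < q by rewrite /q; have : 0 <= `|m.2|%N%:R :> R by []; lra.
have E : p * Num.sqrt p * (q * Num.sqrt q) <= 8 * M%:R ^+ 3.
  have s1 : Num.sqrt p * Num.sqrt q <= 2 * M%:R.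
    rewrite -sqrtrM ?(ltW pp)//.
    have -> : 2 * M%:R = Num.sqrt ((2 * M%:R) ^+ 2) :> R.
      by rewrite sqrtr_sqr ger0_norm// mulr_ge0.
    by rewrite ler_wsqrtr// expr2 ler_pM// ltW.
  have s0 : 0 <= Num.sqrt p * Num.sqrt q by rewrite mulr_ge0 ?sqrtr_ge0.
  have -> : p * Num.sqrt p * (q * Num.sqrt q) = (p * q) * (Num.sqrt p * Num.sqrt q) by ring.
  have -> : 8 * M%:R ^+ 3 = (2 * M%:R * (2 * M%:R)) * (2 * M%:R) :> R by ring.
  have pq : p * q <= 2 * M%:R * (2 * M%:R) by rewrite ler_pM// ltW.
  by rewrite ler_pM// mulr_ge0// ltW.
have X0 : 0 < p * Num.sqrt p * (q * Num.sqrt q) by rewrite !mulr_gt0 ?sqrtr_gt0.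
have n0 : 0 < nm (L m).
  by rewrite nm_gt0 lattice_pt_eq0.
rewrite ler_pdivlMr// mulrC ler_pdivrMr ?exprn_gt0//.
apply: le_trans E _; rewrite -mulrA ler_wpM2l// -exprMn.
have HM' : M%:R <= W / `|D| * nm (L m) by rewrite mulrAC ler_pdivlMr.
by apply: lerXn2r => //; rewrite nnegrE; first exact: ltW; apply: le_trans (ltW M0) HM'.
Qed.

End LatticePoints.

(** * Weierstrass functions of a lattice *)

Section WeierstrassFunctions.
Variables (R : realType) (w1 w2 : Cx R).
Local Notation C := (Cx R).
Local Notation L := (lattice_pt w1 w2).
Local Notation zeta := (lattice_zeta w1 w2).
Local Notation wpL := (lattice_wp w1 w2).
Hypothesis wB : lattice_basis w1 w2.
Implicit Types (x z : C) (m : int * int).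

Let adm := lattice_admissible wB.

Definition offL x := forall m, L m != x.

Lemma offL_notin x : ~ in_lattice w1 w2 x -> offL x.
Proof. by move=> H m; apply/eqP => E; apply: H; exists m. Qed.

Lemma offL_opp x : offL x -> offL (- x).
Proof. by move=> H m; have := H (- m); rewrite lattice_ptN eqr_oppLR. Qed.

Lemma offL_add x (k : int * int) : offL x -> offL (x + L k).
Proof.
move=> H m; have := H (m - k); rewrite lattice_ptD lattice_ptN.
by apply: contra => /eqP ->; rewrite addrK.
Qed.

Lemma offL_neq0 x : offL x -> x != 0.
Proof. by move=> /(_ 0); rewrite lattice_pt0 eq_sym. Qed.

Lemma offL_avoids n x : offL x -> avoids L n x.
Proof. by move=> H m; left. Qed.

Lemma zero_avoids n : (0 < n)%N -> avoids L n 0.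
Proof.
by move=> n0 m; have [|] := eqVneq (L m) 0; [right|left].
Qed.

Lemma offL_ball x : offL x -> exists2 r : R, 0 < r & forall y, nm (y - x) < r -> offL y.
Proof.
move=> H; have [r r0 Hr] := avoids_ball adm (@offL_avoids 0 _ H).
by exists r => // y /Hr Hy m; have [|[_]] := Hy m.
Qed.

Lemma offL_near0 : exists2 r : R, 0 < r & forall y, nm y < r -> y != 0 -> offL y.
Proof.
have [r r0 Hr] := avoids_ball adm (zero_avoids (n := 1) isT).
exists r => // y yr y0 m; have := Hr y; rewrite subr0 => /(_ yr m)[//|[-> _]].
by rewrite eq_sym.
Qed.

Definition Gk n : C := T L n 0 0.

Lemma csum_odd0 (F : int * int -> C) S : hassum F S -> (forall m, F (- m) = - F m) -> S = 0.
Proof.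
move=> H FN; have NK : cancel (-%R : int * int -> int * int) -%R by exact: opprK.
have H1 := hassum_reindex NK NK H.
have H2 : hassum F (- S) by apply: eq_hassum (hassumN H1) => m; rewrite FN opprK.
have /eqP := hassum_unique H H2; rewrite -addr_eq0 -mulr2n mulrn_eq0 /=.
by move/eqP.
Qed.

Lemma Gk_odd n : odd n -> (3 <= n)%N -> Gk n = 0.
Proof.
move=> on n3; apply: (@csum_odd0 (Tterm L n 0 0)); first by apply: T_hassum; rewrite ?addn0.
move=> m; rewrite /Tterm !expr0 !invr1 !mulr1 lattice_ptN.
by rewrite -[- L m]mulN1r exprMn -signr_odd on expr1 invfM invrN1 mulN1r.
Qed.

Lemma offL_finite x : exists A : seq (int * int), forall m, m \notin A -> L m != 0 /\ L m != x.
Proof.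
have [_ /(_ (nm x + 1)) [A HA]] := adm.
exists A => m /HA Hm; have n0 := nm_ge0 x; split; first by rewrite -nm_gt0; lra.
by apply: contraTneq Hm => ->; rewrite -ltNge; lra.
Qed.

(** The compensated Weierstrass term is a multiple of a [Tterm] of total degree 3, for which
    convergence is known. The finitely many excluded [m] do not affect summability. *)
Lemma zeta_term x m : L m != 0 -> L m != x ->
  (x - L m)^-1 + (L m)^-1 + x / L m ^+ 2 = - x ^+ 2 * Tterm L 2 1 x m.
Proof.
move=> l0 lx; have d0 : L m - x != 0 by rewrite subr_eq0.
by rewrite /Tterm; field; rewrite l0 d0 -opprB oppr_eq0 d0.
Qed.

Lemma wp_term x m : L m != 0 -> L m != x ->
  (x - L m) ^- 2 - (L m) ^- 2 = 2 * x * Tterm L 2 1 x m + x ^+ 2 * Tterm L 2 2 x m.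
Proof.
move=> l0 lx; have d0 : L m - x != 0 by rewrite subr_eq0.
by rewrite /Tterm; field; rewrite l0 d0 -opprB oppr_eq0 d0.
Qed.

(** As the inverse of 0 is 0, the term at [m = 0] is [x^-1]: the polar term of [zeta] is absorbed
    into one sum over the full lattice, even when [x] is a lattice point. *)
Lemma zeta_hassum x : hassum (fun m => (x - L m)^-1 + (L m)^-1 + x / L m ^+ 2) (zeta x).
Proof.
have [A HA] := offL_finite x.
have [S HS] := hassum_finite_change (hassumZ (- x ^+ 2) (T_hassum x adm (isT : 3 <= 2 + 1)%N))
  (fun m mA => zeta_term (HA m mA).1 (HA m mA).2).
rewrite /lattice_zeta (lattice_sumE (F := fun w => (x - w)^-1 + w^-1 + x / w ^+ 2) HS).
by rewrite subr0 expr0n /= !invr0 mulr0 !addr0 addrC subrK.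
Qed.

Lemma wp_hassum x : hassum (fun m => (x - L m) ^- 2 - (L m) ^- 2) (wpL x).
Proof.
have [A HA] := offL_finite x.
have [S HS] := hassum_finite_change (hassumD (hassumZ (2 * x) (T_hassum x adm (isT : 3 <= 2 + 1)%N))
  (hassumZ (x ^+ 2) (T_hassum x adm (isT : 3 <= 2 + 2)%N)))
  (fun m mA => wp_term (HA m mA).1 (HA m mA).2).
rewrite /lattice_wp (lattice_sumE (F := fun w => (x - w) ^- 2 - w ^- 2) HS).
by rewrite subr0 expr0n /= invr0 subr0 addrC subrK.
Qed.

Lemma zetaE x : offL x -> zeta x = x^-1 - x ^+ 2 * T L 2 1 x.
Proof.
move=> Hx; apply: hassum_unique (zeta_hassum x) _; rewrite -mulNr.
apply: eq_hassum (hassumD (hassum_delta (0 : int * int) x^-1)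
  (hassumZ (- x ^+ 2) (T_hassum x adm (isT : 3 <= 2 + 1)%N))) => m.
case: eqVneq => [->|m0].
  by rewrite /Tterm lattice_pt0 !expr0n /= !invr0 !subr0 mul0r !mulr0 !addr0.
by rewrite add0r zeta_term// lattice_pt_eq0.
Qed.

Lemma wpE x : offL x -> wpL x = x ^- 2 + 2 * x * T L 2 1 x + x ^+ 2 * T L 2 2 x.
Proof.
move=> Hx; apply: hassum_unique (wp_hassum x) _; rewrite -addrA.
apply: eq_hassum (hassumD (hassum_delta (0 : int * int) (x ^- 2))
  (hassumD (hassumZ (2 * x) (T_hassum x adm (isT : 3 <= 2 + 1)%N))
  (hassumZ (x ^+ 2) (T_hassum x adm (isT : 3 <= 2 + 2)%N)))) => m.
case: eqVneq => [->|m0].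
  by rewrite /Tterm lattice_pt0 !expr0n /= !invr0 !subr0 !mul0r !mulr0 !addr0.
by rewrite add0r wp_term// lattice_pt_eq0.
Qed.

Lemma lattice_g2E : lattice_g2 w1 w2 = 60 * Gk 4.
Proof.
rewrite /lattice_g2 (lattice_sumE (F := fun w => w ^- 4) (S := Gk 4)).
  by rewrite expr0n /= invr0 subr0.
apply: eq_hassum (T_hassum 0 adm (isT : 3 <= 4 + 0)%N) => m.
by rewrite /Tterm expr0 invr1 mulr1.
Qed.

Let subK (k : int * int) : cancel (fun m : int * int => m + k) (fun m => m - k).
Proof. exact: addrK. Qed.
Let subK' (k : int * int) : cancel (fun m : int * int => m - k) (fun m => m + k).
Proof. exact: subrK. Qed.
Let negK : cancel (-%R : int * int -> int * int) -%R.
Proof. exact: opprK. Qed.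

Lemma wp_even x : wpL (- x) = wpL x.
Proof.
apply: hassum_unique (wp_hassum _) _.
apply: eq_hassum (hassum_reindex negK negK (wp_hassum x)) => m.
by rewrite lattice_ptN (_ : x - - L m = - (- x - L m)) ?sqrrN//; ring.
Qed.

(* The increment of [wpL] along a period does not depend on [x], junk values
   included, so it can be computed at minus half the period. *)
Lemma wp_periodic (k : int * int) x : wpL (x + L k) = wpL x.
Proof.
pose b (m : int * int) : C := L m ^- 2 - L (m + k) ^- 2.
have H y : hassum b (wpL (y + L k) - wpL y).
  apply: eq_hassum (hassumB (hassum_reindex (subK k) (subK' k) (wp_hassum (y + L k))) (wp_hassum y)) => m.
  by rewrite /b lattice_ptD opprD addrACA subrr addr0; ring.
have := hassum_unique (H x) (H (- (L k / 2))).
rewrite (_ : - (L k / 2) + L k = L k / 2); last by field.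
rewrite wp_even subrr => /eqP.
by rewrite subr_eq0 => /eqP.
Qed.

(** Termwise, the increment along [L k] changes with [x] only through [x * b m], and [b] sums to 0
    because [wpL] is periodic. The increment can therefore be read off at 0, whatever junk value
    [zeta 0] has. *)
Lemma zeta_quasi_periodic (k : int * int) : exists eta : C, forall x, zeta (x + L k) = zeta x + eta.
Proof.
pose b (m : int * int) : C := L m ^- 2 - L (m + k) ^- 2.
have Hb : hassum b 0.
  have := hassumB (hassum_reindex (subK k) (subK' k) (wp_hassum (0 + L k))) (wp_hassum 0).
  rewrite wp_periodic subrr; apply: eq_hassum => m.
  by rewrite /b lattice_ptD opprD addrACA subrr addr0; ring.
exists (zeta (0 + L k) - zeta 0) => x; apply/eqP; rewrite (addrC (zeta x)) -subr_eq; apply/eqP.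
apply: hassum_unique (hassumB (hassum_reindex (subK k) (subK' k) (zeta_hassum (x + L k))) (zeta_hassum x)) _.
have := hassumB (hassum_reindex (subK k) (subK' k) (zeta_hassum (0 + L k))) (zeta_hassum 0).
move=> /hassumB/(_ (hassumZ x Hb)); rewrite mulr0 subr0; apply: eq_hassum => m.
have E y : y + L k - L (m + k) = y - L m by rewrite lattice_ptD; ring.
by rewrite !E /b; ring.
Qed.

(** A sum over the full lattice without compensation, so that it can be differentiated term by term.
    Its terms are [(L m - x) ^- 3], which accounts for the positive sign. *)
Definition dwp x : C := 2 * T L 0 3 x.

Lemma T_offL_cder n k x : (3 <= n + k)%N -> offL x ->
  cder (T L n k) x (k%:R * T L n k.+1 x).
Proof. by move=> nk Hx; apply: T_cder => //; exact: offL_avoids. Qed.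

Lemma wp_cder x : offL x -> cder wpL x (dwp x).
Proof.
move=> Hx; have [r r0 Hr] := offL_ball Hx; have x0 := offL_neq0 Hx.
have xi : cder (fun y : C => y) x 1 by exact: cder_id.
apply: (@cder_ext _ (fun y => (y ^+ 2)^-1 + 2 * y * T L 2 1 y + y ^+ 2 * T L 2 2 y) _ _ _ r r0).
  by move=> y /Hr Hy; rewrite wpE.
have H1 := @cderV _ (fun y => y ^+ 2) x _ (expf_neq0 2 x0) (cderX 2 xi).
have H2 := cderM (cderZ 2 xi) (T_offL_cder (isT : 3 <= 2 + 1)%N Hx).
have H3 := cderM (cderX 2 xi) (T_offL_cder (isT : 3 <= 2 + 2)%N Hx).
apply: cder_eqv (cderD (cderD H1 H2) H3) _.
have K : T L 0 3 x = - x ^- 3 + T L 2 1 x + 2 * x * T L 2 2 x + x ^+ 2 * T L 2 3 x.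
  apply: csumE; rewrite -!addrA.
  apply: eq_hassum (hassumD (hassum_delta (0 : int * int) (- x ^- 3))
   (hassumD (T_hassum x adm (isT : 3 <= 2 + 1)%N)
   (hassumD (hassumZ (2 * x) (T_hassum x adm (isT : 3 <= 2 + 2)%N))
     (hassumZ (x ^+ 2) (T_hassum x adm (isT : 3 <= 2 + 3)%N))))) => m.
  rewrite /Tterm; case: eqVneq => [->|m0].
    rewrite lattice_pt0 !expr0n /= !invr0 !mul0r !mulr0 !addr0 sub0r invr1 mul1r.
    by rewrite exprNn -signr_odd /= expr1 mulN1r invrN.
  have l0 : L m != 0 by rewrite lattice_pt_eq0.
  have d0 : L m - x != 0 by rewrite subr_eq0 Hx.
  by field; rewrite l0 d0.
by rewrite /dwp K; field.
Qed.

Lemma zeta_cder x : offL x -> cder zeta x (- wpL x).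
Proof.
move=> Hx; have [r r0 Hr] := offL_ball Hx; have x0 := offL_neq0 Hx.
have xi : cder (fun y : C => y) x 1 by exact: cder_id.
apply: (@cder_ext _ (fun y => y^-1 - y ^+ 2 * T L 2 1 y) _ _ _ r r0).
  by move=> y /Hr Hy; rewrite zetaE.
have H1 := cderV x0 xi.
have H2 := cderM (cderX 2 xi) (T_offL_cder (isT : 3 <= 2 + 1)%N Hx).
by apply: cder_eqv (cderB H1 H2) _; rewrite wpE//; field.
Qed.

Lemma dwp_cder x : offL x -> cder dwp x (6 * T L 0 4 x).
Proof.
move=> Hx; apply: cder_eqv (cderZ 2 (T_offL_cder (isT : 3 <= 0 + 3)%N Hx)) _; ring.
Qed.

Lemma dwp_periodic (k : int * int) x : offL x -> dwp (x + L k) = dwp x.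
Proof.
move=> Hx; apply: (@cder_unique _ wpL x) (wp_cder Hx).
apply: eq_cder (cder_shift (wp_cder (offL_add k Hx))) => y; exact: wp_periodic.
Qed.

Lemma dwp_odd x : offL x -> dwp (- x) = - dwp x.
Proof.
move=> Hx; have Hx' : offL (0 - x) by rewrite sub0r; exact: offL_opp.
rewrite -[LHS]opprK; congr (- _); apply: (@cder_unique _ wpL x) (wp_cder Hx).
rewrite -[- x]sub0r; apply: eq_cder (cder_opp (wp_cder Hx')) => y.
by rewrite sub0r wp_even.
Qed.

Lemma derive1_wpL x : offL x -> derive1 wpL x = dwp x.
Proof. by move=> /wp_cder/cder_derive1. Qed.

End WeierstrassFunctions.

(* Directed by the syntax: [apply: smooth2D] would unfold the functions at the leaves. *)
Ltac smooth2_tac := lazymatch goal with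
  | |- smooth2 ?U (fun=> ?c) => exact: smooth2_cst
  | |- smooth2 ?U (fun x => x) => exact: smooth2_id
  | |- smooth2 ?U (fun x => @GRing.add _ (@?f x) (@?g x)) =>
      apply: (@smooth2D _ U f g); smooth2_tac
  | |- smooth2 ?U (fun x => @GRing.opp _ (@?f x)) => apply: (@smooth2N _ U f); smooth2_tac
  | |- smooth2 ?U (fun x => @GRing.mul _ (@?f x) (@?g x)) =>
      apply: (@smooth2M _ U f g); smooth2_tac
  | |- smooth2 ?U (fun x => @GRing.exp _ (@?f x) ?n) => apply: (@smooth2X _ U f n); smooth2_tac
  | _ => idtac
  end.

(** * Elliptic functions that vanish, and the differential equations of wp *)

Section EllipticIdentities.
Variables (R : realType) (w1 w2 : Cx R).
Local Notation C := (Cx R).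
Local Notation L := (lattice_pt w1 w2).
Local Notation zeta := (lattice_zeta w1 w2).
Local Notation wpL := (lattice_wp w1 w2).
Local Notation dwpL := (dwp w1 w2).
Local Notation offL := (offL w1 w2).
Local Notation Gk := (Gk w1 w2).
Hypothesis wB : lattice_basis w1 w2.
Implicit Types (x y : C) (m : int * int).

Let adm := lattice_admissible wB.

(** The extension has to take the value 0 at every point outside [Good]: the constant that
    Liouville's theorem produces is then known to be 0. *)
Definition removable (Good : set C) (E : C -> C) x := exists2 r : R, 0 < r &
  exists f, [/\ smooth2 (cball x r) f, forall y, cball x r y -> Good y -> E y = f y &
    forall y, cball x r y -> ~ Good y -> f y = 0].

Section Removable.
Variables (Good : set C) (E : C -> C).
Hypothesis Gper : forall (k : int * int) x, Good (x + L k) <-> Good x.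
Hypothesis Eper : forall (k : int * int) x, Good x -> E (x + L k) = E x.

Lemma removable_translate (k : int * int) x : removable Good E x -> removable Good E (x + L k).
Proof.
move=> [r r0 [f [f2 Hg Hb]]]; exists r => //; exists (fun y => f (y - L k)).
have sh y : cball (x + L k) r y -> cball x r (y - L k).
  by rewrite /cball /= opprD addrA addrAC.
split.
- exact: smooth2_sub (smooth2_shift (- L k) f2).
- move=> y /sh yr Gy; rewrite -(Hg _ yr); last by apply/(Gper k); rewrite subrK.
  by rewrite -[in RHS](Eper k) ?subrK//; apply/(Gper k); rewrite subrK.
- by move=> y /sh yr nG; apply: (Hb _ yr) => /(Gper k); rewrite subrK.
Qed.

Lemma elliptic_removable : (forall x, removable Good E x) -> (exists x, ~ Good x) ->
  forall x, Good x -> E x = 0.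
Proof.
move=> H [x0 nG0] x Gx.
pose F y := if pselect (Good y) then E y else 0.
have FE y : Good y -> F y = E y by rewrite /F; case: pselect.
have F0 y : ~ Good y -> F y = 0 by rewrite /F; case: pselect.
have Fper k y : F (y + L k) = F y.
  have [Gy|nGy] := pselect (Good y); first by rewrite !FE ?Eper//; apply/Gper.
  by rewrite !F0// => /Gper.
rewrite -FE// -(F0 x0)//; apply: (elliptic_liouville2 wB).
- by move=> y; rewrite -[RHS](Fper (1, 0)) /lattice_pt /= mul1r mul0r addr0.
- by move=> y; rewrite -[RHS](Fper (0, 1)) /lattice_pt /= mul1r mul0r add0r.
- move=> y; have [r r0 [f [f2 Hg Hb]]] := H y; exists r => //.
  apply: smooth2_ext f2 => u ur; have [Gu|nGu] := pselect (Good u).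
    by rewrite FE// Hg.
  by rewrite F0// Hb.
Qed.

End Removable.

Lemma T_smooth2_offL n k (U : set C) : (3 <= n + k)%N -> U `<=` offL -> smooth2 U (T L n k).
Proof. by move=> nk UO; apply: T_smooth2 => // x /UO; exact: offL_avoids. Qed.

Lemma wp_smooth2 : smooth2 offL wpL.
Proof.
exists dwpL, (fun x => 6 * T L 0 4 x) => y Hy.
by split; [exact: wp_cder|exact: dwp_cder].
Qed.

Lemma zeta_smooth2 : smooth2 offL zeta.
Proof.
exists (fun x => - wpL x), (fun x => - dwpL x) => y Hy.
by split; [exact: zeta_cder|apply: cderN; exact: wp_cder].
Qed.

Lemma dwp_smooth2 : smooth2 offL dwpL.
Proof. by apply: smooth2M; [exact: smooth2_cst|exact: T_smooth2_offL]. Qed.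

Lemma offL_cball x : offL x -> exists2 r : R, 0 < r & cball x r `<=` offL.
Proof. by move=> /(offL_ball wB)[r r0 H]; exists r. Qed.

Lemma pole_ball : exists2 r : R, 0 < r & forall y, cball 0 r y ->
  (forall n, (0 < n)%N -> avoids L n y) /\ (y != 0 -> offL y).
Proof.
have [r r0 Hr] := avoids_ball adm (@zero_avoids R w1 w2 1 isT).
exists r => // y /Hr Hy; split=> [n n0 m|y0 m]; first by have [|[]] := Hy m; [left|right].
by have [//|[-> _]] := Hy m; rewrite eq_sym.
Qed.

Local Notation t1 := (T L 3 1).

Lemma G3_0 x : T L 3 0 x = 0.
Proof. by rewrite T_k0; apply: (Gk_odd wB). Qed.

Lemma G5_0 x : T L 5 0 x = 0.
Proof. by rewrite T_k0; apply: (Gk_odd wB). Qed.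

Lemma zeta_near0 x : offL x -> zeta x = x^-1 - x ^+ 3 * t1 x.
Proof.
move=> Hx; rewrite zetaE// (T_recr (k := 0) adm)// ?G3_0 ?add0r; last exact: offL_avoids.
by congr (_ - _); ring.
Qed.

(** An exact Laurent expansion: the sums on the right are smooth across 0, so that in later
    identities the polar terms cancel by [field]. The sum of inverse cubes vanishes by oddness,
    hence the gain of a power of [x]. *)
Lemma wp_near0 x : offL x -> wpL x = x ^- 2 + x ^+ 2 * (3 * t1 x + x * T L 3 2 x).
Proof.
move=> Hx; have Hn n : avoids L n x by exact: offL_avoids.
rewrite wpE// (T_recr (n := 2) (k := 0) adm)// (T_recr (n := 2) (k := 1) adm)// G3_0.
ring.
Qed.

Lemma T_sub n j (x : C) : (3 <= n + j.+1)%N -> (0 < n)%N -> offL x ->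
  T L n j.+1 x = T L n.+1 j x + x * T L n.+1 j.+1 x.
Proof. by move=> nj n0 Hx; apply: T_recr => //; exact: offL_avoids. Qed.

Lemma dwp_near0 x : offL x ->
  dwpL x = - 2 * x ^- 3 + (6 * x * t1 x + 6 * x ^+ 2 * T L 3 2 x + 2 * x ^+ 3 * T L 3 3 x).
Proof.
move=> Hx; have [r r0 Hr] := offL_ball wB Hx; have x0 := offL_neq0 Hx.
have xi : cder (fun y : C => y) x 1 by exact: cder_id.
apply: (@cder_unique _ wpL x); first exact: wp_cder.
apply: (@cder_ext _ (fun y => (y ^+ 2)^-1 + y ^+ 2 * (3 * t1 y + y * T L 3 2 y)) _ _ _ r r0).
  by move=> y /Hr Hy; rewrite wp_near0.
have H1 := @cderV _ (fun y => y ^+ 2) x _ (expf_neq0 2 x0) (cderX 2 xi).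
have H2 := cderD (cderZ 3 (T_offL_cder wB (isT : 3 <= 3 + 1)%N Hx))
  (cderM xi (T_offL_cder wB (isT : 3 <= 3 + 2)%N Hx)).
by apply: cder_eqv (cderD H1 (cderM (cderX 2 xi) H2)) _; field.
Qed.

Lemma ddwp_near0 x : offL x -> 6 * T L 0 4 x =
  6 * x ^- 4 + (6 * t1 x + 18 * x * T L 3 2 x + 18 * x ^+ 2 * T L 3 3 x + 6 * x ^+ 3 * T L 3 4 x).
Proof.
move=> Hx; have [r r0 Hr] := offL_ball wB Hx; have x0 := offL_neq0 Hx.
have xi : cder (fun y : C => y) x 1 by exact: cder_id.
apply: (@cder_unique _ dwpL x); first exact: dwp_cder.
apply: (@cder_ext _ (fun y => - 2 * (y ^+ 3)^-1 +
  (6 * y * t1 y + 6 * y ^+ 2 * T L 3 2 y + 2 * y ^+ 3 * T L 3 3 y)) _ _ _ r r0).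
  by move=> y /Hr Hy; rewrite dwp_near0.
have H1 := @cderV _ (fun y => y ^+ 3) x _ (expf_neq0 3 x0) (cderX 3 xi).
have H2 := cderM (cderZ 6 xi) (T_offL_cder wB (isT : 3 <= 3 + 1)%N Hx).
have H3 := cderM (cderZ 6 (cderX 2 xi)) (T_offL_cder wB (isT : 3 <= 3 + 2)%N Hx).
have H4 := cderM (cderZ 2 (cderX 3 xi)) (T_offL_cder wB (isT : 3 <= 3 + 3)%N Hx).
by apply: cder_eqv (cderD (cderZ (-2) H1) (cderD (cderD H2 H3) H4)) _; field.
Qed.

Lemma smooth2_removable (Good : set C) E x : Good x -> Good `<=` (fun y => exists2 r : R, 0 < r & cball y r `<=` Good) ->
  smooth2 Good E -> removable Good E x.
Proof.
move=> Gx Go Es; have [r r0 Hr] := Go x Gx.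
exists r => //; exists E; split=> // [|y /Hr//].
exact: smooth2_sub Es.
Qed.

Lemma offL_per (k : int * int) x : offL (x + L k) <-> offL x.
Proof.
split; last exact: offL_add.
by move=> /(offL_add (- k)); rewrite lattice_ptN addrK.
Qed.

(** When all poles are lattice points, one expansion [Et] at 0 settles them by periodicity, and
    [Et 0 = 0] fixes the constant. *)
Lemma offL_removable (E Et : C -> C) (r : R) :
  (forall (k : int * int) x, offL x -> E (x + L k) = E x) -> smooth2 offL E ->
  0 < r -> smooth2 (cball 0 r) Et -> Et 0 = 0 ->
  (forall y, cball 0 r y -> offL y -> E y = Et y) ->
  forall x, offL x -> E x = 0.
Proof.
move=> Eper Es r0 Ets Et0 EEt; apply: elliptic_removable => //; first exact: offL_per.
  have H0 : removable offL E 0.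
    have [r' r'0 Hr'] := pole_ball.
    exists (Num.min r r'); first by rewrite lt_min r0.
    exists Et; split.
    - by apply: smooth2_sub Ets => y; rewrite /cball /= lt_min => /andP[].
    - by move=> y; rewrite /cball /= lt_min => /andP[yr _]; exact: EEt.
    - move=> y; rewrite /cball /= lt_min => /andP[_ /Hr'[_ Hy]] nG.
      by have [->|/Hy] := eqVneq y 0.
  move=> x; have [[k Hk]|nk] := pselect (exists k, L k = x).
    by rewrite -Hk -[L k]add0r; exact: removable_translate offL_per Eper _ _ H0.
  apply: smooth2_removable => //; last by move=> y; exact: offL_cball.
  by move=> m; apply/eqP => E'; apply: nk; exists m.
by exists 0 => /(_ 0); rewrite lattice_pt0 eqxx.
Qed.

Lemma ddwp_periodic (k : int * int) x : offL x -> T L 0 4 (x + L k) = T L 0 4 x.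
Proof.
move=> Hx; have H6 : 6 != 0 :> C by rewrite pnatr_eq0.
apply: (mulfI H6); apply: (@cder_unique _ dwpL x); last exact: dwp_cder.
have [r r0 Hr] := offL_ball wB Hx.
apply: (cder_ext (f := fun y => dwpL (y + L k)) r0) => [y /Hr Hy|]; first exact: dwp_periodic.
by apply: cder_shift; apply: dwp_cder => //; exact: offL_add.
Qed.

Theorem wp_ode2 x : offL x -> 6 * T L 0 4 x = 6 * wpL x ^+ 2 - 30 * Gk 4.
Proof.
have [r r0 Hr] := pole_ball.
pose W x := 6 * T L 0 4 x - 6 * wpL x ^+ 2 + 30 * Gk 4.
move=> Hx; suff : W x = 0 by rewrite /W => W0; apply/eqP; rewrite -subr_eq0 -W0; apply/eqP; ring.
(* The polar terms cancel and [6 * t1 - 36 * t1] remains; the constant [30 * Gk 4] compensates its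
   value at 0, by [t1 = Gk 4 + x * T L 4 1 x]. *)
apply: (@offL_removable W (fun x => - 30 * x * T L 4 1 x + 6 * x * T L 3 2 x +
  18 * x ^+ 2 * T L 3 3 x + 6 * x ^+ 3 * T L 3 4 x - 6 * (x ^+ 2 * (3 * t1 x + x * T L 3 2 x)) ^+ 2) r) => //.
- by move=> k y Hy; rewrite /W (wp_periodic wB) (ddwp_periodic k Hy).
- by rewrite /W; smooth2_tac; [exact: T_smooth2_offL|exact: wp_smooth2].
- by smooth2_tac; apply: T_smooth2 => // y /Hr[H _]; exact: H.
- by ring.
- move=> y _ Hy; rewrite /W ddwp_near0// wp_near0//.
  have -> : Gk 4 = t1 y - y * T L 4 1 y.
    by rewrite (T_sub (n := 3) (j := 0))// T_k0 -/(Gk 4); ring.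
  by have y0 := offL_neq0 Hy; field.
Qed.

Theorem wp_ode1 x : offL x ->
  dwpL x ^+ 2 = 4 * wpL x ^+ 3 - 60 * Gk 4 * wpL x - 140 * Gk 6.
Proof.
have [r r0 Hr] := pole_ball.
pose E x := dwpL x ^+ 2 - 4 * wpL x ^+ 3 + 60 * Gk 4 * wpL x + 140 * Gk 6.
move=> Hx; suff : E x = 0 by rewrite /E => E0; apply/eqP; rewrite -subr_eq0 -E0; apply/eqP; ring.
(* [B] and [A] below are the regular parts of [wpL] and [dwpL]. As [dwpL ^+ 2] has a pole of order
   6, they are expanded through the coefficient [Gk 6], which enters the value at 0. *)
pose b x := 6 * T L 6 1 x + x * T L 6 2 x.
pose a x := 30 * T L 6 1 x + 12 * x * T L 6 2 x + 2 * x ^+ 2 * T L 6 3 x.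
pose B x := x ^+ 2 * (3 * Gk 4 + 5 * Gk 6 * x ^+ 2 + x ^+ 3 * b x).
pose A x := 6 * Gk 4 * x + 20 * Gk 6 * x ^+ 3 + x ^+ 4 * a x.
have T6s k : smooth2 (cball 0 r) (T L 6 k).
  by apply: T_smooth2 => // y /Hr[H _]; exact: H.
apply: (@offL_removable E (fun x => - 4 * x * a x - 12 * x * b x + A x ^+ 2
  - 12 * x ^+ 2 * (3 * Gk 4 + 5 * Gk 6 * x ^+ 2 + x ^+ 3 * b x) ^+ 2 - 4 * B x ^+ 3 + 60 * Gk 4 * B x) r) => //.
- by move=> k y Hy; rewrite /E (wp_periodic wB) (dwp_periodic wB k Hy).
- by rewrite /E; smooth2_tac; [exact: dwp_smooth2|exact: wp_smooth2..].
- by cbv beta delta [a A B b]; smooth2_tac; exact: T6s.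
- by rewrite /A /B; ring.
- move=> y _ Hy; have y0 := offL_neq0 Hy.
  (* A triangular system that expresses every sum in [Gk 4], [Gk 6] and the remainders [T L 6 k]. *)
  have E41 : T L 4 1 y = y * (Gk 6 + y * T L 6 1 y).
    by rewrite (T_sub (n := 4) (j := 0))// G5_0 add0r (T_sub (n := 5) (j := 0))// T_k0.
  have E31 : t1 y = Gk 4 + y * T L 4 1 y by rewrite (T_sub (n := 3) (j := 0))// T_k0.
  have E52 : T L 5 2 y = T L 6 1 y + y * T L 6 2 y by apply: T_sub.
  have E51 : T L 5 1 y = Gk 6 + y * T L 6 1 y by rewrite (T_sub (n := 5) (j := 0))// T_k0.
  have E42 : T L 4 2 y = T L 5 1 y + y * T L 5 2 y by apply: T_sub.
  have E32 : T L 3 2 y = T L 4 1 y + y * T L 4 2 y by apply: T_sub.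
  have E53 : T L 5 3 y = T L 6 2 y + y * T L 6 3 y by apply: T_sub.
  have E43 : T L 4 3 y = T L 5 2 y + y * T L 5 3 y by apply: T_sub.
  have E33 : T L 3 3 y = T L 4 2 y + y * T L 4 3 y by apply: T_sub.
  rewrite /E wp_near0// dwp_near0// /A /B /a /b E33 E32 E31 E43 E42 E41 E53 E52 E51.
  by field.
Qed.

End EllipticIdentities.

(** * The addition formula *)

Section AdditionIdentity.
Variables (R : realType) (w1 w2 : Cx R).
Local Notation C := (Cx R).
Local Notation L := (lattice_pt w1 w2).
Local Notation zeta := (lattice_zeta w1 w2).
Local Notation wpL := (lattice_wp w1 w2).
Local Notation dwpL := (dwp w1 w2).
Local Notation offL := (offL w1 w2).
Hypothesis wB : lattice_basis w1 w2.
Variable z : Cx R.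
Hypothesis Hz : offL z.
Implicit Types (x y : C) (m : int * int).

Let adm := lattice_admissible wB.
(** These are the poles of [wpL (z - x)] as a function of [x]; the sums [T a n k] are the remainders
    of its Taylor expansion at 0. *)
Let a (m : int * int) : C := z - L m.
Let adma : admissible a. Proof. exact: admissible_shift. Qed.
Let a0 m : a m != 0. Proof. by rewrite /a subr_eq0 eq_sym; exact: Hz. Qed.

Lemma shift_avoids n x : offL (z - x) -> avoids a n x.
Proof. by move=> H m; left; rewrite /a -subr_eq0 addrAC subr_eq0 eq_sym; exact: H. Qed.

Lemma wp_taylor x : offL (z - x) ->
  wpL (z - x) = wpL z + x * (2 * T a 2 1 x + x * T a 2 2 x).
Proof.
move=> Hx; apply: hassum_unique (wp_hassum wB _) _.
have := hassumD (wp_hassum wB z) (hassumZ x (hassumD (hassumZ 2 (T_hassum x adma (isT : 3 <= 2 + 1)%N))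
  (hassumZ x (T_hassum x adma (isT : 3 <= 2 + 2)%N)))).
apply: eq_hassum => m; rewrite /Tterm /a.
have d0 : z - L m - x != 0 by rewrite addrAC subr_eq0 eq_sym; exact: Hx.
have d1 : z - L m != 0 := a0 m.
have -> : z - x - L m = z - L m - x by ring.
by move: (L m ^- 2) (z - L m) d0 d1 => u v d0 d1; field; rewrite d0 d1.
Qed.

Lemma zeta_taylor x : offL (z - x) -> zeta (z - x) = zeta z + x * wpL z + x ^+ 2 * T a 2 1 x.
Proof.
move=> Hx; apply: hassum_unique (zeta_hassum wB _) _.
have := hassumD (hassumD (zeta_hassum wB z) (hassumZ x (wp_hassum wB z)))
  (hassumZ (x ^+ 2) (T_hassum x adma (isT : 3 <= 2 + 1)%N)).
apply: eq_hassum => m; rewrite /Tterm /a.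
have d0 : z - L m - x != 0 by rewrite addrAC subr_eq0 eq_sym; exact: Hx.
have d1 : z - L m != 0 := a0 m.
have -> : z - x - L m = z - L m - x by ring.
rewrite -(exprVn (L m)) -/(_ / _).
move: (L m)^-1 => u; move: (L m) d0 d1 => l d0 d1.
by field; rewrite d0 d1.
Qed.

Lemma dwp_shift_sum : dwpL z = - 2 * T a 3 0 0.
Proof.
rewrite /dwp mulNr -mulrN; congr (2 * _).
apply: hassum_unique (T_hassum z adm (isT : 3 <= 0 + 3)%N) _.
apply: eq_hassum (hassumN (T_hassum 0 adma (isT : 3 <= 3 + 0)%N)) => m.
rewrite /Tterm /a !expr0 invr1 mulr1 mul1r -[L m - z]opprB exprNn -signr_odd /= expr1 mulN1r.
by rewrite invrN.
Qed.

(** The logarithmic derivative of [sigma x / sigma (z - x) * exp (- zeta z * x)], that is, of [f_Kr]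
    with [alpha = 0]. *)
Definition zeta_defect x := zeta x + zeta (z - x) - zeta z.

Let K x := zeta_defect x * (wpL x - wpL z) + (dwpL x + dwpL z) / 2.
Let Good : set C := [set x | offL x /\ offL (z - x)].

Let Gper (k : int * int) x : Good (x + L k) <-> Good x.
Proof.
rewrite /Good /=; have -> : z - (x + L k) = z - x + L (- k) by rewrite lattice_ptN; ring.
by rewrite !(offL_per w1 w2).
Qed.

Let Kper (k : int * int) x : Good x -> K (x + L k) = K x.
Proof.
move=> [Hx Hzx]; have [eta Heta] := zeta_quasi_periodic wB k.
rewrite /K (wp_periodic wB) (dwp_periodic wB k Hx); congr (_ * _ + _).
rewrite /zeta_defect Heta -(addrNK (L k) (z - x)) Heta.
have -> : z - (x + L k) = z - x - L k by ring.
ring.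
Qed.

Let Good_ball x : Good x -> exists2 r : R, 0 < r & cball x r `<=` Good.
Proof.
move=> [Hx Hzx]; have [r r0 Hr] := offL_cball wB Hx; have [s s0 Hs] := offL_cball wB Hzx.
exists (Num.min r s); first by rewrite lt_min r0.
move=> y; rewrite /cball /= lt_min => /andP[yr ys]; split; first exact: Hr.
apply: Hs; rewrite /cball /= (_ : z - y - (z - x) = - (y - x)) ?nmN//; ring.
Qed.

Let zeta_opp_smooth2 (U : set C) : (forall x, U x -> offL (z - x)) -> smooth2 U (fun x => zeta (z - x)).
Proof. by move=> H; apply: smooth2_sub (smooth2_opp z (zeta_smooth2 wB)) => x /H. Qed.

Let K_smooth2 : smooth2 Good K.
Proof.
rewrite /K /zeta_defect; smooth2_tac.
- by apply: smooth2_sub (zeta_smooth2 wB) => x [].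
- by apply: zeta_opp_smooth2 => x [].
- by apply: smooth2_sub (wp_smooth2 wB) => x [].
- by apply: smooth2_sub (dwp_smooth2 wB) => x [].
Qed.

Let z_ball : exists2 r : R, 0 < r & forall y, cball 0 r y -> offL (z - y).
Proof.
have [r r0 Hr] := offL_cball wB Hz; exists r => // y yr; apply: Hr.
by move: yr; rewrite /cball /= subr0 (_ : z - y - z = - y) ?nmN//; ring.
Qed.

Let tau0 : T a 2 1 0 = - dwpL z / 2.
Proof. by rewrite T_x0 dwp_shift_sum; field. Qed.

Let K_removable0 : removable Good K 0.
Proof.
have [r r0 Hr] := z_ball; have [s s0 Hs] := pole_ball wB.
(* What is left of [K] after the expansions at 0 are inserted and the polar terms cancelled; its
   value at 0 is [T a 2 1 0 + dwpL z / 2], which is 0. *)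
pose f x := x * (3 * T L 3 1 x + x * T L 3 2 x) + wpL z * x ^+ 3 * (3 * T L 3 1 x + x * T L 3 2 x)
  - wpL z ^+ 2 * x + T a 2 1 x + x ^+ 4 * T a 2 1 x * (3 * T L 3 1 x + x * T L 3 2 x)
  - wpL z * x ^+ 2 * T a 2 1 x - x * T L 3 1 x
  - x ^+ 5 * T L 3 1 x * (3 * T L 3 1 x + x * T L 3 2 x) + wpL z * x ^+ 3 * T L 3 1 x
  + (6 * x * T L 3 1 x + 6 * x ^+ 2 * T L 3 2 x + 2 * x ^+ 3 * T L 3 3 x) / 2 + dwpL z / 2.
exists (Num.min r s); first by rewrite lt_min r0.
have mins y : cball 0 (Num.min r s) y -> cball 0 r y /\ cball 0 s y.
  by rewrite /cball /= lt_min => /andP[].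
exists f; split.
- cbv beta delta [f]; smooth2_tac;
    try (by apply: T_smooth2 => // y /mins[_ /Hs[H _]]; exact: H);
    by apply: T_smooth2 => // y /mins[/Hr H _]; exact: shift_avoids.
- move=> y /mins[_ _] [Hy Hzy]; have y0 := offL_neq0 Hy.
  rewrite /K /zeta_defect zeta_taylor// (zeta_near0 wB Hy) (wp_near0 wB Hy) (dwp_near0 wB Hy) /f.
  by field.
- move=> y /mins[yr ys] nG; have [->|y0] := eqVneq y 0; last first.
    by case: nG; split; [exact: (Hs y ys).2|exact: Hr].
  by rewrite /f tau0; field.
Qed.

Let K_removable_z : removable Good K z.
Proof.
have [r r0 Hr] := z_ball; have [s s0 Hs] := pole_ball wB.
(* With [y = z - x], the zero of [wpL x - wpL z] at [y = 0] cancels the pole of [zeta y]: a factor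
   [y] has been moved from the difference of wp into the first parenthesis. *)
pose g y := (y ^+ 2 * wpL z + y ^+ 3 * T a 2 1 y + 1 - y ^+ 4 * T L 3 1 y) *
  (2 * T a 2 1 y + y * T a 2 2 y) + (dwpL (z - y) + dwpL z) / 2.
exists (Num.min r s); first by rewrite lt_min r0.
have mins y : cball z (Num.min r s) y -> cball 0 r (z - y) /\ cball 0 s (z - y).
  by rewrite /cball /= nmBC lt_min subr0 => /andP[].
exists (fun x => g (z - x)); split.
- have gs : smooth2 [set y | cball 0 r y /\ cball 0 s y] g.
    have Ta k : (0 < k)%N -> smooth2 [set y | cball 0 r y /\ cball 0 s y] (T a 2 k).
      by move=> k0; apply: T_smooth2 => // y [/Hr H _]; exact: shift_avoids.
    cbv beta delta [g]; smooth2_tac; [exact: Ta| |exact: Ta|exact: Ta|].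
      by apply: T_smooth2 => // y [_ /Hs[H _]]; exact: H.
    apply: smooth2_sub (smooth2_opp z (dwp_smooth2 wB)) => y [/Hr H _]; exact: H.
  by apply: smooth2_sub (smooth2_opp z gs) => x /mins.
- move=> x _ [Hx Hzx]; set y := z - x.
  have xE : x = z - y by rewrite /y; ring.
  have y0 : y != 0 by exact: offL_neq0 Hzx.
  have Hy : offL y by [].
  have Hzy : offL (z - y) by rewrite -xE.
  rewrite /K /zeta_defect xE (_ : z - (z - y) = y); last by ring.
  rewrite zeta_taylor// (zeta_near0 wB Hy) wp_taylor// /g.
  by field.
- move=> x /mins[yr ys] nG; have [->|y0] := eqVneq (z - x) 0; last first.
    case: nG; split; last exact: (Hs _ ys).2.
    by have -> : x = z - (z - x) by [ring]; exact: Hr.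
  by rewrite /g subr0 tau0; field.
Qed.

Theorem zeta_addition x : offL x -> offL (z - x) ->
  zeta_defect x * (wpL x - wpL z) = - (dwpL x + dwpL z) / 2.
Proof.
move=> Hx Hzx; suff : K x = 0 by rewrite /K => /eqP; rewrite addr_eq0 mulNr => /eqP.
apply: (elliptic_removable wB Gper Kper) => //; last first.
  by exists 0 => -[/(_ 0)]; rewrite lattice_pt0 eqxx.
move=> y; have [[k Hk]|n0] := pselect (exists k, L k = y).
  by rewrite -Hk -[L k]add0r; exact: removable_translate Gper Kper _ _ K_removable0.
have [[k Hk]|nz] := pselect (exists k, L k = z - y).
  have -> : y = z + L (- k) by rewrite lattice_ptN Hk; ring.
  exact: removable_translate Gper Kper _ _ K_removable_z.
apply: (smooth2_removable (Good := Good)) => //.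
by split=> m; apply/eqP => E; [apply: n0|apply: nz]; exists m.
Qed.

Lemma zeta_defect_cder x : offL x -> offL (z - x) ->
  cder zeta_defect x (- wpL x + wpL (z - x)).
Proof.
move=> Hx Hzx; rewrite -[X in - _ + X]opprK -[X in cder _ _ X]subr0.
apply: cderB (cder_cst _ _); apply: cderD; first exact: zeta_cder.
by apply: cder_opp; exact: zeta_cder.
Qed.

(** After differentiation the zeta terms carry the factor [dwpL x]. At a half period this factor is
    0, and an algebraic relation between values of wp remains. *)
Lemma zeta_addition_deriv x : offL x -> offL (z - x) ->
  (- wpL x + wpL (z - x)) * (wpL x - wpL z) + zeta_defect x * dwpL x
  + 3 * T L 0 4 x = 0.
Proof.
move=> Hx Hzx.
pose K' y := zeta_defect y * (wpL y - wpL z) + (dwpL y + dwpL z) / 2.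
have H1 : cder K' x (zeta_defect x * dwpL x + (- wpL x + wpL (z - x)) * (wpL x - wpL z)
    + 6 * T L 0 4 x / 2).
  apply: cderD.
    apply: cderM; first exact: zeta_defect_cder.
    by rewrite -[X in cder _ _ X]subr0; apply: cderB (cder_cst _ _); exact: wp_cder.
  rewrite -[X in cder _ _ X]addr0 -[X in _ + X](mulr0 (dwpL x + dwpL z)) addrC.
  apply: cderM (cder_cst _ _); rewrite -[X in cder _ _ X]addr0.
  by apply: cderD (cder_cst _ _); exact: dwp_cder.
have H2 : cder K' x 0.
  have [r r0 Hr] := Good_ball (conj Hx Hzx).
  apply: (cder_ext (f := fun=> 0) r0) (cder_cst 0 x) => y yr.
  have [Hy Hzy] : Good y by exact: Hr.
  by rewrite /K' zeta_addition//; field.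
by have := cder_unique H1 H2 => <-; field.
Qed.

End AdditionIdentity.

(** * Power series and the exponential *)

Section ProductSums.
Variables (R : realType) (I J : eqType).
Local Notation C := (Cx R).

Lemma hassum_prod (F : I -> C) (G : J -> C) (A B : C) :
  bsummable (fun i => nm (F i)) -> bsummable (fun j => nm (G j)) -> hassum F A -> hassum G B ->
  hassum (fun m : I * J => F m.1 * G m.2) (A * B).
Proof.
move=> bF bG HF HG.
have [S HS] : exists S, hassum (fun m : I * J => F m.1 * G m.2) S.
  by apply: hassum_dom1 (bsummable_prod bF bG) _ => m; rewrite nmM.
suff -> : A * B = S by [].
apply/eqP; rewrite -subr_eq0; apply/eqP/nm_eq0_eps => e e0.
have c0 : 0 < nm A + nm B + 1 by have := nm_ge0 A; have := nm_ge0 B; lra.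
pose d := Num.min 1 (e / 2 / (nm A + nm B + 1)).
have d0 : 0 < d by rewrite lt_min ltr01 !divr_gt0//; lra.
have d1 : d <= 1 by rewrite ge_min lexx.
have d2 : d * (nm A + nm B + 1) <= e / 2.
  by rewrite -ler_pdivlMr// /d ge_min lexx orbT.
have e2 : 0 < e / 2 by lra.
have [sF usF HsF] := HF d d0; have [sG usG HsG] := HG d d0; have [s us Hs] := HS _ e2.
(* The rectangle over [P] and [Q] contains [s], and on it the double sum factorises. *)
pose P := undup (sF ++ map fst s); pose Q := undup (sG ++ map snd s).
have {}HsF := HsF P (undup_uniq _) ltac:(by move=> i; rewrite mem_undup mem_cat => ->).
have {}HsG := HsG Q (undup_uniq _) ltac:(by move=> i; rewrite mem_undup mem_cat => ->).
have uPQ : uniq [seq (i, j) | i <- P, j <- Q].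
  by apply: allpairs_uniq; rewrite ?undup_uniq// => -[? ?] [? ?].
have := Hs _ uPQ; rewrite big_allpairs /=.
have -> : \sum_(i <- P) \sum_(j <- Q) F i * G j = (\sum_(i <- P) F i) * (\sum_(j <- Q) G j).
  by rewrite mulr_suml; apply: eq_bigr => i _; rewrite mulr_sumr.
move=> /(_ _) H.
have {}H : nm ((\sum_(i <- P) F i) * (\sum_(j <- Q) G j) - S) < e / 2.
  apply: H => -[i j] ij; apply/allpairsP; exists (i, j); rewrite !mem_undup !mem_cat; split=> //.
    by apply/orP; right; apply/mapP; exists (i, j).
  by apply/orP; right; apply/mapP; exists (i, j).
set p := \sum_(i <- P) F i in H HsF; set q := \sum_(j <- Q) G j in H HsG.
have -> : A * B - S = (p * q - S) - ((p - A) * q + A * (q - B)) by ring.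
apply: le_trans (nmB _ _) _.
have nq : nm q <= nm B + d.
  by rewrite -(subrK B q); apply: le_trans (nmD _ _) _; lra.
have : nm ((p - A) * q + A * (q - B)) <= d * (nm B + d) + nm A * d.
  apply: le_trans (nmD _ _) _; rewrite !nmM.
  by apply: lerD; [apply: ler_pM|apply: ler_wpM2l]; rewrite ?nm_ge0// ltW.
by have : d * d <= d by [nra]; lra.
Qed.

End ProductSums.

Section PowerSeries.
Variable R : realType.
Local Notation C := (Cx R).
Implicit Types (c d : nat -> C) (x y : C) (r : R).

Lemma ratio01 (a r : R) : 0 <= a -> a < r -> 0 <= a / r < 1.
Proof.
move=> a0 ar; have r0 : 0 < r by lra.
by rewrite ltr_pdivrMr// mul1r ar andbT divr_ge0// ltW.
Qed.

Lemma geometric_bound (q : R) (n : nat) : 0 <= q < 1 -> \sum_(0 <= i < n) q ^+ i <= (1 - q)^-1.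
Proof.
move=> /andP[q0 q1]; have p : 0 < 1 - q by lra.
rewrite -[leRHS]mul1r ler_pdivlMr//.
have -> : (\sum_(0 <= i < n) q ^+ i) * (1 - q) = 1 - q ^+ n.
  elim: n => [|n IH]; first by rewrite big_geq// mul0r expr0 subrr.
  by rewrite big_nat_recr//= mulrDl IH exprS; ring.
by have : 0 <= q ^+ n by [rewrite exprn_ge0]; lra.
Qed.

Lemma bsummable_nat (b : nat -> R) (M : R) : (forall n, 0 <= b n) ->
  (forall n, \sum_(0 <= i < n) b i <= M) -> bsummable b.
Proof.
move=> b0 H; split=> //; exists M => s us.
have [N HN] : exists N, {subset s <= index_iota 0 N}.
  elim: s {us} => [|a s [N IH]]; first by exists 0.
  exists (maxn a.+1 N) => i; rewrite in_cons => /predU1P[->|/IH].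
    by rewrite mem_index_iota /= leq_max ltnSn.
  by rewrite !mem_index_iota /= leq_max => ->; rewrite orbT.
by apply: le_trans (H N); apply: ler_sum_subset => //; exact: iota_uniq.
Qed.

Lemma bsummable_geometric (q : R) : 0 <= q < 1 -> bsummable (fun n => q ^+ n).
Proof.
move=> q01; apply: (@bsummable_nat _ (1 - q)^-1) => n; last exact: geometric_bound.
by case/andP: q01 => q0 _; rewrite exprn_ge0.
Qed.

Lemma hassum_nat_shift (G : nat -> C) S : hassum (fun n => G n.+1) S -> hassum G (G 0 + S).
Proof.
move=> H e /H[s0 us0 Hs].
exists (0%N :: map succn s0).
  rewrite /= map_inj_uniq ?us0 ?andbT//; last exact: succn_inj.
  by apply/mapP => -[].
move=> s us sub.
have s0s : 0%N \in s by apply: sub; rewrite mem_head.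
rewrite (bigD1_seq 0%N)//= opprD addrACA subrr add0r.
pose s' := map predn (seq.filter (fun i => i != 0%N) s).
have us' : uniq s'.
  rewrite map_inj_in_uniq ?filter_uniq// => i j; rewrite !mem_filter.
  by case: i => [|i]; case: j => [|j] //= _ _ ->.
have := Hs s' us'; rewrite big_map big_filter.
rewrite (eq_bigr G); last by case.
apply=> i is0; apply/mapP; exists i.+1 => //; rewrite mem_filter /=; apply: sub.
by rewrite in_cons; apply/orP; right; apply/mapP; exists i.
Qed.

Lemma hassum_series (u : nat -> C) S : hassum u S -> limn (series u) = S.
Proof.
move=> H; rewrite /series /=; apply: (hassum_limn (s := index_iota 0) H).
  by move=> n; exact: iota_uniq.
by move=> i; exists i.+1 => n; rewrite mem_index_iota.
Qed.

(** Bounded terms at radius [r] stand in for the radius of convergence: products and derivatives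
    keep the property at every smaller positive radius. *)
Definition pbound c r := exists K : R, forall n, nm (c n) * r ^+ n <= K.

Definition ps c x := csum (fun n => c n * x ^+ n).
Definition dcoef c : nat -> C := fun n => n.+1%:R * c n.+1.

Lemma pbound_le c r r' : 0 <= r' <= r -> pbound c r -> pbound c r'.
Proof.
move=> /andP[r0 rr] [K HK]; exists K => n; apply: le_trans (HK n).
by rewrite ler_wpM2l ?nm_ge0// lerXn2r ?nnegrE// (le_trans r0).
Qed.

Lemma ps_bsummable c r x : pbound c r -> nm x < r -> bsummable (fun n => nm (c n * x ^+ n)).
Proof.
move=> [K HK] xr; have n0 := nm_ge0 x; have r0 : 0 < r by lra.
have q01 := ratio01 n0 xr.
apply: (bsummable_dom (A := [::]) (c := K) (bsummable_geometric q01)) => n; first exact: nm_ge0.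
move=> _; rewrite nmM nmX expr_div_n mulrA ler_pdivlMr ?exprn_gt0// mulrAC.
by rewrite ler_wpM2r ?exprn_ge0.
Qed.

Lemma ps_hassum c r x : pbound c r -> nm x < r -> hassum (fun n => c n * x ^+ n) (ps c x).
Proof.
move=> Hc xr; have [S HS] := hassum_dom1 (ps_bsummable Hc xr) (fun n => lexx _).
exact: csumP HS.
Qed.

Lemma nat_geometric_bound (q : R) n : 0 <= q < 1 -> n%:R * q ^+ n <= (1 - q)^-1.
Proof.
move=> q01; apply: le_trans (geometric_bound n q01).
rewrite mulr_natl -[in leLHS](subn0 n) -sumr_const_nat.
apply: ler_sum_nat => i /andP[_ iN].
by case/andP: q01 => q0 q1; rewrite subn0 ler_wiXn2l ?(ltW q1) ?(ltnW iN).
Qed.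

Lemma pbound_dcoef c r r' : 0 < r' < r -> pbound c r -> pbound (dcoef c) r'.
Proof.
move=> /andP[r'0 rr'] [K HK].
have r0 : 0 < r by lra.
have q01 := ratio01 (ltW r'0) rr'.
have q1 : 0 < 1 - r' / r by case/andP: q01; lra.
have K0 : 0 <= K by apply: le_trans (HK 0%N); rewrite mulr_ge0 ?nm_ge0.
exists (K * (1 - r' / r)^-1 / r') => n; rewrite /dcoef nmM nm_nat.
have H1 := nat_geometric_bound n.+1 q01.
have H2 := HK n.+1.
have -> : n.+1%:R * nm (c n.+1) * r' ^+ n =
    (nm (c n.+1) * r ^+ n.+1) * (n.+1%:R * (r' / r) ^+ n.+1) / r'.
  rewrite expr_div_n !exprS; field.
  by rewrite !lt0r_neq0 ?exprn_gt0.
rewrite ler_wpM2r ?invr_ge0 ?(ltW r'0)//.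
apply: ler_pM => //; first by rewrite mulr_ge0 ?nm_ge0// exprn_ge0// ltW.
by case/andP: q01 => q0 _; rewrite mulr_ge0 ?exprn_ge0.
Qed.

Theorem ps_cder c r x : pbound c r -> nm x < r -> cder (ps c) x (ps (dcoef c) x).
Proof.
move=> Hc xr; have n0 := nm_ge0 x.
(* The coefficients of the derivative are bounded at radius [r2], and the disc of radius [r1]
   contains a neighbourhood of [x], so that the terms are dominated by powers of [r1 / r2]. *)
pose r1 := (nm x + r) / 2; pose r2 := (r1 + r) / 2.
have xr1 : nm x < r1 by rewrite /r1; lra.
have r12 : r1 < r2 by rewrite /r2 /r1; lra.
have r2r : r2 < r by rewrite /r2 /r1; lra.
have r10 : 0 < r1 by lra.
have r20 : 0 < r2 by lra.
have r2b : 0 < r2 < r by rewrite r20.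
have [K HK] := pbound_dcoef r2b Hc.
have q01 := ratio01 (ltW r10) r12.
have K0 : 0 <= K by apply: le_trans (HK 0%N); rewrite mulr_ge0 ?nm_ge0.
pose G (n : nat) y := n%:R * c n * y ^+ n.-1.
have bq := bsummable_geometric q01.
apply: (@cder_hassum _ _ _ [::] (K * (r2 / r1)) (r1 - nm x) (fun n y => c n * y ^+ n) G _ _ _ bq).
- lra.
- move=> n y _; apply: cder_eqv (cderZ (c n) (cderX n (cder_id y))) _.
  by rewrite /G; ring.
- move=> n _ y yx; have yr1 : nm y <= r1.
    by rewrite -(subrK x y); apply: le_trans (nmD _ _) _; lra.
  case: n => [|n].
    by rewrite /G !mul0r nm0 expr0 mulr1 mulr_ge0// divr_ge0// ltW.
  have -> : K * (r2 / r1) * (r1 / r2) ^+ n.+1 = K / r2 ^+ n * r1 ^+ n.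
    rewrite expr_div_n !exprS; field.
    by rewrite expf_neq0 ?lt0r_neq0.
  rewrite /G /= nmM nmX; apply: ler_pM; rewrite ?nm_ge0 ?exprn_ge0 ?nm_ge0//.
    by rewrite ler_pdivlMr ?exprn_gt0// HK.
  by apply: lerXn2r => //; rewrite nnegrE ?nm_ge0// ltW.
- move=> y yx; apply: (ps_hassum Hc); rewrite -(subrK x y).
  by apply: le_lt_trans (nmD _ _) _; lra.
- have Hd : pbound (dcoef c) r2 by exists K.
  have := ps_hassum Hd (lt_trans xr1 r12) => /(hassum_nat_shift (G := fun n => G n x)).
  by rewrite {2}/G !mul0r add0r.
Qed.

Lemma ps0 c : ps c 0 = c 0%N.
Proof.
apply: csumE; apply: eq_hassum (hassum_delta 0%N (c 0%N)) => n.
by case: eqVneq => [->|n0]; rewrite ?expr0 ?mulr1// expr0n (negbTE n0) mulr0.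
Qed.

Definition cauchy c d : nat -> C := fun n => \sum_(i < n.+1) c i * d (n - i)%N.

Lemma pbound_cauchy c d r r' : 0 < r' < r -> pbound c r -> pbound d r -> pbound (cauchy c d) r'.
Proof.
move=> /andP[r'0 rr'] [K HK] [M HM].
have r0 : 0 < r by lra.
have q01 := ratio01 (ltW r'0) rr'.
have q1 : 0 < 1 - r' / r by case/andP: q01; lra.
have q0 : 0 < r' / r by rewrite divr_gt0.
have K0 : 0 <= K by apply: le_trans (HK 0%N); rewrite mulr_ge0 ?nm_ge0.
have M0 : 0 <= M by apply: le_trans (HM 0%N); rewrite mulr_ge0 ?nm_ge0.
exists (K * M * (1 - r' / r)^-1 / (r' / r)) => n.
have H1 : nm (cauchy c d n) * r ^+ n <= n.+1%:R * (K * M).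
  have : nm (cauchy c d n) <= \sum_(i < n.+1) nm (c i * d (n - i)%N).
    by rewrite /cauchy; exact: nm_sum.
  rewrite -(ler_pM2r (exprn_gt0 n r0)); move/le_trans; apply.
  rewrite mulr_suml; have -> : n.+1%:R * (K * M) = \sum_(i < n.+1) K * M by rewrite sumr_const card_ord mulr_natl.
  apply: ler_sum => i _.
  have -> : nm (c i * d (n - i)%N) * r ^+ n = (nm (c i) * r ^+ i) * (nm (d (n - i)%N) * r ^+ (n - i)).
    have -> : r ^+ n = r ^+ i * r ^+ (n - i) by rewrite -exprD subnKC// -ltnS.
    by rewrite nmM; ring.
  by apply: ler_pM; rewrite ?HK ?HM// mulr_ge0 ?nm_ge0// exprn_ge0// ltW.
have H2 := nat_geometric_bound n.+1 q01.
have -> : nm (cauchy c d n) * r' ^+ n = (nm (cauchy c d n) * r ^+ n) * (r' / r) ^+ n.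
  by rewrite expr_div_n; field; rewrite expf_neq0 ?lt0r_neq0.
rewrite (ler_pdivlMr _ _ q0) -[leLHS]mulrA -(exprSr (r' / r)).
apply: (@le_trans _ _ (n.+1%:R * (K * M) * (r' / r) ^+ n.+1)).
  by rewrite ler_wpM2r// exprn_ge0 ?ltW.
rewrite (_ : n.+1%:R * (K * M) * (r' / r) ^+ n.+1 = K * M * (n.+1%:R * (r' / r) ^+ n.+1)); last by ring.
by apply: ler_wpM2l => //; rewrite mulr_ge0.
Qed.

Lemma ps_mul c d r x : pbound c r -> pbound d r -> nm x < r ->
  ps (cauchy c d) x = ps c x * ps d x.
Proof.
move=> Hc Hd xr; have n0 := nm_ge0 x.
pose r1 := (nm x + r) / 2.
have xr1 : nm x < r1 by rewrite /r1; lra.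
have Hcd : pbound (cauchy c d) r1.
  by apply: pbound_cauchy Hc Hd; apply/andP; split; rewrite /r1; lra.
have HS := ps_hassum Hcd xr1.
have HP := hassum_prod (ps_bsummable Hc xr) (ps_bsummable Hd xr) (ps_hassum Hc xr) (ps_hassum Hd xr).
(* Listing the index pairs by antidiagonals makes the partial sums of the product family those of
   the Cauchy product. *)
pose tri N := [seq (i, (n - i)%N) | n <- iota 0 N, i <- iota 0 n.+1].
rewrite -(hassum_limn (s := tri) HP).
- pose tr N := \sum_(i <- tri N) c i.1 * x ^+ i.1 * (d i.2 * x ^+ i.2).
  suff E : series (fun n => cauchy c d n * x ^+ n) = tr by rewrite -(hassum_series HS) E.
  apply/funext => N; rewrite /tr /tri big_allpairs_dep /series /= /index_iota subn0; apply: eq_bigr => n _.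
  rewrite -[0%N :: iota 1 n]/(index_iota 0 n.+1) big_mkord /cauchy mulr_suml; apply: eq_bigr => i _ /=.
  have -> : x ^+ n = x ^+ i * x ^+ (n - i) by rewrite -exprD subnKC// -ltnS.
  ring.
- move=> N; apply: allpairs_uniq_dep; [exact: iota_uniq|by move=> n _; exact: iota_uniq|].
  move=> _ _ /allpairsPdep[n [i [_ Hi ->]]] /allpairsPdep[n' [i' [_ Hi' ->]]] /= [].
  move: Hi Hi'; rewrite !(mem_iota 0) /= !add0n !ltnS => ni ni' E.
  by rewrite -E => E'; have -> : n = n' by lia.
- move=> [i j]; exists (i + j).+1 => N HN; apply/allpairsPdep; exists (i + j)%N, i.
  by rewrite !(mem_iota 0) /= !add0n; split=> //; [lia|rewrite addKn].
Qed.

End PowerSeries.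

Section Exponential.
Variable R : realType.
Local Notation C := (Cx R).
Implicit Types (x y : C).

Lemma eq_ps (c d : nat -> C) x : c =1 d -> ps c x = ps d x.
Proof. by move=> /funext ->. Qed.

Definition ecoef (n : nat) : C := (n`!%:R)^-1.

Lemma pbound_ecoef (r : R) : 0 <= r -> pbound ecoef r.
Proof.
move=> r0; have [N HN] : exists N : nat, r < N%:R.
  by exists (Num.bound r); exact: archi_boundP.
exists (\sum_(0 <= i < N.+1) r ^+ i / i`!%:R) => n.
rewrite /ecoef nmV nm_nat mulrC.
have pos i : 0 <= r ^+ i / i`!%:R :> R by rewrite divr_ge0 ?exprn_ge0.
elim: n => [|n IH].
  rewrite big_nat_recl// lerDl; exact: sumr_ge0.
have [nN|Nn] := ltnP n N.
  rewrite (bigD1_seq n.+1) ?iota_uniq ?mem_index_iota//= lerDl.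
  by apply: sumr_ge0.
apply: le_trans IH; rewrite factS natrM invfM exprS.
have -> : r * r ^+ n * (n.+1%:R^-1 * (n`!%:R)^-1) = (r / n.+1%:R) * (r ^+ n / n`!%:R) by ring.
rewrite -[leRHS]mul1r ler_wpM2r// ler_pdivrMr ?ltr0n// mul1r.
by apply: le_trans (ltW HN) _; rewrite ler_nat ltnW.
Qed.

Let big_radius x : nm x < nm x + 1. Proof. lra. Qed.
Let pbe x : pbound ecoef (nm x + 1).
Proof. by apply: pbound_ecoef; have := nm_ge0 x; lra. Qed.

Lemma cexpE x : cexp x = ps ecoef x.
Proof.
rewrite /cexp; apply: hassum_series.
by apply: eq_hassum (ps_hassum (pbe x) (big_radius x)) => n; rewrite /ecoef mulrC.
Qed.

Lemma cexp_cder x : cder (@cexp R) x (cexp x).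
Proof.
apply: (@eq_cder _ (ps ecoef)) => [y|]; first by rewrite cexpE.
apply: cder_eqv (ps_cder (pbe x) (big_radius x)) _; rewrite cexpE.
by apply: eq_ps => n; rewrite /dcoef /ecoef factS natrM invfM mulrA mulfV ?mul1r ?pnatr_eq0.
Qed.

Lemma cexp0 : cexp (0 : C) = 1.
Proof. by rewrite cexpE ps0 /ecoef fact0 invr1. Qed.

Lemma global_cder0 (f : C -> C) x y : (forall z, cder f z 0) -> f x = f y.
Proof.
move=> H; apply: (@cder0_cst _ f (nm (y - x) + 1) x); first by move=> z _.
  by rewrite subrr nm0; have := nm_ge0 (y - x); lra.
lra.
Qed.

(** [cexp (z + w) * cexp (- z)] has derivative 0 in [z], hence equals its value at [z = 0]; the
    functional equation combines the cases [w = y] and [w = 0]. *)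
Lemma cexpD x y : cexp (x + y) = cexp x * cexp y.
Proof.
have cN z : cder (fun u : C => cexp (- u)) z (- cexp (- z)).
  have : cder (@cexp R) (0 - z) (cexp (0 - z)) by exact: cexp_cder.
  by move=> /cder_opp; rewrite sub0r; apply: eq_cder => u; rewrite sub0r.
have H (w z : C) : cexp (z + w) * cexp (- z) = cexp w.
  have D u : cder (fun u => cexp (u + w) * cexp (- u)) u 0.
    apply: cder_eqv (cderM (cder_shift (cexp_cder (u + w))) (cN u)) _.
    move: (cexp (u + w)) (cexp (- u)) => A B; ring.
  rewrite (global_cder0 z 0 D) add0r oppr0 cexp0; exact: mulr1.
have E : cexp (- x) * cexp x = 1.
  by have := H 0 (- x); rewrite addr0 opprK cexp0.
have := H y x; move: (cexp (x + y)) (cexp x) (cexp (- x)) (cexp y) E => c a b d E E'.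
by rewrite -[c]mulr1 -E mulrA E' mulrC.
Qed.

Lemma cexp_neq0 x : cexp x != 0.
Proof.
apply/eqP => E; have := cexpD x (- x); rewrite subrr cexp0 E mul0r => /eqP.
by rewrite oner_eq0.
Qed.

Lemma cexp_sum (J : Type) (s : seq J) (F : J -> C) :
  cexp (\sum_(i <- s) F i) = \prod_(i <- s) cexp (F i).
Proof.
elim: s => [|i s IH]; first by rewrite !big_nil cexp0.
by rewrite !big_cons cexpD IH.
Qed.

(* [1 - y = exp (- y - y ^+ 2 / 2 - lrem y)] for [nm y < 1]. *)
Definition lcoef (n : nat) : C := if (n < 3)%N then 0 else n%:R^-1.
Definition lrem := ps lcoef.

Lemma pbound1 (c : nat -> C) : (forall n, nm (c n) <= 1) -> pbound c 1.
Proof. by move=> H; exists 1 => n; rewrite expr1n mulr1. Qed.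

Lemma geometric_hassum y : nm y < 1 -> hassum (fun n => y ^+ n) (1 - y)^-1.
Proof.
move=> y1; have H : hassum (fun n => y ^+ n) (ps (fun=> 1) y).
  have p1 : pbound (fun=> 1 : C) 1 by apply: pbound1 => n; rewrite nm1.
  have := ps_hassum p1 y1.
  by apply: eq_hassum => n; rewrite mul1r.
have d0 : 1 - y != 0.
  rewrite subr_eq0; apply: contraTneq y1 => <-; by rewrite nm1 ltxx.
have := hassum_unique H (hassum_nat_shift (G := fun n => y ^+ n)
  (eq_hassum (fun n => esym (exprS y n)) (hassumZ y H))).
rewrite expr0 => E; have -> : (1 - y)^-1 = ps (fun=> 1) y; last by [].
by apply: (mulfI d0); rewrite mulfV// mulrBl mul1r {1}E addrK.
Qed.

Lemma pbound_lcoef : pbound lcoef 1.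
Proof.
apply: pbound1 => n; rewrite /lcoef; case: ltnP => n3; first by rewrite nm0.
rewrite nmV nm_nat invf_le1 ?ltr0n ?ler1n; by rewrite (leq_trans _ n3).
Qed.

Lemma lrem_cder y : nm y < 1 -> cder lrem y (y ^+ 2 / (1 - y)).
Proof.
move=> y1; apply: cder_eqv (ps_cder pbound_lcoef y1) _.
apply: csumE.
have H := hassumZ (y ^+ 2) (geometric_hassum y1).
have H1 := hassum_nat_shift (G := fun n => dcoef lcoef n * y ^+ n)
  (hassum_nat_shift (G := fun n => dcoef lcoef n.+1 * y ^+ n.+1) _ ).
have c0 : dcoef lcoef 0 = 0 by rewrite /dcoef /lcoef /= mulr0.
have c1 : dcoef lcoef 1 = 0 by rewrite /dcoef /lcoef /= mulr0.
have := H1 (y ^+ 2 / (1 - y)); rewrite c0 c1 !mul0r !add0r; apply.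
apply: eq_hassum H => n; rewrite /dcoef /lcoef /= mulfV ?mul1r ?pnatr_eq0//.
by rewrite -exprD.
Qed.

Lemma lrem0 : lrem 0 = 0.
Proof. exact: ps0. Qed.

Lemma lrem_exp y : nm y < 1 -> (1 - y) * cexp (y + y ^+ 2 / 2) = cexp (- lrem y).
Proof.
move=> y1; have xi z : cder (fun y : C => y) z 1 by exact: cder_id.
pose f y := (1 - y) * cexp (y + y ^+ 2 / 2) * cexp (lrem y).
have df z : nm (z - 0) < 1 -> cder f z 0.
  rewrite subr0 => z1.
  have d0 : 1 - z != 0.
    rewrite subr_eq0; apply: contraTneq z1 => <-; by rewrite nm1 ltxx.
  have H1 : cder (fun u : C => u + u ^+ 2 / 2) z (1 + z).
    apply: cder_eqv (cderD (xi z) (cderM (cderX 2 (xi z)) (cder_cst 2^-1 z))) _.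
    by rewrite /=; field.
  have H2 := cderM (cderB (cder_cst 1 z) (xi z)) (cder_comp H1 (cexp_cder _)).
  have H3 := cder_comp (lrem_cder z1) (cexp_cder _).
  apply: cder_eqv (cderM H2 H3) _; move: (cexp (z + _)) (cexp (lrem z)) => A B.
  by field.
have := @cder0_cst _ f 1 0 y 0 df; rewrite !subr0 nm0 => /(_ y1 (@ltr01 R)).
rewrite /f lrem0 subr0 expr0n /= mul0r addr0 cexp0 !mulr1 => E.
have := cexpD (lrem y) (- lrem y); rewrite subrr cexp0 => E2.
move: E E2; move: (cexp (y + _)) (cexp (lrem y)) (cexp (- lrem y)) => A B D E E2.
transitivity ((1 - y) * A * (B * D)); first by rewrite -E2 mulr1.
by rewrite mulrA E mul1r.
Qed.

(** Cubic decay matches the summability of inverse cubes over a lattice; it is what makes the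
    product for [sigma] converge. *)
Lemma lrem_bound y : nm y <= 1 / 2 -> nm (lrem y) <= 2 * nm y ^+ 3.
Proof.
move=> y2; have n0 := nm_ge0 y.
have H (t : R) : 0 <= t <= 1 -> nm (0 + rc t * y) <= nm y.
  move=> /andP[t0 t1]; rewrite add0r nmM nm_rc ger0_norm//.
  by rewrite -[leRHS]mul1r ler_wpM2r.
have := @mean_value_bound _ lrem (fun u => u ^+ 2 / (1 - u)) (2 * nm y ^+ 2) 0 y.
rewrite add0r lrem0 subr0 => /(_ _ _)/le_trans; apply.
- by move=> t /H Ht; apply: lrem_cder; lra.
- move=> t /H; set u := 0 + _ => Hu; rewrite nmM nmV nmX.
  have d : 1 / 2 <= nm (1 - u) by have := nm_subB 1 u; rewrite nm1; lra.
  rewrite ler_pdivrMr; last lra.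
  have : nm u ^+ 2 <= nm y ^+ 2 by rewrite lerXn2r ?nnegrE ?nm_ge0.
  have : 0 <= nm y ^+ 2 by rewrite exprn_ge0.
  nra.
- by rewrite -mulrA -exprSr.
Qed.

End Exponential.

(** * The sigma function *)

Section SigmaFunction.
Variables (R : realType) (w1 w2 : Cx R).
Local Notation C := (Cx R).
Local Notation L := (lattice_pt w1 w2).
Local Notation zeta := (lattice_zeta w1 w2).
Local Notation sigma := (lattice_sigma w1 w2).
Local Notation offL := (offL w1 w2).
Hypothesis wB : lattice_basis w1 w2.
Implicit Types (x y : C) (m : int * int).

Let adm := lattice_admissible wB.

Definition sfactor (w x : C) : C := (1 - x / w) * cexp (x / w + (x / w) ^+ 2 / 2).
Definition sprod x : C := lattice_prod w1 w2 (fun w => sfactor w x).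

Lemma sigma_sprod x : sigma x = x * sprod x.
Proof. by []. Qed.

Lemma cder_prod_log (J : eqType) (s : seq J) (F : J -> C -> C) (g : J -> C) x :
  (forall j, j \in s -> cder (F j) x (g j * F j x)) ->
  cder (fun y => \prod_(j <- s) F j y) x ((\sum_(j <- s) g j) * \prod_(j <- s) F j x).
Proof.
elim: s => [|j s IH] H.
  rewrite !big_nil mul0r; apply: eq_cder (cder_cst 1 x) => y; by rewrite big_nil.
rewrite !big_cons; apply: (@eq_cder _ (fun y => F j y * \prod_(i <- s) F i y)).
  by move=> y; rewrite big_cons.
have Hj := H j (mem_head _ _).
have Hs := IH (fun i si => H i (mem_behead (s := j :: s) si)).
by apply: cder_eqv (cderM Hj Hs) _; ring.
Qed.

Lemma sfactor_neq0 w x : w != 0 -> w != x -> sfactor w x != 0.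
Proof.
move=> w0 wx; rewrite /sfactor mulf_neq0 ?cexp_neq0// subr_eq0.
by apply: contra wx => /eqP E; rewrite -[w]mul1r E divfK.
Qed.

Lemma sfactor_cder w x : w != 0 -> w != x ->
  cder (sfactor w) x (- (x ^+ 2 / (w ^+ 2 * (w - x))) * sfactor w x).
Proof.
move=> w0 wx; have d0 : w - x != 0 by rewrite subr_eq0.
have xi : cder (fun y : C => y / w) x w^-1.
  by apply: cder_eqv (cderM (cder_id x) (cder_cst w^-1 x)) _; rewrite /=; ring.
have H1 : cder (fun y : C => y / w + (y / w) ^+ 2 / 2) x (w^-1 + x / w ^+ 2).
  apply: cder_eqv (cderD xi (cderM (cderX 2 xi) (cder_cst 2^-1 x))) _.
  by rewrite /=; field.
have H2 := cderM (cderB (cder_cst 1 x) xi) (cder_comp H1 (cexp_cder _)).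
apply: cder_eqv H2 _; rewrite /sfactor; move: (cexp _) => A.
by field; rewrite w0 d0.
Qed.

Lemma sfactor_exp w x : w != 0 -> nm x < nm w -> sfactor w x = cexp (- lrem (x / w)).
Proof.
move=> w0 xw; rewrite /sfactor lrem_exp// nmM nmV ltr_pdivrMr ?mul1r//.
by rewrite nm_gt0.
Qed.

Section Local.
Variable (r : R).
Hypothesis r0 : 0 < r.
Variable A : seq (int * int).
Hypothesis HA : forall m, m \notin A -> 2 * r <= nm (L m).

Let B := [seq m <- undup A | m != 0].
Let uB : uniq B. Proof. by rewrite filter_uniq ?undup_uniq. Qed.

Let notB m : m \notin B -> m != 0 -> 2 * r <= nm (L m).
Proof. by rewrite mem_filter mem_undup negb_and negbK => /orP[/eqP ->|/HA//]; rewrite eqxx. Qed.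

(** In the disc of radius [r], the finitely many factors indexed by [B] may vanish and stay a
    product; the others of nonzero index are exponentials of [- lrem], and their exponents form a
    uniformly dominated sum. *)
Let Lam_term m y : C := if (m \in B) || (m == 0) then 0 else lrem (y / L m).
Let Lam y := csum (fun m => Lam_term m y).

Let Lam_hassum y : nm y < r -> hassum (fun m => Lam_term m y) (Lam y).
Proof.
move=> yr; have [bs _] := adm; have n0 := nm_ge0 y.
have [S HS] : exists S, hassum (fun m => Lam_term m y) S.
  apply: (hassum_dom (A := [::]) (c := 2 * nm y ^+ 3) bs) => m _.
  rewrite /Lam_term; case: ifP => [_|/negbT].
    rewrite nm0 mulr_ge0 ?mulr_ge0 ?exprn_ge0// invr_ge0 exprn_ge0// nm_ge0//.
  rewrite negb_or => /andP[mB m0]; have Hm := notB mB m0.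
  have l0 : 0 < nm (L m) by lra.
  have yl : nm (y / L m) <= 1 / 2 by rewrite nmM nmV ler_pdivrMr//; lra.
  by apply: le_trans (lrem_bound yl) _; rewrite nmM nmV exprMn -mulrA exprVn.
exact: csumP HS.
Qed.

Let sprodE y : nm y < r -> sprod y = (\prod_(m <- B) sfactor (L m) y) * cexp (- Lam y).
Proof.
move=> yr; rewrite /sprod /lattice_prod.
set P := \prod_(m <- B) _.
apply: limn_nm => e e0.
have P1 : 0 < nm P + 1 by have := nm_ge0 P; lra.
have [d d0 Hd] := cder_cont (cexp_cder (- Lam y)) (divr_gt0 e0 P1).
have [s0 us0 Hs0] := Lam_hassum yr d0.
have [N HN] : exists N : nat, forall m, m \in s0 ++ B -> forall n, (N <= n)%N -> m \in box n.
  elim: (s0 ++ B) => [|m s [N IH]]; first by exists 0%N.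
  exists (maxn N (maxn `|m.1| `|m.2|)) => m'; rewrite in_cons => /predU1P[->|/IH H] n.
    by rewrite !geq_max mem_box => /andP[_ ->].
  by rewrite geq_max => /andP[/H].
exists N => n Nn.
have -> : \prod_(m <- box n | m != (0, 0)) sfactor (L m) y =
   P * cexp (- \sum_(m <- box n) Lam_term m y).
  have sB : {subset B <= box n} by move=> m mB; apply: HN Nn; rewrite mem_cat mB orbT.
  move: (box n) (box_uniq n) sB => bn ubn sB.
  rewrite -sumrN cexp_sum big_mkcond /P.
  rewrite (perm_big _ (uniq_subset_perm uB ubn sB)) big_cat /=.
  rewrite [X in _ = _ * X](perm_big _ (uniq_subset_perm uB ubn sB)) big_cat /=.
  rewrite [X in _ = _ * (X * _)]big1_seq; last first.
    by move=> m /= mB; rewrite /Lam_term mB oppr0 cexp0.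
  rewrite mul1r; congr (_ * _).
    by apply: eq_big_seq => m; rewrite mem_filter => /andP[m0 _]; rewrite m0.
  apply: eq_big_seq => m; rewrite mem_filter => /andP[mB _].
  rewrite /Lam_term (negbTE mB) /=; case: eqVneq => [_|m0]; first by rewrite oppr0 cexp0.
  have Hm := notB mB m0.
  have n0 := nm_ge0 y; have nl : 0 < nm (L m) by lra.
  by rewrite /= sfactor_exp//; [rewrite -nm_gt0|lra].
rewrite -mulrBr nmM.
have := Hd (- \sum_(m <- box n) Lam_term m y).
rewrite -opprD nmN.
have H1 := Hs0 (box n) (box_uniq n) ltac:(by move=> m ms; apply: HN Nn; rewrite mem_cat ms).
move=> /(_ H1); rewrite ltr_pdivlMr// => H2.
by apply: le_lt_trans H2; rewrite mulrC ler_wpM2l ?nm_ge0// lerDl.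
Qed.

Let Lam_cder x : nm x < r ->
  cder Lam x (x ^+ 2 * T L 2 1 x - \sum_(m <- B) x ^+ 2 * Tterm L 2 1 x m).
Proof.
move=> xr; have n0 := nm_ge0 x; have [bs _] := adm.
pose G m y : C := if (m \in B) || (m == 0) then 0 else y ^+ 2 * Tterm L 2 1 y m.
have inr y : nm (y - x) < r - nm x -> nm y < r.
  by move=> yx; rewrite -(subrK x y); apply: le_lt_trans (nmD _ _) _; lra.
apply: (@cder_hassum _ _ _ [::] (r ^+ 2 * 2) (r - nm x) Lam_term G _ _ _ bs).
- lra.
- move=> m y /inr yr; rewrite /Lam_term /G; case: ifP => [_|/negbT]; first exact: cder_cst.
  rewrite negb_or => /andP[mB m0]; have Hm := notB mB m0; have ny := nm_ge0 y.
  have l0 : L m != 0 by rewrite -nm_gt0; lra.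
  have d0 : L m - y != 0 by rewrite -nm_gt0; have := nm_subB (L m) y; lra.
  have xi : cder (fun y : C => y / L m) y (L m)^-1.
    by apply: cder_eqv (cderM (cder_id y) (cder_cst (L m)^-1 y)) _; rewrite /=; ring.
  have y1 : nm (y / L m) < 1.
    by rewrite nmM nmV ltr_pdivrMr ?nm_gt0// mul1r; lra.
  apply: cder_eqv (cder_comp xi (lrem_cder y1)) _.
  by rewrite /Tterm; field; rewrite l0 d0.
- move=> m _ y /inr yr; rewrite /G; have ny := nm_ge0 y.
  have b0 : 0 <= nm (L m) ^- 3 by rewrite invr_ge0 exprn_ge0 ?nm_ge0.
  case: ifP => [_|/negbT]; first by rewrite nm0 mulr_ge0// mulr_ge0 ?exprn_ge0 ?(ltW r0).
  rewrite negb_or => /andP[mB m0]; have Hm := notB mB m0.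
  have l0 : 0 < nm (L m) by lra.
  rewrite /Tterm nmM nmX nmM !nmV !nmX expr1.
  have d0 : nm (L m) / 2 <= nm (L m - y) by have := nm_subB (L m) y; lra.
  rewrite -mulrA; apply: ler_pM; rewrite ?exprn_ge0 ?mulr_ge0 ?invr_ge0 ?exprn_ge0 ?nm_ge0//.
    by apply: lerXn2r; rewrite ?nnegrE ?(ltW r0)// ltW.
  have -> : 2 * nm (L m) ^- 3 = (nm (L m)) ^- 2 * (nm (L m) / 2)^-1.
    by field; exact: lt0r_neq0.
  rewrite ler_wpM2l ?invr_ge0 ?exprn_ge0 ?nm_ge0// lef_pV2 ?posrE//; lra.
- by move=> y /inr; exact: Lam_hassum.
- apply: eq_hassum (hassumB (hassumZ (x ^+ 2) (T_hassum x adm (isT : 3 <= 2 + 1)%N))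
    (hassum_finite (fun m => x ^+ 2 * Tterm L 2 1 x m) uB)) => m.
  rewrite /G; case: ifP => [mB|mB] /=; first by rewrite subrr.
  rewrite subr0; case: eqVneq => // ->.
  by rewrite /Tterm lattice_pt0 expr0n /= invr0 mul0r mulr0.
Qed.

Lemma sprod_local x : nm x < r -> avoids L 1 x ->
  cder sprod x (- (x ^+ 2 * T L 2 1 x) * sprod x) /\ sprod x != 0.
Proof.
move=> xr Hx; have n0 := nm_ge0 x.
have B0 m : m \in B -> L m != 0 /\ L m != x.
  rewrite mem_filter => /andP[m0 _]; have l0 : L m != 0 by rewrite lattice_pt_eq0.
  by split=> //; have [//|[/eqP]] := Hx m; rewrite (negbTE l0).
have E := sprodE xr; split; last first.
  rewrite E mulf_neq0 ?cexp_neq0//.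
  rewrite big_seq; apply: (big_ind (fun u : C => u != 0)); first exact: oner_neq0.
    by move=> ? ? ? ?; exact: mulf_neq0.
  by move=> m /B0[? ?]; exact: sfactor_neq0.
have r' : 0 < r - nm x by lra.
apply: (@cder_ext _ (fun y => (\prod_(m <- B) sfactor (L m) y) * cexp (- Lam y)) _ _ _ _ r').
  move=> y yx; have yr : nm y < r.
    by rewrite -(subrK x y); apply: le_lt_trans (nmD _ _) _; lra.
  exact: esym (sprodE yr).
have H1 := cder_prod_log (s := B) (F := fun m => sfactor (L m))
  (g := fun m => - (x ^+ 2 / ((L m) ^+ 2 * (L m - x)))) (x := x)
  (fun m mB => sfactor_cder (B0 m mB).1 (B0 m mB).2).
have H2 := cder_comp (cderN (Lam_cder xr)) (cexp_cder _).
apply: cder_eqv (cderM H1 H2) _; rewrite E.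
have -> : \sum_(m <- B) - (x ^+ 2 / ((L m) ^+ 2 * (L m - x))) =
  - \sum_(m <- B) x ^+ 2 * Tterm L 2 1 x m.
  rewrite -sumrN; apply: eq_bigr => m _; by rewrite /Tterm expr1 invfM.
move: (\prod_(m <- B) _) (cexp _) (\sum_(m <- B) _) => u v w; ring.
Qed.

End Local.

Lemma sprod_cder x : avoids L 1 x ->
  cder sprod x (- (x ^+ 2 * T L 2 1 x) * sprod x) /\ sprod x != 0.
Proof.
move=> Hx; have [_ /(_ (2 * (nm x + 1)))[A HA]] := adm.
have n0 := nm_ge0 x; apply: (sprod_local (r := nm x + 1) _ HA) => //; lra.
Qed.

Lemma sprod0 : sprod 0 = 1.
Proof.
rewrite /sprod /lattice_prod; apply: limn_nm => e e0; exists 0%N => n _.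
rewrite big1 ?subrr ?nm0// => m _.
by rewrite /sfactor mul0r subr0 expr0n /= mul0r addr0 cexp0 mulr1.
Qed.

Lemma sprod_cder0 : cder sprod 0 0.
Proof.
by have [H _] := sprod_cder (zero_avoids w1 w2 (n := 1) isT); apply: cder_eqv H _; ring.
Qed.

Lemma sigma_cder x : offL x -> cder sigma x (zeta x * sigma x).
Proof.
move=> Hx; have [H _] := sprod_cder (offL_avoids 1 Hx).
apply: (@eq_cder _ (fun y => y * sprod y)) => [y|]; first by rewrite sigma_sprod.
apply: cder_eqv (cderM (cder_id x) H) _; rewrite zetaE// sigma_sprod.
by have x0 := offL_neq0 Hx; move: (sprod x) (T L 2 1 x) => u v; field.
Qed.

Lemma sigma_neq0 x : offL x -> sigma x != 0.
Proof.
move=> Hx; have [_ H] := sprod_cder (offL_avoids 1 Hx).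
by rewrite sigma_sprod mulf_neq0// (offL_neq0 Hx).
Qed.

End SigmaFunction.

(** * Coefficients of the formal solutions *)

Section StrongRecursion.
Variables (A : nzRingType) (step : nat -> (nat -> A) -> A).

(** The table of the first [n] values: recursion on the whole history becomes structural
    recursion. *)
Fixpoint stable (n : nat) : seq A :=
  if n is m.+1 then rcons (stable m) (step m (nth 0 (stable m))) else [::].

Definition srec (n : nat) : A := step n (nth 0 (stable n)).

Lemma size_stable n : size (stable n) = n.
Proof. by elim: n => //= n IH; rewrite size_rcons IH. Qed.

Lemma nth_stable n i : nth 0 (stable n) i = if (i < n)%N then srec i else 0.
Proof.
elim: n => [|n IH] /=; first by rewrite nth_nil.
rewrite nth_rcons size_stable; case: ltngtP => [iN|iN|->].
- by rewrite IH iN ltnS ltnW.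
- by rewrite ltnNge iN.
- by rewrite ltnSn.
Qed.

Lemma srecE n : srec n = step n (fun i => if (i < n)%N then srec i else 0).
Proof. by rewrite /srec; congr step; apply/funext => i; rewrite nth_stable. Qed.

End StrongRecursion.

(* [q] plays the role of the embedding of the rationals into [A]. *)
Section FormalSeries.
Variables (A : comNzRingType) (q : rat -> A).

Section Wp.
Variables (g2 g3 : A).

(* [wp = x ^- 2 + \sum_k wcoef k x ^ k] solves [wp'' = 6 wp ^ 2 - g2 / 2]; the recursion
   leaves the coefficient of [x ^ 4] free. *)
Definition wstep (k : nat) (c : nat -> A) : A :=
  if k == 2%N then q (20%:R^-1) * g2
  else if k == 4%N then q (28%:R^-1) * g3
  else if (4 < k)%N then
    q (6%:R / ((k - 4) * (k + 3))%N%:R) * \sum_(i < k.-1) c i * c (k.-2 - i)%N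
  else 0.

Definition wcoef : nat -> A := srec wstep.

Lemma wcoef_small k : (k < 5)%N -> k != 2%N -> k != 4%N -> wcoef k = 0.
Proof. by rewrite /wcoef srecE /wstep; case: k => [|[|[|[|[|k]]]]]. Qed.
Lemma wcoef2 : wcoef 2 = q (20%:R^-1) * g2.
Proof. by rewrite /wcoef srecE. Qed.
Lemma wcoef4 : wcoef 4 = q (28%:R^-1) * g3.
Proof. by rewrite /wcoef srecE. Qed.
Lemma wcoefE k : (4 < k)%N -> wcoef k = q (6%:R / ((k - 4) * (k + 3))%N%:R) *
  \sum_(i < k.-1) wcoef i * wcoef (k.-2 - i)%N.
Proof.
move=> k4; rewrite {1}/wcoef srecE /wstep k4.
have -> : (k == 2%N) = false by apply/eqP; lia.
have -> : (k == 4%N) = false by apply/eqP; lia.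
congr (_ * _); apply: eq_bigr => i _.
by rewrite !ifT//; have := ltn_ord i; lia.
Qed.

End Wp.

Section Kr.
Variables (al be ga la : A).

Definition krg3 : A := 4%:R * be ^+ 3 - la * be - ga ^+ 2.
Definition krw := wcoef la krg3.

(* With [p = wp], [acoef] and [bcoef] are the series of [x ^ 2 * (p - be)] and
   [x ^ 3 * (2 * al * (p - be) - p' - ga)]. *)
Definition acoef (k : nat) : A :=
  if k == 0%N then 1 else if k == 1%N then 0 else krw k.-2 - (if k == 2%N then be else 0).
Definition bcoef (k : nat) : A :=
  (if k == 0%N then 2%:R else 2%:R * al * acoef k.-1) - k.-2%:R * (if k == 0%N then 0 else if k == 1%N then 0 else krw k.-2)
  - (if k == 3%N then ga else 0).

(** Compare the coefficients of [x ^ n] in [2 (x f') (x^2 (p - be)) = f x^3 (2 al (p - be) - p' -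
    ga)]. The leading coefficients 1 and 2 leave the factor [2 n - 2] in front of the unknown of
    index [n], so the coefficient of index 1 is free and is normalised to 1. *)
Definition fstep (n : nat) (f : nat -> A) : A :=
  if n == 0%N then 0 else if n == 1%N then 1 else
  q ((2 * n.-1)%N%:R^-1) * \sum_(j < n) (bcoef (n - j)%N - (2 * j)%N%:R * acoef (n - j)%N) * f j.

Definition fcoef : nat -> A := srec fstep.

Lemma fcoef0 : fcoef 0 = 0. Proof. by rewrite /fcoef srecE. Qed.
Lemma fcoef1 : fcoef 1 = 1. Proof. by rewrite /fcoef srecE. Qed.
Lemma fcoefE n : (1 < n)%N -> fcoef n = q ((2 * n.-1)%N%:R^-1) *
  \sum_(j < n) (bcoef (n - j)%N - (2 * j)%N%:R * acoef (n - j)%N) * fcoef j.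
Proof.
move=> n1; rewrite {1}/fcoef srecE /fstep.
have -> : (n == 0%N) = false by apply/eqP; lia.
have -> : (n == 1%N) = false by apply/eqP; lia.
by congr (_ * _); apply: eq_bigr => i _; rewrite ltn_ord.
Qed.

End Kr.

End FormalSeries.

Section FormalSeriesMorphism.
Variables (A B : comNzRingType) (qA : rat -> A) (qB : rat -> B) (h : {rmorphism A -> B}).
Hypothesis hq : forall r, h (qA r) = qB r.

Lemma rmorph_wcoef g2 g3 k : h (wcoef qA g2 g3 k) = wcoef qB (h g2) (h g3) k.
Proof.
elim/ltn_ind: k => k IH; have [k4|k4] := ltnP 4 k.
  rewrite !wcoefE// rmorphM hq rmorph_sum; congr (_ * _); apply: eq_bigr => i _.
  by rewrite rmorphM !IH//; have := ltn_ord i; lia.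
have [->|k2] := eqVneq k 2%N; first by rewrite !wcoef2 rmorphM hq.
have [->|k4'] := eqVneq k 4%N; first by rewrite !wcoef4 rmorphM hq.
by rewrite !wcoef_small ?rmorph0.
Qed.

Lemma rmorph_krg3 be ga la : h (krg3 be ga la) = krg3 (h be) (h ga) (h la).
Proof. by rewrite /krg3 !rmorphB (rmorphM _ 4%:R) (rmorphM _ la) !rmorphXn rmorph_nat. Qed.

Lemma rmorph_acoef be ga la k :
  h (acoef qA be ga la k) = acoef qB (h be) (h ga) (h la) k.
Proof.
rewrite /acoef /krw; case: ifP => _; first exact: rmorph1.
case: ifP => _; first exact: rmorph0.
rewrite rmorphB rmorph_wcoef rmorph_krg3; congr (_ - _).
by case: ifP => _ //; exact: rmorph0.
Qed.

Lemma rmorph_bcoef al be ga la k :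
  h (bcoef qA al be ga la k) = bcoef qB (h al) (h be) (h ga) (h la) k.
Proof.
rewrite /bcoef /krw !rmorphB; congr (_ - _ - _).
- by case: ifP => _; rewrite ?rmorph_nat// !rmorphM rmorph_nat rmorph_acoef.
- rewrite rmorphM rmorph_nat; congr (_ * _); do 2 (case: ifP => _; first exact: rmorph0).
  by rewrite rmorph_wcoef rmorph_krg3.
- by case: ifP => _ //; exact: rmorph0.
Qed.

(** The same recursion runs over [mpoly 4 rat] and over the complex numbers. Evaluation carries one
    into the other, which makes the coefficients of [krF] values of rational polynomials. *)
Lemma rmorph_fcoef al be ga la k :
  h (fcoef qA al be ga la k) = fcoef qB (h al) (h be) (h ga) (h la) k.
Proof.
elim/ltn_ind: k => -[|[|k]] IH; rewrite ?fcoef0 ?fcoef1 ?rmorph0 ?rmorph1//.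
rewrite !fcoefE// rmorphM hq rmorph_sum; congr (_ * _); apply: eq_bigr => i _.
by rewrite rmorphM rmorphB rmorphM rmorph_nat rmorph_bcoef rmorph_acoef IH.
Qed.

End FormalSeriesMorphism.

Section SeriesAlgebra.
Variable R : realType.
Local Notation C := (Cx R).
Implicit Types (c d : nat -> C) (x S : C).

Definition pser c x S := hassum (fun n => c n * x ^+ n) S.

Lemma pserD c d x S S' : pser c x S -> pser d x S' -> pser (fun n => c n + d n) x (S + S').
Proof. by move=> H H'; apply: eq_hassum (hassumD H H') => n; rewrite mulrDl. Qed.
Lemma pserZ a c x S : pser c x S -> pser (fun n => a * c n) x (a * S).
Proof. by move=> H; apply: eq_hassum (hassumZ a H) => n; rewrite mulrA. Qed.
Lemma pserB c d x S S' : pser c x S -> pser d x S' -> pser (fun n => c n - d n) x (S - S').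
Proof. by move=> H H'; apply: eq_hassum (hassumB H H') => n; rewrite mulrBl. Qed.

Lemma pser_mono a k x : pser (fun n => if n == k then a else 0) x (a * x ^+ k).
Proof.
apply: eq_hassum (hassum_delta k (a * x ^+ k)) => n.
by case: eqVneq => [->|_]//; rewrite mul0r.
Qed.

Definition cshift c : nat -> C := fun n => if n is m.+1 then c m else 0.

Lemma pser_shift c x S : pser c x S -> pser (cshift c) x (x * S).
Proof.
move=> H; have := hassum_nat_shift (G := fun n => cshift c n * x ^+ n) (S := x * S).
rewrite /= mul0r add0r; apply; apply: eq_hassum (hassumZ x H) => n.
by rewrite exprS; ring.
Qed.

(** The operator [x d/dx], which preserves degrees and so fits the Cauchy product with [acoef]. *)
Definition theta c : nat -> C := fun n => n%:R * c n.

Lemma theta_dcoef c : theta c = cshift (dcoef c).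
Proof. by apply/funext => -[|n]; rewrite /theta /cshift ?mul0r. Qed.

Lemma pbound_cshift c (r : R) : 0 <= r -> pbound c r -> pbound (cshift c) r.
Proof.
move=> r0 [K HK]; exists (`|K| * r + `|K|) => -[|n] /=.
  rewrite nm0 mul0r addr_ge0// mulr_ge0//.
rewrite exprSr mulrA; apply: ler_wpDr => //.
rewrite ler_wpM2r//; exact: le_trans (HK n) (ler_norm K).
Qed.

Lemma pbound_theta c (r r' : R) : 0 < r' < r -> pbound c r -> pbound (theta c) r'.
Proof.
move=> rr' Hc; rewrite theta_dcoef; apply: pbound_cshift; first by case/andP: rr' => /ltW.
exact: pbound_dcoef Hc.
Qed.

Lemma pser_eq c d x S S' : c =1 d -> pser c x S -> pser d x S' -> S = S'.
Proof. by move=> /funext -> H H'; exact: hassum_unique H H'. Qed.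

End SeriesAlgebra.

(** * Germs at a pole *)

Section PunctureLemmas.
Variable R : realType.
Local Notation C := (Cx R).
Implicit Types (f F a : C -> C) (x : C).

Lemma segment_point x (t s : R) : rc t * x + rc s * ((1 - rc t) * x) = rc (t + s * (1 - t)) * x.
Proof. by rewrite rcD rcM rcB rc1; ring. Qed.

Lemma segment_in x (d t s : R) : x != 0 -> nm x < d -> 0 < t <= 1 -> 0 <= s <= 1 ->
  [/\ rc (t + s * (1 - t)) * x != 0, nm (rc (t + s * (1 - t)) * x) < d &
      nm (rc (t + s * (1 - t)) * x) <= nm x].
Proof.
move=> x0 xd /andP[t0 t1] /andP[s0 s1].
have u0 : 0 < t + s * (1 - t) by nra.
have u1 : t + s * (1 - t) <= 1 by nra.
have H : nm (rc (t + s * (1 - t)) * x) <= nm x.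
  rewrite nmM nm_rc gtr0_norm// -[leRHS]mul1r ler_wpM2r// nm_ge0//.
split=> //; last exact: le_lt_trans H xd.
by rewrite mulf_neq0// rc_eq0 lt0r_neq0.
Qed.

(** The two points lie on one ray, so the segment between them avoids the puncture. *)
Lemma puncture_mean_value f (f1 : C -> C) (M d t : R) x : x != 0 -> nm x < d -> 0 < t <= 1 ->
  (forall y, y != 0 -> nm y < d -> cder f y (f1 y)) ->
  (forall y, y != 0 -> nm y <= nm x -> nm (f1 y) <= M) ->
  nm (f x - f (rc t * x)) <= M * nm x.
Proof.
move=> x0 xd t01 Hf HM.
have M0 : 0 <= M by apply: le_trans (nm_ge0 _) (HM x x0 _).
have := @mean_value_bound _ f f1 M (rc t * x) ((1 - rc t) * x).
rewrite (_ : rc t * x + (1 - rc t) * x = x); last by ring.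
move=> /(_ _ _)/le_trans; apply.
- move=> s s01; rewrite segment_point; have [? ? _] := segment_in x0 xd t01 s01; exact: Hf.
- move=> s s01; rewrite segment_point; have [? _ ?] := segment_in x0 xd t01 s01; exact: HM.
rewrite ler_wpM2l// nmM -rc1 -rcB nm_rc; case/andP: t01 => t0 t1.
by rewrite ger0_norm ?subr_ge0// -[leRHS]mul1r ler_wpM2r ?nm_ge0//; lra.
Qed.

Lemma puncture_constant f (l : C) (d : R) :
  (forall y, y != 0 -> nm y < d -> cder f y 0) ->
  (forall e : R, 0 < e -> exists2 r : R, 0 < r & forall y, y != 0 -> nm y < r -> nm (f y - l) < e) ->
  forall x, x != 0 -> nm x < d -> f x = l.
Proof.
move=> Hf Hl x x0 xd; apply/eqP; rewrite -subr_eq0; apply/eqP/nm_eq0_eps => e e0.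
have [r r0 Hr] := Hl e e0.
have n0 : 0 < nm x by rewrite nm_gt0.
pose t := Num.min 1 (r / (2 * nm x)).
have t0 : 0 < t by rewrite lt_min ltr01 divr_gt0// mulr_gt0.
have t1 : 0 < t <= 1 by rewrite t0 ge_min lexx.
have tr : nm (rc t * x) < r.
  rewrite nmM nm_rc gtr0_norm//; have : t <= r / (2 * nm x) by rewrite ge_min lexx orbT.
  rewrite ler_pdivlMr ?mulr_gt0//; lra.
have := puncture_mean_value (f1 := fun=> 0) (M := 0) x0 xd t1 Hf.
rewrite mul0r => /(_ _) H; have {}H := H (fun y _ _ => ltac:(rewrite nm0//)).
have -> : f x - l = (f x - f (rc t * x)) + (f (rc t * x) - l) by ring.
apply: le_trans (nmD _ _) _.
have tx0 : rc t * x != 0 by rewrite mulf_neq0// rc_eq0 lt0r_neq0.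
have := Hr _ tx0 tr; lra.
Qed.

(* A solution of [F' = a * F] with [nm (x * a x) <= 1 / 2] cannot vanish to order 4 at 0:
   the bound [K * nm x ^+ 4] improves by a factor 2 when integrated along rays. *)
Lemma singular_gronwall F (F1 : C -> C) (d K : R) :
  (forall y, y != 0 -> nm y < d -> cder F y (F1 y)) ->
  (forall y, y != 0 -> nm y < d -> nm (F1 y) * nm y <= nm (F y) / 2) ->
  (forall y, y != 0 -> nm y < d -> nm (F y) <= K * nm y ^+ 4) ->
  forall x, x != 0 -> nm x < d -> F x = 0.
Proof.
move=> HF HF1 HK.
have step n y : y != 0 -> nm y < d -> nm (F y) <= K / 2 ^+ n * nm y ^+ 4.
  elim: n y => [|n IH] y y0 yd; first by rewrite expr0 divr1; exact: HK.
  have n0 : 0 < nm y by rewrite nm_gt0.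
  have Kn0 : 0 <= K / 2 ^+ n.
    have := le_trans (nm_ge0 _) (IH y y0 yd); rewrite pmulr_lge0// exprn_gt0//.
  have H (t : R) : 0 < t <= 1 -> nm (F y) <= K / 2 ^+ n * (t * nm y) ^+ 4 + K / 2 ^+ n.+1 * nm y ^+ 4.
    move=> t01; case/andP: (t01) => t0 t1.
    have ty0 : rc t * y != 0 by rewrite mulf_neq0// rc_eq0 lt0r_neq0.
    have nt : nm (rc t * y) = t * nm y by rewrite nmM nm_rc gtr0_norm.
    have := IH _ ty0; rewrite nt => /(_ ltac:(nra)) H1.
    have := puncture_mean_value (f1 := F1) (M := K / 2 ^+ n.+1 * nm y ^+ 3) y0 yd t01 HF.
    have HM u : u != 0 -> nm u <= nm y -> nm (F1 u) <= K / 2 ^+ n.+1 * nm y ^+ 3.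
      move=> u0 uy; have un : 0 < nm u by rewrite nm_gt0.
      have ud : nm u < d by lra.
      have h0 : 0 <= 2^-1 :> R by rewrite invr_ge0.
      have := le_trans (HF1 u u0 ud) (ler_wpM2r h0 (IH u u0 ud)).
      have -> : K / 2 ^+ n * nm u ^+ 4 / 2 = (K / 2 ^+ n.+1 * nm u ^+ 3) * nm u.
        by rewrite (exprS 2); field; rewrite expf_neq0.
      rewrite ler_pM2r// => /le_trans; apply.
      rewrite ler_wpM2l//; last by apply: lerXn2r => //; rewrite nnegrE ltW.
      by rewrite exprS invfM mulrA mulrAC mulr_ge0// invr_ge0.
    move=> /(_ HM) H2; rewrite -(subrK (F (rc t * y)) (F y)).
    apply: le_trans (nmD _ _) _.
    have -> : K / 2 ^+ n.+1 * nm y ^+ 4 = K / 2 ^+ n.+1 * nm y ^+ 3 * nm y by ring.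
    lra.
  apply: le_eps => e e0.
  have c0 : 0 < K / 2 ^+ n * nm y ^+ 4 + 1.
    by rewrite ltr_wpDl// mulr_ge0// exprn_ge0// ltW.
  (* The value at [t * y] contributes [t ^+ 4] times the old bound; [t] is so small that this is at
     most [e]. *)
  pose t := Num.min 1 (e / (K / 2 ^+ n * nm y ^+ 4 + 1)).
  have t0 : 0 < t by rewrite lt_min ltr01 divr_gt0.
  have t1 : t <= 1 by rewrite ge_min lexx.
  have t2 : t * (K / 2 ^+ n * nm y ^+ 4 + 1) <= e.
    by rewrite -ler_pdivlMr// ge_min lexx orbT.
  have := H t; rewrite t0 t1 => /(_ isT); rewrite exprMn mulrCA.
  have : t ^+ 4 <= t by rewrite exprS -[leRHS]mulr1 ler_wpM2l ?(ltW t0)// exprn_ile1// ltW.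
  move: t2; set X := K / 2 ^+ n * nm y ^+ 4.
  have X0 : 0 <= X by rewrite mulr_ge0// exprn_ge0// ltW.
  nra.
move=> x x0 xd; apply: nm_eq0_eps => e e0.
have n0 : 0 < nm x by rewrite nm_gt0.
have K0 : 0 <= K.
  by have := le_trans (nm_ge0 _) (HK x x0 xd); rewrite pmulr_lge0// exprn_gt0.
have [n Hn] : exists n : nat, K * nm x ^+ 4 / e < 2 ^+ n.
  have [n Hn] : exists n : nat, K * nm x ^+ 4 / e < n%:R.
    by exists (Num.bound (K * nm x ^+ 4 / e)); apply: archi_boundP; rewrite divr_ge0 ?mulr_ge0 ?exprn_ge0// ltW.
  exists n; apply: lt_trans Hn _; rewrite -natrX ltr_nat; exact: ltn_expl.
apply: le_trans (step n x x0 xd) _.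
rewrite mulrAC ler_pdivrMr ?exprn_gt0//.
by move: Hn; rewrite ltr_pdivrMr// [_ ^+ n * _]mulrC => /ltW.
Qed.

End PunctureLemmas.

(** * Uniqueness of wp as a germ with a double pole *)

Section WpGerms.
Variable R : realType.
Local Notation C := (Cx R).
Implicit Types (x : C) (p dp : C -> C).

Definition wpgerm (g2 g3 : C) p dp (d K : R) := forall x, x != 0 -> nm x < d ->
  [/\ cder p x (dp x), dp x ^+ 2 = 4 * p x ^+ 3 - g2 * p x - g3 & nm (p x - x ^- 2) <= K * nm x].

Lemma is_wp_germ (g2 g3 : C) p : is_wp g2 g3 p ->
  exists2 d : R, 0 < d & exists2 K : R, 0 <= K & wpgerm g2 g3 p (derive1 p) d K.
Proof.
case=> /dnear_nmP[d1 d10 H1] /dnear_nmP[d2 d20 H2] /eqO_exP[k k0 /dnear_nmP[d3 d30 H3]].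
have kE : k = rc (re k) by apply/esym/RRe_real; rewrite gtr0_real.
exists (Num.min (Num.min d1 d2) d3); first by rewrite !lt_min d10 d20.
exists (re k); first by rewrite -rc_le rc0 -kE ltW.
move=> x x0; rewrite !lt_min => /andP[/andP[x1 x2] x3].
have s0 : nm (x - 0) = nm x by rewrite subr0.
split.
- by apply/derivable_cder/H1; rewrite ?s0.
- by apply: H2; rewrite ?s0.
- by have := H3 x x0; rewrite s0 => /(_ x3); rewrite kE !normE -rcM rc_le.
Qed.

Lemma wpgerm_is_wp (g2 g3 : C) p dp (d K : R) : 0 < d -> 0 <= K -> wpgerm g2 g3 p dp d K -> is_wp g2 g3 p.
Proof.
move=> d0 K0 H; split.
- apply/dnear_nmP; exists d => // x x0; rewrite subr0 => xd.
  by have [/cder_derivable] := H x x0 xd.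
- apply/dnear_nmP; exists d => // x x0; rewrite subr0 => xd.
  by have [/cder_derive1 -> -> _] := H x x0 xd.
- apply/eqO_exP; exists (rc (K + 1)); first by rewrite -rc0 rc_lt; lra.
  apply/dnear_nmP; exists d => // x x0; rewrite subr0 => xd.
  have [_ _ Hx] := H x x0 xd; rewrite !normE -rcM rc_le; apply: le_trans Hx _.
  by rewrite ler_wpM2r ?nm_ge0//; lra.
Qed.

(* The sign of [x ^+ 3 * dp x = +-2] is constant along rays by Darboux's theorem,
   and it is negative because [p] grows towards 0. *)
Lemma wpgerm_asymptotic (g2 g3 : C) p dp (d K : R) : 0 < d -> 0 <= K -> wpgerm g2 g3 p dp d K ->
  forall e : R, 0 < e -> exists2 r : R, 0 < r & forall x, x != 0 -> nm x < r ->
    [/\ nm x < d, nm (x ^+ 2 * p x - 1) <= e & nm (x ^+ 3 * dp x + 2) <= e].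
Proof.
have a2 : 0 < (1 / 2 : R) < 1 by apply/andP; split; lra.
have a4 : 0 < (1 / 4 : R) < 1 by apply/andP; split; lra.
have a42 : (1 / 4 : R) < 1 / 2 by lra.
move=> d0 K0 H.
(* [14 * K], [2 * nm g2] and [nm g3] bound the three error terms of the equation multiplied by
   [x ^+ 6]; the larger [28 * K] also yields the tolerance [e / 28] for [x ^+ 2 * p x]. *)
pose c := 28 * K + 2 * nm g2 + nm g3 + 1.
have c0 : 0 < c by rewrite /c; have := nm_ge0 g2; have := nm_ge0 g3; lra.
have near e : 0 < e -> e <= 1 -> forall x, x != 0 -> nm x < Num.min d (Num.min 1 (e / c)) ->
    [/\ nm x < d, nm x < 1, nm (x ^+ 2 * p x - 1) <= e / 28 & nm ((x ^+ 3 * dp x) ^+ 2 - 4) <= e].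
  move=> e0 e1 x x0; rewrite !lt_min => /andP[xd /andP[x1 xe]].
  have [_ ode as1] := H x x0 xd; have n0 := nm_ge0 x.
  have xc : c * nm x <= e by move: xe; rewrite ltr_pdivlMr// => /ltW; rewrite mulrC.
  have g20 := nm_ge0 g2; have g30 := nm_ge0 g3.
  have pw k : (0 < k)%N -> nm x ^+ k <= nm x.
    case: k => // k _; rewrite exprS -[leRHS]mulr1 ler_wpM2l// exprn_ile1// ltW//.
  set v := x ^+ 2 * p x.
  have v1 : nm (v - 1) <= K * nm x.
    have -> : v - 1 = x ^+ 2 * (p x - x ^- 2) by rewrite /v; field.
    rewrite nmM nmX; apply: (@le_trans _ _ (nm x ^+ 2 * (K * nm x))).
      by rewrite ler_wpM2l// exprn_ge0.
    have : nm x ^+ 2 <= 1 by rewrite exprn_ile1// ltW.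
    by have : 0 <= K * nm x by [rewrite mulr_ge0]; move=> ? ?; nra.
  have Kx : 28 * (K * nm x) <= e by move: xc; rewrite /c; nra.
  have v28 : nm (v - 1) <= e / 28 by lra.
  split=> //.
  have -> : (x ^+ 3 * dp x) ^+ 2 - 4 = 4 * (v ^+ 2 + v + 1) * (v - 1) - g2 * x ^+ 4 * v - g3 * x ^+ 6.
    by rewrite exprMn ode /v; ring.
  have nv : nm v <= 1 + 1 / 28.
    by rewrite -(subrK 1 v); apply: le_trans (nmD _ _) _; rewrite nm1; lra.
  have B1 : nm (v ^+ 2 + v + 1) <= 7 / 2.
    apply: le_trans (nmD _ _) _; rewrite nm1; apply: le_trans (lerD (nmD _ _) (lexx _)) _.
    by rewrite nmX; have := nm_ge0 v; nra.
  apply: le_trans (nmB _ _) _; apply: le_trans (lerD (nmB _ _) (lexx _)) _.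
  rewrite (nmM (4 * _)) (nmM 4) (nmM (g2 * _) v) (nmM g2) (nmM g3) !nmX (_ : nm 4 = 4) ?nm_nat//.
  have T1 : 4 * nm (v ^+ 2 + v + 1) * nm (v - 1) <= 14 * (K * nm x).
    have -> : 14 * (K * nm x) = 4 * (7 / 2) * (K * nm x) by field.
    by apply: ler_pM; rewrite ?mulr_ge0 ?nm_ge0//; lra.
  have T2 : nm g2 * nm x ^+ 4 * nm v <= 2 * nm g2 * nm x.
    have -> : 2 * nm g2 * nm x = nm g2 * nm x * 2 by ring.
    apply: ler_pM; rewrite ?mulr_ge0 ?exprn_ge0 ?nm_ge0//; last lra.
    by rewrite ler_wpM2l// pw.
  have T3 : nm g3 * nm x ^+ 6 <= nm g3 * nm x by rewrite ler_wpM2l// pw.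
  by move: xc; rewrite /c; nra.
have neg x : x != 0 -> nm x < Num.min d (Num.min 1 (1 / c)) / 2 -> re (x ^+ 3 * dp x) < 0.
  set r1 := Num.min d _ => x0 xr.
  pose z := rc 2 * x.
  have z0 : z != 0 by rewrite mulf_neq0// rc_eq0.
  have zr : nm z < r1 by rewrite nmM nm_rc ger0_norm//; lra.
  have tz (t : R) : 0 < t < 1 -> rc t * z != 0 /\ nm (rc t * z) < r1.
    move=> /andP[t0 t1]; split; first by rewrite mulf_neq0// rc_eq0 lt0r_neq0.
    by rewrite nmM nm_rc gtr0_norm//; have := nm_ge0 z; nra.
  (* [x] is the midpoint of the segment from 0 to [z = 2 x], and [w] follows [p] along it; by the
     estimates above, [w t] is close to [t ^- 2]. *)
  pose w (t : R) := re (z ^+ 2 * p (0 + rc t * z)).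
  have dw (t : R) : 0 < t < 1 -> is_derive t 1 w (re (z ^+ 2 * (dp (rc t * z) * z))).
    move=> t01; have [tz0 tzr] := tz t t01.
    apply: is_derive_re_line; rewrite add0r; have [zd _ _ _] := near 1 ltr01 (lexx _) _ tz0 tzr.
    by have [] := H _ tz0 zd.
  have wre (t : R) : 0 < t < 1 -> re (z ^+ 2 * (dp (rc t * z) * z)) =
      re ((rc t * z) ^+ 3 * dp (rc t * z)) / t ^+ 3.
    move=> /andP[t0 _]; have tC : rc t != 0 by rewrite rc_eq0 lt0r_neq0.
    have -> : z ^+ 2 * (dp (rc t * z) * z) = rc (t ^- 3) * ((rc t * z) ^+ 3 * dp (rc t * z)).
      by rewrite rcV rcX; field.
    by rewrite reM re_rc im_rc mul0r subr0 mulrC.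
  (* A number with real part 0 has a nonpositive square, so that [x ^+ 3 * dp x], whose square is
     within distance 1 of 4, has nonzero real part. *)
  have dw0 (t : R) : 0 < t < 1 -> re (z ^+ 2 * (dp (rc t * z) * z)) != 0.
    move=> t01; have [tz0 tzr] := tz t t01; rewrite wre//.
    have [_ _ _] := near 1 ltr01 (lexx _) _ tz0 tzr; set y := _ * dp _ => Hy.
    have t0 : 0 < t ^+ 3 by case/andP: t01 => ? _; rewrite exprn_gt0.
    rewrite mulf_eq0 invr_eq0 (negbTE (lt0r_neq0 t0)) orbF; apply/eqP => y0.
    have := le_trans (re_le_nm _) Hy; rewrite expr2 reD reM y0 mul0r sub0r.
    rewrite reN (_ : re 4 = 4); last by rewrite -[4 in LHS]rc_nat.
    have : 0 <= im y * im y by rewrite -expr2 sqr_ge0.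
    by move=> h; rewrite ler0_norm; clear -h; lra.
  have cw : {within [set` `]0, 1[%R], continuous w}.
    apply: derivable_within_continuous => t; rewrite in_itv /= => t01.
    by have [] := dw _ t01.
  have iw : {in `]0, 1[%R &, injective w}.
    move=> s t; rewrite !in_itv /=.
    wlog st : s t / s < t.
      move=> W s01 t01 E; have [st|ts|//] := ltgtP s t; first exact: W.
      by apply/esym; apply: W.
    move=> /andP[s0 s1] /andP[t0 t1] E.
    have in01 u : u \in `]s, t[ -> 0 < u < 1.
      by rewrite in_itv /= => /andP[su ut]; rewrite (lt_trans s0 su) (lt_trans ut t1).
    have cst : {within `[s, t], continuous w}.
      apply: derivable_within_continuous => u; rewrite in_itv /= => /andP[su ut].
      have u01 : 0 < u < 1 by rewrite (lt_le_trans s0 su) (le_lt_trans ut t1).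
      by have [] := dw u u01.
    have [u us] := MVT st (fun u us => dw u (in01 u us)) cst.
    rewrite E subrr => /esym/eqP; rewrite mulf_eq0 subr_eq0 => /orP[/eqP|/eqP ts].
      by have /eqP := dw0 u (in01 u us).
    by rewrite ts.
  (* A continuous injective function on an interval is monotone. It cannot increase here, as
     [w (1 / 4)] is near 16 and [w (1 / 2)] is near 4. *)
  have [inc|dec] := itv_continuous_inj_mono cw iw.
    exfalso.
    have := inc _ _ (a4 : (1 / 4 : R) \in `]0, 1[%R) (a2 : (1 / 2 : R) \in `]0, 1[%R) a42.
    have wv (t : R) : 0 < t < 1 -> `|w t * t ^+ 2 - 1| <= 1 / 28.
      move=> t01; have [tz0 tzr] := tz t t01.
      have [_ _ + _] := near 1 ltr01 (lexx _) _ tz0 tzr.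
      apply: le_trans; apply: le_trans (re_le_nm _).
      have re1 : re (1 : C) = 1 by rewrite -rc1 re_rc.
      rewrite reD reN re1.
      have E : re ((rc t * z) ^+ 2 * p (rc t * z)) = w t * t ^+ 2.
        by rewrite /w add0r exprMn -rcX -mulrA reM re_rc im_rc mul0r subr0 mulrC.
      by rewrite E.
    have := wv _ a4; have := wv _ a2; rewrite !ler_norml.
    set u := w _; set v := w _ => /andP[_ h1] /andP[h2 _] h3; clear -h1 h2 h3; lra.
  have h2 : (1 / 2 : R) \in `]0, 1[ by rewrite in_itv.
  have : derive1 w (1 / 2) <= 0.
    apply: (decr_derive1_le0 (D := [set` `]0, 1[%R])).
    - move=> t; rewrite inE => /interior_subset /=; rewrite in_itv /= => t01.
      by have [] := dw t t01.
    - by move=> s t; rewrite !inE; exact: dec.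
    - have := @interval_open R (BRight 0) (BLeft 1) isT isT; rewrite openE => /(_ _ h2).
      exact.
  rewrite derive1E (@derive_val _ _ _ _ _ _ _ (dw _ a2)).
  have := dw0 _ a2; rewrite wre// => n0 l0.
  have xE : rc (1 / 2) * z = x.
    by rewrite /z mulrA -rcM (_ : 1 / 2 * 2 = 1) ?rc1 ?mul1r//; field.
  rewrite xE in n0 l0.
  have : re (x ^+ 3 * dp x) / (1 / 2) ^+ 3 < 0 by rewrite lt_neqAle n0.
  by rewrite pmulr_llt0// invr_gt0 exprn_gt0//; lra.
move=> e e0; pose e1 := Num.min 1 e.
have e10 : 0 < e1 by rewrite lt_min ltr01.
have e11 : e1 <= 1 by rewrite ge_min lexx.
have e1e : e1 <= e by rewrite ge_min lexx orbT.
exists (Num.min (Num.min d (Num.min 1 (e1 / c))) (Num.min d (Num.min 1 (1 / c)) / 2)).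
  by rewrite !lt_min d0 ltr01 !divr_gt0// !lt_min d0 ltr01 divr_gt0.
move=> x x0; rewrite lt_min => /andP[xa xb].
have [xd _ Hv Hy] := near _ e10 e11 _ x0 xa; have Hneg := neg _ x0 xb.
split=> //; first by clear -Hv e1e e10; lra.
set y := x ^+ 3 * dp x in Hy Hneg *.
(* A negative real part keeps [y] at distance at least 2 from the root 2, so that
   [(y + 2) * (y - 2) = y ^+ 2 - 4] bounds [nm (y + 2)]. *)
have y2 : 2 <= nm (y - 2).
  apply: le_trans (re_le_nm _); rewrite reD reN (_ : re 2 = 2); last by rewrite -[2 in LHS]rc_nat.
  by rewrite ler0_norm; clear -Hneg; lra.
have : nm (y + 2) * nm (y - 2) <= e1.
  by rewrite -nmM; move: Hy; rewrite (_ : (y + 2) * (y - 2) = y ^+ 2 - 4)//; ring.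
have := nm_ge0 (y + 2); clear -y2 e1e; nra.
Qed.

(* [4 (v ^+ 2 + v u + u ^+ 2) / (s + t)] is close to [- 3] near the pole. *)
Lemma pole_quotient_bound (v u s t w : C) : nm (v - 1) <= 1 / 100 -> nm (u - 1) <= 1 / 100 ->
  nm (s + 2) <= 1 / 100 -> nm (t + 2) <= 1 / 100 -> nm w <= 1 / 100 ->
  s + t != 0 /\ nm (3 * (s + t) + (4 * (v ^+ 2 + v * u + u ^+ 2) - w)) <= nm (s + t) / 2.
Proof.
move=> v1 u1 s1 t1 w1.
have n2 : nm ((s + 2) + (t + 2)) <= 1 / 50 by apply: le_trans (nmD _ _) _; lra.
have nst : 3 <= nm (s + t).
  have -> : s + t = - 4 + ((s + 2) + (t + 2)) by ring.
  have := nm_subD (- 4 : C) ((s + 2) + (t + 2)); rewrite nmN (_ : nm 4 = 4) ?nm_nat//; lra.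
split; first by rewrite -nm_gt0; lra.
have near1 x : nm (x - 1) <= 1 / 100 -> nm x <= 1 + 1 / 100 /\ nm (x + 1) <= 3.
  clear; move=> x1; have nx : nm x <= 1 + 1 / 100.
    by rewrite -(subrK 1 x); apply: le_trans (nmD _ _) _; rewrite nm1; lra.
  by split=> //; apply: le_trans (nmD _ _) _; rewrite nm1; lra.
have [nv nv1] := near1 v v1; have [_ nu1] := near1 u u1.
have nv3 : nm v <= 3 by lra.
have P1 : nm ((v - 1) * (v + 1)) <= 1 / 100 * 3 by rewrite nmM ler_pM ?nm_ge0.
have P2 : nm (v * (u - 1)) <= 3 * (1 / 100) by rewrite nmM ler_pM ?nm_ge0.
have P3 : nm ((u - 1) * (u + 1)) <= 1 / 100 * 3 by rewrite nmM ler_pM ?nm_ge0.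
have -> : 3 * (s + t) + (4 * (v ^+ 2 + v * u + u ^+ 2) - w) = 3 * ((s + 2) + (t + 2))
    + 4 * ((v - 1) * (v + 1) + (v * (u - 1) + (v - 1)) + (u - 1) * (u + 1)) - w by ring.
apply: le_trans (nmB _ _) _; apply: le_trans (lerD (nmD _ _) (lexx _)) _.
have n3 : nm (3 : C) = 3 by exact: nm_nat.
have n4 : nm (4 : C) = 4 by exact: nm_nat.
rewrite (nmM 3) (nmM 4) n3 n4.
have := nmD ((v - 1) * (v + 1) + (v * (u - 1) + (v - 1))) ((u - 1) * (u + 1)).
have := nmD ((v - 1) * (v + 1)) (v * (u - 1) + (v - 1)).
have := nmD (v * (u - 1)) (v - 1).
clear -n2 nst v1 P1 P2 P3 w1; lra.
Qed.

(** Subtracting the two equations gives [(dp - dq) (dp + dq) = (p - q) (4 (p^2 + p q + q^2) - g2)],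
    so that a nonzero [p - q] would behave like [x ^- 3] near the pole. Multiplication by [x ^+ 3]
    brings this exponent near 0, while [p - q = O(x)] makes the product vanish to order 4. *)
Theorem wpgerm_unique (g2 g3 : C) p dp q dq (d K d' K' : R) : 0 < d -> 0 <= K -> 0 < d' -> 0 <= K' ->
  wpgerm g2 g3 p dp d K -> wpgerm g2 g3 q dq d' K' ->
  exists2 r : R, 0 < r & forall x, x != 0 -> nm x < r -> p x = q x.
Proof.
move=> d0 K0 d'0 K'0 Hp Hq.
have e0 : 0 < 1 / 100 :> R by lra.
have [r1 r10 A1] := wpgerm_asymptotic d0 K0 Hp e0.
have [r2 r20 A2] := wpgerm_asymptotic d'0 K'0 Hq e0.
pose r3 := Num.min 1 (1 / (nm g2 + 1) / 100).
have g20 := nm_ge0 g2.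
have g21 : 0 < nm g2 + 1 by lra.
have r30 : 0 < r3 by rewrite lt_min ltr01 !divr_gt0.
pose r := Num.min (Num.min r1 r2) r3.
have rr x : nm x < r -> [/\ nm x < r1, nm x < r2, nm x < 1 & nm g2 * nm x <= 1 / 100].
  rewrite !lt_min => /andP[/andP[-> ->] /andP[x1]]; rewrite mulrAC ltr_pdivlMr// => x2; split=> //.
  by have := nm_ge0 x; lra.
exists r; first by rewrite lt_min lt_min r10 r20 r30.
pose F x := x ^+ 3 * (p x - q x).
pose F1 x := 3%:R * x ^+ 2 * 1 * (p x - q x) + x ^+ 3 * (dp x - dq x).
suff F0 x : x != 0 -> nm x < r -> F x = 0.
  move=> x x0 /(F0 x x0)/eqP; rewrite mulf_eq0 expf_eq0 (negbTE x0) /= subr_eq0.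
  by move/eqP.
apply: (singular_gronwall (F1 := F1) (K := K + K')).
- move=> y y0 /rr[/(A1 _ y0)[yd _ _] /(A2 _ y0)[yd' _ _] _ _].
  have [cp _ _] := Hp y y0 yd; have [cq _ _] := Hq y y0 yd'.
  by apply: cder_eqv (cderM (cderX 3 (cder_id y)) (cderB cp cq)) _; rewrite /F1; ring.
- move=> y y0 /rr[/(A1 _ y0)[yd v1 s1] /(A2 _ y0)[yd' v2 s2] y1 yg].
  have [_ op _] := Hp y y0 yd; have [_ oq _] := Hq y y0 yd'.
  have n0 : 0 < nm y by rewrite nm_gt0.
  set v := y ^+ 2 * p y in v1; set u := y ^+ 2 * q y in v2.
  set s := y ^+ 3 * dp y in s1; set t := y ^+ 3 * dq y in s2.
  have w1 : nm (g2 * y ^+ 4) <= 1 / 100.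
    rewrite nmM nmX; apply: le_trans yg; rewrite ler_wpM2l// exprS -[leRHS]mulr1.
    by rewrite ler_wpM2l ?(ltW n0)// exprn_ile1// ltW.
  have [st HQ] := pole_quotient_bound v1 v2 s1 s2 w1.
  pose Q := 4 * (v ^+ 2 + v * u + u ^+ 2) - g2 * y ^+ 4.
  have key : (y ^+ 3 * (dp y - dq y)) * (s + t) = y ^+ 2 * (p y - q y) * Q.
    have -> : (y ^+ 3 * (dp y - dq y)) * (s + t) = y ^+ 6 * (dp y ^+ 2 - dq y ^+ 2).
      by rewrite /s /t; ring.
    by rewrite op oq /Q /v /u; ring.
  have FE : F1 y * y = F y * ((3 * (s + t) + Q) / (s + t)).
    have kk : y ^+ 3 * (dp y - dq y) = y ^+ 2 * (p y - q y) * Q / (s + t).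
      by rewrite -key mulfK.
    by rewrite /F1 kk /F; field.
  rewrite -nmM FE nmM ler_wpM2l ?nm_ge0//.
  by rewrite nmM nmV ler_pdivrMr ?nm_gt0// (mulrC 2^-1).
- move=> y y0 /rr[/(A1 _ y0)[yd _ _] /(A2 _ y0)[yd' _ _] _ _].
  have [_ _ ap] := Hp y y0 yd; have [_ _ aq] := Hq y y0 yd'.
  rewrite /F nmM nmX.
  have -> : p y - q y = (p y - y ^- 2) - (q y - y ^- 2) by ring.
  have H1 : nm ((p y - y ^- 2) - (q y - y ^- 2)) <= (K + K') * nm y.
    by rewrite mulrDl; apply: le_trans (nmB _ _) (lerD ap aq).
  apply: le_trans (ler_wpM2l (exprn_ge0 3 (nm_ge0 y)) H1) _.
  by rewrite mulrCA -exprSr.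
Qed.

End WpGerms.

(** * Existence of wp for arbitrary invariants *)

Section WpExistence.
Variable R : realType.
Local Notation C := (Cx R).

Lemma nm_ratr_nat (a b : nat) : nm (ratr (a%:R / b%:R : rat) : C) = a%:R / b%:R.
Proof. by rewrite rmorphM fmorphV !rmorph_nat nmM nmV !nm_nat. Qed.

(** The recursion multiplies a sum of [k - 1] products, each of size at most [M ^+ (k - 2)], by
    [6 / ((k - 4) * (k + 3))]. The resulting factor is at most 4, which [M ^+ 2] absorbs. *)
Lemma wcoef_bound (a b : C) (M : R) : 2 + nm a + nm b <= M ->
  forall k, nm (wcoef (@ratr C) a b k) <= M ^+ k.
Proof.
move=> HM; have a0 := nm_ge0 a; have b0 := nm_ge0 b.
have M0 : 0 < M by lra.
have Mn n : 1 <= M ^+ n by apply: exprn_ege1; lra.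
elim/ltn_ind => k IH; have [k4|k4] := ltnP 4 k.
  rewrite wcoefE// nmM nm_ratr_nat.
  have H : nm (\sum_(i < k.-1) wcoef (@ratr C) a b i * wcoef (@ratr C) a b (k.-2 - i)%N) <= k.-1%:R * M ^+ k.-2.
    apply: le_trans (nm_sum _ _) _.
    have -> : k.-1%:R * M ^+ k.-2 = \sum_(i < k.-1) M ^+ k.-2 by rewrite sumr_const card_ord mulr_natl.
    apply: ler_sum => i _; rewrite nmM.
    have -> : M ^+ k.-2 = M ^+ i * M ^+ (k.-2 - i) by rewrite -exprD subnKC//; have := ltn_ord i; lia.
    by apply: ler_pM; rewrite ?nm_ge0 ?IH//; have := ltn_ord i; lia.
  apply: le_trans (ler_wpM2l _ H) _; first by rewrite divr_ge0.
  have -> : M ^+ k = M ^+ 2 * M ^+ k.-2 by rewrite -exprD; congr (_ ^+ _); lia.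
  rewrite mulrA ler_wpM2r ?(le_trans ler01)//.
  apply: (@le_trans _ _ 4); last by nra.
  rewrite mulrAC ler_pdivrMr; last by rewrite ltr0n; nia.
  by rewrite -!natrM ler_nat; nia.
have [->|k2] := eqVneq k 2%N.
  rewrite wcoef2 nmM fmorphV rmorph_nat nmV nm_nat.
  by have := Mn 1%N; nra.
have [->|k4'] := eqVneq k 4%N.
  rewrite wcoef4 nmM fmorphV rmorph_nat nmV nm_nat.
  by rewrite exprS; have := Mn 3%N; nra.
by rewrite wcoef_small// nm0 exprn_ge0 ?ltW.
Qed.

Lemma pbound_geometric (c : nat -> C) (K M : R) : 0 < M -> (forall k, nm (c k) <= K * M ^+ k) -> pbound c M^-1.
Proof.
move=> M0 H; exists K => n; rewrite exprVn ler_pdivrMr ?exprn_gt0//.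
Qed.

Definition wcf (a b : C) := wcoef (@ratr C) a b.
Definition wrad (a b : C) : R := (2 + nm a + nm b)^-1.
Definition wreg (a b : C) := ps (wcf a b).

Lemma wrad_gt0 a b : 0 < wrad a b.
Proof. by rewrite invr_gt0; have := nm_ge0 a; have := nm_ge0 b; lra. Qed.

Lemma pbound_wcf a b : pbound (wcf a b) (wrad a b).
Proof.
apply: (@pbound_geometric _ 1); first by rewrite -invr_gt0 wrad_gt0.
by move=> k; rewrite mul1r; apply: wcoef_bound.
Qed.

Lemma cauchy_small (c : nat -> C) n : c 0 = 0 -> c 1 = 0 -> (n < 3)%N -> cauchy c c n = 0.
Proof.
move=> c0 c1 n3; have c01 j : (j < 2)%N -> c j = 0 by case: j => [|[]].
apply: big1 => i _; have [i2|i2] := ltnP i 2; first by rewrite (c01 i)// mul0r.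
by rewrite (c01 (n - i)%N) ?mulr0//; have := ltn_ord i; lia.
Qed.

(** The regular part of [wp'' = 6 wp^2 - g2 / 2], multiplied by [x ^+ 2]: the 12 comes from the
    cross term with [x ^- 2], and it equals [k * (k - 1)] at [k = 4], where the coefficient is
    free. *)
Lemma wcf_recursion a b k :
  k%:R * (k%:R - 1) * wcf a b k = 12 * wcf a b k
    + 6 * cshift (cshift (cauchy (wcf a b) (wcf a b))) k - (if k == 2%N then a / 2 else 0).
Proof.
have [k4|k4] := ltnP 4 k.
  have -> : (k == 2%N) = false by apply/eqP; lia.
  case: k k4 => [|[|k]]//= k4; rewrite subr0 /wcf wcoefE//=.
  rewrite -/(cauchy (wcoef (@ratr C) a b) (wcoef (@ratr C) a b) k); set S := cauchy _ _ _.
  rewrite rmorphM fmorphV !rmorph_nat; set N := (_ * _)%N.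
  have N0 : (N%:R : C) != 0 by rewrite pnatr_eq0 /N; lia.
  have NE : (N%:R : C) = k.+2%:R * (k.+2%:R - 1) - 12.
    have -> : k.+2%:R * (k.+2%:R - 1) = (k.+2 * k.+1)%N%:R :> C by rewrite natrM -[k.+2]addn1 natrD; ring.
    have -> : (k.+2 * k.+1 = N + 12)%N by rewrite /N; nia.
    by rewrite natrD addrK.
  apply/eqP; rewrite -subr_eq0; apply/eqP.
  transitivity ((N%:R * (6 / N%:R * S) - 6 * S) : C); first by rewrite NE; ring.
  by field.
have c0 : wcf a b 0 = 0 by rewrite /wcf wcoef_small.
have c1 : wcf a b 1 = 0 by rewrite /wcf wcoef_small.
have c3 : wcf a b 3 = 0 by rewrite /wcf wcoef_small.
have c2 : wcf a b 2 = a / 20 by rewrite /wcf wcoef2 fmorphV rmorph_nat mulrC.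
have -> : cshift (cshift (cauchy (wcf a b) (wcf a b))) k = 0.
  by case: k k4 => [|[|k]]// k3; apply: (cauchy_small c0 c1).
move: c0 c1 c2 c3; move: (wcf a b) => c c0 c1 c2 c3.
case: k k4 => [|[|[|[|[|]]]]] //= _.
- by rewrite c0; ring.
- by rewrite c1; ring.
- by rewrite c2; field.
- by rewrite c3; ring.
- by ring.
Qed.

Lemma ps_shift c (r : R) x : pbound c r -> nm x < r -> pser (cshift c) x (x * ps c x).
Proof. by move=> Hc xr; apply: pser_shift; exact: ps_hassum Hc xr. Qed.

Lemma wreg_ode a b x : nm x < wrad a b ->
  x ^+ 2 * ps (dcoef (dcoef (wcf a b))) x =
  12 * wreg a b x + 6 * (x ^+ 2 * wreg a b x ^+ 2) - a / 2 * x ^+ 2.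
Proof.
set r := wrad a b => xr; have n0 := nm_ge0 x.
pose r1 := (nm x + r) / 2; pose r2 := (r1 + r) / 2.
have xr1 : nm x < r1 by rewrite /r1; lra.
have r12 : r1 < r2 by rewrite /r2 /r1; lra.
have r2r : r2 < r by rewrite /r2 /r1; lra.
have r10 : 0 < r1 by lra.
have Hc : pbound (wcf a b) r := pbound_wcf a b.
have B2 : pbound (dcoef (wcf a b)) r2 by apply: pbound_dcoef Hc; apply/andP; split; lra.
have B1 : pbound (dcoef (dcoef (wcf a b))) r1 by apply: pbound_dcoef B2; apply/andP; split; lra.
have Bc : pbound (cauchy (wcf a b) (wcf a b)) r1 by apply: (pbound_cauchy _ Hc); last exact: Hc; apply/andP; split; lra.
have H1 := pser_shift (ps_shift B1 xr1).
have H2 : pser (wcf a b) x (wreg a b x) := ps_hassum Hc xr.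
have H3 := pser_shift (ps_shift Bc xr1).
have H4 := pserB (pserD (pserZ 12 H2) (pserZ 6 H3)) (pser_mono (a / 2) 2 x).
have -> : x ^+ 2 * ps (dcoef (dcoef (wcf a b))) x = x * (x * ps (dcoef (dcoef (wcf a b))) x) by ring.
rewrite (pser_eq _ H1 H4) => [|k]; first by rewrite (ps_mul Hc Hc xr) /wreg; ring.
rewrite -wcf_recursion; case: k => [|[|k]] /=; rewrite /dcoef; first by ring.
  by ring.
by move: (wcf a b _) => w; rewrite -[k.+2]addn1 natrD; ring.
Qed.

(** The series beyond [x ^ 4]. Splitting it off leaves explicit terms with which the pole of order 6
    in [p'^2] can be cancelled. *)
Definition wtail (a b : C) (n : nat) := wcf a b (n + 5).

Lemma pbound_wtail a b : pbound (wtail a b) (wrad a b).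
Proof.
have [K HK] := pbound_wcf a b; have r0 := wrad_gt0 a b.
exists (K / wrad a b ^+ 5) => n; rewrite ler_pdivlMr ?exprn_gt0//.
rewrite -mulrA -exprD; exact: HK (n + 5)%N.
Qed.

Lemma wreg_tail a b x : nm x < wrad a b ->
  wreg a b x = a / 20 * x ^+ 2 + b / 28 * x ^+ 4 + x ^+ 5 * ps (wtail a b) x.
Proof.
move=> xr; have Hc := pbound_wcf a b.
have H2 : pser (wcf a b) x (wreg a b x) := ps_hassum Hc xr.
have H3 := pser_shift (pser_shift (pser_shift (pser_shift (ps_shift (pbound_wtail a b) xr)))).
rewrite (pser_eq _ H2 (pserD (pserD (pser_mono (a / 20) 2 x) (pser_mono (b / 28) 4 x)) H3)); first by ring.
move=> n; rewrite /wcf; case: n => [|[|[|[|[|n]]]]] /=; rewrite ?addr0 ?add0r//; try by rewrite wcoef_small.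
- by rewrite wcoef2 fmorphV rmorph_nat mulrC.
- by rewrite wcoef4 fmorphV rmorph_nat mulrC.
- by rewrite /wtail /wcf addnC.
Qed.

Definition wfun (a b x : C) := x ^- 2 + wreg a b x.
Definition wfun' (a b x : C) := - 2 / x ^+ 3 + ps (dcoef (wcf a b)) x.

Lemma wfun_cder a b x : x != 0 -> nm x < wrad a b -> cder (wfun a b) x (wfun' a b x).
Proof.
move=> x0 xr; have H := cderD (cderV (f := fun y : C => y ^+ 2) _ (cderX 2 (cder_id x))) (ps_cder (pbound_wcf a b) xr).
apply: cder_eqv (H _) _; first by rewrite expf_neq0.
by rewrite /wfun'; congr (_ + _); field.
Qed.

Lemma wfun'_cder a b x : x != 0 -> nm x < wrad a b ->
  cder (wfun' a b) x (6 * wfun a b x ^+ 2 - a / 2).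
Proof.
move=> x0 xr; have n0 := nm_ge0 x.
have B : pbound (dcoef (wcf a b)) ((nm x + wrad a b) / 2).
  by apply: pbound_dcoef (pbound_wcf a b); apply/andP; split; lra.
have xr' : nm x < (nm x + wrad a b) / 2 by lra.
have H := cderD (cderZ (- 2) (cderV (f := fun y : C => y ^+ 3) _ (cderX 3 (cder_id x)))) (ps_cder B xr').
apply: cder_eqv (H _) _; first by rewrite expf_neq0.
apply: (mulfI (x := x ^+ 2)); first by rewrite expf_neq0.
by rewrite mulrDr wreg_ode// /wfun; field.
Qed.

(** The first integral [E] of the second-order equation is constant on the punctured disc. Its limit
    at 0 is 0 thanks to the coefficients [a / 20] and [b / 28]: they make [E] equal to [y * Q],
    which extends differentiably by 0. *)
Theorem wfun_ode a b x : x != 0 -> nm x < wrad a b ->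
  wfun' a b x ^+ 2 = 4 * wfun a b x ^+ 3 - a * wfun a b x - b.
Proof.
pose E y := wfun' a b y ^+ 2 - 4 * wfun a b y ^+ 3 + a * wfun a b y + b.
suff H y : y != 0 -> nm y < wrad a b -> E y = 0.
  by move=> x0 xr; apply/eqP; rewrite -subr_eq0 -(H x x0 xr) /E; apply/eqP; ring.
have r0 := wrad_gt0 a b.
apply: (puncture_constant (l := 0)) y => [y y0 yr|e e0].
  have H1 := wfun_cder y0 yr; have H2 := wfun'_cder y0 yr.
  apply: cder_eqv (cderD (cderD (cderB (cderX 2 H2) (cderZ 4 (cderX 3 H1))) (cderZ a H1)) (cder_cst b y)) _.
  by rewrite /=; field.
pose v := ps (wtail a b); pose v1 := ps (dcoef (wtail a b)).
have u1E y : y != 0 -> nm y < wrad a b ->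
    ps (dcoef (wcf a b)) y = a / 10 * y + b / 7 * y ^+ 3 + 5 * y ^+ 4 * v y + y ^+ 5 * v1 y.
  move=> y0 yr; apply: (cder_unique (ps_cder (pbound_wcf a b) yr)).
  have d0 : 0 < wrad a b - nm y by lra.
  apply: (cder_ext (f := fun y => a / 20 * y ^+ 2 + b / 28 * y ^+ 4 + y ^+ 5 * v y) d0).
    move=> z zy; rewrite -wreg_tail//.
    by rewrite -(subrK y z); apply: le_lt_trans (nmD _ _) _; lra.
  apply: cder_eqv (cderD (cderD (cderZ (a / 20) (cderX 2 (cder_id y))) (cderZ (b / 28) (cderX 4 (cder_id y))))
    (cderM (cderX 5 (cder_id y)) (ps_cder (pbound_wtail a b) yr))) _.
  by rewrite /v1 /v /=; field.
pose Q (y w w1 : C) := 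
  let s := a / 20 + b / 28 * y ^+ 2 + y ^+ 3 * w in
  let t := a / 10 + b / 7 * y ^+ 2 + 5 * y ^+ 3 * w + y ^+ 4 * w1 in
  y * t ^+ 2 - 20 * w - 4 * y * w1 - 12 * w - 12 * y * s ^+ 2 - 4 * y ^+ 5 * s ^+ 3 + a * y * s.
have EQ y : y != 0 -> nm y < wrad a b -> E y = y * Q y (v y) (v1 y).
  move=> y0 yr; rewrite /E /wfun' /wfun (wreg_tail yr) (u1E y y0 yr) -/(v y) /Q.
  by move: (v y) (v1 y) => w w1; field.
have z0 : nm (0 : C) < wrad a b by rewrite nm0.
have Hv := ps_cder (pbound_wtail a b) z0.
have Hv1 : exists l, cder v1 0 l.
  have B : pbound (dcoef (wtail a b)) (wrad a b / 2).
    by apply: pbound_dcoef (pbound_wtail a b); apply/andP; split; lra.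
  eexists; apply: (ps_cder B); rewrite nm0; lra.
have [l1 {}Hv1] := Hv1.
have [l Hl] : exists l, cder (fun y => y * Q y (v y) (v1 y)) 0 l.
  have I n := cderX n (cder_id (0 : C)).
  have Hs := cderD (cderD (cder_cst (a / 20) 0) (cderZ (b / 28) (I 2))) (cderM (I 3) Hv).
  have Ht := cderD (cderD (cderD (cder_cst (a / 10) 0) (cderZ (b / 7) (I 2))) (cderM (cderZ 5 (I 3)) Hv)) (cderM (I 4) Hv1).
  eexists; apply: cderM (cder_id _) _.
  exact: (cderD (cderB (cderB (cderB (cderB (cderB (cderM (cder_id 0) (cderX 2 Ht)) (cderZ 20 Hv))
    (cderM (cderZ 4 (cder_id 0)) Hv1)) (cderZ 12 Hv)) (cderM (cderZ 12 (cder_id 0)) (cderX 2 Hs)))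
    (cderM (cderZ 4 (I 5)) (cderX 3 Hs))) (cderM (cderZ a (cder_id 0)) Hs)).
have [d d0 Hd] := cder_cont Hl e0.
exists (Num.min d (wrad a b)); first by rewrite lt_min d0.
move=> y y0; rewrite lt_min => /andP[yd yr].
by rewrite EQ//; have := Hd y; rewrite subr0 mul0r => /(_ yd).
Qed.

Lemma wfun_germ a b : exists2 d : R, 0 < d & exists2 K : R, 0 <= K & wpgerm a b (wfun a b) (wfun' a b) d K.
Proof.
have z0 : nm (0 : C) < wrad a b by rewrite nm0 wrad_gt0.
have [d d0 Hd] := cder_bound (ps_cder (pbound_wcf a b) z0).
exists (Num.min d (wrad a b)); first by rewrite lt_min d0 wrad_gt0.
exists (nm (ps (dcoef (wcf a b)) 0) + 1); first by rewrite addr_ge0 ?nm_ge0.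
move=> x x0; rewrite lt_min => /andP[xd xr]; split.
- exact: wfun_cder.
- exact: wfun_ode.
- rewrite /wfun addrAC subrr add0r; have := Hd x xd; rewrite add0r ps0.
  by rewrite /wcf wcoef_small// subr0.
Qed.

Theorem is_wp_wp a b : is_wp a b (@wp R a b).
Proof.
have [d d0 [K K0 H]] := wfun_germ a b.
by rewrite /wp; case: xgetP => [f -> //|/(_ (wfun a b))[]]; exact: wpgerm_is_wp H.
Qed.

Lemma is_wp_unique a b p q : is_wp a b p -> is_wp a b q ->
  exists2 r : R, 0 < r & forall x, x != 0 -> nm x < r -> p x = q x.
Proof.
move=> /is_wp_germ[d d0 [K K0 H]] /is_wp_germ[d' d'0 [K' K'0 H']].
exact: wpgerm_unique H H'.
Qed.

End WpExistence.

(** * The series of f_Kr *)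

Section PuncturedLimits.
Variable R : realType.
Local Notation C := (Cx R).
Implicit Types (f g : C -> C) (l m : C).

Definition lim0 f l := forall e : R, 0 < e -> exists2 r : R, 0 < r &
  forall y, y != 0 -> nm y < r -> nm (f y - l) < e.

Lemma lim0P f l : lim0 f l <-> f y @[y --> (0 : C)^'] --> l.
Proof.
split=> [H|/cvgrPdist_lt H e e0].
  apply/cvgrPdist_lt => e e0.
  have er : e \is Num.real by rewrite gtr0_real.
  have eE : e = rc (re e) by rewrite /rc /re; apply/esym/RRe_real.
  have /H[r r0 Hr] : 0 < re e by rewrite -rc_lt rc0 -eE.
  by apply/dnear_nmP; exists r => // y y0; rewrite subr0 distrC eE normE rc_lt; exact: Hr.
have /H/dnear_nmP[r r0 Hr] : 0 < rc e by rewrite -rc0 rc_lt.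
by exists r => // y y0 yr; rewrite -rc_lt -normE distrC; apply: Hr; rewrite ?subr0.
Qed.

Lemma lim0_cst l : lim0 (fun=> l) l.
Proof. by apply/lim0P; exact: cvg_cst. Qed.
Lemma lim0D f g l m : lim0 f l -> lim0 g m -> lim0 (fun y => f y + g y) (l + m).
Proof. by move=> /lim0P F /lim0P G; apply/lim0P; exact: cvgD F G. Qed.
Lemma lim0B f g l m : lim0 f l -> lim0 g m -> lim0 (fun y => f y - g y) (l - m).
Proof. by move=> /lim0P F /lim0P G; apply/lim0P; exact: cvgB F G. Qed.
Lemma lim0M f g l m : lim0 f l -> lim0 g m -> lim0 (fun y => f y * g y) (l * m).
Proof. by move=> /lim0P F /lim0P G; apply/lim0P; exact: cvgM F G. Qed.
Lemma lim0V f l : l != 0 -> lim0 f l -> lim0 (fun y => (f y)^-1) l^-1.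
Proof. by move=> l0 /lim0P F; apply/lim0P; exact: cvgV F. Qed.
Lemma lim0_ext f g l (d : R) : 0 < d -> (forall y, y != 0 -> nm y < d -> f y = g y) ->
  lim0 f l -> lim0 g l.
Proof.
move=> d0 E H e /H[r r0 Hr]; exists (Num.min r d); first by rewrite lt_min r0.
by move=> y y0; rewrite lt_min => /andP[yr yd]; rewrite -E//; exact: Hr.
Qed.

Lemma lim0X f l n : lim0 f l -> lim0 (fun y => f y ^+ n) (l ^+ n).
Proof.
move=> H; elim: n => [|n IH]; first exact: lim0_cst.
rewrite exprS; apply: (lim0_ext ltr01) (lim0M H IH) => y _ _.
by rewrite exprS.
Qed.

Lemma lim0_cder f l : cder f 0 l -> lim0 f (f 0).
Proof. by move=> /cder_cont H e /H[r r0 Hr]; exists r => // y _ yr; apply: Hr; rewrite subr0. Qed.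

Lemma lim0_id : lim0 id 0.
Proof. by move=> e e0; exists e => // y _; rewrite subr0. Qed.

Lemma lim0_unique f l m : lim0 f l -> lim0 f m -> l = m.
Proof.
move=> Hl Hm; apply/eqP; rewrite -subr_eq0; apply/eqP/nm_eq0_eps => e e0.
have e20 : 0 < e / 2 by lra.
have [r r0 Hr] := Hl _ e20; have [s s0 Hs] := Hm _ e20.
pose t := Num.min r s / 2.
have m0 : 0 < Num.min r s by rewrite lt_min r0.
have t0 : 0 < t by rewrite /t; lra.
have : nm (rc t) < Num.min r s by rewrite nm_rc gtr0_norm// /t; lra.
have y0 : rc t != 0 :> C by rewrite rc_eq0 lt0r_neq0.
rewrite lt_min => /andP[/(Hr _ y0) H1 /(Hs _ y0) H2].
have -> : l - m = (f (rc t) - m) - (f (rc t) - l) by ring.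
by apply: le_trans (nmB _ _) _; lra.
Qed.

Lemma lim0_neq0 f l : l != 0 -> lim0 f l ->
  exists2 r : R, 0 < r & forall y, y != 0 -> nm y < r -> f y != 0.
Proof.
move=> l0 H; have /H[r r0 Hr] : 0 < nm l by rewrite nm_gt0.
exists r => // y y0 yr; apply/eqP => f0.
by have := Hr y y0 yr; rewrite f0 sub0r nmN ltxx.
Qed.

(* [F / G] has derivative [0] away from [0] and tends to [1]. *)
Lemma log_ode_unique (F F1 G G1 a b : C -> C) (d : R) : 0 < d ->
  (forall y, y != 0 -> nm y < d -> [/\ cder F y (F1 y), cder G y (G1 y),
     F1 y * a y = F y * b y, G1 y * a y = G y * b y & a y != 0]) ->
  lim0 (fun y => F y / y) 1 -> lim0 (fun y => G y / y) 1 ->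
  exists2 r : R, 0 < r & forall y, y != 0 -> nm y < r -> F y = G y.
Proof.
move=> d0 H LF LG; have [r r0 Hr] := lim0_neq0 (oner_neq0 _) LG.
have G0 y : y != 0 -> nm y < Num.min r d -> G y != 0.
  move=> y0; rewrite lt_min => /andP[yr _]; have := Hr y y0 yr.
  by rewrite mulf_eq0 negb_or => /andP[].
have m0 : 0 < Num.min r d by rewrite lt_min r0.
exists (Num.min r d) => // y y0 yr.
have : F y / G y = 1.
  apply: (@puncture_constant _ (fun y => F y / G y) 1 (Num.min r d) _ _ y y0 yr) => [z z0 zr|].
    have zd : nm z < d by move: zr; rewrite lt_min => /andP[].
    have [cF cG eF eG a0] := H z z0 zd; have Gz := G0 z z0 zr.
    apply: cder_eqv (cderM cF (cderV Gz cG)) _.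
    have -> : F1 z = F z * b z / a z by rewrite -eF mulfK.
    have -> : G1 z = G z * b z / a z by rewrite -eG mulfK.
    by field; rewrite Gz.
  have := lim0M LF (lim0V (oner_neq0 _) LG); rewrite invr1 mulr1.
  apply: (lim0_ext m0) => z z0 zr; have Gz := G0 z z0 zr.
  by field; rewrite z0 Gz.
by move/(canRL (mulfVK (G0 y y0 yr))); rewrite mul1r.
Qed.

Lemma wpgerm_lim0 (a b : C) p dp (d K : R) : 0 < d -> 0 <= K -> wpgerm a b p dp d K ->
  lim0 (fun x => x ^+ 2 * p x) 1 /\ lim0 (fun x => x ^+ 3 * dp x) (- 2).
Proof.
move=> d0 K0 /(wpgerm_asymptotic d0 K0) H.
split=> e e0; have e20 : 0 < e / 2 by [lra]; have [r r0 Hr] := H _ e20; exists r => // y y0 yr;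
  have [_ Hv Hs] := Hr y y0 yr; rewrite ?opprK; lra.
Qed.

Lemma wpgerm_neq (a b c : C) p dp (d K : R) : 0 < d -> 0 <= K -> wpgerm a b p dp d K ->
  exists2 r : R, 0 < r & forall x, x != 0 -> nm x < r -> p x - c != 0.
Proof.
move=> d0 K0 /(wpgerm_lim0 d0 K0)[H _].
have L : lim0 (fun x => x ^+ 2 * p x - c * x ^+ 2) (1 - c * 0 ^+ 2).
  by apply: lim0B H (lim0M (lim0_cst c) (lim0X 2 lim0_id)).
have n0 : 1 - c * 0 ^+ 2 != 0 :> C by rewrite expr0n mulr0 subr0 oner_neq0.
have [r r0 Hr] := lim0_neq0 n0 L; exists r => // x x0 xr.
have := Hr x x0 xr; have -> : x ^+ 2 * p x - c * x ^+ 2 = x ^+ 2 * (p x - c) by ring.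
by rewrite mulf_eq0 negb_or => /andP[].
Qed.

End PuncturedLimits.

(** * The power series of f_Kr and its differential equation *)

Section KricheverSeries.
Variable R : realType.
Local Notation C := (Cx R).
Variables (al be ga la : C).

Local Notation q := (@ratr C).
Local Notation g3 := (krg3 be ga la).
Local Notation A := (acoef q be ga la).
Local Notation B := (bcoef q al be ga la).
Local Notation f := (fcoef q al be ga la).

Definition krbound : R := 2 + nm la + nm g3 + nm al + nm be + nm ga.
Local Notation M := krbound.

Let pos : [/\ 2 <= M, nm al <= M, nm be <= M, nm ga <= M & 2 + nm la + nm g3 <= M].
Proof.
have := nm_ge0 al; have := nm_ge0 be; have := nm_ge0 ga; have := nm_ge0 la; have := nm_ge0 g3.
by rewrite /M => *; split; lra.
Qed.

Let M2 : 2 <= M. Proof. by case: pos. Qed.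
Let M0 : 0 < M. Proof. have := M2; lra. Qed.
Let Mle i j : (i <= j)%N -> M ^+ i <= M ^+ j.
Proof. by move=> ij; rewrite ler_weXn2l//; have := M2; lra. Qed.
Let wb k : nm (krw q be ga la k) <= M ^+ k.
Proof. by case: pos => _ _ _ _ h; apply: wcoef_bound. Qed.

Lemma acoef_bound k : nm (A k) <= M ^+ k.
Proof.
rewrite /acoef; case: k => [|[|[|k]]] /=; rewrite ?nm1 ?nm0 ?exprn_ge0//; try exact: ltW.
  rewrite /krw wcoef_small// sub0r nmN; case: pos => _ _ h _ _.
  by apply: le_trans h _; exact: (Mle (i := 1)).
by rewrite subr0; apply: le_trans (wb _) (Mle _); lia.
Qed.

Lemma bcoef_bound k : nm (B k) <= (k + 3)%N%:R * M ^+ k.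
Proof.
rewrite /bcoef; case: k => [|k].
  by rewrite /= mulr0 !subr0 nm_nat expr0 mulr1 ler_nat.
rewrite (_ : (k.+1 == 0)%N = false)// (_ : k.+1.-1 = k)//.
have a1 : nm (2%:R * al * A k) <= 2 * M ^+ k.+1.
  rewrite !nmM nm_nat exprS mulrA; apply: ler_pM; rewrite ?mulr_ge0 ?nm_ge0 ?acoef_bound//.
  by case: pos => _ h _ _ _; rewrite ler_wpM2l.
have a2 : nm (k.+1.-2%:R * (if k.+1 == 1%N then 0 else krw q be ga la k.+1.-2)) <= k%:R * M ^+ k.+1.
  rewrite nmM nm_nat; apply: ler_pM; rewrite ?nm_ge0// ?ler_nat//; first lia.
  case: ifP => _; first by rewrite nm0 exprn_ge0// ltW.
  by apply: le_trans (wb _) (Mle _); lia.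
have a3 : nm (if k.+1 == 3%N then ga else 0) <= M ^+ k.+1.
  case: ifP => _; last by rewrite nm0 exprn_ge0// ltW.
  by case: pos => _ _ _ h _; apply: le_trans h _; exact: (Mle (i := 1)).
apply: le_trans (nmB _ _) _; apply: le_trans (lerD (nmB _ _) (lexx _)) _.
apply: le_trans (lerD (lerD a1 a2) a3) _.
have -> : (k.+1 + 3)%N%:R = k%:R + 4 :> R by rewrite -natrD; congr _%:R; lia.
by have := exprn_ge0 k.+1 (ltW M0); lra.
Qed.

(** The ratio is [4 * M] rather than [M]: the geometric sum of the [4 ^+ j] saves a factor 3, which
    compensates [(2 n + 2) / (2 (n - 1)) <= 3]. *)
Lemma fcoef_bound n : nm (f n) <= (4 * M) ^+ n.
Proof.
elim/ltn_ind: n => n IH; have [n1|] := ltnP 1 n; last first.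
  by case: n IH => [|[|]]// _ _; rewrite ?fcoef0 ?fcoef1 ?nm0 ?nm1 ?expr0 ?expr1//; have := M2; lra.
rewrite fcoefE// nmM fmorphV rmorph_nat nmV nm_nat.
have H : nm (\sum_(j < n) (B (n - j)%N - (2 * j)%N%:R * A (n - j)%N) * f j) <=
    (2 * n + 2)%N%:R * (M ^+ n * (4 ^+ n / 3)).
  apply: le_trans (nm_sum _ _) _.
  apply: (@le_trans _ _ (\sum_(j < n) (2 * n + 2)%N%:R * (M ^+ n * 4 ^+ j))).
    apply: ler_sum => j _; have jn := ltn_ord j; rewrite nmM.
    have -> : (2 * n + 2)%N%:R * (M ^+ n * 4 ^+ j) = ((2 * n + 2)%N%:R * M ^+ (n - j)) * (4 * M) ^+ j.
      have -> : M ^+ n = M ^+ (n - j) * M ^+ j by rewrite -exprD subnK// ltnW.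
      by rewrite exprMn; ring.
    apply: ler_pM; rewrite ?nm_ge0 ?IH//.
    apply: le_trans (nmB _ _) _; rewrite nmM nm_nat.
    have h1 := bcoef_bound (n - j); have h2 := acoef_bound (n - j).
    have h3 := ler_wpM2l (ler0n R (2 * j)) h2.
    apply: le_trans (lerD h1 h3) _; rewrite -mulrDl -natrD; apply: ler_wpM2r; first by rewrite exprn_ge0// ltW.
    by rewrite ler_nat; lia.
  rewrite -mulr_sumr ler_wpM2l// -mulr_sumr; apply: ler_wpM2l; first by rewrite exprn_ge0// ltW.
  rewrite ler_pdivlMr//; have -> : (\sum_(j < n) 4 ^+ j) * 3 = 4 ^+ n - 1 :> R; last lra.
  elim: n {n1 IH} => [|n IHn]; first by rewrite big_ord0 mul0r expr0 subrr.
  by rewrite big_ord_recr /= mulrDl IHn exprS; ring.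
apply: le_trans (ler_wpM2l _ H) _; first by rewrite invr_ge0.
rewrite exprMn mulrC ler_pdivrMr; last by rewrite ltr0n; lia.
have -> : (2 * n + 2)%N%:R * (M ^+ n * (4 ^+ n / 3)) = 4 ^+ n * M ^+ n * ((2 * n + 2)%N%:R / 3) by ring.
rewrite ler_wpM2l ?mulr_ge0 ?exprn_ge0 ?(ltW M0)//.
by rewrite ler_pdivrMr// -natrM ler_nat; lia.
Qed.

Definition krrad : R := (4 * M)^-1.

Lemma krrad_gt0 : 0 < krrad. Proof. by rewrite invr_gt0; have := M2; lra. Qed.

Lemma pbound_fcoef : pbound f krrad.
Proof.
apply: (@pbound_geometric _ _ 1); first (have := M2; lra).
by move=> k; rewrite mul1r; exact: fcoef_bound.
Qed.

Lemma pbound_acoef : pbound A krrad.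
Proof.
apply: (@pbound_geometric _ _ 1); first (have := M2; lra).
move=> k; rewrite mul1r; apply: le_trans (acoef_bound k) _.
by rewrite lerXn2r ?nnegrE//; have := M2; lra.
Qed.

Lemma krrad_wrad : krrad <= wrad la g3.
Proof.
case: pos => _ _ _ _ h; have := nm_ge0 la; have := nm_ge0 g3 => *.
by rewrite lef_pV2 ?posrE; lra.
Qed.

Definition krF := ps f.

Lemma bcoef_shift k : B k = 2 * al * cshift A k + (if k == 0%N then 2 else 0)
  - cshift (cshift (theta (krw q be ga la))) k - (if k == 3%N then ga else 0).
Proof.
rewrite /bcoef; case: k => [|[|k]] /=; rewrite ?mulr0 ?subr0 ?add0r ?addr0//; ring.
Qed.

Lemma acoef_shift k : A k = (if k == 0%N then 1 else 0) + cshift (cshift (krw q be ga la)) k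
  - (if k == 2%N then be else 0).
Proof.
by rewrite /acoef; case: k => [|[|k]] /=; rewrite ?subr0 ?add0r ?addr0.
Qed.

Lemma acoef_sum x : x != 0 -> nm x < krrad ->
  pser A x (x ^+ 2 * (wfun la g3 x - be)).
Proof.
move=> x0 xr; have xw := lt_le_trans xr krrad_wrad.
have H := pserB (pserD (pser_mono 1 0 x) (pser_shift (ps_shift (pbound_wcf la g3) xw))) (pser_mono be 2 x).
have E : x ^+ 2 * (wfun la g3 x - be) = 1 * x ^+ 0 + x * (x * ps (wcf la g3) x) - be * x ^+ 2.
  by rewrite /wfun /wreg; field.
by rewrite E; apply: eq_hassum H => n; rewrite -acoef_shift.
Qed.

Lemma bcoef_sum x : x != 0 -> nm x < krrad ->
  pser B x (x ^+ 3 * (2 * al * (wfun la g3 x - be) - wfun' la g3 x - ga)).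
Proof.
move=> x0 xr; have xw := lt_le_trans xr krrad_wrad; have n0 := nm_ge0 x.
have Bd : pbound (dcoef (wcf la g3)) ((nm x + wrad la g3) / 2).
  by apply: pbound_dcoef (pbound_wcf _ _); apply/andP; split; lra.
have xd : nm x < (nm x + wrad la g3) / 2 by lra.
have HA := pserZ (2 * al) (pser_shift (acoef_sum x0 xr)).
have H := pserB (pserB (pserD HA (pser_mono 2 0 x)) (pser_shift (pser_shift (ps_shift Bd xd)))) (pser_mono ga 3 x).
have E : x ^+ 3 * (2 * al * (wfun la g3 x - be) - wfun' la g3 x - ga) =
    2 * al * (x * (x ^+ 2 * (wfun la g3 x - be))) + 2 * x ^+ 0
    - x * (x * (x * ps (dcoef (wcf la g3)) x)) - ga * x ^+ 3.
  by rewrite /wfun'; field.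
rewrite E; apply: eq_hassum H => n.
by rewrite bcoef_shift -theta_dcoef.
Qed.

Lemma fcoef_cauchy n : 2 * cauchy (theta f) A n = cauchy f B n.
Proof.
have A00 : A 0 = 1 by [].
have B00 : B 0 = 2 by rewrite /bcoef /= mulr0 !subr0.
suff H : \sum_(j < n) (B (n - j)%N - (2 * j)%N%:R * A (n - j)%N) * f j = (2 * (n%:R - 1)) * f n.
  rewrite /cauchy !big_ord_recr /= subnn A00 B00 mulrDr mulr_sumr /theta mulr1.
  apply/eqP; rewrite -subr_eq0; apply/eqP.
  transitivity (2 * (n%:R - 1) * f n - (\sum_(i < n) f i * B (n - i)%N - \sum_(i < n) 2 * (i%:R * f i * A (n - i)%N))).
    by ring.
  rewrite -sumrB -H -sumrB; apply: big1 => i _; rewrite natrM; ring.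
have [n1|] := ltnP 1 n.
  rewrite fcoefE// fmorphV rmorph_nat; set S := \sum_(j < n) _.
  have n0 : (n.-1%:R : C) != 0 by rewrite pnatr_eq0; lia.
  have -> : n%:R - 1 = n.-1%:R :> C by rewrite -[n in LHS]prednK ?(ltnW n1)// -addn1 natrD addrK.
  by rewrite natrM; field.
case: n => [|[|]]// _; first by rewrite big_ord0 fcoef0 mulr0.
by rewrite big_ord_recr big_ord0 /= fcoef0; ring.
Qed.

Theorem krF_ode x : x != 0 -> nm x < krrad ->
  2 * ps (dcoef f) x * (wfun la g3 x - be) =
  krF x * (2 * al * (wfun la g3 x - be) - wfun' la g3 x - ga).
Proof.
move=> x0 xr; have n0 := nm_ge0 x.
pose r1 := (nm x + krrad) / 2.
have xr1 : nm x < r1 by rewrite /r1; lra.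
have r1r : r1 < krrad by rewrite /r1; lra.
have r10 : 0 < r1 by lra.
have Hd : pbound (theta f) r1 by apply: pbound_theta pbound_fcoef; rewrite r10.
have HD : pbound (dcoef f) r1 by apply: pbound_dcoef pbound_fcoef; rewrite r10.
have HA : pbound A r1 by apply: pbound_le pbound_acoef; rewrite !ltW.
have Hf : pbound f r1 by apply: pbound_le pbound_fcoef; rewrite !ltW.
have HB : pbound B r1.
  pose w := krw q be ga la.
  have Hw : pbound w (wrad la g3) := pbound_wcf la g3.
  have rw := lt_le_trans r1r krrad_wrad.
  have H1 : pbound (theta w) r1 by apply: pbound_theta Hw; rewrite r10.
  have [K1 HK1] := pbound_cshift (ltW r10) HA.
  have [K2 HK2] := pbound_cshift (ltW r10) (pbound_cshift (ltW r10) H1).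
  exists (nm (2 * al) * K1 + 2 + K2 + nm ga * r1 ^+ 3) => n.
  rewrite bcoef_shift.
  have P := exprn_ge0 n (ltW r10).
  apply: le_trans (ler_wpM2r P (nmB _ _)) _; rewrite mulrDl.
  apply: lerD; last first.
    case: eqVneq => [->|_]//; rewrite nm0 mul0r mulr_ge0 ?nm_ge0// exprn_ge0// ltW//.
  apply: le_trans (ler_wpM2r P (nmB _ _)) _; rewrite mulrDl.
  apply: lerD; last exact: HK2.
  apply: le_trans (ler_wpM2r P (nmD _ _)) _; rewrite mulrDl.
  apply: lerD; first by rewrite nmM -mulrA ler_wpM2l ?nm_ge0.
  by case: eqVneq => [->|_]; rewrite ?expr0 ?mulr1 ?nm0 ?mul0r ?nm_nat.
have sA := acoef_sum x0 xr; have sB := bcoef_sum x0 xr.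
have EA : ps A x = x ^+ 2 * (wfun la g3 x - be) := hassum_unique (ps_hassum HA xr1) sA.
have EB : ps B x = x ^+ 3 * (2 * al * (wfun la g3 x - be) - wfun' la g3 x - ga) :=
  hassum_unique (ps_hassum HB xr1) sB.
have Ed : ps (theta f) x = x * ps (dcoef f) x.
  have := ps_hassum Hd xr1; rewrite {1}theta_dcoef => H; exact: (hassum_unique H (ps_shift HD xr1)).
have E1 := ps_mul Hd HA xr1; have E2 := ps_mul Hf HB xr1.
have E : 2 * ps (cauchy (theta f) A) x = ps (cauchy f B) x.
  pose r2 := (nm x + r1) / 2.
  have xr2 : nm x < r2 by rewrite /r2; lra.
  have r21 : 0 < r2 < r1 by apply/andP; split; rewrite /r2; lra.
  exact: (pser_eq fcoef_cauchy (pserZ 2 (ps_hassum (pbound_cauchy r21 Hd HA) xr2))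
    (ps_hassum (pbound_cauchy r21 Hf HB) xr2)).
move: E; rewrite E1 E2 Ed EA EB -/krF => E.
apply: (mulfI (x := x ^+ 3)); first by rewrite expf_neq0.
rewrite [RHS]mulrCA -E; ring.
Qed.

Lemma krF_cder x : nm x < krrad -> cder krF x (ps (dcoef f) x).
Proof. exact: ps_cder pbound_fcoef. Qed.

Lemma cder_lim0_div (h : C -> C) l : h 0 = 0 -> cder h 0 l -> lim0 (fun y => h y / y) l.
Proof.
move=> h0 H e e0; have e20 : 0 < e / 2 by lra.
have [d d0 Hd] := H _ e20; exists d => // y y0 yd.
have := Hd y yd; rewrite add0r h0 subr0 => Hy.
have -> : h y / y - l = (h y - l * y) / y by field.
rewrite nmM nmV ltr_pdivrMr ?nm_gt0//; apply: le_lt_trans Hy _.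
by rewrite ltr_pM2r ?nm_gt0//; lra.
Qed.

Lemma krF_lim0 : lim0 (fun y => krF y / y) 1.
Proof.
have := @krF_cder 0; rewrite nm0 krrad_gt0 ps0 /dcoef fcoef1 mulr1 => /(_ isT).
by apply: cder_lim0_div; rewrite /krF ps0 fcoef0.
Qed.

Lemma krF_unique p dp (d K : R) (G G1 : C -> C) (r : R) : 0 < d -> 0 <= K -> wpgerm la g3 p dp d K -> 0 < r ->
  (forall y, y != 0 -> nm y < r -> cder G y (G1 y) /\
     2 * G1 y * (p y - be) = G y * (2 * al * (p y - be) - dp y - ga)) ->
  lim0 (fun y => G y / y) 1 ->
  exists2 s : R, 0 < s & forall y, y != 0 -> nm y < s -> G y = krF y.
Proof.
move=> d0 K0 Hp r0 HG LG.
have [d1 d10 [K1 K10 Hw]] := wfun_germ la g3.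
have [s s0 Hs] := wpgerm_unique d0 K0 d10 K10 Hp Hw.
have [s1 s10 Hs1] := wpgerm_neq be d10 K10 Hw.
pose m := Num.min (Num.min (Num.min r d) (Num.min s krrad)) (Num.min d1 s1).
have m0 : 0 < m by rewrite !lt_min r0 d0 s0 krrad_gt0 d10.
apply: (log_ode_unique (a := fun y => 2 * (wfun la g3 y - be)) m0 _ LG krF_lim0) => y y0.
rewrite !lt_min => /andP[/andP[/andP[yr yd] /andP[ys yk]] /andP[yd1 ys1]].
have [cG eG] := HG y y0 yr; have pE := Hs y y0 ys.
have dpE : dp y = wfun' la g3 y.
  have [cp _ _] := Hp y y0 yd; have [cw _ _] := Hw y y0 yd1.
  have mn : 0 < Num.min (nm y) (s - nm y) by rewrite lt_min nm_gt0 y0 subr_gt0.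
  apply: cder_unique cp (cder_ext mn _ cw) => z; rewrite lt_min => /andP[z1 z2].
  apply/esym/Hs; last by rewrite -(subrK y z); apply: le_lt_trans (nmD _ _) _; lra.
  by apply: contraTneq z1 => ->; rewrite sub0r nmN ltxx.
split; [exact: cG|exact: krF_cder| | |].
- by rewrite -[X in _ = _ * X](_ : 2 * al * (wfun la g3 y - be) - wfun' la g3 y - ga = _)//
    -dpE -pE -eG mulrA [G1 y * 2]mulrC.
- by rewrite -krF_ode//; ring.
- by rewrite mulf_neq0 ?pnatr_eq0// Hs1.
Qed.

End KricheverSeries.

(** * Agreement of the series with the sigma quotient of a lattice *)

Section LatticeSeries.
Variable R : realType.
Local Notation C := (Cx R).

Lemma derive1n_family (f : C -> C) (F : nat -> C -> C) (r : R) :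
  (forall y, nm y < r -> f y = F 0 y) ->
  (forall k y, nm y < r -> cder (F k) y (F k.+1 y)) ->
  forall n y, nm y < r -> derive1n n f y = F n y.
Proof.
move=> H HF n; elim: n f F H HF => [|n IH] f F H HF y yr; first exact: H.
rewrite derive1Sn; apply: (IH _ (fun k => F k.+1)) => [z zr|k z zr|//]; last exact: HF.
have d0 : 0 < r - nm z by rewrite subr_gt0.
apply: cder_derive1; apply: (cder_ext d0) (HF 0%N z zr) => w wz; apply/esym/H.
by rewrite -(subrK z w); apply: le_lt_trans (nmD _ _) _; lra.
Qed.

Lemma pbound_iter_dcoef (c : nat -> C) (r r' : R) k : 0 < r' < r -> pbound c r ->
  pbound (iter k (@dcoef R) c) r'.
Proof.
elim: k r' => [|k IH] r' /andP[r0 rr] H.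
  by apply: pbound_le H; rewrite !ltW.
rewrite iterS; apply: (@pbound_dcoef _ _ ((r' + r) / 2)).
  by rewrite r0; lra.
by apply: IH H; apply/andP; split; lra.
Qed.

Lemma ps_derive1n (f : C -> C) (c : nat -> C) (r d : R) : 0 < d -> 0 < r -> pbound c r ->
  (forall y, nm y < d -> f y = ps c y) -> forall n, derive1n n f 0 = n`!%:R * c n.
Proof.
move=> d0 r0 Hc H n.
pose F k := ps (iter k (@dcoef R) c).
have -> : derive1n n f 0 = F n 0.
  apply: (derive1n_family (r := Num.min d r)); last by rewrite nm0 lt_min d0.
    by move=> y; rewrite lt_min => /andP[/H].
  move=> k y; rewrite lt_min => /andP[_ yr]; have n0 := nm_ge0 y.
  have B : pbound (iter k (@dcoef R) c) ((nm y + r) / 2).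
    by apply: pbound_iter_dcoef Hc; apply/andP; split; lra.
  by apply: ps_cder B _; lra.
rewrite /F ps0; elim: n c {Hc H F} => [|n IH] c; first by rewrite mul1r.
by rewrite iterSr IH /dcoef factS natrM; ring.
Qed.

Variables (w1 w2 : C).
Hypothesis wB : lattice_basis w1 w2.
Local Notation L := (lattice_pt w1 w2).
Local Notation zeta := (lattice_zeta w1 w2).
Local Notation sigma := (lattice_sigma w1 w2).
Local Notation wpL := (lattice_wp w1 w2).
Local Notation dwpL := (dwp w1 w2).
Local Notation offL := (offL w1 w2).
Local Notation Gk := (Gk w1 w2).

Let adm := lattice_admissible wB.

Lemma lattice_wpgerm : exists2 d : R, 0 < d & exists2 K : R, 0 <= K &
  wpgerm (60 * Gk 4) (140 * Gk 6) wpL dwpL d K.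
Proof.
have [r r0 Hr] := offL_near0 wB.
have t31 := T_cder (n := 3) (k := 1) adm isT (zero_avoids w1 w2 (n := 3) isT).
have t32 := T_cder (n := 3) (k := 2) adm isT (zero_avoids w1 w2 (n := 3) isT).
have H := cderM (cderX 2 (cder_id 0)) (cderD (cderZ 3 t31) (cderM (cder_id 0) t32)).
have [d d0 Hd] := cder_bound H.
exists (Num.min d r); first by rewrite lt_min d0.
set v := (X in nm X + 1) in Hd; exists (nm v + 1); first by rewrite addr_ge0 ?nm_ge0.
move=> x x0; rewrite lt_min => /andP[xd xr]; have xL := Hr x xr x0; split.
- exact: wp_cder.
- exact: wp_ode1.
- have := Hd x xd; rewrite add0r expr0n mul0r subr0; apply: le_trans.
  by rewrite (wp_near0 wB xL) addrAC subrr add0r.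
Qed.

Lemma lattice_krg3 z : offL z -> krg3 (wpL z) (dwpL z) (60 * Gk 4) = 140 * Gk 6.
Proof. by move=> zL; rewrite /krg3 (wp_ode1 wB zL); ring. Qed.

Lemma lattice_fKr_cder z al x : offL z -> offL x -> offL (z - x) ->
  cder (lattice_fKr w1 w2 z al) x
    (lattice_fKr w1 w2 z al x * (al + zeta_defect w1 w2 z x)).
Proof.
move=> zL xL zxL; have s0 := sigma_neq0 wB zxL.
have H1 := sigma_cder wB xL.
have H2 := cderV (f := fun y => sigma (z - y)) s0 (cder_opp (sigma_cder wB zxL)).
have H3 := cder_comp (cderB (cderZ al (cder_id x)) (cderZ (zeta z) (cder_id x))) (cexp_cder _).
apply: cder_eqv (cderM (cderM (cderM H1 (cder_cst (sigma z) x)) H2) H3) _.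
rewrite /lattice_fKr /zeta_defect; move: (cexp _) => E; move: s0; move: (sigma (z - x)) => s s0.
by move: (sigma x) (sigma z) (zeta x) (zeta z) (zeta _) => *; field.
Qed.

Lemma lattice_fKr_lim0 z al : offL z -> lim0 (fun y => lattice_fKr w1 w2 z al y / y) 1.
Proof.
move=> zL; have s0 := sigma_neq0 wB zL.
have zL0 : offL (z - 0) by rewrite subr0.
have H1 : lim0 (sprod w1 w2) 1 by rewrite -(sprod0 w1 w2); exact: lim0_cder (sprod_cder0 wB).
have H2 : lim0 (fun y => sigma (z - y)) (sigma z).
  have := lim0_cder (f := fun y => sigma (z - y)) (cder_opp (sigma_cder wB zL0)).
  by rewrite subr0.
have H3 : lim0 (fun y => cexp (al * y - zeta z * y)) 1.
  have := lim0_cder (cder_comp (f := fun x => al * x - zeta z * x)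
    (cderB (cderZ al (cder_id 0)) (cderZ (zeta z) (cder_id 0))) (cexp_cder _)).
  by rewrite !mulr0 subr0 cexp0.
have H := lim0M (lim0M (lim0M H1 (lim0_cst (sigma z))) (lim0V s0 H2)) H3.
have LL : 1 * sigma z / sigma z * 1 = 1 by move: s0; move: (sigma z) => s s0; field.
have E y : y != 0 -> nm y < 1 -> sprod w1 w2 y * sigma z / sigma (z - y) *
    cexp (al * y - zeta z * y) = lattice_fKr w1 w2 z al y / y.
  move=> y0 _; rewrite /lattice_fKr (sigma_sprod _ _ y).
  move: (cexp _) (sprod _ _ _) (sigma z) (sigma (z - y))^-1 => A B D F.
  by rewrite -[RHS]mulrA [A / y]mulrC [y * B]mulrC; field.
have := lim0_ext ltr01 E H; by rewrite LL.
Qed.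

Theorem lattice_fKr_series z al : offL z ->
  exists2 s : R, 0 < s & forall y, nm y < s ->
    lattice_fKr w1 w2 z al y = krF al (wpL z) (dwpL z) (60 * Gk 4) y.
Proof.
move=> zL; have [d d0 [K K0 Hw]] := lattice_wpgerm.
have [r r0 Hr] := offL_near0 wB.
have [r1 r10 Hr1] := offL_ball wB zL.
rewrite -(lattice_krg3 zL) in Hw.
have m0 : 0 < Num.min r r1 by rewrite lt_min r0.
have HG y : y != 0 -> nm y < Num.min r r1 -> cder (lattice_fKr w1 w2 z al) y
      (lattice_fKr w1 w2 z al y * (al + zeta_defect w1 w2 z y)) /\
    2 * (lattice_fKr w1 w2 z al y * (al + zeta_defect w1 w2 z y)) * (wpL y - wpL z) =
      lattice_fKr w1 w2 z al y * (2 * al * (wpL y - wpL z) - dwpL y - dwpL z).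
  move=> y0; rewrite lt_min => /andP[yr yr1].
  have yL := Hr y yr y0; have zyL : offL (z - y) by apply: Hr1; rewrite addrAC subrr sub0r nmN.
  split; first exact: lattice_fKr_cder.
  have := zeta_addition wB zL yL zyL; move: (zeta_defect _ _ _ _) (lattice_fKr _ _ _ _ _) => Z F E.
  transitivity (2 * F * (al * (wpL y - wpL z) + Z * (wpL y - wpL z))); first by ring.
  by rewrite E; field.
have [s s0 Hs] := krF_unique d0 K0 Hw m0 HG (lattice_fKr_lim0 al zL).
exists s => // y ys; have [->|y0] := eqVneq y 0; last exact: Hs.
by rewrite /lattice_fKr /lattice_sigma !mul0r /krF ps0 fcoef0.
Qed.

End LatticeSeries.

(** * The coefficients as rational polynomials *)

Section KricheverPolynomials.
Variable R : realType.
Local Notation C := (Cx R).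

Lemma eval_Kr_morphism (al be ga la : C) : exists2 h : {rmorphism mpoly 4 rat -> C},
  forall p, h p = eval_Kr p al be ga la & forall r : rat, h (mpolyC 4 r) = ratr r.
Proof.
pose v := tnth [tuple al; be; ga; la].
exists (meval v \o map_mpoly (@ratr C) : {rmorphism mpoly 4 rat -> C}) => //= r.
by rewrite map_mpolyC mevalC.
Qed.

Definition krvar (i : nat) : mpoly 4 rat := mpolyX rat (mnm1 (inord i : 'I_4)).

Definition krpoly (n : nat) : mpoly 4 rat :=
  fcoef (@mpolyC 4 rat) (krvar 0) (krvar 1) (krvar 2) (krvar 3) n.

Lemma eval_krpoly n (al be ga la : C) : eval_Kr (krpoly n) al be ga la = fcoef (@ratr C) al be ga la n.
Proof.
have [h hE hC] := eval_Kr_morphism al be ga la.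
have hX i : (i < 4)%N -> h (krvar i) = nth 0 [:: al; be; ga; la] i.
  move=> i4; rewrite hE /eval_Kr /krvar map_mpolyX mevalXU (tnth_nth 0) /= inordK//.
have E := rmorph_fcoef hC (krvar 0) (krvar 1) (krvar 2) (krvar 3) n.
rewrite (hX 0%N isT) (hX 1%N isT) (hX 2 isT) (hX 3 isT) in E.
by rewrite -hE; exact: E.
Qed.

Lemma lattice_fKr_derive1n (w1 w2 z al : C) n : lattice_basis w1 w2 -> ~ in_lattice w1 w2 z ->
  derive1n n (lattice_fKr w1 w2 z al) 0 / n`!%:R
  = fcoef (@ratr C) al (lattice_wp w1 w2 z) (derive1 (lattice_wp w1 w2) z) (lattice_g2 w1 w2) n.
Proof.
move=> wB /offL_notin zL; have [s s0 Hs] := lattice_fKr_series wB al zL.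
rewrite (derive1_wpL wB zL) (lattice_g2E wB).
rewrite (ps_derive1n s0 (krrad_gt0 _ _ _ _) (pbound_fcoef _ _ _ _) Hs).
by rewrite mulrAC mulfV ?mul1r// pnatr_eq0 -lt0n fact_gt0.
Qed.

Lemma is_Kr_coef_krpoly n : is_Kr_coef R n (krpoly n).
Proof. by move=> w1 w2 z al wB zL; rewrite lattice_fKr_derive1n// eval_krpoly. Qed.

(** [xget] might have picked a polynomial other than [krpoly n]; until uniqueness is known, only its
    values at lattice parameters are available. *)
Lemma is_Kr_coef_Kr_coef n : is_Kr_coef R n (Kr_coef R n).
Proof.
rewrite /Kr_coef; case: xgetP => [p -> //|H].
by have := H _ (is_Kr_coef_krpoly n).
Qed.

End KricheverPolynomials.

(** * Uniqueness of the coefficient polynomials *)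

Section WpSurjective.
Variables (R : realType) (w1 w2 : Cx R).
Local Notation C := (Cx R).
Local Notation L := (lattice_pt w1 w2).
Local Notation wpL := (lattice_wp w1 w2).
Local Notation dwpL := (dwp w1 w2).
Local Notation offL := (offL w1 w2).
Local Notation Gk := (Gk w1 w2).
Hypothesis wB : lattice_basis w1 w2.

Let adm := lattice_admissible wB.

(* If [wp] omitted [c], then [1 / (wp - c)] would be an entire elliptic function
   that vanishes on the lattice. *)
Theorem wp_surjective c : exists2 z, offL z & wpL z = c.
Proof.
apply: contrapT => N.
have W z : offL z -> wpL z - c != 0.
  by move=> zL; apply/eqP => /eqP; rewrite subr_eq0 => /eqP E; apply: N; exists z.
have [r r0 Hr] := pole_ball wB.
pose den y := 1 + y ^+ 4 * (3 * T L 3 1 y + y * T L 3 2 y) - c * y ^+ 2.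
have denE y : offL y -> den y = y ^+ 2 * (wpL y - c).
  by move=> yL; rewrite /den (wp_near0 wB yL); have y0 := offL_neq0 yL; field.
have den0 y : cball 0 r y -> den y != 0.
  move=> /Hr[_ Hy]; have [->|/Hy yL] := eqVneq y 0.
    by rewrite /den !expr0n !(mul0r, mulr0) addr0 subr0 oner_neq0.
  by rewrite denE// mulf_neq0 ?W// expf_neq0//; exact: offL_neq0 yL.
have Ts k : (0 < k)%N -> smooth2 (cball 0 r) (T L 3 k).
  by move=> k0; apply: T_smooth2 => // y /Hr[H _]; exact: H.
have Z := @offL_removable _ _ _ wB (fun x => (wpL x - c)^-1) (fun y => y ^+ 2 * (den y)^-1) r.
have [d d0 Hd] := offL_near0 wB.
have d20 : 0 < d / 2 by lra.
have dL : offL (rc (d / 2)).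
  by apply: Hd; rewrite ?rc_eq0 ?lt0r_neq0// nm_rc gtr0_norm//; lra.
have := W _ dL; rewrite -invr_eq0 Z ?eqxx//.
- by move=> k x _; rewrite (wp_periodic wB).
- apply: smooth2V => //; smooth2_tac; exact: wp_smooth2.
- apply: smooth2M; first by smooth2_tac.
  by apply: smooth2V => //; rewrite /den; smooth2_tac; exact: Ts.
- by rewrite expr0n mul0r.
- by move=> y _ yL; rewrite denE//; have y0 := offL_neq0 yL; have := W y yL; move=> ?; field; apply/andP.
Qed.

Lemma Gk_hassum k : (3 <= k)%N -> hassum (fun m => (L m) ^- k) (Gk k).
Proof.
move=> k3; apply: eq_hassum (T_hassum 0 adm (n := k) (k := 0) _) => [m|]; last by rewrite addn0.
by rewrite /Tterm subr0 expr0 invr1 mulr1.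
Qed.

(** The Laurent coefficients of wp at 0, computed once from the lattice sum and once from the
    recursion. Consequently [60 * Gk 4] and [140 * Gk 6] determine all higher Eisenstein sums. *)
Lemma wcf_Gk n : wcf (60 * Gk 4) (140 * Gk 6) n.+1 = n.+2%:R * Gk (n + 3).
Proof.
set a := 60 * Gk 4; set b := 140 * Gk 6.
have [r r0 Hr] := pole_ball wB.
have T0 k : T L 2 k.+1 0 = Gk (k + 3) by rewrite T_x0 addnC addn2 addn3.
have Hcd k y : nm y < r -> cder (T L 2 k.+1) y (k.+1%:R * T L 2 k.+2 y).
  move=> yr; have [H _] : (forall n, (0 < n)%N -> avoids L n y) /\ (y != 0 -> offL y).
    by apply: Hr; rewrite /cball /= subr0.
  by apply: T_cder => //; exact: H.
have D k : derive1n k (T L 2 1) 0 = k`!%:R * Gk (k + 3).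
  pose F j (y : C) := j`!%:R * T L 2 j.+1 y.
  rewrite (derive1n_family (F := F) (r := r)) ?nm0 ?T0//.
    by rewrite /F T0.
  by move=> y _; rewrite /F mul1r.
  move=> j y yr; apply: cder_eqv (cderZ _ (Hcd j y yr)) _.
  by rewrite /F factS natrM; ring.
(* A termwise primitive: [y ^+ 2 * ps c' y] has derivative [wreg a b y], just as
   [y ^+ 2 * T L 2 1 y] has derivative [wpL y - y ^- 2]. *)
pose c' j := wcf a b j.+1 / j.+2%:R.
have Hc : pbound c' (wrad a b).
  have [K HK] := pbound_wcf a b; have w0 := wrad_gt0 a b.
  exists (K / wrad a b) => j; rewrite ler_pdivlMr// -mulrA -exprSr.
  apply: le_trans (HK j.+1); apply: ler_wpM2r; first by rewrite exprn_ge0// ltW.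
  rewrite /c' nmM nmV nm_nat ler_pdivrMr// -[leLHS]mulr1 ler_wpM2l ?nm_ge0//.
  by rewrite ler1n.
have [d d0 [K K0 Hw]] := lattice_wpgerm wB.
have [d1 d10 [K1 K10 Hf]] := wfun_germ a b.
have [s s0 Hs] := wpgerm_unique d0 K0 d10 K10 Hw Hf.
pose m := Num.min s (Num.min r (wrad a b)).
have m0 : 0 < m by rewrite !lt_min s0 r0 wrad_gt0.
pose F y := y ^+ 2 * T L 2 1 y - y ^+ 2 * ps c' y.
have cF y : nm y < m -> cder F y (2 * y * T L 2 1 y + y ^+ 2 * T L 2 2 y
    - (2 * y * ps c' y + y ^+ 2 * ps (dcoef c') y)).
  rewrite !lt_min => /andP[_ /andP[yr yw]].
  have H2 := cderX 2 (cder_id y).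
  apply: cder_eqv (cderB (cderM H2 (Hcd 0%N y yr)) (cderM H2 (ps_cder Hc yw))) _.
  by rewrite /=; ring.
have psE y : nm y < m -> 2 * y * ps c' y + y ^+ 2 * ps (dcoef c') y = wreg a b y.
  rewrite !lt_min => /andP[_ /andP[yr yw]]; have n0 := nm_ge0 y.
  have Bd : pbound (dcoef c') ((nm y + wrad a b) / 2).
    by apply: pbound_dcoef Hc; apply/andP; split; lra.
  have yd : nm y < (nm y + wrad a b) / 2 by lra.
  have H := pserD (pserZ 2 (ps_shift Hc yw)) (pser_shift (ps_shift Bd yd)).
  have E : 2 * y * ps c' y + y ^+ 2 * ps (dcoef c') y =
    2 * (y * ps c' y) + y * (y * ps (dcoef c') y) by ring.
  rewrite E; apply: pser_eq H (ps_hassum (pbound_wcf a b) yw) => -[|j] /=.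
    by rewrite /wcf wcoef_small//; ring.
  case: j => [|j]; rewrite /= /c' ?/dcoef; first by field.
  have j1 : j.+1%:R + 2%:R = j.+3%:R :> C by rewrite -natrD addn2.
  have j0 : j.+3%:R != 0 :> C by rewrite pnatr_eq0.
  by move: (wcf a b _) => w; move: j0; rewrite -j1 => j0; field.
have TE y : nm y < m -> T L 2 1 y = ps c' y.
  have c0 z : z != 0 -> nm z < m -> F z = 0.
    apply: puncture_constant => [x x0 xm|e e0].
      apply: cder_eqv (cF x xm) _; rewrite psE//.
      have := xm; rewrite !lt_min => /andP[xs /andP[xr _]].
      have xL : offL x.
        have [_] : (forall n, (0 < n)%N -> avoids L n x) /\ (x != 0 -> offL x).
          by apply: Hr; rewrite /cball /= subr0.
        exact.
      have := Hs x x0 xs; rewrite (wpE wB xL) /wfun -addrA => /addrI ->.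
      by rewrite subrr.
    have z0 : nm (0 : C) < m by rewrite nm0.
    have [dd dd0 Hdd] := cder_cont (cF 0 z0) e0.
    exists dd => // x _ xd; have := Hdd x; rewrite {2}/F expr0n !mul0r subrr !subr0; exact.
  have nz z : z != 0 -> nm z < m -> T L 2 1 z = ps c' z.
    move=> z0 zm; have := c0 z z0 zm; rewrite /F -mulrBr => /eqP.
    by rewrite mulf_eq0 expf_eq0 (negbTE z0) /= subr_eq0 => /eqP.
  move=> ym; have [->|y0] := eqVneq y 0; last exact: nz.
  have z0 : nm (0 : C) < m by rewrite nm0.
  have := z0; rewrite !lt_min => /andP[_ /andP[zr zw]].
  have L1 := lim0_cder (Hcd 0%N 0 zr); have L2 := lim0_cder (ps_cder Hc zw).
  have {}L2 := lim0_ext m0 (fun y y0 ym => esym (nz y y0 ym)) L2.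
  exact: lim0_unique L1 L2.
have := D n; rewrite (ps_derive1n m0 (wrad_gt0 a b) Hc TE).
move=> /(mulfI _) E; rewrite -E /c'; last by rewrite pnatr_eq0 -lt0n fact_gt0.
by rewrite mulrC divfK// pnatr_eq0.
Qed.

End WpSurjective.

Section WcoefScaling.
Variable R : realType.
Local Notation C := (Cx R).

Lemma wcf_scale (a b c : C) k : wcf (c ^+ 4 * a) (c ^+ 6 * b) k = c ^+ (k + 2) * wcf a b k.
Proof.
rewrite /wcf; elim/ltn_ind: k => k IH; have [k4|k4] := ltnP 4 k.
  rewrite !wcoefE// mulrCA; congr (_ * _); rewrite mulr_sumr; apply: eq_bigr => i _.
  rewrite !IH; try by have := ltn_ord i; lia.
  have -> : (k + 2 = (i + 2) + (k.-2 - i + 2))%N by have := ltn_ord i; lia.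
  by rewrite (exprD c (i + 2)) mulrACA.
have [->|k2] := eqVneq k 2%N; first by rewrite !wcoef2; ring.
have [->|k4'] := eqVneq k 4%N; first by rewrite !wcoef4; ring.
by rewrite !wcoef_small// mulr0.
Qed.

(** Equal invariants mean equal points of a weighted projective line. If [a = 0], a sixth root is
    enough. Otherwise a fourth root matches the first entries; the second ones then agree up to
    sign, which ['i] repairs because ['i ^+ 4 = 1] and ['i ^+ 6 = -1]. *)
Lemma weighted_pair (a b a' b' : C) : (a != 0) || (b != 0) -> (a' != 0) || (b' != 0) ->
  a ^+ 3 * b' ^+ 2 = a' ^+ 3 * b ^+ 2 -> exists c, a' = c ^+ 4 * a /\ b' = c ^+ 6 * b.
Proof.
have [->|a0] := eqVneq a 0.
  rewrite /= expr0n mul0r => b0 _ /esym/eqP; rewrite mulf_eq0 !expf_eq0 /= (negbTE b0) orbF => /eqP ->.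
  by exists (6.-root (b' / b)); rewrite mulr0 rootCK// divfK.
move=> _ _ E; pose c := 4.-root (a' / a).
have c4 : c ^+ 4 = a' / a by rewrite rootCK.
have aE : a' = c ^+ 4 * a by rewrite c4 divfK.
have : b' ^+ 2 == (c ^+ 6 * b) ^+ 2.
  rewrite -subr_eq0 -(mulrI_eq0 _ (mulfI (expf_neq0 3 a0))); apply/eqP.
  transitivity (a ^+ 3 * b' ^+ 2 - (c ^+ 4 * a) ^+ 3 * b ^+ 2); first by ring.
  by rewrite -aE E subrr.
rewrite eqf_sqr => /orP[/eqP|/eqP] ->; first by exists c.
have i2 : 'i ^+ 2 = -1 :> C := sqrCi _.
exists ('i * c); rewrite !exprMn; split.
  by rewrite aE (exprM 'i 2 2) i2; ring.
by rewrite (exprM 'i 2 3) i2; ring.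
Qed.

End WcoefScaling.

Section DominatedPowers.
Variables (R : realType) (I : eqType).

Lemma finite_powers_small (q : I -> R) (l : seq I) (e : R) : 0 < e -> (forall i, 0 <= q i) ->
  (forall i, i \in l -> q i < 1) -> exists N, forall k, (N <= k)%N -> \sum_(i <- l) q i ^+ k <= e.
Proof.
move=> + q0; elim: l e => [|i l IH] e e0 H.
  by exists 0%N => k _; rewrite big_nil ltW.
have e20 : 0 < e / 2 by lra.
have [j jl|N HN] := IH _ e20; first by apply: H; rewrite in_cons jl orbT.
have qi1 : q i < 1 by apply: H; rewrite mem_head.
have p : 0 < 1 - q i by lra.
pose M := Num.bound ((1 - q i)^-1 / (e / 2)).
have HM : (1 - q i)^-1 / (e / 2) < M%:R.
  by apply: archi_boundP; rewrite divr_ge0 ?invr_ge0 ?ltW.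
exists (maxn M N) => k; rewrite geq_max big_cons => /andP[Mk Nk].
have := HN k Nk; suff : q i ^+ k <= e / 2 by lra.
have k0 : 0 < k%:R :> R.
  apply: lt_le_trans (_ : M%:R <= _); last by rewrite ler_nat.
  by apply: le_lt_trans HM; rewrite divr_ge0 ?invr_ge0 ?ltW.
rewrite -(ler_pM2l k0); apply: le_trans (nat_geometric_bound k (q := q i) _) _.
  by rewrite q0.
move: HM; rewrite ltr_pdivrMr// => /ltW /le_trans; apply.
by rewrite ler_wpM2r ?(ltW e20)// ler_nat.
Qed.

(** From the exponent 3 on, the powers off [A] are at most the cubes, which leave a small tail
    beyond a finite list; on that list, finitely many numbers below 1 are raised to a high power. *)
Lemma dominated_powers (q : I -> R) (A : seq I) (e : R) : 0 < e -> bsummable (fun i => q i ^+ 3) ->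
  (forall i, 0 <= q i) -> (forall i, i \notin A -> q i < 1) ->
  exists N, forall k, (N <= k)%N -> forall s, uniq s -> (forall i, i \in s -> i \notin A) ->
    \sum_(i <- s) q i ^+ k <= e.
Proof.
move=> e0 bq q0 q1; have e20 : 0 < e / 2 by lra.
have [s0 us0 Hs0] := bsum_tail bq e20.
pose s1 := [seq i <- s0 | i \notin A].
have [i|N HN] := finite_powers_small (l := s1) e20 q0.
  by rewrite mem_filter => /andP[/q1].
exists (maxn N 3) => k; rewrite geq_max => /andP[Nk k3] s us sA.
rewrite (bigID (fun i => i \in s0)) /= -big_filter -[X in _ + X]big_filter.
have H1 : \sum_(i <- [seq i <- s | i \in s0]) q i ^+ k <= e / 2.
  apply: le_trans (HN k Nk); apply: ler_sum_subset; rewrite ?filter_uniq//.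
    by move=> i; rewrite !mem_filter => /andP[-> /sA ->].
  by move=> i; rewrite exprn_ge0.
have H2 : \sum_(i <- [seq i <- s | i \notin s0]) q i ^+ k <= e / 2.
  apply: le_trans (Hs0 [seq i <- s | i \notin s0] _ _); last 2 first.
  - by rewrite filter_uniq.
  - by move=> i; rewrite mem_filter => /andP[].
  rewrite !big_filter big_seq_cond [leRHS]big_seq_cond.
  apply: ler_sum => i /andP[/sA/q1 qi _]; apply: ler_wiXn2l => //; exact: ltW.
lra.
Qed.

End DominatedPowers.

(** * Rectangular lattices and their Eisenstein sums *)

Section RectangularLattices.
Variable R : realType.
Local Notation C := (Cx R).

Definition rect (n : nat) : C := Complex 0 n%:R.
Local Notation Ln n := (lattice_pt 1 (rect n)).
Local Notation G n := (Gk 1 (rect n)).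

Lemma rect_re_im n m : re (Ln n m) = m.1%:~R /\ im (Ln n m) = m.2%:~R * n%:R.
Proof.
have rcz (j : int) : j%:~R = rc j%:~R :> C by rewrite /rc; exact/esym/rmorph_int.
rewrite /lattice_pt mulr1 !rcz reD imD reM imM !re_rc !im_rc.
by rewrite /rect /re /im /= !(mulr0, mul0r, addr0, add0r, subr0).
Qed.

Lemma rect_nm2 n m : nm (Ln n m) ^+ 2 = m.1%:~R ^+ 2 + n%:R ^+ 2 * m.2%:~R ^+ 2.
Proof.
have [E1 E2] := rect_re_im n m.
by rewrite /nm sqr_sqrtr ?addr_ge0 ?sqr_ge0// E1 E2; ring.
Qed.

Lemma sum_pair (I : Type) (F : I -> C) i j : \sum_(k <- [:: i; j]) F k = F i + F j.
Proof. by rewrite !big_cons big_nil addr0. Qed.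

Lemma opposite_powers (z z' : C) j : z != 0 -> z' != 0 ->
  z ^+ 2 ^+ j * ((- z ^+ 2) ^- j - (- z' ^+ 2) ^- j) + z ^+ 2 ^+ j * ((- z ^+ 2) ^- j - (- z' ^+ 2) ^- j) =
  2 * (-1) ^+ j * (1 - (z / z') ^+ 2 ^+ j).
Proof.
move=> z0 z'0; rewrite (exprNn (z ^+ 2)) (exprNn (z' ^+ 2)) !exprMn !exprVn !invfM.
have -> : ((-1) ^+ j)^-1 = (-1) ^+ j :> C by rewrite -exprVn invrN invr1.
have : z ^+ j != 0 by rewrite !expf_neq0.
have : z' ^+ j != 0 by rewrite !expf_neq0.
by move: ((-1) ^+ j) (z ^+ j) (z' ^+ j) => s u v v0 u0; field; rewrite u0 v0.
Qed.

Lemma re_rect n : re (rect n) = 0. Proof. by []. Qed.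
Lemma im_rect n : im (rect n) = n%:R. Proof. by []. Qed.

Lemma rect_sqr n : rect n ^+ 2 = - rc n%:R ^+ 2.
Proof.
rewrite -rcX -rcN expr2; apply: cplx_eq.
  by rewrite reM re_rc re_rect im_rect mulr0 sub0r expr2.
by rewrite imM im_rc re_rect im_rect mulr0 mul0r addr0.
Qed.

Lemma rect_pt10 n : Ln n (1, 0) = 1.
Proof. by rewrite /lattice_pt mulr0z mul0r addr0 mulr1 mulr1z. Qed.
Lemma rect_pt01 n : Ln n (0, 1) = rect n.
Proof. by rewrite /lattice_pt mulr0z mul0r add0r mulr1z mul1r. Qed.
Lemma rect_ptN10 n : Ln n (-1, 0) = -1.
Proof. by rewrite /lattice_pt mulr0z mul0r addr0 mulr1 mulrN1z. Qed.
Lemma rect_ptN01 n : Ln n (0, -1) = - rect n.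
Proof. by rewrite /lattice_pt mulr0z mul0r add0r mulrN1z mulN1r. Qed.

Lemma rect_basis n : (0 < n)%N -> lattice_basis 1 (rect n).
Proof.
move=> n0 a b; rewrite -[(a%:C)%C]/(rc a) -[(b%:C)%C]/(rc b) mulr1 => E.
have n0' : n%:R != 0 :> R by rewrite pnatr_eq0 -lt0n.
have := congr1 (@im R) E; have := congr1 (@re R) E.
rewrite reD imD reM imM !re_rc !im_rc /rect /re /im /= !(mulr0, mul0r, addr0, add0r, subr0) => ->.
by move/eqP; rewrite mulf_eq0 (negbTE n0') orbF => /eqP.
Qed.

Lemma int_sqr_ge1 (j : int) : j != 0 -> 1 <= j%:~R ^+ 2 :> R.
Proof. by move=> j0; rewrite -rmorphXn /= ler1z; nia. Qed.

Lemma nm_lt_sqr (a : R) (z : C) : 0 <= a -> a ^+ 2 < nm z ^+ 2 -> a < nm z.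
Proof. by move=> a0; rewrite ltr_pXn2r// nnegrE nm_ge0. Qed.

(** Apart from 1 and -1, every nonzero point has modulus greater than 1: a nonzero second coordinate
    alone gives modulus at least [n]. *)
Lemma rect_Gk_limit n (e : R) : (2 <= n)%N -> 0 < e ->
  exists N, forall j, (N <= j)%N -> nm (G n (2 * j) - 2) <= e.
Proof.
move=> n2 e0; have wB : lattice_basis 1 (rect n) by apply: rect_basis; lia.
pose A : seq (int * int) := [:: (1, 0); (-1, 0)].
pose q m := (nm (Ln n m))^-1.
have [|m|m mA|N HN] := dominated_powers (q := q) (A := A) e0.
- have [H _] := lattice_admissible wB.
  by move: H; congr bsummable; apply/funext => m; rewrite exprVn.
- by rewrite invr_ge0 nm_ge0.
- rewrite /q; have [E|m0] := eqVneq m 0.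
    by rewrite E lattice_pt0 nm0 invr0.
  have p : 0 < nm (Ln n m) by rewrite nm_gt0 lattice_pt_eq0.
  rewrite invf_lt1//; apply: nm_lt_sqr => //; rewrite expr1n rect_nm2.
  have n4 : 4 <= n%:R ^+ 2 :> R by rewrite -natrX ler_nat; nia.
  case: m m0 mA {p} => a b /= m0; rewrite !inE /=.
  have [E|b0] := eqVneq b 0; last first.
    by move=> _; have := int_sqr_ge1 b0; have := sqr_ge0 (a%:~R : R); nra.
  have a0 : a != 0 by apply: contraNneq m0 => ->; rewrite E.
  rewrite E !xpair_eqE /= !andbT mulr0z expr0n mulr0 addr0 => aN.
  by rewrite -rmorphXn /= ltr1z; nia.
exists (maxn N 2) => j; rewrite geq_max => /andP[Nj j2].
have k3 : (3 <= 2 * j)%N by lia.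
have H := hassum_tail (M := e) (Gk_hassum wB k3) (s0 := A) isT.
have AE : \sum_(i <- A) Ln n i ^- (2 * j) = 2.
  by rewrite /A sum_pair rect_pt10 rect_ptN10 expr1n exprM sqrrN !expr1n invr1.
rewrite -AE; apply: H => s us sA; apply: le_trans (nm_sum _ _) _.
apply: le_trans (HN (2 * j)%N _ s us sA); last lia.
by apply: ler_sum => m _; rewrite nmV nmX /q exprVn.
Qed.

(** The real points belong to both lattices and cancel in the difference. After multiplication by
    [n ^ (2 j)], the points [n i] and [- n i] contribute a term of modulus 2, their counterparts
    [n' i] and [- n' i] one of modulus [2 t ^ (2 j)] with [t = n / n'], and the others become
    small. *)
Lemma rect_Gk_inj n n' : (2 <= n)%N -> (n < n')%N ->
  (exists N, forall j, (N <= j)%N -> G n (2 * j) = G n' (2 * j)) -> False.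
Proof.
move=> n2 nn' [N0 H0].
have wB : lattice_basis 1 (rect n) by apply: rect_basis; lia.
have wB' : lattice_basis 1 (rect n') by apply: rect_basis; lia.
pose A : seq (int * int) := [:: (0, 1); (0, -1)].
(* Set to 0 on the real axis, where the terms of the two lattices cancel although they are not
   small. *)
pose q l m := if m.2 == 0 then 0 else n%:R / nm (Ln l m).
have n0 : 0 < n%:R :> R by rewrite ltr0n; lia.
have bq l : lattice_basis 1 (rect l) -> bsummable (fun m => q l m ^+ 3).
  move=> lB; have [H _] := lattice_admissible lB.
  apply: (bsummable_dom (A := [::]) (c := n%:R ^+ 3) H) => m.
    by rewrite exprn_ge0// /q; case: ifP => // _; rewrite divr_ge0 ?nm_ge0 ?ltW.
  move=> _; rewrite /q; case: ifP => _; last by rewrite expr_div_n.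
  by rewrite expr0n mulr_ge0 ?invr_ge0 ?exprn_ge0 ?nm_ge0 ?ltW.
have q0 l m : 0 <= q l m by rewrite /q; case: ifP => // _; rewrite divr_ge0 ?nm_ge0 ?ltW.
have q1 m : m \notin A -> q n m < 1.
  rewrite /q; case: eqVneq => // m20 mA.
  have s2 := int_sqr_ge1 m20.
  have p : n%:R < nm (Ln n m).
    apply: nm_lt_sqr; first exact: ltW.
    rewrite rect_nm2; case: m m20 mA s2 => a b /= b0; rewrite !inE /= => mA s2.
    have n20 : 0 < n%:R ^+ 2 :> R by rewrite exprn_gt0.
    have [a0|a0] := eqVneq a 0; last by have := int_sqr_ge1 a0; nra.
    have : 4 <= b%:~R ^+ 2 :> R.
      by rewrite -rmorphXn /= (ler_int _ 4); move: mA; rewrite a0 !xpair_eqE /=; nia.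
    rewrite a0 mulr0z expr0n add0r; nra.
  by rewrite ltr_pdivrMr ?mul1r//; lra.
have q1' m : m \notin [::] -> q n' m < 1.
  rewrite /q; case: eqVneq => // m20 _; have s2 := int_sqr_ge1 m20.
  have p : n%:R < nm (Ln n' m).
    apply: nm_lt_sqr; first exact: ltW.
    have : n%:R ^+ 2 < n'%:R ^+ 2 :> R by rewrite -!natrX ltr_nat ltn_sqr.
    by rewrite rect_nm2; have := sqr_ge0 (m.1%:~R : R); have := sqr_ge0 (n%:R : R); nra.
  by rewrite ltr_pdivrMr ?mul1r//; lra.
have n'0 : 0 < n'%:R :> R by rewrite ltr0n; lia.
pose t : R := n%:R / n'%:R.
have t0 : 0 <= t by rewrite divr_ge0// ltW.
have t1 : t < 1 by rewrite ltr_pdivrMr// mul1r ltr_nat.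
pose e := (1 - t) / 2.
have e0 : 0 < e by rewrite /e; lra.
have [N1 HN1] := dominated_powers e0 (bq n wB) (q0 n) q1.
have [N2 HN2] := dominated_powers e0 (bq n' wB') (q0 n') q1'.
pose j := maxn (maxn N0 N1) (maxn N2 2).
have [j0 j1 j2 j3] : [/\ N0 <= j, N1 <= 2 * j, N2 <= 2 * j & 3 <= 2 * j]%N by split; rewrite /j; lia.
have HD := hassumZ (rc n%:R ^+ (2 * j)) (hassumB (Gk_hassum wB j3) (Gk_hassum wB' j3)).
rewrite (H0 j j0) subrr mulr0 in HD.
have := hassum_tail (M := e + e) HD (s0 := A) isT.
have -> : \sum_(i <- A) rc n%:R ^+ (2 * j) * (Ln n i ^- (2 * j) - Ln n' i ^- (2 * j)) =
    2 * (-1) ^+ j * (1 - rc t ^+ (2 * j)).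
  have ez : rc n%:R != 0 :> C by rewrite rc_eq0 lt0r_neq0.
  have ez' : rc n'%:R != 0 :> C by rewrite rc_eq0 lt0r_neq0.
  rewrite /A sum_pair !rect_pt01 !rect_ptN01 !(exprM _ 2) !sqrrN !rect_sqr /t rcM rcV.
  exact: opposite_powers.
rewrite sub0r nmN !nmM nm_nat nmX nmN nm1 expr1n mulr1.
move=> /(_ _)/wrap[] => [s us sA|].
  apply: le_trans (nm_sum _ _) _.
  have H1 := HN1 _ j1 s us sA; have H2 := HN2 _ j2 s us (fun _ _ => isT).
  apply: le_trans (lerD H1 H2); rewrite -big_split /=; apply: ler_sum => m _.
  rewrite nmM nmX nm_rc ger0_norm ?(ltW n0)// /q; case: eqVneq => m20.
    rewrite /lattice_pt m20 !mulr0z !mul0r subrr nm0 mulr0 addr_ge0// exprn_ge0//.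
  rewrite !expr_div_n -mulrDr ler_wpM2l ?exprn_ge0 ?(ltW n0)//.
  by apply: le_trans (nmB _ _) _; rewrite !nmV !nmX.
have : 1 - t <= nm (1 - rc t ^+ (2 * j)).
  rewrite -rc1 -rcX -rcB nm_rc; apply: le_trans (ler_norm _).
  have : t ^+ (2 * j) <= t ^+ 1 by rewrite ler_wiXn2l//; [exact: ltW|lia].
  rewrite expr1; lra.
rewrite /e; lra.
Qed.

(** The sums of weight [k] differ by the factor [c ^+ k]. As both families of even weight tend to 2,
    comparing consecutive even weights forces [c ^+ 2 = 1], and all sums of even weight at least 4
    agree. *)
Lemma rect_homothety_inj n n' (c : C) : (2 <= n)%N -> (2 <= n')%N ->
  60 * G n' 4 = c ^+ 4 * (60 * G n 4) -> 140 * G n' 6 = c ^+ 6 * (140 * G n 6) -> n = n'.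
Proof.
move=> n2 n'2 E4 E6.
have wB : lattice_basis 1 (rect n) by apply: rect_basis; lia.
have wB' : lattice_basis 1 (rect n') by apply: rect_basis; lia.
have GE k : (4 <= k)%N -> G n' k = c ^+ k * G n k.
  move=> k4; have := wcf_Gk wB' (k - 3); rewrite E4 E6 wcf_scale (wcf_Gk wB).
  have -> : ((k - 3).+1 + 2 = k)%N by lia.
  rewrite subnK; last by lia.
  by rewrite mulrCA => /mulfI -> //; rewrite pnatr_eq0.
have c2 : c ^+ 2 = 1.
  apply/eqP; rewrite -subr_eq0; apply/eqP/nm_eq0_eps => e e0.
  pose d := Num.min (1 / 2) (e / 20).
  have d0 : 0 < d by rewrite lt_min; apply/andP; split; lra.
  have [d1 d2] : d <= 1 / 2 /\ d <= e / 20 by split; rewrite ge_min lexx ?orbT.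
  have [N HN] := rect_Gk_limit n2 d0; have [N' HN'] := rect_Gk_limit n'2 d0.
  pose j := maxn (maxn N N') 2.
  have [j1 j2 j3] : [/\ N <= j, N' <= j & 2 <= j]%N by split; rewrite /j; lia.
  have a1 := HN j j1; have a2 := HN j.+1 (leqW j1).
  have b1 := HN' j j2; have b2 := HN' j.+1 (leqW j2).
  have [jj jj'] : (4 <= 2 * j /\ 4 <= 2 * j.+1)%N by clear -j3; lia.
  have E1 := GE _ jj.
  have E2 : G n' (2 * j.+1) = c ^+ 2 * c ^+ (2 * j) * G n (2 * j.+1).
    rewrite -exprD (_ : 2 + 2 * j = 2 * j.+1)%N; last by rewrite mulnS.
    exact: GE _ jj'.
  move: E1 E2 a1 a2 b1 b2; move: (G n (2 * j)) (G n (2 * j.+1)) (G n' (2 * j)) (G n' (2 * j.+1)).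
  move=> X Y X' Y' E1 E2 a1 a2 b1 b2.
  (* Cross multiplication eliminates the unknown power [c ^+ (2 * j)]; all four sums are close to 2,
     so that the right side is small while [X' * Y] is not. *)
  have K : (c ^+ 2 - 1) * (X' * Y) = X * Y' - X' * Y by rewrite E1 E2; ring.
  have B : nm (X * Y' - X' * Y) <= 10 * d.
    have -> : X * Y' - X' * Y = ((X - 2) * (Y' - 2) - (X' - 2) * (Y - 2))
      + 2 * ((X - 2) + (Y' - 2) - ((X' - 2) + (Y - 2))) by ring.
    apply: le_trans (nmD _ _) _; rewrite nmM nm_nat.
    have p1 : nm ((X - 2) * (Y' - 2)) <= d * d by rewrite nmM ler_pM ?nm_ge0.
    have p2 : nm ((X' - 2) * (Y - 2)) <= d * d by rewrite nmM ler_pM ?nm_ge0.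
    have p3 := nmB ((X - 2) * (Y' - 2)) ((X' - 2) * (Y - 2)).
    have p4 := nmB ((X - 2) + (Y' - 2)) ((X' - 2) + (Y - 2)).
    have p5 := nmD (X - 2) (Y' - 2); have p6 := nmD (X' - 2) (Y - 2); nra.
  have lo Z : nm (Z - 2) <= d -> 1 <= nm Z.
    move=> HZ; have E : 2 + (Z - 2) = Z by ring.
    by have := nm_subD (2 : C) (Z - 2); rewrite E nm_nat; lra.
  have l1 := lo _ b1; have l2 := lo _ a2.
  have := congr1 (@nm R) K; rewrite !nmM => K'.
  have : nm (c ^+ 2 - 1) * 1 <= nm (c ^+ 2 - 1) * (nm X' * nm Y).
    by rewrite ler_wpM2l ?nm_ge0//; nra.
  lra.
have GG : forall j, (2 <= j)%N -> G n' (2 * j) = G n (2 * j).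
  by move=> j j2; rewrite GE ?exprM ?c2 ?expr1n ?mul1r//; lia.
have [lt|lt|//] := ltngtP n n'.
  exfalso; apply: (rect_Gk_inj n2 lt); exists 2%N => j j2; exact/esym/GG.
exfalso; apply: (rect_Gk_inj n'2 lt); exists 2%N => j j2; exact: GG.
Qed.

End RectangularLattices.

(** * A polynomial that vanishes at all lattice parameters *)

Section KricheverUniqueness.
Variable R : realType.
Local Notation C := (Cx R).

Lemma Gk_scale (w1 w2 t : C) k : lattice_basis w1 w2 -> t != 0 -> (3 <= k)%N ->
  lattice_basis (w1 / t) (w2 / t) /\ Gk (w1 / t) (w2 / t) k = t ^+ k * Gk w1 w2 k.
Proof.
move=> wB t0 k3; have ptE m : lattice_pt (w1 / t) (w2 / t) m = lattice_pt w1 w2 m / t.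
  by rewrite /lattice_pt mulrDl !mulrA.
have wBt : lattice_basis (w1 / t) (w2 / t).
  move=> a b; rewrite !mulrA -mulrDl => /eqP; rewrite mulf_eq0 invr_eq0 (negbTE t0) orbF.
  by move=> /eqP; exact: wB.
split=> //; apply: hassum_unique (Gk_hassum wBt k3) _.
apply: eq_hassum (hassumZ (t ^+ k) (Gk_hassum wB k3)) => m.
by rewrite ptE exprMn exprVn invfM invrK mulrC.
Qed.

Lemma meval_slice n (p : mpoly n C) (v : 'I_n -> {poly C}) :
  exists P : {poly C}, forall t, P.[t] = meval (fun i => (v i).[t]) p.
Proof.
exists (\sum_(m <- msupp p) (mcoeff m p)%:P * \prod_i v i ^+ m i) => t.
rewrite mevalE horner_sum; apply: eq_bigr => m _.
rewrite hornerM hornerC horner_prod; congr (_ * _); apply: eq_bigr => i _.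
by rewrite horner_exp.
Qed.

Lemma poly_infinite_roots (P : {poly C}) (r : nat -> C) : injective r ->
  (forall k, P.[r k] = 0) -> P = 0.
Proof.
move=> ri H; apply/eqP; apply: contraT => P0.
have := max_poly_roots (rs := map r (iota 0 (size P))) P0.
rewrite size_map size_iota ltnn; apply.
  by apply/allP => _ /mapP[k _ ->]; rewrite rootE H.
by rewrite map_inj_uniq ?iota_uniq.
Qed.

Lemma eval_Kr_slice_gamma D (al be la : C) : exists P : {poly C}, forall t, P.[t] = eval_Kr D al be t la.
Proof.
have [P HP] := meval_slice (map_mpoly ratr D) (tnth [tuple al%:P; be%:P; 'X; la%:P]).
exists P => t; rewrite HP /eval_Kr; apply: meval_eq => i.
by rewrite !(tnth_nth 0); case: i => -[|[|[|[|]]]] //= _; rewrite ?hornerC ?hornerX.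
Qed.

Lemma eval_Kr_slice_lambda D (al be ga : C) : exists P : {poly C}, forall t, P.[t] = eval_Kr D al be ga t.
Proof.
have [P HP] := meval_slice (map_mpoly ratr D) (tnth [tuple al%:P; be%:P; ga%:P; 'X]).
exists P => t; rewrite HP /eval_Kr; apply: meval_eq => i.
by rewrite !(tnth_nth 0); case: i => -[|[|[|[|]]]] //= _; rewrite ?hornerC ?hornerX.
Qed.

Local Notation G n := (Gk 1 (rect R n)).

(** If both invariants were 0, all higher Eisenstein sums would be 0, contrary to their limit 2. *)
Lemma rect_invariants_neq0 n : (2 <= n)%N -> (60 * G n 4 != 0) || (140 * G n 6 != 0).
Proof.
move=> n2; have wB : lattice_basis 1 (rect R n) by apply: rect_basis; lia.
rewrite -negb_and; apply/negP => /andP[/eqP E4 /eqP E6].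
have [N HN] := rect_Gk_limit n2 (ltr01 : 0 < (1 : R)).
have j1 : (N <= maxn N 2)%N by lia.
have := HN _ j1; set j := maxn N 2.
have -> : G n (2 * j) = 0.
  have := wcf_Gk wB (2 * j - 3); rewrite E4 E6.
  have := wcf_scale (0 : C) 0 0 (2 * j - 3).+1; rewrite !mulr0 => ->.
  rewrite expr0n addn2 mul0r => /esym/eqP; rewrite mulf_eq0 pnatr_eq0 /= subnK; last by rewrite /j; lia.
  by move/eqP.
by rewrite sub0r nmN nm_nat; lra.
Qed.

Lemma rect_invariants_inj n n' : (2 <= n)%N -> (2 <= n')%N ->
  (60 * G n 4) ^+ 3 * (140 * G n' 6) ^+ 2 = (60 * G n' 4) ^+ 3 * (140 * G n 6) ^+ 2 -> n = n'.
Proof.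
move=> n2 n'2 E.
have [c [E4 E6]] := weighted_pair (rect_invariants_neq0 n2) (rect_invariants_neq0 n'2) E.
exact: rect_homothety_inj E4 E6.
Qed.

(** The two integers with half [k + 1] cannot both have vanishing [g2], as their invariants would
    then coincide. Recording the half keeps the choices for different [k] distinct. *)
Lemma rect_g2_neq0 k : exists n, [/\ (2 <= n)%N, n./2 = k.+1 & 60 * G n 4 != 0].
Proof.
have [e2 e3 h2 h3] : [/\ 2 <= 2 * k + 2, 2 <= 2 * k + 3, (2 * k + 2)./2 = k.+1 & (2 * k + 3)./2 = k.+1]%N.
  by split; lia.
have ne : (2 * k + 2)%N <> (2 * k + 3)%N by lia.
have Z (x y x' y' : C) : x = 0 -> x' = 0 -> x ^+ 3 * y' = x' ^+ 3 * y by move=> -> ->; rewrite expr0n !mul0r.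
have [E|/eqP E] := pselect (60 * G (2 * k + 2) 4 = 0); last by exists (2 * k + 2)%N; exact: And3 e2 h2 E.
exists (2 * k + 3)%N; apply: (And3 e3 h3); apply/eqP => E'; apply: ne; apply: (rect_invariants_inj e2 e3).
exact: Z E E'.
Qed.

(** Each lattice is rescaled to the first invariant [la]. With [B = 4 be^3 - la be], the number
    [r k] is an ordinate over the abscissa [be] on the corresponding cubic, and these ordinates
    differ because the rescaled second invariants do. *)
Lemma infinite_branches (la B : C) (a b : nat -> C) : la != 0 -> (forall k, a k != 0) ->
  (forall k k', a k ^+ 3 * b k' ^+ 2 = a k' ^+ 3 * b k ^+ 2 -> k = k') ->
  exists t r : nat -> C, injective r /\
    forall k, [/\ t k != 0, t k ^+ 4 * a k = la & r k ^+ 2 = B - t k ^+ 6 * b k].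
Proof.
move=> la0 a0 inj; pose t k := 4.-root (la / a k).
have t4 k : t k ^+ 4 * a k = la by rewrite rootCK// divfK.
have t0 k : t k != 0.
  by apply: contra_neq la0 => t0; rewrite -(t4 k) t0 expr0n mul0r.
exists t, (fun k => sqrtC (B - t k ^+ 6 * b k)); split=> [k k' E|k]; last by rewrite sqrtCK.
apply: inj; have : t k ^+ 6 * b k = t k' ^+ 6 * b k'.
  by apply: oppr_inj; apply: (addrI B); rewrite -[LHS]sqrtCK E sqrtCK.
move=> /(congr1 (fun x => x ^+ 2)); rewrite (exprMn 2 (t k ^+ 6)) (exprMn 2 (t k' ^+ 6)) => E2.
have A k0 : (t k0 ^+ 6) ^+ 2 = (la / a k0) ^+ 3.
  by rewrite -!exprM (exprM _ 4 3) -(mulfK (a0 k0) (t k0 ^+ 4)) t4.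
rewrite !A in E2; apply: (mulfI (expf_neq0 3 la0)).
have a1 := a0 k; have a2 := a0 k'.
transitivity (a k ^+ 3 * a k' ^+ 3 * ((la / a k') ^+ 3 * b k' ^+ 2)); first by field.
by rewrite -E2; field.
Qed.

(** For nonzero [la], the polynomial in [ga] has infinitely many roots. The value [la = 0], which
    the rescaled lattices do not reach, follows by viewing the result as a polynomial in [la]. *)
Lemma eval_Kr_lattice_zero D :
  (forall w1 w2 z al : C, lattice_basis w1 w2 -> ~ in_lattice w1 w2 z ->
     eval_Kr D al (lattice_wp w1 w2 z) (derive1 (lattice_wp w1 w2) z) (lattice_g2 w1 w2) = 0) ->
  forall al be ga la : C, eval_Kr D al be ga la = 0.
Proof.
move=> H al be.
have curve w1 w2 ga : lattice_basis w1 w2 ->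
    ga ^+ 2 = 4 * be ^+ 3 - 60 * Gk w1 w2 4 * be - 140 * Gk w1 w2 6 ->
    eval_Kr D al be ga (60 * Gk w1 w2 4) = 0.
  move=> wB gaE; have [z zL zE] := wp_surjective wB be.
  have key y : offL w1 w2 y -> lattice_wp w1 w2 y = be -> dwp w1 w2 y = ga ->
      eval_Kr D al be ga (60 * Gk w1 w2 4) = 0.
    move=> yL <- <-; rewrite -(derive1_wpL wB yL) -(lattice_g2E wB); apply: H => // -[m _ E].
    by have := yL m; rewrite E eqxx.
  have : dwp w1 w2 z ^+ 2 == ga ^+ 2 by rewrite (wp_ode1 wB zL) zE gaE.
  rewrite eqf_sqr => /orP[/eqP|/eqP] E; first exact: key zL zE E.
  (* The cubic fixes [dwp z] up to sign only; [- z] has the same value of wp and the opposite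
     derivative. *)
  apply: (key (- z)); [exact: offL_opp|by rewrite wp_even|by rewrite dwp_odd// E opprK].
have nonzero ga la : la != 0 -> eval_Kr D al be ga la = 0.
  move=> la0; have [P HP] := eval_Kr_slice_gamma D al be la.
  have [n Hn] := choice rect_g2_neq0.
  have [k|k k' E|t [r [ri Hr]]] := infinite_branches (4 * be ^+ 3 - la * be)
      (a := fun k => 60 * G (n k) 4) (b := fun k => 140 * G (n k) 6) la0.
  - by have [] := Hn k.
  - have [k2 kh _] := Hn k; have [k'2 kh' _] := Hn k'.
    by have E' := rect_invariants_inj k2 k'2 E; move: kh; rewrite E' kh' => -[].
  rewrite -HP (@poly_infinite_roots P r ri) ?horner0// => k; rewrite HP.
  have [k2 _ _] := Hn k; have [t0 t4 rE] := Hr k.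
  have wB : lattice_basis 1 (rect R (n k)) by apply: rect_basis; lia.
  have [wBt G4] := Gk_scale wB t0 (isT : (3 <= 4)%N).
  have [_ G6] := Gk_scale wB t0 (isT : (3 <= 6)%N).
  have laE : la = 60 * Gk (1 / t k) (rect R (n k) / t k) 4 by rewrite G4 -t4; ring.
  rewrite laE; apply: curve => //; rewrite rE -laE G6; ring.
move=> ga la; have [P HP] := eval_Kr_slice_lambda D al be ga.
rewrite -HP (@poly_infinite_roots P (fun k => k.+1%:R)) ?horner0// => [k k' /eqP|k].
  by rewrite eqr_nat => /eqP[].
by rewrite HP nonzero// pnatr_eq0.
Qed.

Theorem eval_Kr_coef n (al be ga la : C) :
  eval_Kr (Kr_coef R n) al be ga la = fcoef (@ratr C) al be ga la n.
Proof.
rewrite -eval_krpoly; apply/eqP; rewrite -subr_eq0; apply/eqP.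
have evB (a b c d : C) : eval_Kr (Kr_coef R n - krpoly n) a b c d =
    eval_Kr (Kr_coef R n) a b c d - eval_Kr (krpoly n) a b c d.
  by have [h hE _] := eval_Kr_morphism a b c d; rewrite -!hE rmorphB.
rewrite -evB; apply: eval_Kr_lattice_zero => w1 w2 z a wB zL.
by rewrite evB -(is_Kr_coef_Kr_coef n a wB zL) -(is_Kr_coef_krpoly n a wB zL) subrr.
Qed.

Theorem fKr_krF (al be ga la x : C) : nm x < krrad al be ga la -> fKr al be ga la x = krF al be ga la x.
Proof.
move=> xr; rewrite /fKr /krF.
have -> : (fun n => eval_Kr (Kr_coef R n) al be ga la * x ^+ n) =
    (fun n => fcoef (@ratr C) al be ga la n * x ^+ n).
  by apply/funext => n; rewrite eval_Kr_coef.
exact: hassum_series (ps_hassum (pbound_fcoef _ _ _ _) xr).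
Qed.

End KricheverUniqueness.

(** * Level four *)

Section LevelFourAlgebra.
Variable F : numFieldType.
Implicit Types (al be d Y X r : F).

Definition lv4_ga al be : F := 4 * al * (4 * al ^+ 2 - 3 * be).
Definition lv4_la al be : F := 4 * (32 * al ^+ 4 - 24 * al ^+ 2 * be + 3 * be ^+ 2).
Definition lv4_g2 al be : F := - (1 / 4) * (13 * al ^+ 4 - 6 * al ^+ 2 * be - 3 * be ^+ 2).
Definition lv4_g3 al be : F := 1 / 8 * (al ^+ 2 - be) * (17 * al ^+ 4 - 14 * al ^+ 2 * be + be ^+ 2).

(* With [wp = wp(x; lv4_g2, lv4_g3)], [Y = wp - lv4_e] and [X = Y + lv4_d], the functions
   [lv4_s = p - be] and [lv4_h] below are such that [p] is the Weierstrass function of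
   the lattice of [f4] and [f4 = lv4_h / lv4_s]; [lv4_e] is a root of the cubic. *)
Definition lv4_d al be : F := (5 * al ^+ 2 - 3 * be) / 4.
Definition lv4_e al be : F := (al ^+ 2 - be) / 2.

Definition lv4_s al d Y : F := (Y + d) ^+ 2 / Y - 2 * al ^+ 2 * (Y ^+ 2 + d ^+ 2) / (Y + d) ^+ 2.
Definition lv4_s' al d Y : F := 1 + 4 * al ^+ 2 * d * (d - Y) / (Y + d) ^+ 3 - d ^+ 2 / Y ^+ 2.
Definition lv4_h al d Y r : F := al * (Y - d) / (Y + d) - r / (2 * Y).
Definition lv4_cubic al d Y : F := 4 * Y * ((Y + d) ^+ 2 - al ^+ 2 * Y).
Definition lv4_cubic' al d Y : F := 4 * ((Y + d) ^+ 2 + 2 * (Y + d) * Y - 2 * al ^+ 2 * Y).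

Variables (al be : F).
Local Notation d := (lv4_d al be).
Local Notation e := (lv4_e al be).
Local Notation ga := (lv4_ga al be).
Local Notation la := (lv4_la al be).

(** Once [be], [ga] and [la] are written in [al] and [d], the identities below are checked in the
    independent variables [al], [d] and [Y]. *)
Lemma lv4_beE : be = (5 * al ^+ 2 - 4 * d) / 3.
Proof. by rewrite /lv4_d; field. Qed.
Lemma lv4_gaE : ga = 4 * al * (4 * d - al ^+ 2).
Proof. by rewrite /lv4_d /lv4_ga; field. Qed.
Lemma lv4_laE : la = 4 / 3 * (al ^+ 4 + 56 * al ^+ 2 * d + 16 * d ^+ 2).
Proof. by rewrite /lv4_d /lv4_la; field. Qed.
Lemma lv4_cubicE q : 4 * q ^+ 3 - lv4_g2 al be * q - lv4_g3 al be = lv4_cubic al d (q - e).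
Proof. by rewrite /lv4_cubic /lv4_d /lv4_e /lv4_g2 /lv4_g3; field. Qed.
Lemma lv4_cubic'E q : 6 * q ^+ 2 - lv4_g2 al be / 2 = lv4_cubic' al d (q - e) / 2.
Proof. by rewrite /lv4_cubic' /lv4_d /lv4_e /lv4_g2; field. Qed.

Section Identities.
Variable Y : F.
Hypotheses (Y0 : Y != 0) (X0 : Y + d != 0).
Local Notation s := (lv4_s al d Y).

Lemma lv4_s_ode : lv4_s' al d Y ^+ 2 * lv4_cubic al d Y =
  4 * (s + be) ^+ 3 - la * (s + be) - (4 * be ^+ 3 - la * be - ga ^+ 2).
Proof.
have bE := lv4_beE; rewrite lv4_laE lv4_gaE /lv4_s' /lv4_s /lv4_cubic.
move: d X0 bE => c c0 ->.
by field; rewrite Y0 c0.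
Qed.

Lemma lv4_h_ode r : r ^+ 2 = lv4_cubic al d Y ->
  2 * (2 * al * d / (Y + d) ^+ 2 * r - lv4_cubic' al d Y / 2 / (2 * Y) + r ^+ 2 / (2 * Y ^+ 2)) * s
  = lv4_h al d Y r * (2 * al * s + lv4_s' al d Y * r - ga).
Proof.
move=> r2; rewrite lv4_gaE.
(* [E1] compares the coefficients of [r] and [E0] the terms free of [r], after [r ^+ 2] is replaced
   by the cubic. *)
have E1 : 2 * (2 * al * d / (Y + d) ^+ 2) * s =
    al * (Y - d) / (Y + d) * lv4_s' al d Y - (2 * al * s - 4 * al * (4 * d - al ^+ 2)) / (2 * Y).
  rewrite /lv4_s' /lv4_s; move: d X0 => c c0.
  by field; rewrite Y0 c0.
have E0 : 2 * (- (lv4_cubic' al d Y / 2 / (2 * Y)) + lv4_cubic al d Y / (2 * Y ^+ 2)) * s =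
    al * (Y - d) / (Y + d) * (2 * al * s - 4 * al * (4 * d - al ^+ 2)) - lv4_cubic al d Y * lv4_s' al d Y / (2 * Y).
  rewrite /lv4_s' /lv4_s /lv4_cubic /lv4_cubic'; move: d X0 => c c0.
  by field; rewrite Y0 c0.
rewrite /lv4_h; move: E1 E0; rewrite -r2.
move: (lv4_s' _ _ _) s (lv4_cubic' _ _ _) => s' s c'.
set A := al * (Y - d) / (Y + d); set B := 2 * al * d / _; move=> E1 E0.
transitivity (2 * B * s * r + 2 * (- (c' / 2 / (2 * Y)) + r ^+ 2 / (2 * Y ^+ 2)) * s); first by ring.
by rewrite E1 E0; field.
Qed.

(** The quartic denominator is [(Y + d)^2 Y s] and the linear factors of the numerator are
    [4 (Y + d)], [2 Y] and [4 (Y - d)]; this is the origin of the coefficients in the theorem. *)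
Lemma lv4_formula q r : Y = q - e -> s != 0 ->
  let D := q ^+ 4 + (al ^+ 2 - be) * q ^+ 3
    + (51 / 8 * al ^+ 4 - 21 / 4 * al ^+ 2 * be + 3 / 8 * be ^+ 2) * q ^+ 2
    + (- (1 / 16) * (al ^+ 2 - be) * (47 * al ^+ 4 - 34 * al ^+ 2 * be - be ^+ 2)) * q
    + (545 / 256 * al ^+ 8 - 295 / 64 * al ^+ 6 * be + 435 / 128 * al ^+ 4 * be ^+ 2
       - 55 / 64 * al ^+ 2 * be ^+ 3 + 1 / 256 * be ^+ 4) in
  1 / 32 * (al * (4 * q + 3 * al ^+ 2 - be) * (2 * q - al ^+ 2 + be) * (4 * q - 7 * al ^+ 2 + 5 * be) / D)
  - 1 / 32 * (r * (4 * q + 3 * al ^+ 2 - be) ^+ 2 / D) = lv4_h al d Y r / s.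
Proof.
move=> YE s0 D.
have DE : D = (Y + d) ^+ 2 * Y * s.
  transitivity ((Y + d) ^+ 4 - 2 * al ^+ 2 * Y * (Y ^+ 2 + d ^+ 2)); last first.
    by rewrite /lv4_s; move: d X0 => c c0; field; rewrite Y0 c0.
  by rewrite /D YE /lv4_d /lv4_e; field.
have -> : 4 * q + 3 * al ^+ 2 - be = 4 * (Y + d) by rewrite YE /lv4_d /lv4_e; field.
have -> : 2 * q - al ^+ 2 + be = 2 * Y by rewrite YE /lv4_d /lv4_e; field.
have -> : 4 * q - 7 * al ^+ 2 + 5 * be = 4 * (Y - d) by rewrite YE /lv4_d /lv4_e; field.
rewrite DE /lv4_h; move: s s0 => s1 s0; move: d X0 => c c0.
by field; rewrite Y0 c0 s0.
Qed.

End Identities.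
End LevelFourAlgebra.

(** * The formula for f4 *)

Section LevelFourFormula.
Variable R : realType.
Local Notation C := (Cx R).
Variables (al be : C).
Local Notation g2 := (lv4_g2 al be).
Local Notation g3 := (lv4_g3 al be).
Local Notation ga := (lv4_ga al be).
Local Notation la := (lv4_la al be).
Local Notation d := (lv4_d al be).
Local Notation e := (lv4_e al be).

Let q := wfun g2 g3.
Let q' := wfun' g2 g3.
Let Y x := q x - e.
Let S x := lv4_s al d (Y x).
Let H x := lv4_h al d (Y x) (q' x).

Let limq : lim0 (fun x => x ^+ 2 * q x) 1 /\ lim0 (fun x => x ^+ 3 * q' x) (- 2).
Proof. by have [r r0 [K K0 Hw]] := wfun_germ g2 g3; exact: wpgerm_lim0 r0 K0 Hw. Qed.

Let lim_shift c : lim0 (fun x => x ^+ 2 * (q x - c)) 1.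
Proof.
have L := lim0B limq.1 (lim0M (lim0_cst c) (lim0X 2 (@lim0_id R))).
have E : 1 - c * 0 ^+ 2 = 1 :> C by rewrite expr0n mulr0 subr0.
by rewrite E in L; apply: lim0_ext ltr01 _ L => x _ _; ring.
Qed.

Let limY : lim0 (fun x => x ^+ 2 * Y x) 1. Proof. exact: lim_shift. Qed.
Let limX : lim0 (fun x => x ^+ 2 * (Y x + d)) 1.
Proof. by apply: lim0_ext ltr01 _ (lim_shift (e - d)) => x _ _; rewrite /Y; ring. Qed.

Let nonzero (f : C -> C) : lim0 (fun x => x ^+ 2 * f x) 1 ->
  exists2 r : R, 0 < r & forall x, x != 0 -> nm x < r -> f x != 0.
Proof.
move=> /(lim0_neq0 (oner_neq0 _))[r r0 Hr]; exists r => // x x0 xr.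
by have := Hr x x0 xr; rewrite mulf_eq0 negb_or => /andP[].
Qed.

Let YX0 : exists2 r : R, 0 < r & forall x, x != 0 -> nm x < r ->
  [/\ Y x != 0, Y x + d != 0 & nm x < wrad g2 g3].
Proof.
have [r1 r10 H1] := nonzero limY; have [r2 r20 H2] := nonzero limX.
exists (Num.min (Num.min r1 r2) (wrad g2 g3)); first by rewrite !lt_min r10 r20 wrad_gt0.
by move=> x x0; rewrite !lt_min => /andP[/andP[/(H1 x x0) ? /(H2 x x0) ?] ?].
Qed.

(* [lv4_s + be = wp + 4 al^2 d Y / X^2 + d^2 / Y]. *)
Let S_expand x : x != 0 -> Y x != 0 -> Y x + d != 0 -> S x + be - q x =
  x ^+ 2 * (4 * al ^+ 2 * d * (x ^+ 2 * Y x) / (x ^+ 2 * (Y x + d)) ^+ 2 + d ^+ 2 / (x ^+ 2 * Y x)).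
Proof.
move=> x0 y0 z0; have -> : q x = Y x + e by rewrite /Y; ring.
have -> : e = (2 * d - al ^+ 2) / 3 by rewrite /lv4_e /lv4_d; field.
have bE := lv4_beE al be; rewrite /S /lv4_s; move: (Y x) d y0 z0 bE => y c y0 z0 ->.
by field; rewrite x0 y0 z0.
Qed.

(** By [S_expand], [S + be] differs from [q] by [O(x^2)], so it has the normalised expansion at the
    pole; together with its equation this makes it the wp attached to the parameters of [f4]. *)
Let germ : exists2 r : R, 0 < r & exists2 K : R, 0 <= K &
  wpgerm la (krg3 be ga la) (fun x => S x + be) (fun x => lv4_s' al d (Y x) * q' x) r K.
Proof.
have [r r0 Hr] := YX0; have [r1 r10 [K K0 Hw]] := wfun_germ g2 g3.
pose w x := 4 * al ^+ 2 * d * (x ^+ 2 * Y x) / (x ^+ 2 * (Y x + d)) ^+ 2 + d ^+ 2 / (x ^+ 2 * Y x).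
have one0 : (1 : C) ^+ 2 != 0 by rewrite expr1n oner_neq0.
pose l : C := 4 * al ^+ 2 * d * 1 / 1 ^+ 2 + d ^+ 2 / 1.
have Lw : lim0 w l.
  apply: lim0D; apply: lim0M.
  - exact: lim0M (lim0_cst _) limY.
  - exact: lim0V one0 (lim0X 2 limX).
  - exact: lim0_cst.
  - exact: lim0V (oner_neq0 _) limY.
have [r2 r20 Hr2] := Lw 1 ltr01.
exists (Num.min (Num.min r r1) (Num.min r2 1)); first by rewrite !lt_min r0 r10 r20 ltr01.
exists (K + nm l + 1); first by rewrite !addr_ge0 ?nm_ge0.
move=> x x0; rewrite !lt_min => /andP[/andP[xr xr1] /andP[xr2 x1]].
have [y0 z0 xw] := Hr x x0 xr; have [cq odeq asq] := Hw x x0 xr1; split.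
- have cY : cder Y x (q' x) := cder_eqv (cderB cq (cder_cst e x)) (subr0 _).
  have cX := cderD cY (cder_cst d x).
  have cX2 := @cderV _ (fun x => (Y x + d) ^+ 2) x _ (expf_neq0 2 z0) (cderX 2 cX).
  have H1 := cderM (cderX 2 cX) (@cderV _ Y x _ y0 cY).
  have H2 := cderM (cderZ (2 * al ^+ 2) (cderD (cderX 2 cY) (cder_cst (d ^+ 2) x))) cX2.
  apply: cder_eqv (cderD (cderB H1 H2) (cder_cst be x)) _.
  rewrite /lv4_s' /=; move: (Y x) d y0 z0 (q' x) => y c y0 z0 t.
  by field; rewrite y0 z0.
- rewrite exprMn odeq lv4_cubicE -/q -/(Y x) -/(S x).
  by rewrite (lv4_s_ode y0 z0).
- have -> : S x + be - x ^- 2 = (q x - x ^- 2) + (S x + be - q x) by ring.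
  rewrite S_expand// -/(w x); apply: le_trans (nmD _ _) _.
  have wl : nm (w x) <= nm l + 1.
    by rewrite -(subrK l (w x)); apply: le_trans (nmD _ _) _; have := Hr2 x x0 xr2; lra.
  rewrite nmM nmX; have n0 := nm_ge0 x.
  have h1 : nm x ^+ 2 * nm (w x) <= nm x * (nm l + 1).
    apply: ler_pM => //; rewrite ?exprn_ge0 ?nm_ge0// expr2 -[leRHS]mulr1.
    by rewrite ler_wpM2l// ltW.
  by have := asq; rewrite -/q; lra.
Qed.

Let limS : lim0 (fun x => x ^+ 2 * S x) 1.
Proof.
have [r r0 [K K0 Hw]] := germ; have [L _] := wpgerm_lim0 r0 K0 Hw.
have := lim0B L (lim0M (lim0_cst be) (lim0X 2 (@lim0_id R))).
have E : 1 - be * 0 ^+ 2 = 1 :> C by rewrite expr0n mulr0 subr0.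
by rewrite E; apply: lim0_ext ltr01 _ => x _ _; ring.
Qed.

Let limHS : lim0 (fun x => H x / S x / x) 1.
Proof.
have [r r0 Hr] := YX0; have [r1 r10 Hr1] := nonzero limS.
have m0 : 0 < Num.min r r1 by rewrite lt_min r0.
have two1 : 2 * 1 != 0 :> C by rewrite mulr1 pnatr_eq0.
have one1 := oner_neq0 C.
have LA := lim0M (lim0M (lim0_cst al) (@lim0_id R)) (lim0M (lim_shift (e + d)) (lim0V one1 limX)).
have LB := lim0M limq.2 (lim0V two1 (lim0M (lim0_cst 2) limY)).
have LL := lim0M (lim0B LA LB) (lim0V one1 limS).
have E : (al * 0 * (1 * 1^-1) - (- 2) * (2 * 1)^-1) * 1^-1 = 1 :> C by field.
rewrite E in LL; apply: lim0_ext m0 _ LL => x x0; rewrite lt_min => /andP[xr xr1].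
have [y0 z0 _] := Hr x x0 xr; have s0 := Hr1 x x0 xr1.
have -> : q x - (e + d) = Y x - d by rewrite /Y; ring.
rewrite /H /lv4_h; move: (Y x) d (q' x) (S x) y0 z0 s0 => y c t s y0 z0 s0.
by field; rewrite x0 y0 z0 s0.
Qed.

Theorem level4_series : exists2 r : R, 0 < r & forall x, x != 0 -> nm x < r ->
  let p := wfun g2 g3 x in let p' := wfun' g2 g3 x in
  let D := p ^+ 4 + (al ^+ 2 - be) * p ^+ 3
    + (51 / 8 * al ^+ 4 - 21 / 4 * al ^+ 2 * be + 3 / 8 * be ^+ 2) * p ^+ 2
    + (- (1 / 16) * (al ^+ 2 - be) * (47 * al ^+ 4 - 34 * al ^+ 2 * be - be ^+ 2)) * p
    + (545 / 256 * al ^+ 8 - 295 / 64 * al ^+ 6 * be + 435 / 128 * al ^+ 4 * be ^+ 2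
       - 55 / 64 * al ^+ 2 * be ^+ 3 + 1 / 256 * be ^+ 4) in
  krF al be ga la x =
    1 / 32 * (al * (4 * p + 3 * al ^+ 2 - be) * (2 * p - al ^+ 2 + be) * (4 * p - 7 * al ^+ 2 + 5 * be) / D)
    - 1 / 32 * (p' * (4 * p + 3 * al ^+ 2 - be) ^+ 2 / D).
Proof.
have [r r0 Hr] := YX0; have [r1 r10 Hr1] := nonzero limS.
have [r2 r20 [K K0 Hw]] := germ.
pose m := Num.min (Num.min r r1) r2.
have m0 : 0 < m by rewrite !lt_min r0 r10.
pose h1 x := 2 * al * d / (Y x + d) ^+ 2 * q' x - lv4_cubic' al d (Y x) / 2 / (2 * Y x) + q' x ^+ 2 / (2 * Y x ^+ 2).
pose G1 x := (h1 x * S x - H x * (lv4_s' al d (Y x) * q' x)) / S x ^+ 2.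
have HG x : x != 0 -> nm x < m -> cder (fun x => H x / S x) x (G1 x) /\
    2 * G1 x * ((S x + be) - be) = (H x / S x) * (2 * al * ((S x + be) - be) - lv4_s' al d (Y x) * q' x - ga).
  move=> x0; rewrite !lt_min => /andP[/andP[xr xr1] xr2].
  have [y0 z0 xw] := Hr x x0 xr; have s0 := Hr1 x x0 xr1; have [cS _ _] := Hw x x0 xr2.
  have cq := wfun_cder x0 xw; have cq' := wfun'_cder x0 xw.
  have r2E : q' x ^+ 2 = lv4_cubic al d (Y x) by rewrite /q' (wfun_ode x0 xw) lv4_cubicE.
  rewrite lv4_cubic'E in cq'.
  have cY : cder Y x (q' x) := cder_eqv (cderB cq (cder_cst e x)) (subr0 _).
  have cSx : cder S x (lv4_s' al d (Y x) * q' x).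
    by apply: eq_cder (cder_eqv (cderB cS (cder_cst be x)) (subr0 _)) => y; rewrite addrK.
  have cH : cder H x (h1 x).
    have cX := cderD cY (cder_cst d x); have cX' := cderB cY (cder_cst d x).
    have y20 : 2 * Y x != 0 by rewrite mulf_neq0// pnatr_eq0.
    have c1 := cderM (cderZ al cX') (@cderV _ (fun x => Y x + d) x _ z0 cX).
    have c2 := cderM cq' (@cderV _ (fun x => 2 * Y x) x _ y20 (cderZ 2 cY)).
    apply: cder_eqv (cderB c1 c2) _.
    rewrite /h1 -/q -/(Y x) -/q'; move: (Y x) d (q' x) (lv4_cubic' _ _ _) y0 z0 => y c t cc y0 z0.
    by field; rewrite y0 z0.
  split.
    apply: cder_eqv (cderM cH (@cderV _ S x _ s0 cSx)) _.
    by rewrite /G1; move: (H x) (S x) s0 (h1 x) (lv4_s' _ _ _ * _) => * ; field.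
  have := lv4_h_ode y0 z0 r2E; rewrite -/(h1 x) -/(S x) -/(H x) addrK /G1 => E.
  have -> : 2 * ((h1 x * S x - H x * (lv4_s' al d (Y x) * q' x)) / S x ^+ 2) * S x =
      (2 * h1 x * S x - 2 * H x * (lv4_s' al d (Y x) * q' x)) / S x.
    by move: (H x) (S x) s0 (h1 x) (lv4_s' _ _ _ * _) => * ; field.
  rewrite E; move: (H x) (S x) s0 (lv4_s' _ _ _) (q' x) ga => *; field; done.
have [r3 r30 Hr3] := krF_unique r20 K0 Hw m0 HG limHS.
exists (Num.min r3 m); first by rewrite lt_min r30.
move=> x x0; rewrite !lt_min => /andP[xr3 /andP[/andP[xr xr1] _]] p p' D.
have [y0 z0 _] := Hr x x0 xr; have s0 := Hr1 x x0 xr1.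
by rewrite -(Hr3 x x0 xr3) /D (lv4_formula (Y := Y x) _ _ _ _ s0).
Qed.

End LevelFourFormula.

(** * The lattice of level four *)

Section CosetSums.
Variable R : realType.
Local Notation C := (Cx R).

Lemma hassum_embed (I J : eqType) (f : J -> I) (g : I -> option J) (G : J -> C) S :
  pcancel f g -> ocancel g f -> hassum G S -> hassum (fun i => oapp G 0 (g i)) S.
Proof.
move=> fg gf H e /H[s0 us0 Hs0]; exists (map f s0).
  by rewrite map_inj_uniq//; exact: pcan_inj fg.
move=> s us sub; rewrite -big_pmap; apply: Hs0.
  by apply: pmap_uniq gf _ us.
by move=> j js0; rewrite mem_pmap; apply/mapP; exists (f j); rewrite ?fg// sub// map_f.
Qed.

Definition residue4 (k : int) (m : int * int) : option (int * int) :=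
  if (m.1 %% 4)%Z == k then Some ((m.1 %/ 4)%Z, m.2) else None.

Lemma hassum_residue4 (F : int * int -> C) (S0 S1 S2 S3 : C) :
  hassum (fun m => F (4 * m.1, m.2)) S0 -> hassum (fun m => F (4 * m.1 + 1, m.2)) S1 ->
  hassum (fun m => F (4 * m.1 + 2, m.2)) S2 -> hassum (fun m => F (4 * m.1 + 3, m.2)) S3 ->
  hassum F (S0 + S1 + S2 + S3).
Proof.
move=> H0 H1 H2 H3.
have E (k : int) S : (0 <= k < 4)%R -> hassum (fun m => F (4 * m.1 + k, m.2)) S ->
    hassum (fun m => if (m.1 %% 4)%Z == k then F m else 0) S.
  move=> k4 H; have fg : pcancel (fun m : int * int => (4 * m.1 + k, m.2)) (residue4 k).
    move=> [a b]; rewrite /residue4 /=.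
    have -> : ((4 * a + k) %% 4)%Z = k by lia.
    by rewrite eqxx; congr (Some (_, _)); lia.
  have gf : ocancel (residue4 k) (fun m : int * int => (4 * m.1 + k, m.2)).
    by move=> [a b]; rewrite /residue4 /=; case: eqVneq => //= E; congr (_, _); lia.
  apply: eq_hassum (hassum_embed fg gf H) => -[a b]; rewrite /residue4 /=.
  by case: eqVneq => //= E; congr (F (_, _)); lia.
have H0' : hassum (fun m => F (4 * m.1 + 0, m.2)) S0 by apply: eq_hassum H0 => m; rewrite addr0.
apply: eq_hassum (hassumD (hassumD (hassumD (E 0 _ isT H0') (E 1 _ isT H1)) (E 2 _ isT H2)) (E 3 _ isT H3)).
move=> [a b] /=.
have : [\/ (a %% 4)%Z = 0, (a %% 4)%Z = 1, (a %% 4)%Z = 2 | (a %% 4)%Z = 3].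
  have [h|h] := eqVneq (a %% 4)%Z 0; first by constructor 1.
  have [h1|h1] := eqVneq (a %% 4)%Z 1; first by constructor 2.
  have [h2|h2] := eqVneq (a %% 4)%Z 2; first by constructor 3.
  by constructor 4; lia.
by case=> -> /=; rewrite ?addr0 ?add0r.
Qed.

Variables (w1 w2 : C).
Hypothesis wB : lattice_basis w1 w2.
Local Notation L := (lattice_pt w1 w2).
Local Notation wpL := (lattice_wp w1 w2).
Local Notation dwpL := (dwp w1 w2).
Local Notation offL := (offL w1 w2).
Local Notation G := (Gk w1 w2).

Let adm := lattice_admissible wB.

Lemma T04E x : offL x -> T L 0 4 x = wpL x ^+ 2 - 5 * G 4.
Proof.
move=> xL; have := wp_ode2 wB xL; move: (T L 0 4 x) => t E.
by apply: (mulfI (x := 6)); rewrite ?pnatr_eq0// E; ring.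
Qed.

(** [T L 0 6] is the fourth derivative of wp divided by 120; it is obtained by differentiating
    [T L 0 4], the second derivative divided by 6, twice more. *)
Lemma T06E x : offL x ->
  T L 0 6 x = wpL x ^+ 3 - 3 / 20 * (60 * G 4) * wpL x - 140 * G 6 / 10.
Proof.
move=> xL; have [r r0 Hr] := offL_ball wB xL.
have T05 y : offL y -> T L 0 5 y = wpL y * dwpL y / 2.
  move=> yL; have [s s0 Hs] := offL_ball wB yL.
  have H1 := T_offL_cder wB (n := 0) (k := 4) isT yL.
  have H2 := cderB (cderX 2 (wp_cder wB yL)) (cder_cst (5 * G 4) y).
  have {}H2 : cder (T L 0 4) y _ := cder_ext s0 (fun z zy => esym (T04E (Hs z zy))) H2.
  have := cder_unique H1 H2; rewrite /= expr1 subr0 => E.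
  by apply: (mulfI (x := 4)); rewrite ?pnatr_eq0// E; field.
have H1 := T_offL_cder wB (n := 0) (k := 5) isT xL.
have H2 := cderM (cderM (wp_cder wB xL) (dwp_cder wB xL)) (cder_cst 2^-1 x).
have {}H2 : cder (T L 0 5) x _ := cder_ext r0 (fun z zy => esym (T05 z (Hr z zy))) H2.
have := cder_unique H1 H2; rewrite (wp_ode2 wB xL) mulr0 add0r -expr2 (wp_ode1 wB xL) => E.
by apply: (mulfI (x := 5)); rewrite ?pnatr_eq0// E; field.
Qed.

Lemma quarter_offL (k : int) : (0 < k < 4)%R -> offL (- (k%:~R * (w1 / 4))).
Proof.
move=> k4 [a b]; apply/eqP => /= E.
have rcz (j : int) : j%:~R = rc j%:~R :> C by rewrite /rc; exact/esym/rmorph_int.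
have := wB (a := a%:~R + k%:~R / 4) (b := b%:~R).
rewrite -[((_ + _)%:C)%C]/(rc _) -[((b%:~R)%:C)%C]/(rc _) rcD rcM rcV rc_nat -!rcz.
case=> [|+ _].
  by move: E; rewrite /lattice_pt /= => E; rewrite mulrDl addrAC E; field.
move=> /eqP; rewrite -(mulrI_eq0 _ (mulfI (x := 4) _)) ?pnatr_eq0//.
have -> : 4 * (a%:~R + k%:~R / 4) = (4 * a + k)%:~R :> R by rewrite intrD intrM; field.
by rewrite intr_eq0; lia.
Qed.

Lemma quarter_basis : lattice_basis (w1 / 4) w2.
Proof.
move=> a b; rewrite -[(a%:C)%C]/(rc a) -[(b%:C)%C]/(rc b) => E.
have := wB (a := a / 4) (b := b); rewrite -[((_ / _)%:C)%C]/(rc _) -[(b%:C)%C]/(rc b) rcM rcV rc_nat.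
case; first by rewrite -[RHS]E; ring.
by move=> /eqP; rewrite mulf_eq0 invr_eq0 pnatr_eq0 orbF => /eqP.
Qed.

(* The lattice [<w1 / 4, w2>] is the union of four cosets of [<w1, w2>]. *)
Lemma Gk_quarter n : (3 <= n)%N -> Gk (w1 / 4) w2 n =
  G n + T L 0 n (- (1 * (w1 / 4))) + T L 0 n (- (2 * (w1 / 4))) + T L 0 n (- (3 * (w1 / 4))).
Proof.
move=> n3; have H := Gk_hassum quarter_basis n3.
have K (k : int) : hassum (fun m => lattice_pt (w1 / 4) w2 (4 * m.1 + k, m.2) ^- n)
    (T L 0 n (- (k%:~R * (w1 / 4)))).
  apply: eq_hassum (T_hassum _ adm (n := 0) (k := n) n3) => m.
  rewrite /Tterm expr0 invr1 mul1r opprK; congr (_ ^- n).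
  by rewrite /lattice_pt /= intrD intrM; field.
apply: hassum_unique H (hassum_residue4 _ (K 1) (K 2) (K 3)).
apply: eq_hassum (Gk_hassum wB n3) => m; congr (_ ^- n).
by rewrite /lattice_pt /= intrM; field.
Qed.

Local Notation z := (w1 / 4).
Local Notation g2 := (60 * G 4).
Local Notation g3 := (140 * G 6).

Let offLk (k : nat) : (0 < k < 4)%N -> offL (- (k%:R * z)).
Proof. by move=> k4; have := @quarter_offL k%:Z; rewrite -pmulrn; apply; lia. Qed.

Let wpk1 : wpL (- (1 * z)) = wpL z. Proof. by rewrite mul1r wp_even. Qed.
Let wpk3 : wpL (- (3 * z)) = wpL z.
Proof.
rewrite -(wp_periodic wB (1, 0)) /lattice_pt /= mulr1z mulr0z mul0r addr0 mul1r.
by congr (lattice_wp _ _ _); field.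
Qed.
Let wpk2 : wpL (- (2 * z)) = wpL (w1 / 2).
Proof. by have E : 2 * z = w1 / 2 by [field]; rewrite (wp_even wB (2 * z)) E. Qed.

Lemma half_offL : offL (w1 / 2).
Proof.
have -> : w1 / 2 = - - (2 * z) by field.
by apply: offL_opp; apply: (offLk (k := 2)).
Qed.

Lemma quarter_pt_offL : offL z.
Proof.
have -> : z = - - (1 * z) by field.
by apply: offL_opp; apply: (offLk (k := 1)).
Qed.

Lemma quarter_g2 : 60 * Gk (w1 / 4) w2 4 = - 14 * g2 + 120 * wpL z ^+ 2 + 60 * wpL (w1 / 2) ^+ 2.
Proof.
rewrite Gk_quarter// (T04E (offLk (k := 1) isT)) (T04E (offLk (k := 2) isT)) (T04E (offLk (k := 3) isT)).
by rewrite wpk1 wpk2 wpk3; ring.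
Qed.

Lemma quarter_g3 : 140 * Gk (w1 / 4) w2 6 =
  - 41 * g3 + 280 * wpL z ^+ 3 - 42 * g2 * wpL z + 140 * wpL (w1 / 2) ^+ 3 - 21 * g2 * wpL (w1 / 2).
Proof.
rewrite Gk_quarter// (T06E (offLk (k := 1) isT)) (T06E (offLk (k := 2) isT)) (T06E (offLk (k := 3) isT)).
by rewrite wpk1 wpk2 wpk3; field.
Qed.

Lemma dwp_half : dwpL (w1 / 2) = 0.
Proof.
have E : dwpL (w1 / 2) = - dwpL (w1 / 2).
  rewrite -(dwp_odd wB half_offL) -(dwp_periodic wB (1, 0) (offL_opp half_offL)).
  by rewrite /lattice_pt /= mulr1z mulr0z mul0r addr0 mul1r; congr (dwp _ _ _); field.
apply/eqP; rewrite -(mulrI_eq0 _ (mulfI (x := 2) _)) ?pnatr_eq0//; apply/eqP.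
by rewrite [2]mulr2n mulrDl !mul1r {1}E addNr.
Qed.

Lemma half_cubic : 4 * wpL (w1 / 2) ^+ 3 - g2 * wpL (w1 / 2) - g3 = 0.
Proof. by rewrite -(wp_ode1 wB half_offL) dwp_half expr0n. Qed.

(** The differentiated addition formula with shift [w1 / 2] at the point [w1 / 4] is replaced by its
    mirror case: shift [w1 / 4], point [w1 / 2]. The difference is then [- w1 / 4], where wp has its
    value at [w1 / 4] again, and the zeta terms vanish with [dwpL (w1 / 2)]. *)
Lemma half_quadratic :
  2 * wpL (w1 / 2) ^+ 2 + 2 * wpL (w1 / 2) * wpL z - wpL z ^+ 2 - g2 / 4 = 0.
Proof.
have zE : z - w1 / 2 = - z by field.
have Hz : offL (z - w1 / 2) by rewrite zE; exact: offL_opp quarter_pt_offL.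
have := zeta_addition_deriv wB quarter_pt_offL half_offL Hz.
rewrite zE (wp_even wB z) dwp_half mulr0 addr0.
rewrite (T04E half_offL) => E.
by rewrite -[RHS]E; field.
Qed.

End CosetSums.

(** * Recovering the parameters and the period lattice *)

Section LevelFourLattice.
Variable R : realType.
Local Notation C := (Cx R).

Lemma wpgerm_dp_unique (a b a' b' : C) p dp q dq (d K d' K' r : R) :
  wpgerm a b p dp d K -> wpgerm a' b' q dq d' K' -> (forall x, x != 0 -> nm x < r -> p x = q x) ->
  forall x, x != 0 -> nm x < d -> nm x < d' -> nm x < r -> dp x = dq x.
Proof.
move=> H H' E x x0 xd xd' xr.
have [cp _ _] := H x x0 xd; have [cq _ _] := H' x x0 xd'.
have m0 : 0 < Num.min (nm x) (r - nm x) by rewrite lt_min nm_gt0 x0 subr_gt0.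
apply: cder_unique cp (cder_ext m0 _ cq) => y; rewrite lt_min => /andP[y1 y2].
apply/esym/E; last by rewrite -(subrK x y); apply: le_lt_trans (nmD _ _) _; lra.
by apply: contraTneq y1 => ->; rewrite sub0r nmN ltxx.
Qed.

(** The difference of the two equations is [(a - a') p + (b - b') = 0], and [p] is unbounded near
    0. *)
Lemma wpgerm_invariants (a b a' b' : C) p dp q dq (d K d' K' r : R) : 0 < d -> 0 <= K -> 0 < d' -> 0 < r ->
  wpgerm a b p dp d K -> wpgerm a' b' q dq d' K' -> (forall x, x != 0 -> nm x < r -> p x = q x) ->
  a = a' /\ b = b'.
Proof.
move=> d0 K0 d'0 r0 H H' E.
pose m := Num.min (Num.min d d') r.
have m0 : 0 < m by rewrite !lt_min d0 d'0.
have Z x : x != 0 -> nm x < m -> (a - a') * p x + (b - b') = 0.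
  move=> x0; rewrite !lt_min => /andP[/andP[xd xd'] xr].
  have dE := wpgerm_dp_unique H H' E x0 xd xd' xr.
  have [_ op _] := H x x0 xd; have [_ oq _] := H' x x0 xd'.
  have : dp x ^+ 2 - dq x ^+ 2 = 0 by rewrite dE subrr.
  by rewrite op oq -(E x x0 xr) => Z; rewrite -[RHS]oppr0 -Z; ring.
have [L _] := wpgerm_lim0 d0 K0 H.
have LL := lim0D (lim0M (lim0_cst (a - a')) L) (lim0M (lim0_cst (b - b')) (lim0X 2 (@lim0_id R))).
have L0 : lim0 (fun x : C => (a - a') * (x ^+ 2 * p x) + (b - b') * x ^+ 2) 0.
  apply: lim0_ext m0 _ (lim0_cst 0) => x x0 xm.
  by rewrite -(mulr0 (x ^+ 2)) -(Z x x0 xm); ring.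
have /eqP := lim0_unique LL L0; rewrite expr0n mulr0 addr0 mulr1 subr_eq0 => /eqP aE.
split=> //; have y0 : rc (m / 2) != 0 :> C by rewrite rc_eq0 lt0r_neq0// divr_gt0.
have := Z _ y0; rewrite aE subrr mul0r add0r nm_rc gtr0_norm ?divr_gt0// => bE.
by apply/eqP; rewrite -subr_eq0 bE//; lra.
Qed.

(** Equal second invariants give both equations the same [p]. Their difference equates
    [2 f' (be' - be)] with a constant multiple of [f]; at 0 the former tends to [2 (be' - be)] and
    the latter to 0. *)
Lemma krF_injective (al be ga be' ga' la : C) (r : R) : 0 < r -> krg3 be ga la = krg3 be' ga' la ->
  (forall x, nm x < r -> krF al be ga la x = krF al be' ga' la x) -> be = be' /\ ga = ga'.
Proof.
move=> r0 gE E.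
pose m := Num.min (Num.min r (krrad al be ga la)) (krrad al be' ga' la).
have m0 : 0 < m by rewrite !lt_min r0 !krrad_gt0.
pose F1 := ps (dcoef (fcoef (@ratr C) al be ga la)).
have Z x : x != 0 -> nm x < m ->
    2 * F1 x * (be' - be) = krF al be ga la x * (2 * al * (be' - be) + (ga' - ga)).
  move=> x0; rewrite !lt_min => /andP[/andP[xr xk] xk'].
  have O1 := krF_ode x0 xk; have O2 := krF_ode x0 xk'.
  have d0 : 0 < r - nm x by rewrite subr_gt0.
  have FE : ps (dcoef (fcoef (@ratr C) al be' ga' la)) x = F1 x.
    apply: cder_unique (krF_cder xk') (cder_ext d0 _ (krF_cder xk)) => y yx; apply: E.
    by rewrite -(subrK x y); apply: le_lt_trans (nmD _ _) _; lra.
  rewrite FE -gE -(E x xr) in O2; rewrite -/F1 in O1.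
  transitivity (2 * F1 x * (wfun la (krg3 be ga la) x - be) - 2 * F1 x * (wfun la (krg3 be ga la) x - be')); first by ring.
  by rewrite O1 O2; ring.
have z0 : nm (0 : C) < krrad al be ga la by rewrite nm0 krrad_gt0.
have HF := krF_cder z0.
have F10 : F1 0 = 1 by rewrite /F1 ps0 /dcoef fcoef1 mulr1.
have L1 : lim0 F1 1.
  have B : pbound (dcoef (fcoef (@ratr C) al be ga la)) (krrad al be ga la / 2).
    by apply: pbound_dcoef (pbound_fcoef _ _ _ _); have := krrad_gt0 al be ga la; move=> ?; apply/andP; split; lra.
  rewrite -F10; apply: lim0_cder (ps_cder B _).
  by rewrite nm0 divr_gt0// krrad_gt0.
have L2 : lim0 (krF al be ga la) 0.
  by have := lim0_cder HF; rewrite {2}/krF ps0 fcoef0.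
have LL := lim0M (lim0M (lim0_cst 2) L1) (lim0_cst (be' - be)).
have L0 := lim0M L2 (lim0_cst (2 * al * (be' - be) + (ga' - ga))).
have := lim0_unique LL (lim0_ext m0 (fun x x0 xm => esym (Z x x0 xm)) L0).
rewrite mul0r mulr1 => /eqP; rewrite mulf_eq0 pnatr_eq0 /= subr_eq0 => /eqP bE.
split; first by rewrite bE.
have [s s0 Hs] := lim0_neq0 (oner_neq0 _) (krF_lim0 al be ga la).
have h0 : 0 < Num.min s m by rewrite lt_min s0.
have y0 : rc (Num.min s m / 2) != 0 :> C by rewrite rc_eq0 lt0r_neq0// divr_gt0.
have ym : nm (rc (Num.min s m / 2) : C) < Num.min s m.
  by rewrite nm_rc gtr0_norm ?divr_gt0//; lra.
move: y0 ym; move: (rc _) => y y0; rewrite lt_min => /andP[ys ym].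
have := Z y y0 ym; rewrite bE subrr !mulr0 add0r => /esym/eqP; rewrite mulf_eq0 subr_eq0.
have := Hs y y0 ys; rewrite mulf_eq0 negb_or => /andP[/negbTE -> _] /= /eqP -> //.
Qed.

(* The quadratic equation for [e = wp(w1)] has the second root [be - 4 al^2], which
   satisfies the cubic equation only if it is equal to the first one. *)
Lemma level4_half_value (al be e : C) : al != 0 -> 4 * al ^+ 2 - 3 * be != 0 ->
  2 * e ^+ 2 + 2 * e * be - be ^+ 2 - lv4_la al be / 4 = 0 ->
  4 * e ^+ 3 - lv4_la al be * e - (4 * be ^+ 3 - lv4_la al be * be - lv4_ga al be ^+ 2) = 0 ->
  e = 4 * al ^+ 2 - 2 * be.
Proof.
move=> al0 n0 Q K.
have : (e - (4 * al ^+ 2 - 2 * be)) * (e - (be - 4 * al ^+ 2)) == 0.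
  by rewrite -(mulrI_eq0 _ (mulfI (x := 2) _)) ?pnatr_eq0//; apply/eqP; rewrite -[RHS]Q /lv4_la; field.
rewrite mulf_eq0 !subr_eq0 => /orP[/eqP //|/eqP eE].
have : 16 * al ^+ 2 * (4 * al ^+ 2 - 3 * be) * (8 * al ^+ 2 - 3 * be) == 0.
  by apply/eqP; rewrite -[RHS]K eE /lv4_la /lv4_ga; ring.
have nz : 16 * al ^+ 2 * (4 * al ^+ 2 - 3 * be) != 0.
  by apply: mulf_neq0 n0; apply: mulf_neq0; rewrite ?pnatr_eq0// expf_neq0.
rewrite mulf_eq0 (negbTE nz) /= subr_eq0 => /eqP E.
have bE : be = 8 / 3 * al ^+ 2.
  by apply: (mulfI (x := 3)); rewrite ?pnatr_eq0// -E; field.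
by rewrite eE bE; field.
Qed.

Theorem level4_lattice (al be w1 w2 : C) (r : R) :
  al != 0 -> 4 * al ^+ 2 - 3 * be != 0 -> 0 < r ->
  is_wp_lattice (lv4_la al be) (krg3 be (lv4_ga al be) (lv4_la al be)) (2 * w1) (2 * w2) ->
  (forall x, nm x < r -> krF al be (lv4_ga al be) (lv4_la al be) x =
     lattice_fKr (2 * w1) (2 * w2) (w1 / 2) al x) ->
  is_wp_lattice (lv4_g2 al be) (lv4_g3 al be) (2 * w1) (8 * w2).
Proof.
move=> al0 n0 r0 [wB /dnear_nmP[r1 r10 H1]] H2.
have [d d0 [K K0 Hw]] := lattice_wpgerm wB.
have [d' d'0 [K' K'0 Hw']] := is_wp_germ (is_wp_wp (lv4_la al be) (krg3 be (lv4_ga al be) (lv4_la al be))).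
have [laE gE] := wpgerm_invariants d'0 K'0 d0 r10 Hw' Hw (fun x x0 xr => H1 x x0 (eq_ind_r (fun y => nm y < r1) xr (subr0 x))).
have zE : w1 / 2 = 2 * w1 / 4 by field.
have zL : offL (2 * w1) (2 * w2) (w1 / 2) by rewrite zE; exact: quarter_pt_offL wB.
have [s s0 Hs] := lattice_fKr_series wB al zL.
have m0 : 0 < Num.min r s by rewrite lt_min r0.
have [bE cE] : be = lattice_wp (2 * w1) (2 * w2) (w1 / 2) /\ lv4_ga al be = dwp (2 * w1) (2 * w2) (w1 / 2).
  apply: (krF_injective (al := al) (la := lv4_la al be) m0).
    by rewrite gE laE (lattice_krg3 wB zL).
  move=> x; rewrite lt_min => /andP[xr xs]; rewrite (H2 x xr) (Hs x xs) -laE.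
  exact: erefl.
have Q := half_quadratic wB; have T := half_cubic wB.
have q2 := quarter_g2 wB; have q3 := quarter_g3 wB.
rewrite -laE -zE -bE in Q; rewrite -laE -gE in T.
rewrite -laE -zE -bE in q2; rewrite -laE -gE -zE -bE in q3.
have eE := level4_half_value al0 n0 Q T.
rewrite eE in q2 q3.
have four0 : (1 / 4 : C) != 0 by rewrite div1r invr_neq0 ?pnatr_eq0.
have qB := quarter_basis wB; rewrite -zE in qB.
(* Dividing by [1 / 4] multiplies the generators [w1 / 2] and [2 * w2] by 4. *)
have [B G4] := Gk_scale qB four0 (isT : (3 <= 4)%N).
have [_ G6] := Gk_scale qB four0 (isT : (3 <= 6)%N).
have w1E : w1 / 2 / (1 / 4) = 2 * w1 by field.
have w2E : 2 * w2 / (1 / 4) = 8 * w2 by field.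
rewrite w1E w2E in B G4 G6; split=> //.
have [d2 d20 [K2 K20 Hw2]] := lattice_wpgerm B.
have E4 : 60 * Gk (2 * w1) (8 * w2) 4 = lv4_g2 al be.
  by rewrite G4 mulrCA q2 /lv4_la /lv4_g2; field.
have E6 : 140 * Gk (2 * w1) (8 * w2) 6 = lv4_g3 al be.
  by rewrite G6 mulrCA q3 /krg3 /lv4_ga /lv4_la /lv4_g3; field.
rewrite E4 E6 in Hw2.
have [r3 r30 H3] := is_wp_unique (is_wp_wp _ _) (wpgerm_is_wp d20 K20 Hw2).
by apply/dnear_nmP; exists r3 => // x x0; rewrite subr0; exact: H3.
Qed.

End LevelFourLattice.

Theorem theorem7p7 (R : realType) (alpha beta : Cx R) :
  let c1 : Cx R := alpha ^+ 2 - beta in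
  let c2 : Cx R := 51 / 8 * alpha ^+ 4 - 21 / 4 * alpha ^+ 2 * beta
                   + 3 / 8 * beta ^+ 2 in
  let c3 : Cx R := - (1 / 16) * (alpha ^+ 2 - beta)
                   * (47 * alpha ^+ 4 - 34 * alpha ^+ 2 * beta - beta ^+ 2) in
  let c4 : Cx R := 545 / 256 * alpha ^+ 8 - 295 / 64 * alpha ^+ 6 * beta
                   + 435 / 128 * alpha ^+ 4 * beta ^+ 2
                   - 55 / 64 * alpha ^+ 2 * beta ^+ 3
                   + 1 / 256 * beta ^+ 4 in
  let g2t : Cx R := - (1 / 4) * (13 * alpha ^+ 4 - 6 * alpha ^+ 2 * beta
                                 - 3 * beta ^+ 2) in
  let g3t : Cx R := 1 / 8 * (alpha ^+ 2 - beta)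
                    * (17 * alpha ^+ 4 - 14 * alpha ^+ 2 * beta
                       + beta ^+ 2) in
  let Delta : Cx R := 256 * alpha ^+ 2 * (5 * alpha ^+ 2 - 3 * beta)
                      * (4 * alpha ^+ 2 - 3 * beta) ^+ 4 in
  (\forall x \near (0 : Cx R)^',
     let p := wp g2t g3t x in
     let p' := derive1 (wp g2t g3t) x in
     let D := p ^+ 4 + c1 * p ^+ 3 + c2 * p ^+ 2 + c3 * p + c4 in
     f4 alpha beta x =
       1 / 32 * (alpha * (4 * p + 3 * alpha ^+ 2 - beta)
                 * (2 * p - alpha ^+ 2 + beta)
                 * (4 * p - 7 * alpha ^+ 2 + 5 * beta) / D)
       - 1 / 32 * (p' * (4 * p + 3 * alpha ^+ 2 - beta) ^+ 2 / D))
  /\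
  (Delta != 0 -> forall w1 w2 : Cx R,
     is_wp_lattice (lambda4 alpha beta) (g3_4 alpha beta) (2 * w1) (2 * w2) ->
     (\forall x \near (0 : Cx R),
        f4 alpha beta x =
          lattice_fKr (2 * w1) (2 * w2) (w1 / 2) alpha x) ->
     is_wp_lattice g2t g3t (2 * w1) (8 * w2)).
Proof.
move=> c1 c2 c3 c4 g2t g3t Delta.
pose k := krrad alpha beta (lv4_ga alpha beta) (lv4_la alpha beta).
have k0 : 0 < k := krrad_gt0 _ _ _ _.
have fE x : nm x < k -> f4 alpha beta x = krF alpha beta (lv4_ga alpha beta) (lv4_la alpha beta) x.
  by move=> xk; exact: fKr_krF.
split.
  have [d d0 [K K0 Hw]] := is_wp_germ (is_wp_wp g2t g3t).
  have [d' d'0 [K' K'0 Hw']] := wfun_germ g2t g3t.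
  have [s s0 Hs] := wpgerm_unique d0 K0 d'0 K'0 Hw Hw'.
  have [r r0 Hr] := level4_series alpha beta.
  apply/dnear_nmP; exists (Num.min (Num.min (Num.min d d') s) (Num.min r k)).
    by rewrite !lt_min d0 d'0 s0 r0.
  move=> x x0; rewrite subr0 !lt_min => /andP[/andP[/andP[xd xd'] xs] /andP[xr xk]].
  have pE : wfun (lv4_g2 alpha beta) (lv4_g3 alpha beta) x = wp g2t g3t x := esym (Hs x x0 xs).
  have dE : wfun' (lv4_g2 alpha beta) (lv4_g3 alpha beta) x = derive1 (wp g2t g3t) x :=
    esym (wpgerm_dp_unique Hw Hw' Hs x0 xd xd' xs).
  by rewrite (fE x xk); have := Hr x x0 xr; rewrite /= pE dE => ->.
move=> D0 w1 w2 HL /near_nmP[r r0 Hr].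
have al0 : alpha != 0.
  by apply: contra_neq D0; rewrite /Delta => ->; rewrite expr0n mulr0 !mul0r.
have n0 : 4 * alpha ^+ 2 - 3 * beta != 0.
  by apply: contra_neq D0; rewrite /Delta => ->; rewrite expr0n mulr0.
apply: (level4_lattice al0 n0 (r := Num.min r k)) HL _; first by rewrite lt_min r0.
move=> x; rewrite lt_min => /andP[xr xk]; rewrite -(fE x xk).
by apply: Hr; rewrite subr0.
Qed.
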